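(* Consider a boundary controlled and observed (BCO) stochastic system $$d\varepsilon(t)=\mathcal{A}\varepsilon(t)dt+H\,dw(t),\quad\varepsilon(0)=\varepsilon_0,\qquad u(t)=\mathcal{B}\varepsilon(t),\qquad y(t)=\mathcal{C}\varepsilon(t),$$ as defined in the context, and let $X_0=\varepsilon_0-Bu(0)$ and $\tilde u=\dot u\in L^2_{\mathbb{F}}([0,T];\mathbb{K}^m)$. Assume in addition that $HQ^{1/2}(Z)\subset D(A)$, that $X_0\in D(A)$, and that for all $t\ge0$ $$\int_0^t\|AT(t-s)H\|^2_{L_2^0}\,ds<\infty .$$ Then for all $\lambda\in\rho(A^e)$ the equation $$dX^e_\lambda(t)=A^eX^e_\lambda(t)dt+B^e_\lambda\tilde u(t)dt+H^e\,dw(t),\qquad X^e_\lambda(0)=\begin{pmatrix}u(0)\\ X_0\end{pmatrix}\in D(A^e),$$ where $B^e_\lambda\tilde u=\lambda R(\lambda,A^e)B^e\tilde u$ for all $\tilde u\in\mathbb{K}^m$, has a unique strong solution $X^e_\lambda(t)$ with respect to $w(t)$, and $$\sup_{0\le s\le t}\mathbb{E}\|X^e_\lambda(s)-X^e(s)\|^2_{\mathcal{X}^e}\to0\qquad\text{as }\lambda\to\infty,$$ where $X^e(t)$ is the mild solution of the extended equation $$dX^e(t)=A^eX^e(t)dt+B^e\tilde u(t)dt+H^e\,dw(t),\qquad X^e(0)=\begin{pmatrix}u(0)\\ X_0\end{pmatrix}.$$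
   Context: Let $\mathbb{K}\in\{\mathbb{R},\mathbb{C}\}$, $T>0$, and let $(\Omega,\mathcal{F},\mathbb{F}=(\mathcal{F}_t)_{t\ge0},\mathbb{P})$ be a complete filtered probability space with right-continuous filtration. The state space is $\mathcal{X}=L^2([a,b];\mathbb{K}^n)$ with inner product $\langle\varepsilon_1,\varepsilon_2\rangle_{\mathcal{X}}=\frac12\int_a^b\varepsilon_2^*(\zeta)\mathcal{H}(\zeta)\varepsilon_1(\zeta)d\zeta$, where $\mathcal{H}\in L^\infty([a,b];\mathbb{K}^{n\times n})$ is self-adjoint with $m_0I\le\mathcal{H}(\zeta)\le M_0I$ for constants $m_0,M_0>0$. $L^2_{\mathbb{F}}([0,T];\mathbb{K}^m)$ is the set of $\mathbb{F}$-adapted processes $v$ with $\mathbb{E}\int_0^T\|v(s)\|^2ds<\infty$. A BCO stochastic system is given by unbounded linear operators $\mathcal{A}:D(\mathcal{A})\to\mathcal{X}$, $\mathcal{B}:D(\mathcal{B})\to\mathbb{K}^m$, $\mathcal{C}:D(\mathcal{C})\to\mathbb{K}^p$ with $D(\mathcal{A})\subset D(\mathcal{B})\subset\mathcal{X}$, such that: 1. $A:=\mathcal{A}|_{D(A)}$, $D(A)=D(\mathcal{A})\cap\ker\mathcal{B}$, generates a $C_0$-semigroup $(T(t))_{t\ge0}$ on $\mathcal{X}$; 2. there is $B\in\mathcal{L}(\mathbb{K}^m,\mathcal{X})$ with $Bu\in D(\mathcal{A})$ and $\mathcal{B}Bu=u$ for all $u\in\mathbb{K}^m$, and $\mathcal{A}B\in\mathcal{L}(\mathbb{K}^m,\mathcal{X})$;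 3. $\mathcal{C}\in\mathcal{L}(D(A),\mathbb{K}^p)$, $D(A)$ with the graph norm of $A$; 4. $w$ is a Wiener process on a separable Hilbert space $Z$ (adapted to $\mathbb{F}$, with increments $w(t)-w(s)$, $t\ge s$, independent of $\mathcal F_s$ and distributed as $\mathcal N(0,(t-s)Q)$), with symmetric, nonnegative covariance operator $Q\in\mathcal L(Z)$, $\mathrm{Tr}[Q]<\infty$, and $H\in\mathcal{L}(Z,\mathcal{X})$ satisfies $\|H\|^2_{L_2^0}<\infty$, where $\|G\|_{L_2^0}^2=\|GQ^{1/2}\|^2_{L_2(Z,\mathcal{X})}=\mathrm{Tr}[GQG^*]$ (Hilbert–Schmidt norm of $GQ^{1/2}$). The initial condition $\varepsilon_0$ is an $\mathcal{F}_0$-measurable $\mathcal{X}$-valued Gaussian random variable independent of $w$; ''$X_0\in D(A)$'' means $X_0$ takes values in $D(A)$. Extended system: $\mathcal{X}^e=\mathbb{K}^m\oplus\mathcal{X}$, $$A^e=\begin{pmatrix}0&0\\ \mathcal{A}B&A\end{pmatrix},\quad D(A^e)=\mathbb{K}^m\oplus D(A),\qquad B^e=\begin{pmatrix}I\\ -B\end{pmatrix}\in\mathcal{L}(\mathbb{K}^m,\mathcal{X}^e),\qquad H^e=\begin{pmatrix}0\\ H\end{pmatrix}\in\mathcal{L}(Z,\mathcal{X}^e).$$ $A^e$ generates a $C_0$-semigroup $T^e(t)=\begin{pmatrix}I&0\\ S(t)&T(t)\end{pmatrix}$ on $\mathcal{X}^e$ with $S(t)u=\int_0^tT(t-s)\mathcal{A}Bu\,ds$.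 $\rho(A^e)$ is the resolvent set and $R(\lambda,A^e)=(\lambda I-A^e)^{-1}$; the limit $\lambda\to\infty$ is along real $\lambda$. The mild solution of the extended equation is $X^e(t)=T^e(t)X^e(0)+\int_0^tT^e(t-s)B^e\tilde u(s)ds+\int_0^tT^e(t-s)H^e\,dw(s)$. Strong solution of the equation for $X^e_\lambda$: an $\mathcal{X}^e$-valued process $(X^e_\lambda(t))_{t\in[0,T]}$ with $X_\lambda^e(t)\in D(A^e)$, $\int_0^T\|A^eX^e_\lambda(s)\|ds<\infty$ $\mathbb{P}$-a.s., and $X^e_\lambda(t)=X^e_\lambda(0)+\int_0^t(A^eX^e_\lambda(s)+B^e_\lambda\tilde u(s))ds+\int_0^tH^e\,dw(s)$ $\mathbb{P}$-a.s. *)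

(* Defs.v *)
From HB Require Import structures.
From mathcomp Require Import all_boot all_order all_algebra.
From mathcomp Require Import all_classical all_reals all_analysis.
From mathcomp Require Import measurable_realfun.
From mathcomp Require Import ring lra complex.
Import Order.TTheory GRing.Theory Num.Theory.
Import numFieldNormedType.Exports.

Set Implicit Arguments.
Unset Strict Implicit.
Unset Printing Implicit Defensive.

Local Open Scope classical_set_scope.
Local Open Scope ring_scope.

Variant scalar_kind := RealScalars | ComplexScalars.

Definition scal (R : realType) (k : scalar_kind) : numFieldType :=
  match k with RealScalars => R | ComplexScalars => R[i] end.

Section Scalars.
Context {R : realType} {k : scalar_kind}.

Definition mkscal (x y : R) : scal R k :=
  match k return scal R k with
  | RealScalars => x
  | ComplexScalars => (x +i* y)%C
  end.

Definition sRe : scal R k -> R :=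
  match k return scal R k -> R with
  | RealScalars => fun x => x
  | ComplexScalars => fun z => complex.Re z
  end.

Definition sIm : scal R k -> R :=
  match k return scal R k -> R with
  | RealScalars => fun _ => 0
  | ComplexScalars => fun z => complex.Im z
  end.

Definition ofR (x : R) : scal R k := mkscal x 0.
Definition sconj (z : scal R k) : scal R k := mkscal (sRe z) (- sIm z).
Definition sabs2 (z : scal R k) : R := sRe z ^+ 2 + sIm z ^+ 2.

Definition sintegral d (T : measurableType d)
    (mu : {measure set T -> \bar R}) (D : set T) (f : T -> scal R k) :
    scal R k :=
  mkscal (\int[mu]_(x in D) sRe (f x)) (\int[mu]_(x in D) sIm (f x)).

End Scalars.

Section ScalarLemmas.
Context {R : realType}.
Implicit Types k : scalar_kind.

Lemma sReD k (x y : scal R k) : sRe (x + y) = sRe x + sRe y.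
Proof. by case: k x y => // -[? ?] [? ?]. Qed.

Lemma sImD k (x y : scal R k) : sIm (x + y) = sIm x + sIm y.
Proof. by case: k x y => /= [_ _|[? ?] [? ?]//]; rewrite addr0. Qed.

Lemma sReM k (x y : scal R k) : sRe (x * y) = sRe x * sRe y - sIm x * sIm y.
Proof.
by case: k x y => /= [x y|[? ?] [? ?]//]; rewrite mul0r subr0.
Qed.

Lemma sImM k (x y : scal R k) : sIm (x * y) = sRe x * sIm y + sIm x * sRe y.
Proof.
by case: k x y => /= [x y|[? ?] [? ?]//]; rewrite mul0r mulr0 addr0.
Qed.

Lemma sRe0 k : sRe (0 : scal R k) = 0. Proof. by case: k. Qed.
Lemma sIm0 k : sIm (0 : scal R k) = 0. Proof. by case: k. Qed.

Lemma sabs2_ge0 k (z : scal R k) : 0 <= sabs2 z.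
Proof. by rewrite addr_ge0// sqr_ge0. Qed.

Lemma sabs2M k (x y : scal R k) : sabs2 (x * y) = sabs2 x * sabs2 y.
Proof. by rewrite /sabs2 sReM sImM; ring. Qed.

Lemma sabs2D k (x y : scal R k) : sabs2 (x + y) <= 2 * (sabs2 x + sabs2 y).
Proof.
rewrite /sabs2 sReD sImD.
have := sqr_ge0 (sRe x - sRe y); have := sqr_ge0 (sIm x - sIm y).
by nra.
Qed.

End ScalarLemmas.

Definition mx_measurable {R : realType} {k : scalar_kind} d
    (T : measurableType d) (D : set T) (p q : nat)
    (f : T -> 'M[scal R k]_(p, q)) : Prop :=
  forall i j, measurable_fun D (fun x => sRe (f x i j)) /\
              measurable_fun D (fun x => sIm (f x i j)).

Definition cvabs2 {R : realType} {k : scalar_kind} (n : nat)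
    (v : 'cV[scal R k]_n) : R := \sum_i sabs2 (v i 0).

Section L2.
Context (R : realType) (k : scalar_kind) (a b : R) (n : nat).
Local Notation K := (scal R k).
Local Notation D := (`[a, b]%classic : set R).
Local Notation mu := (@lebesgue_measure R).

Definition sq_integrable : {pred R -> 'cV[K]_n} :=
  mem [set f | mx_measurable D f /\
               (\int[mu]_(x in D) (cvabs2 (f x))%:E < +oo)%E].

Lemma cvabs2_ge0 (v : 'cV[K]_n) : 0 <= cvabs2 v.
Proof. by apply: sumr_ge0 => i _; exact: sabs2_ge0. Qed.

Lemma mx_measurable_lin (c : K) (f g : R -> 'cV[K]_n) :
  mx_measurable D f -> mx_measurable D g -> mx_measurable D (c *: f + g).
Proof.
move=> mf mg i j; have [f1 f2] := mf i j; have [g1 g2] := mg i j; split.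
- rewrite (_ : (fun _ => _) = (fun x => sRe c * sRe (f x i j)
    - sIm c * sIm (f x i j) + sRe (g x i j))).
    by apply: measurable_funD => //; apply: measurable_funB => //;
      apply: measurable_funM => //; exact: measurable_cst.
  by apply/funext => x; rewrite !mxE sReD sReM.
- rewrite (_ : (fun _ => _) = (fun x => sRe c * sIm (f x i j)
    + sIm c * sRe (f x i j) + sIm (g x i j))).
    by apply: measurable_funD => //; apply: measurable_funD => //;
      apply: measurable_funM => //; exact: measurable_cst.
  by apply/funext => x; rewrite !mxE sImD sImM.
Qed.

Lemma measurable_cvabs2 (f : R -> 'cV[K]_n) :
  mx_measurable D f -> measurable_fun D (fun x => cvabs2 (f x)).
Proof.
move=> mf; rewrite /cvabs2; apply: measurable_sum => i.
have [f1 f2] := mf i 0.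
by apply: measurable_funD; exact: measurable_funX.
Qed.

Lemma cvabs2_lin (c : K) (u v : 'cV[K]_n) :
  cvabs2 (c *: u + v) <= 2 * sabs2 c * cvabs2 u + 2 * cvabs2 v.
Proof.
rewrite /cvabs2 !mulr_sumr -big_split/=; apply: ler_sum => i _.
by rewrite !mxE (le_trans (sabs2D _ _))// sabs2M mulrDr mulrA.
Qed.

Lemma sq_integrable_submod : submod_closed sq_integrable.
Proof.
split.
  rewrite inE; split.
    by move=> i j; split; rewrite (_ : (fun _ => _) = cst 0) ?measurable_cst//;
      apply/funext => x; rewrite mxE ?sRe0 ?sIm0.
  rewrite integral0_eq ?ltry// => x _.
  by congr EFin; apply: big1 => i _; rewrite mxE /sabs2 sRe0 sIm0 expr0n addr0.
move=> c f g; rewrite !inE => -[mf lf] [mg lg].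
have mD : measurable D by exact: measurable_itv.
have mcf := mx_measurable_lin c mf mg; split => //.
have m1 := measurable_cvabs2 mf; have m2 := measurable_cvabs2 mg.
apply: (@le_lt_trans _ _ (\int[mu]_(x in D)
  ((2 * sabs2 c)%:E * (cvabs2 (f x))%:E + 2%:E * (cvabs2 (g x))%:E)))%E.
  apply: ge0_le_integral => //.
  - by move=> x _; rewrite lee_fin cvabs2_ge0.
  - by apply/measurable_EFinP; exact: measurable_cvabs2.
  - by apply: emeasurable_funD; apply: measurable_funeM; exact/measurable_EFinP.
  - by move=> x _; rewrite -!EFinM -EFinD lee_fin cvabs2_lin.
have c0 : 0 <= 2 * sabs2 c by rewrite mulr_ge0// sabs2_ge0.
rewrite ge0_integralD//;
  try by [move=> x _; rewrite -EFinM lee_fin mulr_ge0// cvabs2_ge0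
         | apply: measurable_funeM; exact/measurable_EFinP].
rewrite !ge0_integralZl_EFin//;
  try by [move=> x _; rewrite lee_fin cvabs2_ge0 | exact/measurable_EFinP].
by apply: lte_add_pinfty; apply: lte_mul_pinfty.
Qed.

HB.instance Definition _ := GRing.isSubmodClosed.Build K (R -> 'cV[K]_n)
  sq_integrable sq_integrable_submod.

Record L2fun := MkL2fun {
  L2fun_val :> R -> 'cV[K]_n;
  L2fun_prop : L2fun_val \in sq_integrable }.

HB.instance Definition _ := [isSub of L2fun for L2fun_val].
HB.instance Definition _ := [Choice of L2fun by <:].
HB.instance Definition _ := [SubChoice_isSubLmodule of L2fun by <:].

Lemma lebesgue_ae1 (P Q : R -> Prop) : (forall x, P x -> Q x) ->
  {ae mu, forall x, P x} -> {ae mu, forall x, Q x}.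
Proof.
have F : Filter (almost_everywhere mu) by exact: ae_filter_ringOfSetsType.
by move=> PQ; exact: (@filterS _ _ F P Q).
Qed.

Lemma lebesgue_ae2 (P Q S : R -> Prop) : (forall x, P x -> Q x -> S x) ->
  {ae mu, forall x, P x} -> {ae mu, forall x, Q x} -> {ae mu, forall x, S x}.
Proof.
have F : Filter (almost_everywhere mu) by exact: ae_filter_ringOfSetsType.
by move=> PQ; exact: (@filterS2 _ _ F P Q S).
Qed.

Definition L2_eq (f g : L2fun) : bool :=
  `[< {ae mu, forall x, D x -> f x = g x} >].

Lemma L2_eq_refl : reflexive L2_eq.
Proof. by move=> f; apply/asboolP; exact: aeW. Qed.

Lemma L2_eq_sym : symmetric L2_eq.
Proof.
by move=> f g; apply/idP/idP => /asboolP h; apply/asboolP;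
  apply: lebesgue_ae1 h => x h /h.
Qed.

Lemma L2_eq_trans : transitive L2_eq.
Proof.
move=> g f h /asboolP fg /asboolP gh; apply/asboolP.
by apply: lebesgue_ae2 fg gh => x fg gh Dx; rewrite fg// gh.
Qed.

Canonical L2_eqv := EquivRel L2_eq L2_eq_refl L2_eq_sym L2_eq_trans.

Definition L2space : Type := {eq_quot L2_eqv}%qT.
HB.instance Definition _ := Choice.on L2space.
HB.instance Definition _ := EqQuotient.on L2space.

Definition L2cls (f : L2fun) : L2space := (\pi_L2space f)%qT.
Definition L2repr (x : L2space) : L2fun := repr x.

Lemma L2clsP (f g : L2fun) :
  L2cls f = L2cls g <-> {ae mu, forall x, D x -> f x = g x}.
Proof.
rewrite /L2cls; split => [/eqP|h].
  by rewrite eqmodE => /asboolP.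
by apply/eqP; rewrite eqmodE; exact/asboolP.
Qed.

Lemma L2reprK : cancel L2repr L2cls.
Proof. by move=> x; exact: reprK. Qed.

Lemma L2repr_ae (f : L2fun) :
  {ae mu, forall x, D x -> L2repr (L2cls f) x = f x}.
Proof. by apply/L2clsP; rewrite L2reprK. Qed.

Definition L2zero : L2space := L2cls 0.
Definition L2opp (x : L2space) : L2space := L2cls (- L2repr x).
Definition L2add (x y : L2space) : L2space := L2cls (L2repr x + L2repr y).
Definition L2scale (c : K) (x : L2space) : L2space := L2cls (c *: L2repr x).

Lemma L2addE (f g : L2fun) : L2add (L2cls f) (L2cls g) = L2cls (f + g).
Proof.
apply/L2clsP; have h := L2repr_ae f; have h' := L2repr_ae g.
apply: lebesgue_ae2 h h' => x h h' Dx.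
rewrite -[LHS]/(L2repr (L2cls f) x + L2repr (L2cls g) x) -[RHS]/(f x + g x).
by rewrite h// h'.
Qed.

Lemma L2oppE (f : L2fun) : L2opp (L2cls f) = L2cls (- f).
Proof.
apply/L2clsP; apply: lebesgue_ae1 (L2repr_ae f) => x h Dx.
by rewrite -[LHS]/(- L2repr (L2cls f) x) -[RHS]/(- f x) h.
Qed.

Lemma L2scaleE c (f : L2fun) : L2scale c (L2cls f) = L2cls (c *: f).
Proof.
apply/L2clsP; apply: lebesgue_ae1 (L2repr_ae f) => x h Dx.
by rewrite -[LHS]/(c *: L2repr (L2cls f) x) -[RHS]/(c *: f x) h.
Qed.

Lemma L2addA : associative L2add.
Proof.
move=> x y z; rewrite -(L2reprK x) -(L2reprK y) -(L2reprK z).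
by rewrite !L2addE addrA.
Qed.

Lemma L2addC : commutative L2add.
Proof. by move=> x y; rewrite /L2add addrC. Qed.

Lemma L2add0 : left_id L2zero L2add.
Proof. by move=> x; rewrite -(L2reprK x) L2addE add0r. Qed.

Lemma L2addN : left_inverse L2zero L2opp L2add.
Proof. by move=> x; rewrite -(L2reprK x) L2oppE L2addE addNr. Qed.

HB.instance Definition _ :=
  GRing.isZmodule.Build L2space L2addA L2addC L2add0 L2addN.

Lemma L2scaleA (c e : K) (x : L2space) :
  L2scale c (L2scale e x) = L2scale (c * e) x.
Proof. by rewrite -(L2reprK x) !L2scaleE scalerA. Qed.

Lemma L2scale1 : left_id 1 L2scale.
Proof. by move=> x; rewrite -(L2reprK x) L2scaleE scale1r. Qed.

Lemma L2scaleDr : right_distributive L2scale (@GRing.add L2space).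
Proof.
move=> c x y; rewrite -(L2reprK x) -(L2reprK y) /GRing.add/= L2addE.
by rewrite !L2scaleE L2addE scalerDr.
Qed.

Lemma L2scaleDl (x : L2space) : {morph L2scale^~ x : c e / c + e}.
Proof.
by move=> c e; rewrite -(L2reprK x) /GRing.add/= !L2scaleE L2addE scalerDl.
Qed.

HB.instance Definition _ := GRing.Zmodule_isLmodule.Build K L2space
  L2scaleA L2scale1 L2scaleDr L2scaleDl.

End L2.

(* Data only; the axioms are in [hilbert].  They hold for the spaces K^m,
   L^2([a, b]; K^n) (when the weight is an [energy_density]) and their products
   built below.  Inner products are linear in the first argument. *)
Record ipSpace (R : realType) (k : scalar_kind) := IPSpace {
  ipsort :> lmodType (scal R k);
  ip : ipsort -> ipsort -> scal R k }.

Definition hnorm {R : realType} {k : scalar_kind} (V : ipSpace R k) (x : V) :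
  R := Num.sqrt (sRe (ip x x)).
Arguments hnorm {R k V} x.

Section HilbertSpaces.
Context {R : realType} {k : scalar_kind}.
Implicit Types V W : ipSpace R k.

Definition hilbert V : Prop :=
  [/\ forall (c : scal R k) (x y z : V),
        ip (c *: x + y) z = c * ip x z + ip y z,
      forall x y : V, ip y x = sconj (ip x y),
      forall x : V, x <> 0 -> 0 < ip x x
    & forall u : nat -> V,
        (forall e : R, 0 < e -> exists N, forall i j,
           (N <= i)%N -> (N <= j)%N -> hnorm (u i - u j) < e) ->
        exists l : V, hnorm (u i - l) @[i --> \oo] --> (0 : R)].

Definition hseparable V : Prop :=
  exists d : nat -> V, forall (x : V) (e : R), 0 < e ->
    exists i, hnorm (x - d i) < e.

(* For orthonormal E, maximality is equivalent to totality. *)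
Definition orthonormal_basis V (E : set V) : Prop :=
  [/\ forall e, E e -> ip e e = 1,
      forall e f, E e -> E f -> e <> f -> ip e f = 0
    & forall x, (forall e, E e -> ip x e = 0) -> x = 0].

Definition bounded_op V W (f : V -> W) : Prop :=
  linear f /\ exists C : R, forall x, hnorm (f x) <= C * hnorm x.

Definition euclid (m : nat) : ipSpace R k :=
  IPSpace (fun u v : 'cV[scal R k]_m => \sum_i u i 0 * sconj (v i 0)).

Definition prod_ip V W : ipSpace R k :=
  @IPSpace R k (V * W)%type (fun p q => ip p.1 q.1 + ip p.2 q.2).

Definition L2weighted (a b : R) (n : nat) (Hm : R -> 'M[scal R k]_n) :
    ipSpace R k :=
  @IPSpace R k (L2space k a b n) (fun x y =>
    ofR 2^-1 * sintegral (@lebesgue_measure R) `[a, b]%classic (fun z =>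
      ((map_mx sconj (L2repr y z))^T *m Hm z *m L2repr x z) 0 0)).

(* Hm \in L^oo([a, b]; K^(n x n)), self-adjoint, m0 I <= Hm <= M0 I *)
Definition energy_density (a b : R) (n : nat) (Hm : R -> 'M[scal R k]_n) :
    Prop :=
  let D := `[a, b]%classic in
  let mu := @lebesgue_measure R in
  let qform (z : R) (v : 'cV[scal R k]_n) :=
    sRe (((map_mx sconj v)^T *m Hm z *m v) 0 0) in
  [/\ mx_measurable (D : set (measurableTypeR R)) Hm,
      exists c : R, {ae mu, forall z, D z ->
        forall i j, sabs2 (Hm z i j) <= c},
      {ae mu, forall z, D z -> (map_mx sconj (Hm z))^T = Hm z}
    & exists m0 M0 : R, [/\ 0 < m0, 0 < M0
        & {ae mu, forall z, D z -> forall v,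
            m0 * cvabs2 v <= qform z v <= M0 * cvabs2 v}]].

(* The values of [ufun] outside [udom] are irrelevant. *)
Record unbounded V W := Unbounded { udom : set V; ufun :> V -> W }.

Definition linear_operator V W (A : unbounded V W) : Prop :=
  [/\ udom A 0,
      forall (c : scal R k) x y,
        udom A x -> udom A y -> udom A (c *: x + y)
    & forall (c : scal R k) x y,
        udom A x -> udom A y -> A (c *: x + y) = c *: A x + A y].

Definition graph_bounded V W1 W2 (A : unbounded V W1) (C : unbounded V W2) :
    Prop :=
  udom A `<=` udom C /\
  exists c : R, forall x, udom A x ->
    hnorm (C x) <= c * Num.sqrt (hnorm x ^+ 2 + hnorm (A x) ^+ 2).

Definition is_resolvent V (A : unbounded V V) (l : scal R k) (Rl : V -> V) :
    Prop :=
  [/\ bounded_op Rl,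
      forall x, udom A (Rl x) /\ l *: Rl x - A (Rl x) = x
    & forall x, udom A x -> Rl (l *: x - A x) = x].

Definition resolvent_set V (A : unbounded V V) : set (scal R k) :=
  [set l | exists Rl, is_resolvent A l Rl].

Definition resolvent V (A : unbounded V V) (l : scal R k) : V -> V :=
  xget (fun=> 0) [set Rl | is_resolvent A l Rl].

Definition C0_semigroup V (S : R -> V -> V) : Prop :=
  [/\ forall t, 0 <= t -> bounded_op (S t),
      forall x, S 0 x = x,
      forall s t x, 0 <= s -> 0 <= t -> S (s + t) x = S s (S t x)
    & forall x, hnorm (S t x - x) @[t --> 0^'+] --> (0 : R)].

Definition generates V (A : unbounded V V) (S : R -> V -> V) : Prop :=
  C0_semigroup S /\
  forall x y, (udom A x /\ A x = y) <->
    hnorm (ofR t^-1 *: (S t x - x) - y) @[t --> 0^'+] --> (0 : R).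

Definition hopen V (U : set V) : Prop :=
  forall x, U x -> exists2 r : R, 0 < r & forall y, hnorm (y - x) < r -> U y.

Definition hborel V : set (set V) := <<s @hopen V >>.

Definition hmeasurable T V (G : set (set T)) (f : T -> V) : Prop :=
  forall U, hborel U -> G (f @^-1` U).

Section Bochner.
Context d (T : measurableType d) (mu : {measure set T -> \bar R}).

Record simple_fun V := SimpleFun {
  sf_size : nat;
  sf_set : 'I_sf_size -> set T;
  sf_val : 'I_sf_size -> V;
  sf_measurable : forall i, measurable (sf_set i);
  sf_finite : forall i, (mu (sf_set i) < +oo)%E }.

Definition sf_fun V (s : simple_fun V) (x : T) : V :=
  \sum_i ofR (\1_(sf_set (s := s) i) x) *: sf_val (s := s) i.

Definition sf_integral V (D : set T) (s : simple_fun V) : V :=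
  \sum_i ofR (fine (mu (D `&` sf_set (s := s) i))) *: sf_val (s := s) i.

(* f is Bochner integrable over D, with integral v.  The a.e. convergence
   records strong measurability, which a vanishing [\int] alone does not
   give. *)
Definition is_bochner V (D : set T) (f : T -> V) (v : V) : Prop :=
  exists s : nat -> simple_fun V,
    [/\ {ae mu, forall x, D x ->
          hnorm (f x - sf_fun (s i) x) @[i --> \oo] --> (0 : R)},
        (\int[mu]_(x in D) (hnorm (f x - sf_fun (s i) x))%:E)%E
          @[i --> \oo] --> 0%E
      & hnorm (sf_integral D (s i) - v) @[i --> \oo] --> (0 : R)].

Definition bochner V (D : set T) (f : T -> V) : V :=
  xget 0 [set v | is_bochner D f v].

End Bochner.
End HilbertSpaces.
Arguments euclid {R} k m.

Section Stochastic.
Context {R : realType} {k : scalar_kind}.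
Context d (Om : measurableType d) (P : probability Om R).
Implicit Types (V W : ipSpace R k) (F : R -> set (set Om)).
Local Notation leb := (@lebesgue_measure R).
Local Notation cc t := (`[0%R, t]%classic : set R).

(* (F_t)_(t >= 0), complete and right-continuous *)
Definition usual_filtration F : Prop :=
  [/\ forall t, 0 <= t -> sigma_algebra setT (F t) /\ F t `<=` measurable,
      forall s t, 0 <= s -> s <= t -> F s `<=` F t,
      measure_is_complete P /\ P.-negligible `<=` F 0
    & forall t, 0 <= t -> F t = \bigcap_(s in [set s | t < s]) F s].

Definition adapted F V (I : set R) (v : R -> Om -> V) : Prop :=
  forall t, I t -> hmeasurable (F t) (v t).

Definition measurable_process V (T : R) (v : R -> Om -> V) : Prop :=
  forall U, hborel U ->
    measurable [set p : measurableTypeR R * Om |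
                  0 <= p.1 <= T /\ U (v p.1 p.2)].

Definition process F V (T : R) (v : R -> Om -> V) : Prop :=
  adapted F (cc T) v /\ measurable_process T v.

(* v \in L^2_F([0, T]; V) *)
Definition L2_process F V (T : R) (v : R -> Om -> V) : Prop :=
  process F T v /\
  (\int[P]_om \int[leb]_(s in cc T) (hnorm (v s om) ^+ 2)%:E < +oo)%E.

(* v is the time derivative of u on [0, T], u being absolutely continuous *)
Definition has_derivative V (T : R) (u v : R -> Om -> V) : Prop :=
  {ae P, forall om, forall t, 0 <= t <= T ->
    is_bochner leb (cc t) (fun s => v s om) (u t om - u 0 om)}.

(* N(m, s^2); the library's [normal_prob m 0] is not the Dirac mass. *)
Definition gaussian_law (m s : R) (U : set R) : \bar R :=
  if s == 0 then \d_m U else normal_prob m s U.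

Definition has_gaussian_law (Y : Om -> R) (m s : R) : Prop :=
  measurable_fun setT Y /\
  forall U : set R, measurable U -> P (Y @^-1` U) = gaussian_law m s U.

(* The real-linear continuous functionals on V are the Re <., x>. *)
Definition gaussian_vector V (Y : Om -> V) : Prop :=
  forall x : V, exists m s : R,
    has_gaussian_law (fun om => sRe (ip (Y om) x)) m s.

(* Y ~ N(0, Q): centred Gaussian with E[<x, Y> <Y, y>] = <Q x, y>.  If K = C
   this leaves the pseudo-covariance of Y free. *)
Definition centred_gaussian V (Y : Om -> V) (Q : V -> V) : Prop :=
  (forall x : V, exists s : R,
     has_gaussian_law (fun om => sRe (ip (Y om) x)) 0 s) /\
  (forall x y : V,
     sintegral P setT (fun om => ip x (Y om) * ip (Y om) y) = ip (Q x) y).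

Definition independent_classes (G1 G2 : set (set Om)) : Prop :=
  forall A B, G1 A -> G2 B -> P (A `&` B) = (P A * P B)%E.

Definition sigma_of V (Y : Om -> V) : set (set Om) :=
  [set Y @^-1` U | U in @hborel R k V].

Definition sigma_of_process V (w : R -> Om -> V) : set (set Om) :=
  <<s [set A | exists2 t, 0 <= t & sigma_of (w t) A] >>.

Definition covariance_operator V (E : set V) (Q : V -> V) : Prop :=
  [/\ bounded_op Q,
      forall x y, ip (Q x) y = ip x (Q y),
      forall x, 0 <= ip (Q x) x
    & (\esum_(e in E) (sRe (ip (Q e) e))%:E < +oo)%E].

Definition square_root V (Q Qh : V -> V) : Prop :=
  [/\ bounded_op Qh,
      forall x y, ip (Qh x) y = ip x (Qh y),
      forall x, 0 <= ip (Qh x) x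
    & forall x, Qh (Qh x) = Q x].

Definition wiener F V (Q : V -> V) (w : R -> Om -> V) : Prop :=
  [/\ {ae P, forall om, w 0 om = 0},
      {ae P, forall om, forall t, 0 <= t ->
        hnorm (w s om - w t om) @[s --> within `[0, +oo[%classic (nbhs t)]
          --> (0 : R)},
      adapted F `[0, +oo[%classic w,
      forall s t, 0 <= s -> s <= t ->
        independent_classes (F s) (sigma_of (fun om => w t om - w s om))
    & forall s t, 0 <= s -> s <= t ->
        centred_gaussian (fun om => w t om - w s om)
                         (fun x => ofR (t - s) *: Q x)].

(* ||G||^2_{L_2^0} = ||G Q^(1/2)||^2 (Hilbert-Schmidt), computed in the
   orthonormal basis E; Qh is Q^(1/2). *)
Definition L20norm2 V W (E : set V) (Qh : V -> V) (G : V -> W) : \bar R :=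
  \esum_(e in E) (hnorm (G (Qh e)) ^+ 2)%:E.

(* Elementary integrands: sum_i 1_(]l_i, r_i]) G_i on [0, t] *)
Record elementary V W (t : R) := Elementary {
  el_size : nat;
  el_left : 'I_el_size -> R;
  el_right : 'I_el_size -> R;
  el_op : 'I_el_size -> V -> W;
  el_bounds : forall i, 0 <= el_left i /\ el_left i <= el_right i /\
                        el_right i <= t;
  el_bounded : forall i, bounded_op (el_op i) }.

Definition el_fun V W t (s : elementary V W t) (r : R) : V -> W := fun x =>
  \sum_i ofR (\1_(`](el_left (e := s) i), (el_right (e := s) i)]%classic) r)
           *: el_op (e := s) i x.

Definition el_integral V W t (s : elementary V W t) (w : R -> Om -> V)
    (om : Om) : W :=
  \sum_i el_op (e := s) i
           (w (el_right (e := s) i) om - w (el_left (e := s) i) om).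

(* I = int_0^t Phi(s) dw(s), for Phi deterministic with
   int_0^t ||Phi(s)||^2_{L_2^0} ds < oo: the limit in L^2(Om; W) of the
   integrals of elementary integrands converging to Phi in
   L^2([0, t]; L_2^0).  The a.e. convergence plays the same role as in
   [is_bochner]. *)
Definition is_stochastic_integral V W (E : set V) (Qh : V -> V)
    (w : R -> Om -> V) (t : R) (Phi : R -> V -> W) (I : Om -> W) : Prop :=
  hmeasurable measurable I /\
  exists s : nat -> elementary V W t,
    let dist i r := L20norm2 E Qh (fun x => Phi r x - el_fun (s i) r x) in
    [/\ {ae leb, forall r, (cc t) r ->
          dist i r @[i --> \oo] --> 0%E},
        (\int[leb]_(r in cc t) dist i r)%E @[i --> \oo] --> 0%E
      & (\int[P]_om (hnorm (el_integral (s i) w om - I om) ^+ 2)%:E)%E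
          @[i --> \oo] --> 0%E].

(* dX = (A X + f) dt + G dw, X(0) = x0, on [0, T]. *)
Definition strong_solution F V W (E : set V) (Qh : V -> V) (w : R -> Om -> V)
    (T : R) (A : unbounded W W) (f : R -> Om -> W) (G : V -> W)
    (x0 : Om -> W) (X : R -> Om -> W) : Prop :=
  [/\ process F T X,
      forall t, 0 <= t <= T -> {ae P, forall om, udom A (X t om)},
      {ae P, forall om,
        (\int[leb]_(s in cc T) (hnorm (A (X s om)))%:E < +oo)%E}
    & forall t, 0 <= t <= T -> exists I : Om -> W,
        is_stochastic_integral E Qh w t (fun=> G) I /\
        {ae P, forall om, exists v : W,
          is_bochner leb (cc t)
            (fun s => A (X s om) + f s om) v /\
          X t om = x0 om + v + I om}].

(* S is the semigroup of the equation. *)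
Definition mild_solution F V W (E : set V) (Qh : V -> V) (w : R -> Om -> V)
    (T : R) (S : R -> W -> W) (f : R -> Om -> W) (G : V -> W)
    (x0 : Om -> W) (X : R -> Om -> W) : Prop :=
  process F T X /\
  forall t, 0 <= t <= T -> exists I : Om -> W,
    is_stochastic_integral E Qh w t (fun s z => S (t - s) (G z)) I /\
    {ae P, forall om, exists v : W,
      is_bochner leb (cc t) (fun s => S (t - s) (f s om)) v /\
      X t om = S t (x0 om) + v + I om}.

End Stochastic.

Section BCO.
Context {R : realType} {k : scalar_kind} (X : ipSpace R k) (m p : nat).
Local Notation U := (euclid k m : ipSpace R k).
Local Notation Y := (euclid k p : ipSpace R k).

Definition restricted_operator (cA : unbounded X X) (cB : unbounded X U) :
    unbounded X X :=
  Unbounded (udom cA `&` [set x | udom cB x /\ cB x = 0]) cA.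

Definition bco_system (cA : unbounded X X) (cB : unbounded X U)
    (cC : unbounded X Y) (B : U -> X) (S : R -> X -> X) : Prop :=
  let A := restricted_operator cA cB in
  [/\ [/\ linear_operator cA, linear_operator cB & linear_operator cC],
      udom cA `<=` udom cB,
      generates A S,
      [/\ bounded_op B,
          forall u, udom cA (B u) /\ cB (B u) = u
        & bounded_op (fun u : U => cA (B u))]
    & graph_bounded A cC].

Local Notation Xe := (prod_ip U X).

Definition ext_operator (cA : unbounded X X) (cB : unbounded X U)
    (B : U -> X) : unbounded Xe Xe :=
  let A := restricted_operator cA cB in
  @Unbounded R k Xe Xe [set x | udom A x.2] (fun x => (0, cA (B x.1) + A x.2)).

(* T^e(t) = (I 0; S(t) T(t)), S(t) u = int_0^t T(t - s) cA B u ds *)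
Definition ext_semigroup (cA : unbounded X X) (B : U -> X)
    (S : R -> X -> X) (t : R) : Xe -> Xe := fun x =>
  (x.1, bochner (@lebesgue_measure R) `[0, t]%classic
          (fun s => S (t - s) (cA (B x.1))) + S t x.2).

Definition ext_input (B : U -> X) : U -> Xe := fun u => (u, - B u).

Definition ext_noise (Z : ipSpace R k) (H : Z -> X) : Z -> Xe :=
  fun z => (0, H z).

Definition yosida_input (A : unbounded Xe Xe) (Be : U -> Xe) (l : scal R k) :
    U -> Xe :=
  fun u => l *: resolvent A l (Be u).

End BCO.

(* Main.v *)
(* Write S for the semigroup generated by A = A^e.  Both solutions have the form
   X = S x0 + y + W, where y is the convolution of S with the input and W the
   stochastic convolution int_0^t S(t - r) H^e dw(r).  The stochastic integral of
   a deterministic integrand is controlled by the Ito isometry, which only needs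
   the second moments of the Wiener increments.  The difference quotients
   (S(h) - I)/h converge along S(t - r) H^e in L^2([0, t]; L_2^0), so W(t) lies
   in D(A) almost surely and A W(t) has bounded second moment.

   The integral equation for W needs no stochastic Fubini theorem.  Summation by
   parts in Riemann-Stieltjes sums gives W = H^e w + A Y, with Y the pathwise
   convolution of S with H^e w; Fubini in two time variables gives
   Y(t) = int_0^t W; and Hille's theorem moves A under the last integral.

   The difference D of two strong solutions satisfies D(t) = int_0^t A D.
   Evaluating the convolution of S with D by Fubini gives int_0^t D = 0, and
   Hille's theorem gives D(t) = A 0 = 0.

   Finally, X_lambda - X is the convolution of S with (B_lambda - B^e) u~, and
   B_lambda -> B^e in operator norm because K^m has finite dimension. *)
Require Import Defs.
From mathcomp Require Import all_boot all_order all_algebra.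
From mathcomp Require Import all_classical all_reals all_analysis.
From mathcomp Require Import measurable_realfun.
From mathcomp Require Import ring lra complex.
Import Order.TTheory GRing.Theory Num.Theory.
Import numFieldNormedType.Exports.

Set Implicit Arguments.
Unset Strict Implicit.
Unset Printing Implicit Defensive.

Local Open Scope classical_set_scope.
Local Open Scope ring_scope.

(** * Inner product spaces *)

(** An unbounded operator offers no estimates, so A is handled through two families of bounded
    operators. For Phi(h) x = int_0^h S(s) x ds, the relation A x = y follows once S(h) x - x =
    Phi(h) y for all small h > 0. The difference quotients at h = 1/(n+1) converge exactly on D(A),
    which makes A applied to a process measurable.

    Random objects are at first known for one time at a time, outside a null set depending on that
    time, whereas pathwise arguments need whole paths. Modifications repair this: completeness of
    [F 0] keeps them adapted, and Tonelli replaces a null set for each time by an exceptional set of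
    times on almost every path.

    Measurability and Bochner integrals are tested against real parts of inner products, which
    reduces vector-valued Fubini to the scalar one. The convolution with the merely square
    integrable input is shown adapted by integrating by parts against its continuous primitive B
    (u(t) - u(0)). *)

Section ScalarAlgebra.
Context {R : realType} {k : scalar_kind}.
Local Notation K := (scal R k).
Implicit Types (x y : R) (z : K).

Lemma scal_ext (z1 z2 : K) : sRe z1 = sRe z2 -> sIm z1 = sIm z2 -> z1 = z2.
Proof. by case: k z1 z2 => [z1 z2|[? ?] [? ?]] //= -> ->. Qed.

Lemma sRe_ofR x : sRe (ofR x : K) = x. Proof. by case: k. Qed.
Lemma sIm_ofR x : sIm (ofR x : K) = 0. Proof. by case: k. Qed.
Lemma sReN z : sRe (- z) = - sRe z. Proof. by case: k z => // -[]. Qed.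
Lemma sImN z : sIm (- z) = - sIm z.
Proof. by case: k z => [z|[]//]; rewrite /= oppr0. Qed.
Lemma sRe1 : sRe (1 : K) = 1. Proof. by case: k. Qed.
Lemma sIm1 : sIm (1 : K) = 0. Proof. by case: k. Qed.
Lemma sRe_conj z : sRe (sconj z) = sRe z. Proof. by case: k z => // -[]. Qed.
Lemma sIm_conj z : sIm (sconj z) = - sIm z.
Proof. by case: k z => [z|[]//]; rewrite /= oppr0. Qed.
Lemma sRe_mkscal x y : sRe (mkscal x y : K) = x. Proof. by case: k. Qed.

Lemma sRe_sum (I : Type) (r : seq I) (p : pred I) (F : I -> K) :
  sRe (\sum_(i <- r | p i) F i) = \sum_(i <- r | p i) sRe (F i).
Proof. by apply: (big_morph sRe); [exact: sReD|exact: sRe0]. Qed.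

Lemma sIm_sum (I : Type) (r : seq I) (p : pred I) (F : I -> K) :
  sIm (\sum_(i <- r | p i) F i) = \sum_(i <- r | p i) sIm (F i).
Proof. by apply: (big_morph sIm); [exact: sImD|exact: sIm0]. Qed.

Definition sE := (@sReD R k, @sImD R k, @sReM R k, @sImM R k, sReN, sImN,
  @sRe0 R k, @sIm0 R k, sRe1, sIm1, sRe_conj, sIm_conj, sRe_ofR, sIm_ofR).

Lemma ofR0 : ofR 0 = 0 :> K. Proof. by apply: scal_ext; rewrite !sE. Qed.
Lemma ofR1 : ofR 1 = 1 :> K. Proof. by apply: scal_ext; rewrite !sE. Qed.
Lemma ofRN x : ofR (- x) = - ofR x :> K.
Proof. by apply: scal_ext; rewrite !sE// oppr0. Qed.
Lemma ofRD x y : ofR (x + y) = ofR x + ofR y :> K.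
Proof. by apply: scal_ext; rewrite !sE// addr0. Qed.
Lemma ofRB x y : ofR (x - y) = ofR x - ofR y :> K.
Proof. by rewrite ofRD ofRN. Qed.
Lemma ofRM x y : ofR (x * y) = ofR x * ofR y :> K.
Proof. by apply: scal_ext; rewrite !sE; ring. Qed.

Lemma ofR_neq0 x : x != 0 -> ofR x != 0 :> K.
Proof. by apply: contra => /eqP/(congr1 sRe); rewrite sRe0 sRe_ofR => ->. Qed.

Lemma sconjK z : sconj (sconj z) = z.
Proof. by apply: scal_ext; rewrite !sE// opprK. Qed.
Lemma sconjD z1 z2 : sconj (z1 + z2) = sconj z1 + sconj z2 :> K.
Proof. by apply: scal_ext; rewrite !sE//; ring. Qed.
Lemma sconjM z1 z2 : sconj (z1 * z2) = sconj z1 * sconj z2 :> K.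
Proof. by apply: scal_ext; rewrite !sE//; ring. Qed.
Lemma sconj0 : sconj 0 = 0 :> K.
Proof. by apply: scal_ext; rewrite !sE// oppr0. Qed.
Lemma sconj_ofR x : sconj (ofR x) = ofR x :> K.
Proof. by apply: scal_ext; rewrite !sE// oppr0. Qed.
Lemma sconj_sum (I : Type) (r : seq I) (p : pred I) (F : I -> K) :
  sconj (\sum_(i <- r | p i) F i) = \sum_(i <- r | p i) sconj (F i).
Proof. by apply: (big_morph sconj); [exact: sconjD|exact: sconj0]. Qed.

Lemma sabs2_eq0 z : (sabs2 z == 0) = (z == 0).
Proof.
apply/eqP/eqP => [|->]; last by rewrite /sabs2 !sE expr0n addr0.
move=> h; have := sqr_ge0 (sRe z); have := sqr_ge0 (sIm z).
move: h; rewrite /sabs2 => h i0 r0.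
by apply: scal_ext; rewrite !sE; apply/eqP; rewrite -sqrf_eq0; apply/eqP; lra.
Qed.
Lemma sabs2_0 : sabs2 (0 : K) = 0. Proof. by apply/eqP; rewrite sabs2_eq0. Qed.
Lemma sabs2_conj z : sabs2 (sconj z) = sabs2 z.
Proof. by rewrite /sabs2 !sE sqrrN. Qed.
Lemma sabs2_ofR x : sabs2 (ofR x : K) = x ^+ 2.
Proof. by rewrite /sabs2 !sE expr0n addr0. Qed.
Lemma mul_sconj z : z * sconj z = ofR (sabs2 z).
Proof. by apply: scal_ext; rewrite /sabs2 !sE; ring. Qed.

Lemma scal_gt0P z : 0 < z <-> 0 < sRe z /\ sIm z = 0.
Proof.
by case: k z => [z|[x y]] /=; [split => [|[]//]|];
  rewrite ?ltcE/= => //; split => [/andP[/eqP<- ->]//|[-> ->]]; rewrite eqxx.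
Qed.
Lemma measurable_sabs2 d (T : measurableType d) (D : set T) (f : T -> K) :
  measurable_fun D (fun t => sRe (f t)) -> measurable_fun D (fun t => sIm (f t)) ->
  measurable_fun D (fun t => sabs2 (f t)).
Proof. by move=> f1 f2; apply: measurable_funD; exact: measurable_funX. Qed.

End ScalarAlgebra.

Section InnerProduct.
Context {R : realType} {k : scalar_kind} (V : ipSpace R k).
Local Notation K := (scal R k).
Implicit Types (c : K) (a : R) (x y z : V).

Definition rip x y : R := sRe (ip x y).

Lemma hnormE x : hnorm x = Num.sqrt (rip x x). Proof. by []. Qed.
Lemma hnorm_ge0 x : 0 <= hnorm x. Proof. exact: sqrtr_ge0. Qed.

Hypothesis hV : hilbert V.

Lemma ip_lin c x y z : ip (c *: x + y) z = c * ip x z + ip y z.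
Proof. by case: hV => h _ _ _; exact: h. Qed.
Lemma ipC x y : ip y x = sconj (ip x y).
Proof. by case: hV => _ h _ _; exact: h. Qed.
Lemma ip0l z : ip 0 z = 0.
Proof.
have := ip_lin 1 0 0 z; rewrite scale1r addr0 mul1r => /esym/eqP.
by rewrite -subr_eq0 addrK => /eqP.
Qed.
Lemma ipDl x y z : ip (x + y) z = ip x z + ip y z.
Proof. by rewrite -{1}[x]scale1r ip_lin mul1r. Qed.
Lemma ipZl c x z : ip (c *: x) z = c * ip x z.
Proof. by rewrite -{1}[_ *: x]addr0 ip_lin ip0l addr0. Qed.
Lemma ipNl x z : ip (- x) z = - ip x z.
Proof. by rewrite -scaleN1r ipZl mulN1r. Qed.
Lemma ipBl x y z : ip (x - y) z = ip x z - ip y z.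
Proof. by rewrite ipDl ipNl. Qed.
Lemma ip0r z : ip z 0 = 0. Proof. by rewrite ipC ip0l sconj0. Qed.
Lemma ipDr x y z : ip z (x + y) = ip z x + ip z y.
Proof. by rewrite ipC ipDl sconjD -!ipC. Qed.
Lemma ipZr c x z : ip z (c *: x) = sconj c * ip z x.
Proof. by rewrite ipC ipZl sconjM -!ipC. Qed.
Lemma ipNr x z : ip z (- x) = - ip z x.
Proof. by rewrite -scaleN1r ipZr -ofR1 -ofRN sconj_ofR ofRN ofR1 mulN1r. Qed.
Lemma ip_suml (I : Type) (r : seq I) (p : pred I) (F : I -> V) z :
  ip (\sum_(i <- r | p i) F i) z = \sum_(i <- r | p i) ip (F i) z.
Proof. by apply: (big_morph (fun x => ip x z)) => [x y|]; rewrite ?ip0l ?ipDl. Qed.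
Lemma ip_sumr (I : Type) (r : seq I) (p : pred I) (F : I -> V) z :
  ip z (\sum_(i <- r | p i) F i) = \sum_(i <- r | p i) ip z (F i).
Proof. by apply: (big_morph (fun x => ip z x)) => [x y|]; rewrite ?ip0r ?ipDr. Qed.

Lemma ripC x y : rip x y = rip y x. Proof. by rewrite /rip ipC sRe_conj. Qed.
Lemma rip0l z : rip 0 z = 0. Proof. by rewrite /rip ip0l sRe0. Qed.
Lemma rip0r z : rip z 0 = 0. Proof. by rewrite ripC rip0l. Qed.
Lemma ripDl x y z : rip (x + y) z = rip x z + rip y z.
Proof. by rewrite /rip ipDl sReD. Qed.
Lemma ripDr x y z : rip z (x + y) = rip z x + rip z y.
Proof. by rewrite ripC ripDl !(ripC z). Qed.
Lemma ripNl x z : rip (- x) z = - rip x z.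
Proof. by rewrite /rip ipNl sReN. Qed.
Lemma ripNr x z : rip z (- x) = - rip z x.
Proof. by rewrite ripC ripNl ripC. Qed.
Lemma ripBl x y z : rip (x - y) z = rip x z - rip y z.
Proof. by rewrite ripDl ripNl. Qed.
Lemma ripZl a x z : rip (ofR a *: x) z = a * rip x z.
Proof. by rewrite /rip ipZl !sE mul0r subr0. Qed.
Lemma ripZr a x z : rip z (ofR a *: x) = a * rip z x.
Proof. by rewrite ripC ripZl ripC. Qed.
Lemma rip_suml (I : Type) (r : seq I) (p : pred I) (F : I -> V) z :
  rip (\sum_(i <- r | p i) F i) z = \sum_(i <- r | p i) rip (F i) z.
Proof. by rewrite /rip ip_suml sRe_sum. Qed.

Lemma ipxx x : ip x x = ofR (rip x x).
Proof.
apply: scal_ext; rewrite !sE//.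
by have := congr1 sIm (ipC x x); rewrite sIm_conj => h; lra.
Qed.
Lemma rip_ge0 x : 0 <= rip x x.
Proof.
have [->|/eqP x0] := eqVneq x 0; first by rewrite rip0l.
by case: hV => _ _ /(_ _ x0)/scal_gt0P[/ltW].
Qed.
Lemma rip_eq0 x : rip x x = 0 -> x = 0.
Proof.
move=> h; apply/eqP; apply: contraT => /eqP x0.
by case: hV => _ _ /(_ _ x0)/scal_gt0P[]; rewrite -/(rip x x) h ltxx.
Qed.
Lemma hnorm2 x : hnorm x ^+ 2 = rip x x.
Proof. by rewrite sqr_sqrtr// rip_ge0. Qed.
Lemma hnorm_eq0 x : hnorm x = 0 -> x = 0.
Proof. by move=> h; apply: rip_eq0; rewrite -hnorm2 h expr0n. Qed.
Lemma hnorm0 : hnorm (0 : V) = 0.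
Proof. by rewrite hnormE rip0l sqrtr0. Qed.
Lemma hnormN x : hnorm (- x) = hnorm x.
Proof. by rewrite !hnormE ripNl ripNr opprK. Qed.
Lemma hnormBC x y : hnorm (x - y) = hnorm (y - x).
Proof. by rewrite -hnormN opprB. Qed.
Lemma hnormZ c x : hnorm (c *: x) = Num.sqrt (sabs2 c) * hnorm x.
Proof.
rewrite !hnormE -sqrtrM ?sabs2_ge0//; congr Num.sqrt.
by rewrite /rip ipZl ipZr mulrA mul_sconj sReM !sE mul0r subr0.
Qed.
Lemma hnormZR a x : hnorm (ofR a *: x) = `|a| * hnorm x.
Proof. by rewrite hnormZ sabs2_ofR sqrtr_sqr. Qed.

Lemma ripD2 x y : rip (x + y) (x + y) = rip x x + 2 * rip x y + rip y y.
Proof. by rewrite !ripDl !ripDr (ripC y x); ring. Qed.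

Lemma rip_le x y : `|rip x y| <= hnorm x * hnorm y.
Proof.
have [->|/eqP y0] := eqVneq y 0; first by rewrite rip0r hnorm0 normr0 mulr0.
have yy : 0 < rip y y.
  by rewrite lt0r rip_ge0 andbT; apply/eqP => /rip_eq0.
rewrite -[_ * _]ger0_norm ?mulr_ge0 ?hnorm_ge0// -ler_sqr ?nnegrE//.
rewrite !real_normK ?num_real// exprMn !hnorm2.
(* The real minimiser of t -> ||x + t y||^2; nonnegativity of the minimum is the claim. *)
have := rip_ge0 (x + ofR (- (rip x y / rip y y)) *: y).
rewrite ripD2 ripZr ripZl ripZr => /mulr_ge0/(_ (ltW yy)).
rewrite [X in _ <= X -> _](_ : _ = rip x x * rip y y - rip x y ^+ 2).
  by rewrite subr_ge0.
by field; rewrite gt_eqF.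
Qed.

Lemma hnormD x y : hnorm (x + y) <= hnorm x + hnorm y.
Proof.
rewrite -[leLHS]ger0_norm ?hnorm_ge0// -[leRHS]ger0_norm ?addr_ge0 ?hnorm_ge0//.
rewrite -ler_sqr ?nnegrE// !real_normK ?num_real//.
have := le_trans (ler_norm _) (rip_le x y).
by rewrite sqrrD !hnorm2 ripD2; lra.
Qed.
Lemma hnormB x y : hnorm (x - y) <= hnorm x + hnorm y.
Proof. by rewrite (le_trans (hnormD _ _))// hnormN. Qed.
Lemma hnormDB x y z : hnorm (x - z) <= hnorm (x - y) + hnorm (y - z).
Proof. by rewrite -(subrK y x) -addrA addrK; exact: hnormD. Qed.
Lemma hnorm_sum (I : Type) (r : seq I) (p : pred I) (F : I -> V) :
  hnorm (\sum_(i <- r | p i) F i) <= \sum_(i <- r | p i) hnorm (F i).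
Proof.
apply: (big_ind2 (fun x (b : R) => hnorm x <= b)) => //; first by rewrite hnorm0.
by move=> x1 b1 x2 b2 h1 h2; rewrite (le_trans (hnormD _ _))// lerD.
Qed.
Lemma hnorm_leB x y : `|hnorm x - hnorm y| <= hnorm (x - y).
Proof.
have h1 := hnormD (x - y) y; have h2 := hnormD (y - x) x.
rewrite !subrK (hnormBC y) in h1 h2.
by rewrite ler_norml; apply/andP; split; lra.
Qed.
Lemma hnormD2_le x y : hnorm (x + y) ^+ 2 <= 2 * hnorm x ^+ 2 + 2 * hnorm y ^+ 2.
Proof.
have := hnormD x y; have := hnorm_ge0 x; have := hnorm_ge0 y.
have := hnorm_ge0 (x + y); set a := hnorm x; set b := hnorm y; set c := hnorm _.
by move=> ? ? ? ?; have := sqr_ge0 (a - b); nra.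
Qed.
Lemma hnormD3_le x y z :
  hnorm (x + y + z) ^+ 2 <= 3 * (hnorm x ^+ 2 + hnorm y ^+ 2 + hnorm z ^+ 2).
Proof.
have := hnormD (x + y) z; have := hnormD x y.
have := hnorm_ge0 x; have := hnorm_ge0 y; have := hnorm_ge0 z.
have := hnorm_ge0 (x + y + z).
set a := hnorm x; set b := hnorm y; set c := hnorm z; set e := hnorm (x + y + z).
move=> ? ? ? ? ? ?; have := sqr_ge0 (a - b); have := sqr_ge0 (a - c).
have := sqr_ge0 (b - c).
have : e ^+ 2 <= (a + b + c) ^+ 2 by rewrite ler_sqr ?nnegrE//; lra.
by nra.
Qed.
(** Real parts of inner products already separate points, which is why measurability, integrals and
    equality are tested with [rip] throughout. *)
Lemma rip_ext x y : (forall z, rip x z = rip y z) -> x = y.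
Proof.
move=> h; apply/eqP; rewrite -subr_eq0; apply/eqP/rip_eq0.
by rewrite ripBl h subrr.
Qed.

(** Multiplying x by the conjugate of <x, y> makes the inner product real and equal to |<x, y>|^2,
    so that the real Cauchy-Schwarz inequality applies. *)
Lemma sabs2_ip_le x y : sabs2 (ip x y) <= hnorm x ^+ 2 * hnorm y ^+ 2.
Proof.
set c := ip x y; have [->|c0] := eqVneq c 0.
  by rewrite sabs2_0 mulr_ge0 ?sqr_ge0.
have sc : 0 < sabs2 c by rewrite lt0r sabs2_ge0 sabs2_eq0 c0.
have := rip_le (sconj c *: x) y.
rewrite /rip ipZl -/c mulrC mul_sconj sRe_ofR hnormZ sabs2_conj.
rewrite ger0_norm ?(ltW sc)// -ler_sqr ?nnegrE ?(ltW sc)//; last first.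
  by rewrite !mulr_ge0 ?sqrtr_ge0.
rewrite !exprMn sqr_sqrtr ?(ltW sc)//.
by rewrite -mulrA expr2 ler_pM2l.
Qed.

Lemma hilbert_complete (u : nat -> V) :
  (forall e : R, 0 < e -> exists N, forall i j,
     (N <= i)%N -> (N <= j)%N -> hnorm (u i - u j) < e) ->
  exists l : V, hnorm (u i - l) @[i --> \oo] --> (0 : R).
Proof. by case: hV => _ _ _; exact. Qed.

End InnerProduct.

Section HilbertLimits.
Context {R : realType} {k : scalar_kind}.
Implicit Types V W : ipSpace R k.

Definition hlim V (u : nat -> V) (l : V) : Prop :=
  hnorm (u i - l) @[i --> \oo] --> (0 : R).

Lemma cvg0_nat (a : nat -> R) : (forall i, 0 <= a i) ->
  (a i @[i --> \oo] --> (0 : R)) <->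
  (forall e, 0 < e -> exists N, forall i, (N <= i)%N -> a i < e).
Proof.
move=> a0; split=> [/cvgrPdist_lt h e /h[N _ hN]|h].
  exists N => i /hN /=; rewrite sub0r normrN ger0_norm//.
apply/cvgrPdist_lt => e /h[N hN]; exists N => //= i /hN.
by rewrite sub0r normrN ger0_norm.
Qed.

Lemma hlimP V (u : nat -> V) (l : V) : hlim u l <->
  forall e, 0 < e -> exists N, forall i, (N <= i)%N -> hnorm (u i - l) < e.
Proof. by apply: cvg0_nat => i; exact: hnorm_ge0. Qed.

Lemma cvg0_squeeze (a b : nat -> R) : (forall i, 0 <= a i <= b i) ->
  b i @[i --> \oo] --> (0 : R) -> a i @[i --> \oo] --> (0 : R).
Proof.
move=> ab b0; apply: (@squeeze_cvgr _ _ _ _ (cst 0) b) => //.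
  by near=> i.
exact: cvg_cst.
Unshelve. all: by end_near. Qed.

Lemma hlim_le V (u : nat -> V) (l : V) (b : nat -> R) :
  (forall i, hnorm (u i - l) <= b i) -> b i @[i --> \oo] --> (0 : R) ->
  hlim u l.
Proof. by move=> h; apply: cvg0_squeeze => i; rewrite hnorm_ge0 h. Qed.

Lemma cvg0_sub (a : nat -> R) (phi : nat -> nat) : (forall i, (i <= phi i)%N) ->
  a i @[i --> \oo] --> (0 : R) -> a (phi i) @[i --> \oo] --> (0 : R).
Proof.
move=> hphi /cvgrPdist_lt h; apply/cvgrPdist_lt => e /h[N _ hN].
by exists N => //= i Ni; apply: hN => /=; exact: leq_trans (hphi i).
Qed.

Lemma hlim_sub V (u : nat -> V) l (phi : nat -> nat) :
  (forall i, (i <= phi i)%N) -> hlim u l -> hlim (u \o phi) l.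
Proof. by move=> hphi; exact: (@cvg0_sub (fun i => hnorm (u i - l))). Qed.

Section Fixed.
Context (V : ipSpace R k) (hV : hilbert V).
Implicit Types (u v : nat -> V) (x y l : V).

Lemma hlim_cst x : hlim (fun=> x) x.
Proof.
by rewrite /hlim; under eq_fun do rewrite subrr hnorm0//; exact: cvg_cst.
Qed.

Lemma hlimD u v l l' : hlim u l -> hlim v l' -> hlim (fun i => u i + v i) (l + l').
Proof.
move=> ul vl; apply: (hlim_le (b := fun i => hnorm (u i - l) + hnorm (v i - l'))).
  by move=> i; rewrite opprD addrACA hnormD.
by rewrite -[X in _ --> X]addr0; exact: cvgD.
Qed.

Lemma hlimN u l : hlim u l -> hlim (fun i => - u i) (- l).
Proof.
move=> ul; apply: (hlim_le (b := fun i => hnorm (u i - l))) => // i.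
by rewrite -opprD hnormN.
Qed.

Lemma hlimB u v l l' : hlim u l -> hlim v l' -> hlim (fun i => u i - v i) (l - l').
Proof. by move=> ul /hlimN; exact: hlimD. Qed.

Lemma hlim_uniq u l l' : hlim u l -> hlim u l' -> l = l'.
Proof.
move=> ul ul'; have := hlimB ul ul'; rewrite /hlim => h.
have : hnorm (l - l') = 0.
  have h' : hnorm (l - l') @[_ --> \oo] --> (0 : R).
    by apply: cvg_trans h; apply: near_eq_cvg; near=> i; rewrite subrr sub0r hnormN.
  exact: (cvg_unique (@Rhausdorff R) (@cvg_cst _ _ _ _ _) h').
by move/(hnorm_eq0 hV)/eqP; rewrite subr_eq0 => /eqP.
Unshelve. all: by end_near. Qed.

Lemma hlim_rip u l x : hlim u l -> rip (u i) x @[i --> \oo] --> rip l x.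
Proof.
move=> ul; apply/cvgrPdist_le => e e0.
have [N hN] := (hlimP u l).1 ul _ (divr_gt0 e0 (ltr_wpDl (hnorm_ge0 x) ltr01)).
exists N => //= i /hN ui; rewrite distrC -ripBl//.
rewrite (le_trans (rip_le _ _ _))//.
rewrite -(divfK (lt0r_neq0 (ltr_wpDl (hnorm_ge0 x) ltr01)) e).
by rewrite ler_pM ?hnorm_ge0 ?(ltW ui)// lerDl.
Qed.

Lemma hlim_norm u l : hlim u l -> hnorm (u i) @[i --> \oo] --> hnorm l.
Proof.
move=> /hlimP ul; apply/cvgrPdist_le => e /ul[N hN].
by exists N => //= i /hN/ltW; apply: le_trans; rewrite distrC hnorm_leB.
Qed.

Lemma hlim_cauchy u l : hlim u l -> forall e, 0 < e -> exists N, forall i j,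
  (N <= i)%N -> (N <= j)%N -> hnorm (u i - u j) < e.
Proof.
move=> /hlimP ul e e0; have [N hN] := ul _ (divr_gt0 e0 (ltr0n R 2)).
exists N => i j /hN ui /hN uj.
rewrite (le_lt_trans (hnormDB hV (u i) l (u j)))// (hnormBC hV l); lra.
Qed.

Lemma geometric_cauchy u (C : R) :
  (forall i, hnorm (u i.+1 - u i) <= C * 2^-1 ^+ i) -> exists l, hlim u l.
Proof.
move=> hu; apply: (hilbert_complete hV).
have C0 : 0 <= C by have := hu 0; rewrite expr0 mulr1; apply: le_trans; exact: hnorm_ge0.
(* The exact geometric sum rather than its limit 2 C 2^-i: the induction step is then an
   equality. *)
have hd i n : hnorm (u (i + n)%N - u i) <= 2 * C * 2^-1 ^+ i * (1 - 2^-1 ^+ n).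
  elim: n => [|n ih]; first by rewrite addn0 subrr hnorm0// expr0 subrr mulr0.
  rewrite (le_trans (hnormDB hV _ (u (i + n)%N) _))// addnS.
  rewrite (le_trans (lerD (hu _) ih))// exprD exprS; set a := _ ^+ i; set b := _ ^+ n.
  by rewrite le_eqVlt; apply/orP; left; apply/eqP; field.
have hd2 i j : (i <= j)%N -> hnorm (u j - u i) <= 2 * C * 2^-1 ^+ i.
  move=> ij; rewrite -(subnKC ij) (le_trans (hd _ _))//.
  by rewrite ler_piMr ?mulr_ge0 ?exprn_ge0// gerBl exprn_ge0.
move=> e e0.
have : (2 * C + 2 * C) * 2^-1 ^+ i @[i --> \oo] --> (0 : R).
  rewrite -[X in _ --> X](mulr0 (2 * C + 2 * C)); apply: cvgM; first exact: cvg_cst.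
  by apply: cvg_expr; rewrite ger0_norm; lra.
move/cvg0_nat => h; have {h}[|N hN] := h _ e e0.
  by move=> i; rewrite mulr_ge0 ?exprn_ge0// addr_ge0 ?mulr_ge0.
exists N => i j Ni Nj; rewrite (le_lt_trans (hnormDB hV _ (u N) _))//.
rewrite (le_lt_trans _ (hN N (leqnn _)))// mulrDl lerD ?hd2//.
by rewrite (hnormBC hV) hd2.
Qed.

End Fixed.

Lemma hlim_bounded V W (G : V -> W) u l (hV : hilbert V) (hW : hilbert W) :
  bounded_op G -> hlim u l -> hlim (G \o u) (G l).
Proof.
move=> [linG [C hC]] ul; apply: (hlim_le (b := fun i => C * hnorm (u i - l))).
  move=> i /=; have -> : G (u i) - G l = G (u i - l); last exact: hC.
  by rewrite -[in RHS]scaleN1r addrC -[X in _ = G X]addrC addrC linG scaleN1r addrC.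
by rewrite -[X in _ --> X](mulr0 C); apply: cvgM => //; exact: cvg_cst.
Qed.

End HilbertLimits.

Section BoundedOperators.
Context {R : realType} {k : scalar_kind}.
Implicit Types V W : ipSpace R k.

Section Bop.
Context V W (hV : hilbert V) (hW : hilbert W) (G : V -> W) (bG : bounded_op G).

Lemma bopP (c : scal R k) x y : G (c *: x + y) = c *: G x + G y.
Proof. by case: bG => l _; exact: l. Qed.
Lemma bopD x y : G (x + y) = G x + G y.
Proof. by rewrite -{1}[x]scale1r bopP scale1r. Qed.
Lemma bop0 : G 0 = 0.
Proof. by apply: (addrI (G 0)); rewrite -bopD !addr0. Qed.
Lemma bopZ (c : scal R k) x : G (c *: x) = c *: G x.
Proof. by rewrite -[c *: x]addr0 bopP bop0 addr0. Qed.
Lemma bopN x : G (- x) = - G x. Proof. by rewrite -scaleN1r bopZ scaleN1r. Qed.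
Lemma bopB x y : G (x - y) = G x - G y. Proof. by rewrite bopD bopN. Qed.
Lemma bop_sum (I : Type) (r : seq I) (p : pred I) (F : I -> V) :
  G (\sum_(i <- r | p i) F i) = \sum_(i <- r | p i) G (F i).
Proof. by apply: (big_morph G); [exact: bopD|exact: bop0]. Qed.

Lemma bop_bound : exists2 C : R, 0 < C & forall x, hnorm (G x) <= C * hnorm x.
Proof.
case: bG => _ [C hC]; exists (`|C| + 1); first by rewrite ltr_wpDl.
move=> x; rewrite (le_trans (hC x))// ler_wpM2r ?hnorm_ge0//.
by rewrite (le_trans (ler_norm C))// lerDl.
Qed.
End Bop.

Lemma bounded_opP V W (G : V -> W) (C : R) : hilbert V -> hilbert W ->
  (forall (c : scal R k) x y, G (c *: x + y) = c *: G x + G y) ->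
  (forall x, hnorm (G x) <= C * hnorm x) -> bounded_op G.
Proof. by move=> _ _ l hC; split; [move=> c x y; exact: l|exists C]. Qed.

Lemma bounded_op_comp V W (X : ipSpace R k) (G : W -> X) (F : V -> W) :
  hilbert V -> hilbert W -> hilbert X ->
  bounded_op G -> bounded_op F -> bounded_op (fun x => G (F x)).
Proof.
move=> hV hW hX bG bF.
have [C C0 hC] := bop_bound bG; have [D D0 hD] := bop_bound bF.
apply: (bounded_opP (C := C * D)) => // [c x y|x]; first by rewrite !bopP.
by rewrite (le_trans (hC _))// -mulrA ler_wpM2l// ltW.
Qed.

Lemma bounded_op_lin V W (c : scal R k) (G F : V -> W) :
  hilbert V -> hilbert W -> bounded_op G -> bounded_op F ->
  bounded_op (fun x => c *: G x + F x).
Proof.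
move=> hV hW bG bF.
have [C C0 hC] := bop_bound bG; have [D D0 hD] := bop_bound bF.
apply: (bounded_opP (C := Num.sqrt (sabs2 c) * C + D)) => // [a x y|x].
  by rewrite (bopP bG) (bopP bF) scalerDr scalerA mulrC -scalerA addrACA -scalerDr.
rewrite (le_trans (hnormD hW _ _))// hnormZ// mulrDl lerD// -mulrA.
by rewrite ler_wpM2l// sqrtr_ge0.
Qed.

Lemma bounded_op0 V W : hilbert V -> hilbert W -> bounded_op (fun _ : V => (0 : W)).
Proof.
move=> hV hW; apply: (bounded_opP (C := 0)) => // [c x y|x].
  by rewrite scaler0 addr0.
by rewrite hnorm0// mul0r.
Qed.

Lemma bounded_op_id V : hilbert V -> bounded_op (fun x : V => x).
Proof. by move=> hV; apply: (bounded_opP (C := 1)) => // x; rewrite mul1r. Qed.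

Lemma bounded_opB V W (G F : V -> W) :
  hilbert V -> hilbert W -> bounded_op G -> bounded_op F ->
  bounded_op (fun x => G x - F x).
Proof.
move=> hV hW bG bF; have -> : (fun x => G x - F x) = (fun x => -1 *: F x + G x).
  by apply/funext => x; rewrite scaleN1r addrC.
exact: bounded_op_lin.
Qed.

Lemma bounded_opZ V W (c : scal R k) (G : V -> W) :
  hilbert V -> hilbert W -> bounded_op G -> bounded_op (fun x => c *: G x).
Proof.
move=> hV hW bG; have -> : (fun x => c *: G x) = (fun x => c *: G x + 0).
  by apply/funext => x; rewrite addr0.
by apply: bounded_op_lin => //; exact: bounded_op0.
Qed.

Lemma bounded_op_sum V W (I : Type) (r : seq I) (F : I -> V -> W) :
  hilbert V -> hilbert W -> (forall i, bounded_op (F i)) ->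
  bounded_op (fun x => \sum_(i <- r) F i x).
Proof.
move=> hV hW bF; elim: r => [|i r ih].
  rewrite (_ : (fun _ => _) = fun=> 0); first exact: bounded_op0.
  by apply/funext => x; rewrite big_nil.
rewrite (_ : (fun _ => _) = (fun x => 1 *: F i x + \sum_(j <- r) F j x)).
  exact: bounded_op_lin.
by apply/funext => x; rewrite big_cons scale1r.
Qed.

End BoundedOperators.

Import HBNNSimple.

(** * Almost everywhere convergence *)

Section ErealLimits.
Context {R : realType}.
Local Open Scope ereal_scope.

Lemma ecvg0_nat (a : nat -> \bar R) : (forall i, 0 <= a i) ->
  (a i @[i --> \oo] --> 0) <->
  (forall e : R, (0 < e)%R -> exists N, forall i, (N <= i)%N -> a i <= e%:E).
Proof.
move=> a0; split=> [/fine_cvgP[[N0 _ hf] /cvgrPdist_le h] e /h[N _ hN]|h].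
  exists (maxn N0 N) => i; rewrite geq_max => /andP[/hf/= af /hN/=].
  by rewrite sub0r normrN ger0_norm ?fine_ge0// => ie; rewrite -(fineK af) lee_fin.
have afin : \forall i \near \oo, a i \is a fin_num.
  have [N hN] := h _ ltr01; exists N => //= i /hN ai.
  by rewrite ge0_fin_numE// (le_lt_trans ai)// ltry.
apply/fine_cvgP; split => //; apply/cvgrPdist_le => e /h[N hN].
case: afin => N0 _ hN0; exists (maxn N0 N) => // i /=; rewrite geq_max.
move=> /andP[/hN0/= af /hN]; rewrite -{1}(fineK af) lee_fin.
by rewrite sub0r normrN ger0_norm// fine_ge0.
Qed.

End ErealLimits.

Section AlmostEverywhere.
Context {R : realType} d (T : measurableType d) (mu : {measure set T -> \bar R}).
Local Open Scope ereal_scope.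

Lemma aeS (P Q : T -> Prop) : (forall x, P x -> Q x) ->
  {ae mu, forall x, P x} -> {ae mu, forall x, Q x}.
Proof.
have F : Filter (almost_everywhere mu) by exact: ae_filter_ringOfSetsType.
by move=> PQ; exact: (@filterS _ _ F P Q).
Qed.

Lemma aeS2 (P Q S : T -> Prop) : (forall x, P x -> Q x -> S x) ->
  {ae mu, forall x, P x} -> {ae mu, forall x, Q x} -> {ae mu, forall x, S x}.
Proof.
have F : Filter (almost_everywhere mu) by exact: ae_filter_ringOfSetsType.
by move=> PQ; exact: (@filterS2 _ _ F P Q S).
Qed.

Lemma aeS3 (P Q S U : T -> Prop) : (forall x, P x -> Q x -> S x -> U x) ->
  {ae mu, forall x, P x} -> {ae mu, forall x, Q x} -> {ae mu, forall x, S x} ->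
  {ae mu, forall x, U x}.
Proof.
have F : Filter (almost_everywhere mu) by exact: ae_filter_ringOfSetsType.
by move=> PQ; exact: (@filterS3 _ _ F P Q S U).
Qed.

(* [\int] of a nonnegative function is a supremum over simple functions below
   it, so no measurability is needed here. *)
Lemma nonneg_ae_le_integral (D : set T) (f g : T -> \bar R) :
  (forall x, D x -> 0 <= f x) -> (forall x, D x -> 0 <= g x) ->
  {ae mu, forall x, D x -> f x <= g x} ->
  \int[mu]_(x in D) f x <= \int[mu]_(x in D) g x.
Proof.
move=> f0 g0 [N [mN N0 hN]].
have rf0 x : 0 <= (f \_ D) x by exact: erestrict_ge0.
have rg0 x : 0 <= (g \_ D) x by exact: erestrict_ge0.
rewrite (integral_mkcond D f) (integral_mkcond D g) (ge0_integralTE _ rf0).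
rewrite (ge0_integralTE _ rg0).
apply: ge_ereal_sup => _ [h hf <-].
have mNC : measurable (~` N) by exact: measurableC.
pose h' := proj_nnsfun h mNC.
apply: (@le_trans _ _ (sintegral mu h')); last first.
  apply: ereal_sup_ubound; exists h' => //= x; rewrite /h' /proj_nnsfun/= mindicE.
  have [xN|xN] := boolP (x \in ~` N).
    rewrite mulr1 (le_trans (hf x))// /patch; case: ifPn => // xD.
    have : (D x -> f x <= g x) by apply: contrapT => /hN; move: xN; rewrite inE.
    by apply; move: xD; rewrite inE.
  by rewrite mulr0; exact: erestrict_ge0.
rewrite -!integralT_nnsfun.
apply: (ae_ge0_le_integral measurableT) => //.
- by move=> x _; rewrite lee_fin.
- by apply/measurable_EFinP.
- by move=> x _; rewrite lee_fin.
- by apply/measurable_EFinP.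
exists N; split => // x /= /not_implyP[_]; apply: contra_notP => xN.
by rewrite mindicE mem_set// mulr1.
Qed.

Lemma nonneg_ae_eq_integral (D : set T) (f g : T -> \bar R) :
  (forall x, D x -> 0 <= f x) -> (forall x, D x -> 0 <= g x) ->
  {ae mu, forall x, D x -> f x = g x} ->
  \int[mu]_(x in D) f x = \int[mu]_(x in D) g x.
Proof.
move=> f0 g0 fg; apply/eqP; rewrite eq_le; apply/andP; split;
  apply: nonneg_ae_le_integral => //; apply: aeS fg => x h Dx;
  by rewrite h.
Qed.

Lemma nonneg_le_integral (D : set T) (f g : T -> \bar R) :
  (forall x, D x -> 0 <= f x) -> (forall x, D x -> f x <= g x) ->
  \int[mu]_(x in D) f x <= \int[mu]_(x in D) g x.
Proof.
move=> f0 fg; apply: nonneg_ae_le_integral => //.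
  by move=> x Dx; exact: le_trans (f0 x Dx) (fg x Dx).
exact: aeW.
Qed.

Lemma integral_lty_ae (D : set T) (f : T -> \bar R) : measurable D ->
  measurable_fun D f -> (forall x, D x -> 0 <= f x) ->
  \int[mu]_(x in D) f x < +oo -> {ae mu, forall x, D x -> f x < +oo}.
Proof.
move=> mD mf f0 fi; have : mu.-integrable D f.
  apply/integrableP; split => //.
  by under eq_integral => x /set_mem Dx do rewrite gee0_abs ?f0//.
move=> /(integrable_ae mD); apply: aeS => x h /h.
by rewrite fin_numElt => /andP[].
Qed.

Lemma nneseries_geo_le (a : nat -> \bar R) (C : R) :
  (forall i, 0 <= a i) -> (forall i, a i <= (C * 2^-1 ^+ i)%:E) ->
  \sum_(0 <= i <oo) a i <= (2 * C)%:E.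
Proof.
move=> a0 aC; apply: lime_le; first by apply: is_cvg_nneseries.
apply: nearW => n; rewrite (@le_trans _ _ (\sum_(0 <= i < n) (C * 2^-1 ^+ i)%:E))//.
  by apply: lee_sum => i _; exact: aC.
rewrite sumEFin lee_fin -mulr_sumr [leRHS]mulrC.
have C0 : (0 <= C)%R by have := le_trans (a0 0%N) (aC 0%N); rewrite lee_fin expr0 mulr1.
apply: ler_wpM2l => //.
have -> : (\sum_(0 <= i < n) 2^-1 ^+ i = 2 * (1 - 2^-1 ^+ n) :> R)%R.
  elim: n => [|n ih]; first by rewrite big_geq// expr0 subrr mulr0.
  by rewrite big_nat_recr//= ih exprS; field.
by rewrite ler_piMr// gerBl exprn_ge0.
Qed.

(** Fatou's lemma for an a.e. limit and a bound that holds from rank N on: g agrees a.e. with the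
    measurable lower limit. *)
Lemma fatou_le (D : set T) (mD : measurable D) (F : nat -> T -> \bar R)
    (g : T -> \bar R) (C : \bar R) (N : nat) :
  (forall n, measurable_fun D (F n)) -> (forall n x, D x -> 0 <= F n x) ->
  (forall n, (N <= n)%N -> \int[mu]_(x in D) F n x <= C) ->
  (forall x, D x -> 0 <= g x) ->
  {ae mu, forall x, D x -> F n x @[n --> \oo] --> g x} ->
  \int[mu]_(x in D) g x <= C.
Proof.
move=> mF F0 hC g0 hg.
have einf0 x : D x -> 0 <= limn_einf (F^~ x).
  move=> Dx; rewrite limn_einf_lim; apply: lime_ge; first exact: is_cvg_einfs.
  by apply: nearW => n; apply: le_ereal_inf_tmp => _ [m _ <-]; exact: F0.
pose g' x := limn_einf (F^~ x).
have -> : \int[mu]_(x in D) g x = \int[mu]_(x in D) g' x.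
  apply: nonneg_ae_eq_integral => //; apply: aeS hg => x h /h {}h.
  by rewrite /g' is_cvg_limn_einfE; [apply/esym/cvg_lim|apply/cvg_ex; exists (g x)].
apply: le_trans (fatou _ _ _ _) _ => //.
rewrite limn_einf_lim; apply: lime_le; first exact: is_cvg_einfs.
(* The infimum over ranks at least n is compared with the term of rank max(n, N), where the bound is
   available. *)
apply: nearW => n; apply: (@le_trans _ _ (\int[mu]_(x in D) F (maxn n N) x)).
  by apply: ereal_inf_lbound; exists (maxn n N) => //=; exact: leq_maxl.
by apply: hC; exact: leq_maxr.
Qed.

End AlmostEverywhere.

(** * Riesz-Fischer for vector-valued functions *)

Section RieszFischer.
Context {R : realType} {k : scalar_kind} d (T : measurableType d).
Context (mu : {measure set T -> \bar R}) (D : set T) (mD : measurable D).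
Context (V : ipSpace R k) (hV : hilbert V) (f : nat -> T -> V).
Hypothesis mf : forall i j, measurable_fun D (fun x => hnorm (f i x - f j x)).
Local Open Scope ereal_scope.
Local Notation n2 i j := (\int[mu]_(x in D) (hnorm (f i x - f j x) ^+ 2)%:E).

(** The weighted squares 4^i ||f_(i+1) - f_i||^2 have integrals at most 2^-i, so their sum is finite
    a.e.; each increment is then O(2^-i) and the sequence is geometrically Cauchy at almost every
    point. *)
Lemma ae_cvg_of_fast_cauchy (phi : nat -> nat) :
  (forall i, n2 (phi i.+1) (phi i) <= (8^-1 ^+ i)%:E) ->
  {ae mu, forall x, D x -> exists l, hlim (fun i => f (phi i) x) l}.
Proof.
move=> fast; pose a i x := hnorm (f (phi i.+1) x - f (phi i) x).
pose g i x : \bar R := (4 ^+ i * a i x ^+ 2)%:E.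
have g0 i x : D x -> 0 <= g i x.
  by move=> _; rewrite lee_fin mulr_ge0 ?exprn_ge0// hnorm_ge0.
have mg i : measurable_fun D (g i).
  apply/measurable_EFinP; apply: measurable_funM; first exact: measurable_cst.
  by apply: measurable_funX; exact: mf.
have mS : measurable_fun D (fun x => \sum_(0 <= i <oo) g i x).
  by apply: ge0_emeasurable_sum => // i x Dx _; exact: g0.
have : \int[mu]_(x in D) \sum_(0 <= i <oo) g i x < +oo.
  rewrite integral_nneseries//; apply: (@le_lt_trans _ _ (2 * 1)%:E); last exact: ltry.
  apply: nneseries_geo_le => i; first by apply: integral_ge0 => x; exact: g0.
  under eq_integral do rewrite /g EFinM.
  rewrite ge0_integralZl_EFin//; last first.
    by apply/measurable_EFinP; apply: measurable_funX; exact: mf.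
    by move=> x _; rewrite lee_fin exprn_ge0// hnorm_ge0.
  rewrite (@le_trans _ _ ((4 ^+ i)%:E * (8^-1 ^+ i)%:E))//.
    by rewrite lee_pmul2l ?lte_fin ?exprn_gt0//; exact: fast.
  rewrite -EFinM lee_fin -exprMn mul1r.
  by have -> : (4 * 8^-1 = 2^-1 :> R)%R by field.
move/(integral_lty_ae mD mS); move=> /(_ _)h; have {}h := h (fun x Dx => nneseries_ge0 (fun i _ _ => g0 i x Dx)).
apply: aeS h => x h Dx.
have {h} := h Dx; set S := \sum_(0 <= i <oo) _ => Sfin.
have S0 : 0 <= S by apply: nneseries_ge0 => i _ _; exact: g0.
have gS i : g i x <= S.
  apply: (@le_trans _ _ (\sum_(0 <= j < i.+1) g j x)).
    rewrite big_nat_recr//= leeDr// sume_ge0// => j _; exact: g0.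
  by apply: nneseries_lim_ge => j _ _; exact: g0.
have Sr : S = (fine S)%:E by rewrite fineK// ge0_fin_numE.
apply: (geometric_cauchy hV (C := fine S + 1)) => i.
have := gS i; rewrite Sr /g lee_fin -/(a i x) => h.
have fS : (0 <= fine S)%R by rewrite fine_ge0.
have a0 : (0 <= a i x)%R by exact: hnorm_ge0.
rewrite -ler_sqr ?nnegrE ?mulr_ge0 ?addr_ge0 ?exprn_ge0//.
rewrite exprMn -exprM mulnC exprM.
have -> : (2^-1 ^+ 2 = 4^-1 :> R)%R by field.
rewrite exprVn ler_pdivlMr ?exprn_gt0// mulrC (le_trans h)//.
by nra.
Qed.

Hypothesis cauchy : forall e : R, (0 < e)%R -> exists N, forall i j,
  (N <= i)%N -> (N <= j)%N -> n2 i j <= e%:E.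

Lemma L2_cauchy_ae_subseq : exists phi : nat -> nat, (forall i, (i <= phi i)%N) /\
  {ae mu, forall x, D x -> exists l, hlim (fun i => f (phi i) x) l}.
Proof.
have /choice[N hN] : forall i, exists N, forall i1 i2, (N <= i1)%N -> (N <= i2)%N ->
    n2 i1 i2 <= (8^-1 ^+ i)%:E.
  by move=> i; apply: cauchy; rewrite exprn_gt0.
(* The partial sums of N dominate [N i] at both ranks i and i.+1, and the summand i ensures i <= phi
   i. *)
pose phi i := (\sum_(j < i.+1) N j + i)%N.
exists phi; split; first by move=> i; rewrite leq_addl.
apply: ae_cvg_of_fast_cauchy => i; apply: hN; rewrite /phi.
  by rewrite big_ord_recr/= big_ord_recr/= -!addnA addnCA leq_addr.
by rewrite big_ord_recr/= -addnA addnCA leq_addr.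
Qed.

(** For fixed i, Fatou is applied to ||f_i - f_(phi j)||^2 as j grows: the Cauchy bound passes to
    the distance from f_i to the a.e. limit. *)
Lemma L2_cauchy_cvg (phi : nat -> nat) (g : T -> V) : (forall i, (i <= phi i)%N) ->
  {ae mu, forall x, D x -> hlim (fun i => f (phi i) x) (g x)} ->
  \int[mu]_(x in D) (hnorm (f i x - g x) ^+ 2)%:E @[i --> \oo] --> 0.
Proof.
move=> hphi hg; apply/ecvg0_nat.
  by move=> i; apply: integral_ge0 => x _; rewrite lee_fin exprn_ge0// hnorm_ge0.
move=> e e0; have [N hN] := cauchy e0; exists N => i Ni.
pose F j x : \bar R := (hnorm (f i x - f (phi j) x) ^+ 2)%:E.
apply: (@fatou_le _ _ _ mu D mD F _ _ N).
- move=> j; apply/measurable_EFinP; apply: measurable_funX; exact: mf.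
- by move=> j x Dx; rewrite lee_fin exprn_ge0// hnorm_ge0.
- by move=> j Nj; apply: hN => //; exact: leq_trans (hphi j).
- by move=> x Dx; rewrite lee_fin exprn_ge0// hnorm_ge0.
apply: aeS hg => x h /h {}h.
apply: cvg_EFin; first exact: nearW.
have := hlim_norm hV (hlimB hV (hlim_cst hV (f i x)) h) => {}h.
exact: (cvgM h h).
Qed.

End RieszFischer.

Arguments hlim_rip {R k V} hV {u l} x _.

Lemma cvg_nat_uniq (R : realType) (u : nat -> R) (a b : R) :
  u i @[i --> \oo] --> a -> u i @[i --> \oo] --> b -> a = b.
Proof. exact: (@cvg_unique R (@Rhausdorff R)). Qed.

Lemma cvg_nat_eq (R : realType) (u v : nat -> R) (a : R) (N : nat) :
  (forall n, (N <= n)%N -> u n = v n) ->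
  v i @[i --> \oo] --> a -> u i @[i --> \oo] --> a.
Proof.
move=> uv va; apply: cvg_trans va; apply: near_eq_cvg.
by exists N => //= n /uv ->.
Qed.

Lemma cvg_sqr (R : realType) (u : nat -> R) (a : R) :
  u i @[i --> \oo] --> a -> u i ^+ 2 @[i --> \oo] --> a ^+ 2.
Proof. by move=> ua; exact: (cvgM ua ua). Qed.

Section ImaginaryPart.
Context {R : realType} {k : scalar_kind} (V : ipSpace R k) (hV : hilbert V).
Implicit Types x y : V.

Lemma sIm_ip_le x y : `|sIm (ip x y)| <= hnorm x * hnorm y.
Proof.
rewrite -ler_sqr ?nnegrE ?mulr_ge0 ?hnorm_ge0// real_normK ?num_real//.
by rewrite exprMn (le_trans _ (sabs2_ip_le hV x y))// /sabs2 lerDr sqr_ge0.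
Qed.

Lemma hlim_ipIm (u : nat -> V) l x : hlim u l ->
  sIm (ip (u i) x) @[i --> \oo] --> sIm (ip l x).
Proof.
move=> ul; apply/cvgrPdist_le => eps eps0.
have [N hN] := (hlimP u l).1 ul _ (divr_gt0 eps0 (ltr_wpDl (hnorm_ge0 x) ltr01)).
exists N => //= i /hN ui; rewrite distrC -sImN -sImD -ipBl//.
rewrite (le_trans (sIm_ip_le _ _))//.
rewrite -(divfK (lt0r_neq0 (ltr_wpDl (hnorm_ge0 x) ltr01)) eps).
by rewrite ler_pM ?hnorm_ge0 ?(ltW ui)// lerDl.
Qed.

(** Over the reals [mkscal] discards its second argument and both imaginary parts vanish, hence an
    inequality where the complex case has equality. *)
Lemma sIm_mkscal_le (z : scal R k) (x y : R) :
  (sIm z - sIm (mkscal x y : scal R k)) ^+ 2 <= (sIm z - y) ^+ 2.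
Proof. by case: k z => [z|[z1 z2]] //=; rewrite subrr expr0n sqr_ge0. Qed.

End ImaginaryPart.
Arguments hlim_ipIm {R k V} hV {u l} x _.

(** * Orthonormal bases *)

Section OrthonormalSequences.
Context {R : realType} {k : scalar_kind}.
Local Notation K := (scal R k).

(* Zero vectors are allowed, so that finite bases are covered. *)
Definition onb_seq (V : ipSpace R k) (e : nat -> V) : Prop :=
  [/\ forall i, e i = 0 \/ ip (e i) (e i) = 1,
      forall i j, i <> j -> ip (e i) (e j) = 0
    & forall x, (forall i, ip x (e i) = 0) -> x = 0].

Section Expansion.
Context (V : ipSpace R k) (hV : hilbert V) (e : nat -> V) (onb : onb_seq e).
Implicit Types (x y : V) (c : nat -> K).

Let S c n : V := \sum_(i < n) c i *: e i.

Lemma onb_partial_ip c n j :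
  ip (S c n) (e j) = if (j < n)%N then c j * ip (e j) (e j) else 0.
Proof.
rewrite ip_suml//; case: ifPn => jn.
  rewrite (bigD1 (Ordinal jn))//= ipZl// big1 ?addr0// => i ij.
  rewrite ipZl//; case: onb => _ -> //; first by rewrite mulr0.
  by move=> eij; move/eqP: ij; apply; exact: val_inj.
rewrite big1// => i _; rewrite ipZl//; case: onb => _ -> //; first by rewrite mulr0.
by move=> ij; move: jn; rewrite -ij ltn_ord.
Qed.

Lemma onb_ip_le1 i : rip (e i) (e i) <= 1.
Proof. by rewrite /rip; case: onb => /(_ i)[->|->] _ _; rewrite ?ip0l// !sE. Qed.

(** Pythagoras, as an inequality because some of the e_i may be zero. *)
Lemma onb_partial_diff c m n : (m <= n)%N ->
  hnorm (S c n - S c m) ^+ 2 <= \sum_(m <= i < n) sabs2 (c i).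
Proof.
move=> mn; rewrite -(subnKC mn); elim: (n - m)%N => [|d ih].
  by rewrite addn0 subrr hnorm0// expr0n/= big_geq.
rewrite addnS big_nat_recr ?leq_addr//= /S big_ord_recr/= -/(S c _) addrAC.
rewrite hnorm2// ripD2//.
have -> : rip (S c (m + d)%N - S c m) (c (m + d)%N *: e (m + d)%N) = 0.
  rewrite /rip ipZr// ipBl// !onb_partial_ip ltnn.
  by rewrite ltnNge leq_addr/= subr0 mulr0 sRe0.
rewrite mulr0 addr0 -!hnorm2// lerD// hnormZ// exprMn sqr_sqrtr ?sabs2_ge0//.
by rewrite ler_piMr ?sabs2_ge0// hnorm2// onb_ip_le1.
Qed.

Lemma onb_partial_le c n : hnorm (S c n) ^+ 2 <= \sum_(i < n) sabs2 (c i).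
Proof.
have := onb_partial_diff c (leq0n n).
by rewrite /S big_ord0 subr0 big_mkord.
Qed.

Lemma onb_series_cvg c (C : R) : (forall n, \sum_(i < n) sabs2 (c i) <= C) ->
  exists l, hlim (S c) l.
Proof.
move=> hC; apply: (hilbert_complete hV) => eps eps0.
pose s n := \sum_(i < n) sabs2 (c i).
have s_nd : nondecreasing_seq s.
  by apply/nondecreasing_seqP => n; rewrite /s big_ord_recr/= lerDl sabs2_ge0.
have hb : has_ubound (range s) by exists C => _ [n _ <-]; exact: hC.
have sl := nondecreasing_cvgn s_nd hb.
have e2 : 0 < eps ^+ 2 by rewrite exprn_gt0.
move/cvgrPdist_lt: (sl) => /(_ _ e2)[N _ hN].
have near i j : (N <= i)%N -> (i <= j)%N -> hnorm (S c j - S c i) < eps.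
  move=> Ni ij; rewrite -ltr_sqr ?nnegrE ?hnorm_ge0 ?ltW//.
  rewrite (le_lt_trans (onb_partial_diff c ij))// (le_lt_trans _ (hN i Ni))//=.
  rewrite (le_trans _ (ler_norm _))// lerBrDr addrC.
  rewrite (le_trans _ (ub_le_sup hb (_ : range s (s j))))//.
  by rewrite /s -2!(big_mkord xpredT (fun i => sabs2 (c i))) -big_cat_nat.
exists N => i j Ni Nj; case/orP: (leq_total i j) => ij; last exact: near.
by rewrite hnormBC//; exact: near.
Qed.

Lemma onb_bessel x n : \sum_(i < n) sabs2 (ip x (e i)) <= hnorm x ^+ 2.
Proof.
pose c i := ip x (e i).
have hc i : c i * ip (e i) (e i) = c i.
  by rewrite /c; case: onb => /(_ i)[->|->] _ _; rewrite ?ip0r ?mul0r ?mulr1.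
have xS : rip x (S c n) = \sum_(i < n) sabs2 (c i).
  rewrite /rip ip_sumr// sRe_sum; apply: eq_bigr => i _.
  by rewrite ipZr// mulrC mul_sconj sRe_ofR.
have := rip_ge0 hV (x - S c n); have := onb_partial_le c n.
by rewrite ripD2// ripNr// xS ripNl// ripNr// opprK -!hnorm2// => ? ?; lra.
Qed.

Lemma onb_coef_lim c l j : hlim (S c) l -> ip l (e j) = c j * ip (e j) (e j).
Proof.
move=> hl; have near_eq (f : K -> R) : f (ip (S c n) (e j)) @[n --> \oo] -->
    f (c j * ip (e j) (e j)).
  apply: (@cvg_nat_eq _ _ (fun=> f (c j * ip (e j) (e j))) _ j.+1).
    by move=> n jn; rewrite onb_partial_ip jn.
  exact: cvg_cst.
apply: scal_ext.
  have h : sRe (ip (S c n) (e j)) @[n --> \oo] --> sRe (ip l (e j)) by exact: hlim_rip.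
  exact: cvg_nat_uniq h (near_eq sRe).
have h : sIm (ip (S c n) (e j)) @[n --> \oo] --> sIm (ip l (e j)) by exact: hlim_ipIm.
exact: cvg_nat_uniq h (near_eq sIm).
Qed.

(** Bessel's inequality makes the partial sums converge; the limit has the same coefficients as x,
    and totality identifies the two. *)
Lemma onb_expansion x : hlim (S (fun i => ip x (e i))) x.
Proof.
have [l hl] := @onb_series_cvg (fun i => ip x (e i)) _ (onb_bessel x).
suff {2}-> : x = l by [].
apply/eqP; rewrite -subr_eq0; apply/eqP; case: onb => eP _; apply => i.
rewrite ipBl// (onb_coef_lim _ hl).
by case: (eP i) => ->; rewrite ?ip0r ?mul0r ?mulr1 ?subrr.
Qed.

Lemma onb_parseval x :
  (\sum_(0 <= i <oo) (sabs2 (ip x (e i)))%:E = (hnorm x ^+ 2)%:E)%E.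
Proof.
apply/cvg_lim => //.
rewrite (_ : (fun n => _) = (fun n => (\sum_(i < n) sabs2 (ip x (e i)))%:E)); last first.
  by apply/funext => n; rewrite sumEFin big_mkord.
apply: cvg_EFin; first exact: nearW.
apply: (@cvg_nat_eq _ _ _ _ 0) (cvg_sqr (hlim_norm hV (onb_expansion x))) => n _ /=.
rewrite hnorm2// /rip ip_sumr// sRe_sum; apply: eq_bigr => i _.
rewrite ipZr// onb_partial_ip ltn_ord mulrC mulrAC mul_sconj; case: onb => /(_ i)[->|->] _ _.
  by rewrite !ip0r// mulr0 sabs2_0 sRe0.
by rewrite mulr1 sRe_ofR.
Qed.

(** The vector representing x -> <G x, y> is the series of the conj(<G e_i, y>) e_i. For s the sum
    of the first n squared moduli and S_n the partial sum, s <= C ||y|| ||S_n|| and ||S_n||^2 <= s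
    give s <= (C ||y||)^2, so the series converges. *)
Lemma adjoint_exists (W : ipSpace R k) (G : V -> W) : hilbert W -> bounded_op G ->
  exists Gs : W -> V, forall x (y : W), ip (G x) y = ip x (Gs y).
Proof.
move=> hW bG; suff : forall y : W, exists z, forall x, ip (G x) y = ip x z.
  by move=> /choice[Gs hGs]; exists Gs => x y.
move=> y; have [C C0 hC] := bop_bound bG.
pose c i := sconj (ip (G (e i)) y).
have Sy (a : nat -> K) n : ip (G (S a n)) y = \sum_(i < n) a i * sconj (c i).
  rewrite (bop_sum bG) ip_suml//; apply: eq_bigr => i _.
  by rewrite (bopZ bG) ipZl// sconjK.
have cb n : \sum_(i < n) sabs2 (c i) <= (C * hnorm y) ^+ 2.
  set s := \sum_(i < n) _; have s0 : 0 <= s by apply: sumr_ge0 => i _; exact: sabs2_ge0.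
  have hs : s <= C * hnorm y * hnorm (S c n).
    have -> : s = rip (G (S c n)) y.
      rewrite /rip Sy sRe_sum; apply: eq_bigr => i _.
      by rewrite mul_sconj sRe_ofR.
    rewrite (le_trans (ler_norm _))// (le_trans (rip_le hW _ _))//.
    by rewrite mulrAC ler_wpM2r ?hnorm_ge0.
  have := onb_partial_le c n; rewrite -/s.
  have := hnorm_ge0 (S c n); move: hs.
  have : 0 <= C * hnorm y by rewrite mulr_ge0 ?hnorm_ge0 ?ltW.
  set A := C * _; set N := hnorm _ => A0 hs N0 hN.
  have [->|sp] := eqVneq s 0; first by rewrite sqr_ge0.
  have {}sp : 0 < s by rewrite lt0r sp.
  rewrite -(ler_pM2r sp); have : s ^+ 2 <= (A * N) ^+ 2 by rewrite ler_sqr ?nnegrE// mulr_ge0.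
  rewrite exprMn; have := sqr_ge0 A; nra.
have [l hl] := onb_series_cvg cb.
exists l => x; have hx := onb_expansion x.
have hG := hlim_bounded hV hW bG hx.
have cl i : ip (e i) l = sconj (c i).
  rewrite ipC// (onb_coef_lim i hl).
  case: onb => /(_ i)[ei|->] _ _; last by rewrite mulr1.
  by rewrite /c ei (bop0 bG) !ip0l// !sconj0 mul0r sconj0.
have xl n : ip (S (fun i => ip x (e i)) n) l = ip (G (S (fun i => ip x (e i)) n)) y.
  by rewrite Sy ip_suml//; apply: eq_bigr => i _; rewrite ipZl// cl.
apply: scal_ext.
  have h1 := hlim_rip hW y hG; have h2 := hlim_rip hV l hx.
  apply: (cvg_nat_uniq h1); apply: (@cvg_nat_eq _ _ _ _ 0 _ h2) => n _ /=.
  by rewrite /rip xl.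
have h1 := hlim_ipIm hW y hG; have h2 := hlim_ipIm hV l hx.
apply: (cvg_nat_uniq h1); apply: (@cvg_nat_eq _ _ _ _ 0 _ h2) => n _ /=.
by rewrite xl.
Qed.

(** The dense sequence consists of the finite combinations of the basis with rational real and
    imaginary parts, enumerated by [unpickle] on lists of pairs of rationals. *)
Lemma separable_of_onb_seq : hseparable V.
Proof.
pose comb (s : seq (rat * rat)) : V :=
  \sum_(i < size s) (mkscal (ratr (nth (0, 0) s i).1) (ratr (nth (0, 0) s i).2) : K) *: e i.
exists (fun n => if unpickle n is Some s then comb s else 0) => x eps eps0.
have [n hn] := (hlimP _ x).1 (onb_expansion x) _ (divr_gt0 eps0 (ltr0n R 2)).
(* Each of the n coefficients is off by at most 2 dl in modulus, so the total error stays below eps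
   / 2. *)
pose dl := eps / (4 * n.+1%:R).
have d0 : 0 < dl by rewrite divr_gt0// mulr_gt0.
have ratapp (r : R) : exists q : rat, `|r - ratr q| < dl.
  have [q] : exists q : rat, ratr q \in `]r - dl, r[.
    by apply: rat_in_itvoo; rewrite ltrBlDr ltrDl.
  rewrite in_itv/= => /andP[h1 h2]; exists q.
  by rewrite ger0_norm ?subr_ge0 ?(ltW h2)//; lra.
have [q hq] := choice ratapp.
pose s := [seq (q (sRe (ip x (e i))), q (sIm (ip x (e i)))) | i <- iota 0 n].
exists (pickle s); rewrite pickleK.
have sz : size s = n by rewrite size_map size_iota.
rewrite (le_lt_trans (hnormDB hV _ (S (fun i => ip x (e i)) n) _))//.
rewrite [ltRHS](_ : _ = eps / 2 + eps / 2); last by field.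
rewrite hnormBC// ltr_leD ?hn// /comb sz /S -sumrB.
rewrite (le_trans (hnorm_sum hV _ _ _))//.
apply: (@le_trans _ _ (\sum_(i < n) (2 * dl))).
  apply: ler_sum => i _; rewrite -scalerBl hnormZ//.
  rewrite (nth_map 0%N) ?size_iota// nth_iota// add0n/=.
  set z := ip x (e i); set w := mkscal _ _.
  have e1 : hnorm (e i) <= 1.
    by rewrite -(@expr_le1 _ 2) ?hnorm_ge0// hnorm2// onb_ip_le1.
  rewrite (le_trans (ler_wpM2l (sqrtr_ge0 _) e1))// mulr1.
  rewrite -(ger0_norm (mulr_ge0 (ler0n R 2) (ltW d0))) -sqrtr_sqr ler_sqrt ?sqr_ge0//.
  have h1 := ltW (hq (sRe z)); have h2 := ltW (hq (sIm z)).
  have sqr_le (r : R) : `|r| <= dl -> r ^+ 2 <= dl ^+ 2.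
    by move=> h; rewrite -real_normK ?num_real// ler_sqr ?nnegrE// ltW.
  move: (sqr_le _ h1) (sqr_le _ h2) => h1' h2'.
  have : sabs2 (z - w) <= (sRe z - ratr (q (sRe z))) ^+ 2 + (sIm z - ratr (q (sIm z))) ^+ 2.
    by rewrite /sabs2 !sE /w sRe_mkscal lerD2l sIm_mkscal_le.
  by move: h1' h2'; nra.
rewrite sumr_const card_ord -(mulr_natl _ n) /dl.
rewrite [leLHS](_ : _ = eps / 2 * (n%:R / n.+1%:R)); last by field; rewrite ?pnatr_eq0.
rewrite ler_piMr ?divr_ge0 ?(ltW eps0)// ler_pdivrMr ?ltr0n// mul1r ler_nat.
by [].
Qed.

End Expansion.

Section GramSchmidt.
Context (V : ipSpace R k) (hV : hilbert V) (x : nat -> V).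

(** [gram_schmidt n] is the table of the first n vectors, extended by 0, which makes the recursion
    structural. A vector depending on its predecessors leaves a zero remainder; since the inverse of
    0 is 0 it is sent to 0, as [onb_seq] permits. *)
Fixpoint gram_schmidt (n : nat) : nat -> V := fun i =>
  if n isn't m.+1 then 0 else
  if i == m then
    let v := x m - \sum_(j < m) ip (x m) (gram_schmidt m j) *: gram_schmidt m j in
    ofR (hnorm v)^-1 *: v
  else gram_schmidt m i.

Let e i := gram_schmidt i.+1 i.

Let gsE n i : (i < n)%N -> gram_schmidt n i = e i.
Proof.
elim: n => // n ih; rewrite ltnS leq_eqVlt => /orP[/eqP->//|lin] /=.
by rewrite (ltn_eqF lin) ih.
Qed.

Let v n := x n - \sum_(j < n) ip (x n) (e j) *: e j.

Let eE n : e n = ofR (hnorm (v n))^-1 *: v n.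
Proof.
rewrite /e /= eqxx /v.
by rewrite (eq_bigr (fun j : 'I_n => ip (x n) (e j) *: e j))// => j _; rewrite gsE.
Qed.

Let vE n : v n = ofR (hnorm (v n)) *: e n.
Proof.
rewrite eE scalerA -ofRM; have [v0|v0] := eqVneq (hnorm (v n)) 0.
  by rewrite v0 mul0r ofR0 scale0r (hnorm_eq0 hV v0).
by rewrite mulfV// ofR1 scale1r.
Qed.

Let e01 n : e n = 0 \/ ip (e n) (e n) = 1.
Proof.
have [v0|v0] := eqVneq (hnorm (v n)) 0.
  by left; rewrite eE (hnorm_eq0 hV v0) scaler0.
right; rewrite eE ipZl// ipZr// sconj_ofR ipxx// -hnorm2// -!ofRM.
by rewrite expr2 mulKf// mulVf// ofR1.
Qed.

Let e_orth n i : (i < n)%N -> ip (e n) (e i) = 0.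
Proof.
elim/ltn_ind: n i => n ih i lin.
rewrite (eE n) ipZl//; set a := ofR _.
rewrite /v ipBl// ip_suml// (bigD1 (Ordinal lin))// ipZl// big1.
  rewrite Monoid.mulm1 -[e (Ordinal lin)]/(e i); case: (e01 i) => ->; first by rewrite !ip0r// mul0r subrr mulr0.
  by rewrite mulr1 subrr mulr0.
move=> j /= ji; rewrite ipZl//; have [lij|lji|eij] := ltngtP i j.
- by rewrite ih// mulr0.
- by rewrite (ipC hV (e i)) ih// sconj0 mulr0.
- by exfalso; move/eqP: ji; apply; exact/val_inj.
Qed.

Lemma onb_seq_exists_of_total : (forall y, (forall i, ip y (x i) = 0) -> y = 0) ->
  exists e : nat -> V, onb_seq e.
Proof.
move=> tot; exists e; split; first exact: e01.
  move=> i j; have [lij|lji|//] := ltngtP i j => _; last exact: e_orth.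
  by rewrite ipC// e_orth// sconj0.
move=> y hy; apply: tot => n.
have -> : x n = ofR (hnorm (v n)) *: e n + \sum_(j < n) ip (x n) (e j) *: e j.
  by rewrite -vE subrK.
rewrite ipDr// ipZr// hy mulr0 add0r ip_sumr// big1// => j _.
by rewrite ipZr// hy mulr0.
Qed.

Lemma separable_of_total : (forall y, (forall i, ip y (x i) = 0) -> y = 0) ->
  hseparable V.
Proof. by move=> /onb_seq_exists_of_total[e' he']; exact: (separable_of_onb_seq hV he'). Qed.

End GramSchmidt.

(** A vector y orthogonal to a dense sequence satisfies ||y - d_i||^2 = ||y||^2 + ||d_i||^2, so no
    d_i comes closer to y than ||y||; hence y = 0. *)
Lemma onb_seq_exists (V : ipSpace R k) : hilbert V -> hseparable V ->
  exists e : nat -> V, onb_seq e.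
Proof.
move=> hV [d hd]; apply: (onb_seq_exists_of_total hV (x := d)) => y hy.
apply: (hnorm_eq0 hV); apply/eqP; rewrite eq_le hnorm_ge0 andbT leNgt; apply/negP => y0.
have [i hi] := hd y _ y0.
have := hnorm2 hV (y - d i); rewrite ripD2// ripNr// ripNl// ripNr//.
rewrite {2}/rip hy sRe0 -!hnorm2// => h.
have : hnorm (y - d i) ^+ 2 < hnorm y ^+ 2 by rewrite ltr_sqr ?nnegrE ?hnorm_ge0.
by rewrite h; have := sqr_ge0 (hnorm (d i)); lra.
Qed.

(** Two distinct basis vectors are at distance sqrt 2, so the choice of a point of the dense
    sequence within 1/2 embeds E into nat. Indices outside the image carry the vector 0, whence the
    condition f 0 = 0. *)
Lemma orthonormal_basis_enum (V : ipSpace R k) (E : set V) : hilbert V ->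
  hseparable V -> orthonormal_basis E -> exists e : nat -> V, onb_seq e /\
  forall f : V -> \bar R, (forall x, 0 <= f x)%E -> f 0 = 0%E ->
    (\esum_(x in E) f x = \sum_(0 <= i <oo) f (e i))%E.
Proof.
move=> hV [d hd] [E1 E0 Emax].
have /choice[iota hiota] : forall x, exists i, hnorm (x - d i) < 2^-1.
  by move=> x; apply: hd; rewrite invr_gt0.
have iota_inj x y : E x -> E y -> iota x = iota y -> x = y.
  move=> Ex Ey xy; apply: contrapT => nxy.
  have : hnorm (x - y) < 1.
    rewrite (le_lt_trans (hnormDB hV _ (d (iota x)) _))// [ltRHS](_ : _ = 2^-1 + 2^-1); last by field.
    by rewrite ltrD ?hiota// hnormBC// xy hiota.
  rewrite -(@expr_lt1 _ 2) ?hnorm_ge0// hnorm2// ripD2// ripNr// ripNl// ripNr//.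
  by rewrite /rip !E1// E0// sRe0 sRe1; lra.
pose J := [set i | exists2 x, E x & iota x = i].
have /choice[e he] : forall i, exists x, (J i -> E x /\ iota x = i) /\ (~ J i -> x = 0).
  move=> i; have [[x Ex xi]|nJ] := pselect (J i); last by exists 0.
  by exists x; split => // -[]; exists x.
have eE i : J i -> E (e i) by move=> /(he i).1[].
have e0 i : ~ J i -> e i = 0 by exact: (he i).2.
have ei x : E x -> e (iota x) = x.
  move=> Ex; have Jx : J (iota x) by exists x.
  by apply: iota_inj => //; [exact: eE|exact: ((he _).1 Jx).2].
exists e; split.
  split.
  - move=> i; have [/eE/E1|/e0] := pselect (J i); first by right.
    by left.
  - move=> i j ij; have [Ji|/e0->] := pselect (J i); last by rewrite ip0l.
    have [Jj|/e0->] := pselect (J j); last by rewrite ip0r.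
    apply: E0; [exact: eE|exact: eE|] => eij; apply: ij.
    by have := ((he _).1 Ji).2; have := ((he _).1 Jj).2; rewrite eij => -> ->.
  - by move=> x hx; apply: Emax => y Ey; rewrite -(ei y Ey).
move=> f f0 f00; rewrite nneseries_esumT//.
rewrite (reindex_esum J E e); last first.
  split; first by move=> i /= /eE.
    move=> i j /set_mem Ji /set_mem Jj eij.
    by have := ((he _).1 Ji).2; have := ((he _).1 Jj).2; rewrite eij => -> ->.
  by move=> x Ex; exists (iota x); [exists x|exact: ei].
rewrite esum_mkcond; apply: eq_esum => i _; case: ifPn => //.
by rewrite notin_setE => /e0 ->.
Qed.

End OrthonormalSequences.

(** * Measurability and integration of vector functions *)

Section VectorMeasurability.
Context {R : realType} {k : scalar_kind}.
Local Notation K := (scal R k).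

(* Measurability of [f] on [D], tested weakly; equivalent to Borel
   measurability when V is separable ([wmeasP]). *)
Definition wmeas (V : ipSpace R k) d (T : measurableType d) (D : set T)
  (f : T -> V) : Prop := forall v, measurable_fun D (fun x => rip (f x) v).

(** [mkscal 0 1] is the imaginary unit over C and 0 over R, so real parts tested on all vectors also
    give the imaginary parts. *)
Lemma sIm_ip_rip (V : ipSpace R k) (hV : hilbert V) (x y : V) :
  sIm (ip x y) = rip x (mkscal 0 1 *: y).
Proof.
rewrite /rip ipZr//; case: k V hV x y => V hV x y /=; first by rewrite mul0r.
by case: (ip x y) => u v /=; ring.
Qed.

Section Fixed.
Context (V : ipSpace R k) (hV : hilbert V) (sV : hseparable V).
Context d (T : measurableType d) (D : set T) (mD : measurable D).
Implicit Types f g : T -> V.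

Lemma wmeas_Im f y : wmeas D f -> measurable_fun D (fun x => sIm (ip (f x) y)).
Proof.
by move=> mf; rewrite (_ : (fun _ => _) = (fun x => rip (f x) (mkscal 0 1 *: y)));
  [exact: mf|apply/funext => x; rewrite sIm_ip_rip].
Qed.

Lemma wmeas_sabs2 f y : wmeas D f -> measurable_fun D (fun x => sabs2 (ip (f x) y)).
Proof. by move=> mf; apply: measurable_sabs2; [exact: mf|exact: wmeas_Im]. Qed.

Lemma wmeas_cst (v : V) : wmeas D (fun=> v).
Proof. by move=> w; exact: measurable_cst. Qed.

Lemma wmeasD f g : wmeas D f -> wmeas D g -> wmeas D (fun x => f x + g x).
Proof.
move=> mf mg v; rewrite (_ : (fun _ => _) = (fun x => rip (f x) v + rip (g x) v)).
  by apply: measurable_funD; [exact: mf|exact: mg].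
by apply/funext => x; rewrite ripDl.
Qed.

Lemma wmeasN f : wmeas D f -> wmeas D (fun x => - f x).
Proof.
move=> mf v; rewrite (_ : (fun _ => _) = (fun x => - rip (f x) v)).
  by apply: measurableT_comp => //; exact: mf.
by apply/funext => x; rewrite ripNl.
Qed.

Lemma wmeasB f g : wmeas D f -> wmeas D g -> wmeas D (fun x => f x - g x).
Proof. by move=> mf mg; apply: wmeasD => //; exact: wmeasN. Qed.

Lemma wmeasZ (c : T -> K) f : measurable_fun D (fun x => sRe (c x)) ->
  measurable_fun D (fun x => sIm (c x)) -> wmeas D f -> wmeas D (fun x => c x *: f x).
Proof.
move=> c1 c2 mf v.
rewrite (_ : (fun _ => _) =
  (fun x => sRe (c x) * rip (f x) v - sIm (c x) * sIm (ip (f x) v))).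
  by apply: measurable_funB; apply: measurable_funM => //; first [exact: mf|exact: wmeas_Im].
by apply/funext => x; rewrite /rip ipZl// sReM.
Qed.

Lemma wmeas_sum (I : Type) (r : seq I) (F : I -> T -> V) :
  (forall i, wmeas D (F i)) -> wmeas D (fun x => \sum_(i <- r) F i x).
Proof.
move=> mF; elim: r => [|i r ih].
  by rewrite (_ : (fun _ => _) = fun=> 0); [exact: wmeas_cst|apply/funext => x; rewrite big_nil].
rewrite (_ : (fun _ => _) = (fun x => F i x + \sum_(j <- r) F j x)); first exact: wmeasD.
by apply/funext => x; rewrite big_cons.
Qed.

Lemma eq_wmeas f g : (forall x, D x -> f x = g x) -> wmeas D f -> wmeas D g.
Proof.
by move=> fg mf v; apply: (eq_measurable_fun (fun x => rip (f x) v)) (mf v) => x /set_mem/fg ->.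
Qed.

Lemma wmeas_lim (F : nat -> T -> V) f : (forall n, wmeas D (F n)) ->
  (forall x, D x -> hlim (fun n => F n x) (f x)) -> wmeas D f.
Proof.
move=> mF hF v; apply: (measurable_fun_cvg (h := fun n x => rip (F n x) v)) => //.
  by move=> n; exact: mF.
by move=> x /hF h; exact: hlim_rip.
Qed.

(** The adjoint moves G onto the test vector. *)
Lemma wmeas_bop (W : ipSpace R k) (G : V -> W) f : hilbert W -> bounded_op G ->
  wmeas D f -> wmeas D (fun x => G (f x)).
Proof.
move=> hW bG mf v; have [e onb] := onb_seq_exists hV sV.
have [Gs hGs] := adjoint_exists hV onb hW bG.
rewrite (_ : (fun _ => _) = (fun x => rip (f x) (Gs v))); first exact: mf.
by apply/funext => x; rewrite /rip hGs.
Qed.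

(** Parseval writes the squared norm as a countable sum of measurable functions; this is where
    separability enters. *)
Lemma wmeas_norm f : wmeas D f -> measurable_fun D (fun x => hnorm (f x)).
Proof.
move=> mf; have [e onb] := onb_seq_exists hV sV.
rewrite (_ : (fun _ => _) = (fun x => Num.sqrt (hnorm (f x) ^+ 2))); last first.
  by apply/funext => x; rewrite sqrtr_sqr ger0_norm// hnorm_ge0.
apply: measurableT_comp; first by apply: continuous_measurable_fun; exact: sqrt_continuous.
apply/measurable_EFinP.
rewrite (_ : _ \o _ = (fun x => (\sum_(0 <= i <oo) (sabs2 (ip (f x) (e i)))%:E)%E)).
  apply: ge0_emeasurable_sum => [i x _ _|i _]; first by rewrite lee_fin sabs2_ge0.
  by apply/measurable_EFinP; exact: wmeas_sabs2.
by apply/funext => x /=; rewrite onb_parseval.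
Qed.

Lemma wmeas_dist f v : wmeas D f -> measurable_fun D (fun x => hnorm (f x - v)).
Proof. by move=> mf; apply: wmeas_norm; apply: wmeasB => //; exact: wmeas_cst. Qed.

Lemma open_rip (v : V) (r : R) : hopen [set x : V | r < rip x v].
Proof.
move=> x /= rx; exists ((rip x v - r) / (1 + hnorm v)).
  by rewrite divr_gt0 ?subr_gt0// ltr_wpDr ?hnorm_ge0.
move=> y yx /=; have h1 : 0 < 1 + hnorm v by rewrite ltr_wpDr ?hnorm_ge0.
have : `|rip (y - x) v| < rip x v - r.
  rewrite (le_lt_trans (rip_le hV _ _))//.
  rewrite (@le_lt_trans _ _ (hnorm (y - x) * (1 + hnorm v)))//.
    by rewrite ler_wpM2l ?hnorm_ge0// lerDr.
  by rewrite -ltr_pdivlMr.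
rewrite ripBl// ltr_norml => /andP[h _].
by lra.
Qed.

Lemma vmeas_wmeas f : (forall U, hopen U -> measurable (D `&` f @^-1` U)) ->
  wmeas D f.
Proof.
move=> mf v; apply: (measurability _ (RGenOInfty.measurableE R)) => _ [_ [r ->] <-].
have := mf _ (@open_rip v r); congr measurable; apply/seteqP.
by split => x /= []; rewrite in_itv/= andbT.
Qed.

(** An open set is the union of those balls B(d_i, 1/(n+1)) around the dense sequence that it
    contains, and distances to fixed points are measurable. *)
Lemma wmeas_vmeas f : wmeas D f ->
  forall U, hopen U -> measurable (D `&` f @^-1` U).
Proof.
move=> mf U oU; have [dd hdd] := sV.
pose A i n : set T := [set x | (forall y, hnorm (y - dd i) < n.+1%:R^-1 -> U y) /\
  (D `&` [set x | hnorm (f x - dd i) < n.+1%:R^-1]) x].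
have -> : D `&` f @^-1` U = \bigcup_i \bigcup_n A i n.
  apply/seteqP; split => [x [Dx Ux]|x [i _ [n _]]].
    have [r r0 hr] := oU _ Ux.
    have [n] : exists n, n.+1%:R^-1 < r / 2.
      have := near_infty_natSinv_lt (PosNum (divr_gt0 r0 (ltr0n R 2))).
      by move=> [n _ /(_ n (leqnn n))]; exists n.
    move=> hn; have [i hi] := hdd (f x) n.+1%:R^-1 (ltac:(by rewrite invr_gt0)).
    exists i => //; exists n => //; split => // y hy; apply: hr; rewrite (le_lt_trans (hnormDB hV _ (dd i) _))//.
    by rewrite (hnormBC hV (dd i)); move: hy hi hn; set q := n.+1%:R^-1 => *; lra.
  by move=> [h [Dx hx]]; split => //; exact: h.
apply: bigcup_measurable => i _; apply: bigcup_measurable => n _.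
have [h|nh] := pselect (forall y, hnorm (y - dd i) < n.+1%:R^-1 -> U y); last first.
  by rewrite (_ : A i n = set0) //; apply/seteqP; split => x // -[].
have /(_ mD _ (measurable_itv `]-oo, n.+1%:R^-1[)) := wmeas_dist (dd i) mf.
congr measurable; apply/seteqP.
by split => x /=; [case; rewrite in_itv/=|case=> _ []; rewrite in_itv].
Qed.

Lemma wmeasP f :
  wmeas D f <-> forall U, hborel U -> measurable (D `&` f @^-1` U).
Proof.
split=> [mf|mf]; last first.
  by apply: vmeas_wmeas => U oU; apply: mf; exact: sub_sigma_algebra.
suff : @hborel R k V `<=` [set U | measurable (D `&` f @^-1` U)] by [].
apply: smallest_sub; last exact: wmeas_vmeas.
split => /=.
- by rewrite preimage_set0 setI0.
- move=> A mA; rewrite setTD preimage_setC -setDE.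
  rewrite (_ : D `\` _ = D `\` (D `&` f @^-1` A)); first exact: measurableD.
  by rewrite setDIr setDv set0U.
- by move=> F mF; rewrite preimage_bigcup setI_bigcupr; exact: bigcup_measurable.
Qed.

(** By completeness, existence of a limit is the Cauchy condition, a countable combination of
    measurable sets. *)
Lemma wmeas_cvg_set (F : nat -> T -> V) : (forall n, wmeas D (F n)) ->
  measurable (D `&` [set x | exists l, hlim (fun n => F n x) l]).
Proof.
move=> mF; pose A m i j := D `&` [set x | hnorm (F i x - F j x) < m.+1%:R^-1].
have mA m i j : measurable (A m i j).
  have /(_ mD _ (measurable_itv `]-oo, m.+1%:R^-1[)) := wmeas_norm (wmeasB (mF i) (mF j)).
  by congr measurable; apply/seteqP; split => x /= []; rewrite in_itv.
have -> : D `&` [set x | exists l, hlim (fun n => F n x) l] =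
    D `&` \bigcap_m \bigcup_N \bigcap_(i in [set i | (N <= i)%N])
      \bigcap_(j in [set j | (N <= j)%N]) A m i j.
  apply/seteqP; split => x [Dx].
    move=> [l /(hlim_cauchy hV) hl]; split => // m _.
    have [N hN] := hl m.+1%:R^-1 (ltac:(by rewrite invr_gt0)).
    by exists N => // i Ni j Nj; split => //; exact: hN.
  move=> h; split => //; apply: (hilbert_complete hV) => e e0.
  have [m _ /(_ m (leqnn m)) hm] := near_infty_natSinv_lt (PosNum e0).
  have [N _ hN] := h m Logic.I; exists N => i j Ni Nj.
  by have [_ /= hx] := hN i Ni j Nj; exact: lt_trans hm.
apply: measurableI => //; apply: bigcapT_measurable => m.
apply: bigcup_measurable => N _; apply: bigcap_measurableType => i _.
by apply: bigcap_measurableType => j _.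
Qed.

(** The default 0 makes the limit a total function of the sequence, hence measurable in a parameter
    on the whole domain. It serves to build measurable representatives of a.e. limits. *)
Definition hlim_or0 (u : nat -> V) : V := xget 0 [set l | hlim u l].

Lemma hlim_or0_lim u l : hlim u l -> hlim_or0 u = l.
Proof.
move=> ul; rewrite /hlim_or0; case: xgetP => [l' _ /= ul'|/(_ l)//].
exact: (hlim_uniq hV ul').
Qed.

Lemma wmeas_restrict (A : set T) f : measurable A ->
  wmeas (D `&` A) f -> wmeas D (fun x => if pselect (A x) then f x else 0).
Proof.
move=> mA mf v; rewrite (_ : (fun _ => _) = (fun x => rip (f x) v) \_ A).
  by apply/(measurable_restrict _ mA mD); exact: mf.
apply/funext => x; rewrite patchE; case: pselect => Ax; first by rewrite mem_set.
by rewrite memNset// rip0l.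
Qed.

End Fixed.

Lemma wmeasS (V : ipSpace R k) d (T : measurableType d) (A D : set T) (f : T -> V) :
  measurable D -> A `<=` D -> wmeas D f -> wmeas A f.
Proof. by move=> mD AD mf v; exact: measurable_funS (mf v). Qed.

Lemma wmeas_comp (V : ipSpace R k) d (T : measurableType d) d' (T' : measurableType d')
    (D : set T) (D' : set T') (f : T -> V) (phi : T' -> T) :
  measurable D -> phi @` D' `<=` D -> measurable_fun D' phi -> wmeas D f ->
  wmeas D' (f \o phi).
Proof.
move=> mD phiD mphi mf v.
exact: (@measurable_comp _ _ _ _ _ _ D (fun x => rip (f x) v) D' phi).
Qed.

Lemma wmeas_hlim_or0 (V : ipSpace R k) (hV : hilbert V) (sV : hseparable V)
    d (T : measurableType d) (D : set T) (F : nat -> T -> V) : measurable D ->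
  (forall n, wmeas D (F n)) -> wmeas D (fun x => hlim_or0 (fun n => F n x)).
Proof.
move=> mD mF; pose A := D `&` [set x | exists l, hlim (fun n => F n x) l].
have mA : measurable A by exact: wmeas_cvg_set.
apply: (eq_wmeas (f := fun x => if pselect (A x) then hlim_or0 (fun n => F n x) else 0)).
  move=> x Dx; case: pselect => //= nA; rewrite /hlim_or0 xgetPN// => l hl.
  by apply: nA; split => //; exists l.
apply: wmeas_restrict => //; apply: (wmeas_lim hV (F := F)).
- by move=> n; apply: wmeasS (mF n) => //; exact: subIsetl.
- move=> x [Dx [_ [l hl]]]; rewrite (hlim_or0_lim hV hl)//.
Qed.

Lemma hmeasurableP (V : ipSpace R k) (hV : hilbert V) (sV : hseparable V)
    d (T : measurableType d) (f : T -> V) :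
  hmeasurable measurable f <-> wmeas setT f.
Proof.
rewrite wmeasP//; split => h U /h; first by rewrite setTI.
by rewrite setTI.
Qed.

(** Turns adaptedness to a sigma-algebra of the filtration into weak measurability over the
    corresponding measurable type, so that the closure properties of [wmeas] become closure
    properties of adapted processes. *)
Lemma hmeasurable_subP (V : ipSpace R k) (hV : hilbert V) (sV : hseparable V)
    (T : pointedType) (G : set (set T)) (f : T -> V) : sigma_algebra setT G ->
  hmeasurable G f <-> wmeas (T := g_sigma_algebraType G) setT f.
Proof.
move=> sG; rewrite -hmeasurableP//.
by rewrite {2}/hmeasurable /measurable/= (sigma_algebra_id sG).
Qed.

End VectorMeasurability.

(** * The Bochner integral in Pettis form *)

Section BochnerIntegral.
Context {R : realType} {k : scalar_kind} (V : ipSpace R k).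
Context (hV : hilbert V) (sV : hseparable V).
Context d (T : measurableType d) (mu : {measure set T -> \bar R}).
Context (D : set T) (mD : measurable D).
Local Notation nrm f := (\int[mu]_(x in D) (hnorm (f x))%:E)%E.
Implicit Types (f g : T -> V) (v w : V).

Lemma nrm_ge0 f : (0 <= nrm f)%E.
Proof. by apply: integral_ge0 => x _; rewrite lee_fin hnorm_ge0. Qed.

Lemma le_nrmD f g : wmeas D f -> wmeas D g ->
  (nrm (fun x => f x + g x)%R <= nrm f + nrm g)%E.
Proof.
move=> mf mg; rewrite -ge0_integralD//.
- apply: nonneg_le_integral => x _; first by rewrite lee_fin hnorm_ge0.
  by rewrite -EFinD lee_fin hnormD.
- by move=> x _; rewrite lee_fin hnorm_ge0.
- by apply/measurable_EFinP; exact: wmeas_norm.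
- by move=> x _; rewrite lee_fin hnorm_ge0.
- by apply/measurable_EFinP; exact: wmeas_norm.
Qed.

Lemma nrmN f : nrm (fun x => - f x) = nrm f.
Proof. by apply: eq_integral => x _; rewrite hnormN. Qed.

Lemma integrable_rip f v : wmeas D f -> (nrm f < +oo)%E ->
  mu.-integrable D (EFin \o (fun x => rip (f x) v)).
Proof.
move=> mf fi; apply/integrableP; split; first by apply/measurable_EFinP; exact: mf.
apply: (@le_lt_trans _ _ ((hnorm v)%:E * nrm f)%E); last first.
  by apply: lte_mul_pinfty => //; rewrite lee_fin hnorm_ge0.
rewrite -ge0_integralZl_EFin ?hnorm_ge0//.
- apply: nonneg_le_integral => // x _ /=.
  by rewrite -EFinM lee_fin mulrC rip_le.
- by move=> x _; rewrite lee_fin hnorm_ge0.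
- by apply/measurable_EFinP; exact: wmeas_norm.
Qed.

Lemma Rintegral_rip_le f v : wmeas D f -> (nrm f < +oo)%E ->
  (`|\int[mu]_(x in D) rip (f x) v|%:E <= nrm f * (hnorm v)%:E)%E.
Proof.
move=> mf fi; rewrite EFin_normr_Rintegral//; last exact: integrable_rip.
rewrite (le_trans (le_abse_integral _ _ _))//.
  by apply/measurable_EFinP; exact: mf.
rewrite muleC -ge0_integralZl_EFin ?hnorm_ge0//.
- apply: nonneg_le_integral => // x _ /=.
  by rewrite -EFinM lee_fin mulrC rip_le.
- by move=> x _; rewrite lee_fin hnorm_ge0.
- by apply/measurable_EFinP; exact: wmeas_norm.
Qed.

(* [v] is the Pettis integral of [f]. *)
Definition weak_integral f v : Prop :=
  forall w, rip v w = \int[mu]_(x in D) rip (f x) w.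

Lemma weak_integral_uniq f v v' : weak_integral f v -> weak_integral f v' -> v = v'.
Proof. by move=> h h'; apply: (rip_ext hV) => w; rewrite h h'. Qed.

(** The defining identity is tested against v itself and divided by ||v||. *)
Lemma weak_integral_le f v : wmeas D f -> (nrm f < +oo)%E -> weak_integral f v ->
  ((hnorm v)%:E <= nrm f)%E.
Proof.
move=> mf fi hv; have [->|/eqP v0] := eqVneq v 0; first by rewrite hnorm0// nrm_ge0.
have nv : 0 < hnorm v by rewrite lt0r hnorm_ge0 andbT; apply/eqP => /(hnorm_eq0 hV).
have := Rintegral_rip_le v mf fi; rewrite -hv -hnorm2// ger0_norm ?sqr_ge0//.
by rewrite expr2 EFinM lee_pmul2r.
Qed.

Lemma weak_integralB f g v w : wmeas D f -> wmeas D g -> (nrm f < +oo)%E ->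
  (nrm g < +oo)%E -> weak_integral f v -> weak_integral g w ->
  weak_integral (fun x => f x - g x) (v - w).
Proof.
move=> mf mg fi gi hv hw z; rewrite ripBl// hv hw -RintegralB//; try exact: integrable_rip.
by apply: eq_Rintegral => x _; rewrite ripBl.
Qed.

Implicit Types s : simple_fun mu V.

Lemma sf_fun_wmeas s : wmeas D (sf_fun s).
Proof.
apply: wmeas_sum => // i; apply: wmeasZ => //.
- under eq_fun do rewrite sRe_ofR.
  by apply: measurable_indic; exact: sf_measurable.
- by under eq_fun do rewrite sIm_ofR; exact: measurable_cst.
Qed.

Let fin_meas s i : (mu (D `&` sf_set (s := s) i) < +oo)%E.
Proof.
apply: le_lt_trans (sf_finite (s := s) i).
by apply: le_measure; rewrite ?inE//; [apply: measurableI => //|]; exact: sf_measurable.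
Qed.

Lemma sf_nrm s : (nrm (sf_fun s) < +oo)%E.
Proof.
apply: (@le_lt_trans _ _ (\int[mu]_(x in D)
   \sum_(i < sf_size s) ((hnorm (sf_val (s := s) i))%:E *
      (\1_(sf_set (s := s) i) x)%:E))%E).
  apply: nonneg_le_integral => x _; first by rewrite lee_fin hnorm_ge0.
  under eq_bigr do rewrite -EFinM.
  rewrite sumEFin lee_fin (le_trans (hnorm_sum hV _ _ _))//.
  by apply: ler_sum => i _; rewrite hnormZR// ger0_norm// mulrC.
rewrite ge0_integral_sum//; last first.
- by move=> i x _; rewrite mule_ge0 ?lee_fin ?hnorm_ge0.
- move=> i; apply: measurable_funeM; apply/measurable_EFinP.
  by apply: measurable_indic; exact: sf_measurable.
apply: lte_sum_pinfty => i _; rewrite ge0_integralZl_EFin ?hnorm_ge0//; last first.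
  by apply/measurable_EFinP; apply: measurable_indic; exact: sf_measurable.
rewrite integral_indic//; last exact: sf_measurable.
by rewrite lte_mul_pinfty ?lee_fin ?hnorm_ge0// setIC; exact: fin_meas.
Qed.

Lemma sf_weak s : weak_integral (sf_fun s) (sf_integral D s).
Proof.
move=> w; rewrite /sf_integral rip_suml// /Rintegral.
rewrite (_ : (\int[mu]_(x in D) _)%E = (\int[mu]_(x in D) \sum_(i < sf_size s)
   ((rip (sf_val (s := s) i) w)%:E * (\1_(sf_set (s := s) i) x)%:E))%E); last first.
  apply: eq_integral => x _; rewrite /sf_fun rip_suml// -sumEFin; apply: eq_bigr => i _.
  by rewrite ripZl// mulrC.
have ii i : mu.-integrable D (fun x => (\1_(sf_set (s := s) i) x)%:E).
  have mi : measurable_fun D (fun x => (\1_(sf_set (s := s) i) x)%:E : \bar R).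
    by apply/measurable_EFinP; apply: measurable_indic; exact: sf_measurable.
  apply/integrableP; split => //; under eq_integral do rewrite gee0_abs//.
  rewrite integral_indic//; last exact: sf_measurable.
  by rewrite setIC; exact: fin_meas.
rewrite integral_sum//; last by move=> i; exact: integrableZl.
rewrite (eq_bigr (fun i => (fine (mu (D `&` sf_set (s := s) i)) *
    rip (sf_val (s := s) i) w)%:E)); last first.
  move=> i _; rewrite integralZl// integral_indic//; last exact: sf_measurable.
  by rewrite EFinM fineK 1?muleC 1?setIC// ge0_fin_numE// setIC fin_meas.
by rewrite sumEFin; apply: eq_bigr => i _; rewrite ripZl.
Qed.

Lemma is_bochner_eq_ae f g v : {ae mu, forall x, D x -> f x = g x} ->
  is_bochner mu D f v -> is_bochner mu D g v.
Proof.
move=> fg [s [s1 s2 s3]]; exists s; split => //.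
  by apply: aeS2 fg s1 => x h h1 Dx; rewrite -h//; exact: h1.
rewrite (_ : (fun i => _) = (fun i => nrm (fun x => f x - sf_fun (s i) x)))//.
apply/funext => i; apply: nonneg_ae_eq_integral.
- by move=> x _; rewrite lee_fin hnorm_ge0.
- by move=> x _; rewrite lee_fin hnorm_ge0.
- by apply: aeS fg => x h Dx; rewrite h.
Qed.

Lemma bochner_weak f v : wmeas D f -> is_bochner mu D f v ->
  (nrm f < +oo)%E /\ weak_integral f v.
Proof.
move=> mf [s [_ /ecvg0_nat s2 s3]].
have mfs i : wmeas D (fun x => f x - sf_fun (s i) x).
  by apply: wmeasB => //; exact: sf_fun_wmeas.
have s2' := s2 (fun i => nrm_ge0 _).
have fi : (nrm f < +oo)%E.
  have [N hN] := s2' 1 ltr01.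
  rewrite (_ : nrm f = nrm (fun x => (f x - sf_fun (s N) x) + sf_fun (s N) x)).
    apply: le_lt_trans (le_nrmD (mfs N) (sf_fun_wmeas _)) _.
    by rewrite lte_add_pinfty ?sf_nrm// (le_lt_trans (hN N _))// ltry.
  by apply: eq_integral => x _; rewrite subrK.
split=> // w; have sw : rip (sf_integral D (s i)) w @[i --> \oo] --> rip v w.
  exact: (@hlim_rip _ _ _ hV (fun i => sf_integral D (s i))).
apply: (cvg_nat_uniq sw); apply/cvgrPdist_le => e e0.
have w0 : 0 < 1 + hnorm w by rewrite ltr_wpDr ?hnorm_ge0.
have [N hN] := s2' _ (divr_gt0 e0 w0); exists N => // i /hN hi /=.
have di : (nrm (fun x => f x - sf_fun (s i) x) < +oo)%E by rewrite (le_lt_trans hi)// ltry.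
rewrite (sf_weak (s i) w) -RintegralB//;
  [|exact: integrable_rip|by apply: integrable_rip; [exact: sf_fun_wmeas|exact: sf_nrm]].
rewrite (_ : \int[mu]_(x in D) _ = \int[mu]_(x in D) rip (f x - sf_fun (s i) x) w).
  rewrite -lee_fin (le_trans (Rintegral_rip_le w (mfs i) di))//.
  apply: (@le_trans _ _ ((e / (1 + hnorm w))%:E * (hnorm w)%:E)%E).
    by rewrite lee_wpmul2r ?lee_fin ?hnorm_ge0.
  rewrite -EFinM lee_fin mulrAC ler_pdivrMr// ler_wpM2l ?(ltW e0)//.
  by rewrite lerDr.
by apply: eq_Rintegral => x _; rewrite ripBl.
Qed.

(** The simple function of rank N takes the nearest of the first N points of the dense sequence,
    among those no farther from f(x) than 0 is, and 0 if there is none. That restriction gives ||f -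
    s_N|| <= ||f||, so dominated convergence applies. *)
Lemma bochner_exists f : (mu D < +oo)%E -> wmeas D f -> (nrm f < +oo)%E ->
  exists v, is_bochner mu D f v.
Proof.
move=> muD mf fi; have [dd hdd] := sV.
pose B N i : set T := D `&` [set x | hnorm (f x - dd i) <= hnorm (f x)] `&`
  \bigcap_(j in [set j | (j < N)%N]) [set x | hnorm (f x - dd i) <= hnorm (f x - dd j)].
have mle (g h : T -> R) : measurable_fun D g -> measurable_fun D h ->
    measurable (D `&` [set x | g x <= h x]).
  move=> mg mh; rewrite (_ : _ `&` _ = D `&` (fun x => h x - g x) @^-1` `[0, +oo[).
    by apply: measurable_funB.
  by apply/seteqP; split => x /= []; rewrite in_itv/= andbT subr_ge0.
have mB N i : measurable (B N i).
  rewrite /B; have -> : D `&` [set x | hnorm (f x - dd i) <= hnorm (f x)] `&`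
     \bigcap_(j in [set j | (j < N)%N]) [set x | hnorm (f x - dd i) <= hnorm (f x - dd j)] =
     D `&` [set x | hnorm (f x - dd i) <= hnorm (f x)] `&`
     \bigcap_(j in [set j | (j < N)%N]) (D `&` [set x | hnorm (f x - dd i) <= hnorm (f x - dd j)]).
    apply/seteqP; split => x [[Dx hx] hB]; split => // j /hB //.
    by case.
  apply: measurableI; first by apply: mle; [exact: wmeas_dist|exact: wmeas_norm].
  by apply: bigcap_measurableType => j _; apply: mle; exact: wmeas_dist.
(* Ties between nearest points are broken by the least index, which makes the sets disjoint. *)
pose A N i := B N i `\` \bigcup_(j in [set j | (j < i)%N]) B N j.
have mA N i : measurable (A N i).
  by apply: measurableD => //; apply: bigcup_measurable => j _.
have fA N i : (mu (A N i) < +oo)%E.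
  apply: le_lt_trans muD; apply: le_measure; rewrite ?inE//.
  by move=> x [[[]]].
pose s N := @SimpleFun R k d T mu V N (fun i => A N i) (fun i => dd i)
  (fun i => mA N i) (fun i => fA N i).
have sE N x : sf_fun (s N) x = 0 /\ (forall i, (i < N)%N -> ~ B N i x) \/
    exists2 i, (i < N)%N & B N i x /\ sf_fun (s N) x = dd i.
  have [[i0 [i0N Bi0]]|nB] := pselect (exists i, (i < N)%N /\ B N i x); last first.
    left; split; last by move=> i iN Bi; apply: nB; exists i.
    rewrite /sf_fun big1// => i _ /=; rewrite indicE memNset ?ofR0 ?scale0r//.
    by move=> [Bi _]; apply: nB; exists i.
  right; have exB : exists i, `[< B N i x >] by exists i0; exact/asboolP.
  case: (ex_minnP exB) => i /asboolP Bi imin.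
  have iN : (i < N)%N by rewrite (leq_ltn_trans _ i0N)// imin//; exact/asboolP.
  exists i => //; split => //; rewrite /sf_fun (bigD1 (Ordinal iN))//=.
  rewrite indicE mem_set; last first.
    by split => // -[j /= ji Bj]; have := imin j (asboolT Bj); rewrite leqNgt ji.
  rewrite ofR1 scale1r big1 ?addr0// => j ji; rewrite indicE memNset ?ofR0 ?scale0r//.
  move=> [Bj nj]; have ij := imin j (asboolT Bj).
  apply: nj; exists i => //=; rewrite ltn_neqAle ij andbT.
  by apply: contra ji => /eqP ij'; apply/eqP/val_inj.
have sle N x : hnorm (f x - sf_fun (s N) x) <= hnorm (f x).
  by case: (sE N x) => [[-> _]|[i _ [[[_ h] _] ->]]]; rewrite ?subr0.
have scv x : D x -> hnorm (f x - sf_fun (s N) x) @[N --> \oo] --> (0 : R).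
  move=> Dx; apply/cvg0_nat => [i|e e0]; first exact: hnorm_ge0.
  have [f0|/eqP f0] := eqVneq (f x) 0.
    by exists 0%N => N _; rewrite (le_lt_trans (sle N x))// f0 hnorm0.
  have nf : 0 < hnorm (f x) by rewrite lt0r hnorm_ge0 andbT; apply/eqP => /(hnorm_eq0 hV).
  (* Closer than both e and ||f x||: this point is admissible, so from rank i0.+1 on a nearest
     admissible point exists and is within e. *)
  have [i0 hi0] := hdd (f x) (Num.min e (hnorm (f x))) (ltac:(by rewrite lt_min e0)).
  have /andP[hi0e hi0f] : (hnorm (f x - dd i0) < e) && (hnorm (f x - dd i0) < hnorm (f x)).
    by rewrite -lt_min.
  exists i0.+1 => N i0N.
  have [[_ nB]|[i iN [[_ hmin] ->]]] := sE N x; last by rewrite (le_lt_trans (hmin i0 i0N)).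
  exfalso; pose G (i : 'I_N) := hnorm (f x - dd i).
  have [im _ him] := @arg_minP _ _ _ (Ordinal i0N) xpredT G isT.
  apply: (nB im) => //; split; first split => //=.
    by apply: le_trans (ltW hi0f); exact: (him (Ordinal i0N)).
  by move=> j /= jN; exact: (him (Ordinal jN)).
have msf N : wmeas D (fun x => f x - sf_fun (s N) x).
  by apply: wmeasB => //; exact: sf_fun_wmeas.
have s0 : (nrm (fun x => f x - sf_fun (s N) x) @[N --> \oo] --> 0)%E.
  have := @dominated_convergence _ _ _ mu D mD
    (fun N x => (hnorm (f x - sf_fun (s N) x))%:E) (cst 0%E) (fun x => (hnorm (f x))%:E).
  case=> //.
  - by move=> N; apply/measurable_EFinP; exact: wmeas_norm.
  - by apply: aeW => x Dx; apply: cvg_EFin; [exact: nearW|exact: scv].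
  - apply/integrableP; split; first by apply/measurable_EFinP; exact: wmeas_norm.
    rewrite (_ : (\int[mu]_(x in D) _)%E = nrm f)//; apply: eq_integral => x _.
    by rewrite /= ger0_norm// hnorm_ge0.
  - by apply: aeW => x N Dx /=; rewrite ger0_norm ?hnorm_ge0// lee_fin.
  by move=> _ _; rewrite integral0_eq.
have sfd N M : ((hnorm (sf_integral D (s N) - sf_integral D (s M)))%:E <=
   nrm (fun x => (f x - sf_fun (s M) x)%R) + nrm (fun x => (f x - sf_fun (s N) x)%R))%E.
  have mN := sf_fun_wmeas (s N); have mM := sf_fun_wmeas (s M).
  have hd : nrm (fun x => sf_fun (s N) x - sf_fun (s M) x) =
      nrm (fun x => (f x - sf_fun (s M) x) + - (f x - sf_fun (s N) x)).
    by apply: eq_integral => x _; congr (hnorm _)%:E; rewrite opprB [RHS]addrC addrA subrK.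
  have hle : (nrm (fun x => sf_fun (s N) x - sf_fun (s M) x)%R <=
      nrm (fun x => (f x - sf_fun (s M) x)%R) + nrm (fun x => (f x - sf_fun (s N) x)%R))%E.
    by rewrite hd -(nrmN (fun x => f x - sf_fun (s N) x)) le_nrmD//; exact: wmeasN.
  apply: le_trans hle; apply: weak_integral_le.
  - exact: wmeasB.
  - have := le_nrmD mN (wmeasN hV mM); rewrite nrmN => /le_lt_trans; apply.
    by rewrite lte_add_pinfty ?sf_nrm.
  - by apply: weak_integralB => //; [exact: sf_nrm|exact: sf_nrm|exact: sf_weak|exact: sf_weak].
have [v hv] : exists v, hlim (fun N => sf_integral D (s N)) v.
  apply: (hilbert_complete hV) => e e0.
  have [N hN] := (ecvg0_nat (fun N => nrm_ge0 _)).1 s0 _ (divr_gt0 e0 (ltr0n R 4)).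
  exists N => i j /hN hi /hN hj.
  have := le_trans (sfd i j) (leeD hj hi).
  by rewrite -EFinD lee_fin => /le_lt_trans; apply; lra.
by exists v, s; split => //; exact: aeW.
Qed.

Lemma bochnerP f v : (mu D < +oo)%E -> wmeas D f ->
  is_bochner mu D f v <-> (nrm f < +oo)%E /\ weak_integral f v.
Proof.
move=> muD mf; split; first exact: bochner_weak.
move=> [fi hv]; have [v' bv'] := bochner_exists muD mf fi.
by rewrite (weak_integral_uniq hv (bochner_weak mf bv').2).
Qed.

Lemma bochner_uniq f v v' : wmeas D f -> is_bochner mu D f v ->
  is_bochner mu D f v' -> v = v'.
Proof.
by move=> mf /(bochner_weak mf)[_ h] /(bochner_weak mf)[_ h']; exact: weak_integral_uniq h'.
Qed.

Lemma bochnerE f v : wmeas D f -> is_bochner mu D f v -> bochner mu D f = v.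
Proof.
move=> mf bv; rewrite /bochner; case: xgetP => [v' _ /= bv'|/(_ v)//].
exact: bochner_uniq bv' bv.
Qed.

End BochnerIntegral.

(** * Completeness and separability of the concrete spaces *)

Section Completeness.
Context {R : realType}.

Lemma real_complete (u : nat -> R) :
  (forall e, 0 < e -> exists N, forall i j,
     (N <= i)%N -> (N <= j)%N -> `|u i - u j| < e) ->
  exists l, u i @[i --> \oo] --> (l : R).
Proof.
move=> hu; apply/cvg_ex; apply: cauchy_cvg; apply/cauchyP => e e0.
have [N hN] := hu e e0; exists (u N), N => // i /= Ni.
by rewrite /ball/=; exact: hN.
Qed.

Lemma cvg0_sum (I : finType) (F : I -> nat -> R) :
  (forall l, F l i @[i --> \oo] --> (0 : R)) ->
  \sum_l F l i @[i --> \oo] --> (0 : R).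
Proof.
move=> F0; elim: (index_enum I) => [|l s ih].
  by under eq_fun do rewrite big_nil; exact: cvg_cst.
apply: (@cvg_nat_eq _ _ (fun n => F l n + \sum_(j <- s) F j n) _ 0) => [n _|].
  by rewrite big_cons.
rewrite [X in _ --> X](_ : _ = 0 + 0); last by rewrite addr0.
exact: cvgD.
Qed.

Lemma cvg0_sqrt (u : nat -> R) : u i @[i --> \oo] --> (0 : R) ->
  Num.sqrt (u i) @[i --> \oo] --> (0 : R).
Proof. by move=> /(cvg_comp _ _)/(_ (@sqrt_continuous R 0)); rewrite sqrtr0. Qed.

End Completeness.

Section ConcreteSpaces.
Context {R : realType} {k : scalar_kind}.
Local Notation K := (scal R k).

Lemma euclid_rip m (x : euclid k m) : rip x x = \sum_i sabs2 (x i 0) :> R.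
Proof.
by rewrite /rip/= sRe_sum; apply: eq_bigr => i _; rewrite mul_sconj sRe_ofR.
Qed.

Lemma euclid_hilbert m : hilbert (euclid k m : ipSpace R k).
Proof.
have pos (x : euclid k m) : 0 <= \sum_i sabs2 (x i 0) :> R.
  by apply: sumr_ge0 => i _; exact: sabs2_ge0.
split.
- move=> c x y z /=; rewrite mulr_sumr -big_split/=; apply: eq_bigr => i _.
  by rewrite !mxE mulrDl mulrA.
- move=> x y /=; rewrite sconj_sum; apply: eq_bigr => i _.
  by rewrite sconjM sconjK mulrC.
- move=> x x0; apply/scal_gt0P; split.
    rewrite -/(rip x x) euclid_rip lt0r pos andbT; apply/eqP => s0; apply: x0.
    apply/matrixP => i j; rewrite ord1 mxE; apply/eqP; rewrite -sabs2_eq0; apply/eqP.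
    by move/psumr_eq0P : s0; apply => // l _; exact: sabs2_ge0.
  rewrite /= sIm_sum big1// => i _; rewrite mul_sconj sIm_ofR//.
- move=> u cu.
  have le i j l : Num.sqrt (sabs2 ((u i - u j : euclid k m) l 0)) <= hnorm (u i - u j).
    rewrite hnormE ler_wsqrtr// euclid_rip (bigD1 l)//= lerDl.
    by apply: sumr_ge0 => *; exact: sabs2_ge0.
  have Re_le (z : K) : `|sRe z| <= Num.sqrt (sabs2 z).
    by rewrite -sqrtr_sqr ler_wsqrtr// /sabs2 lerDl sqr_ge0.
  have Im_le (z : K) : `|sIm z| <= Num.sqrt (sabs2 z).
    by rewrite -sqrtr_sqr ler_wsqrtr// /sabs2 lerDr sqr_ge0.
  have /choice[re hre] : forall l, exists r, sRe (u i l 0) @[i --> \oo] --> (r : R).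
    move=> l; apply: real_complete => e /cu[N hN]; exists N => i j Ni Nj.
    rewrite (le_lt_trans _ (hN i j Ni Nj))// (le_trans _ (le i j l))//.
    by rewrite (le_trans _ (Re_le _))// !mxE sReD sReN.
  have /choice[im him] : forall l, exists r, sIm (u i l 0) @[i --> \oo] --> (r : R).
    move=> l; apply: real_complete => e /cu[N hN]; exists N => i j Ni Nj.
    rewrite (le_lt_trans _ (hN i j Ni Nj))// (le_trans _ (le i j l))//.
    by rewrite (le_trans _ (Im_le _))// !mxE sImD sImN.
  exists (\col_l (mkscal (re l) (im l) : K)).
  have h2 : (\sum_l ((sRe (u i l 0) - re l) ^+ 2 + (sIm (u i l 0) - im l) ^+ 2))
      @[i --> \oo] --> (0 : R).
    apply: cvg0_sum => l; rewrite -[X in _ --> X]addr0.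
    have sqr0 : (0 : R) = 0 ^+ 2 by rewrite expr0n.
    apply: cvgD; rewrite [X in _ --> X]sqr0; apply: cvg_sqr.
      by rewrite -[X in _ --> X](subrr (re l)); apply: cvgB => //; exact: cvg_cst.
    by rewrite -[X in _ --> X](subrr (im l)); apply: cvgB => //; exact: cvg_cst.
  apply: (cvg0_squeeze (b := fun i => Num.sqrt (\sum_l
    ((sRe (u i l 0) - re l) ^+ 2 + (sIm (u i l 0) - im l) ^+ 2)))).
    move=> i; rewrite hnorm_ge0/= hnormE ler_wsqrtr// euclid_rip.
    apply: ler_sum => l _; rewrite !mxE /sabs2 sReD sReN sImD sImN sRe_mkscal.
    by rewrite lerD2l sIm_mkscal_le.
  exact: cvg0_sqrt.
Qed.

Lemma euclid_separable m : hseparable (euclid k m : ipSpace R k).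
Proof.
have hE := euclid_hilbert m.
apply: (separable_of_total hE (x := fun i => if insub i is Some j
    then (delta_mx (j : 'I_m) 0 : euclid k m) else 0)) => y hy.
apply/matrixP => i j; rewrite ord1 mxE.
have := hy i; rewrite valK /= (bigD1 i)//= big1 ?addr0.
  by rewrite mxE !eqxx/= -ofR1 sconj_ofR ofR1 mulr1.
by move=> l li; rewrite mxE (negbTE li)/= sconj0 mulr0.
Qed.

Section Product.
Context (V W : ipSpace R k) (hV : hilbert V) (hW : hilbert W).
Local Notation P := (prod_ip V W).

Lemma prod_rip (x y : P) : rip x y = rip x.1 y.1 + rip x.2 y.2.
Proof. by rewrite /rip/= sReD. Qed.

Lemma prod_hnorm2 (x : P) : hnorm x ^+ 2 = hnorm x.1 ^+ 2 + hnorm x.2 ^+ 2.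
Proof.
rewrite (hnorm2 hV) (hnorm2 hW) /hnorm sqr_sqrtr; first by rewrite -/(rip x x) prod_rip.
by rewrite -/(rip x x) prod_rip addr_ge0// rip_ge0.
Qed.

Lemma prod_hnorm_le (x : P) : hnorm x <= hnorm x.1 + hnorm x.2.
Proof.
rewrite -ler_sqr ?nnegrE ?addr_ge0 ?hnorm_ge0// prod_hnorm2.
have := hnorm_ge0 x.1; have := hnorm_ge0 x.2; nra.
Qed.

Lemma prod_hnorm_fst (x : P) : hnorm x.1 <= hnorm x.
Proof.
by rewrite -ler_sqr ?nnegrE ?hnorm_ge0// prod_hnorm2 lerDl sqr_ge0.
Qed.

Lemma prod_hnorm_snd (x : P) : hnorm x.2 <= hnorm x.
Proof.
by rewrite -ler_sqr ?nnegrE ?hnorm_ge0// prod_hnorm2 lerDr sqr_ge0.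
Qed.

Lemma prod_hlim (u : nat -> P) (l : P) :
  hlim (fun i => (u i).1) l.1 -> hlim (fun i => (u i).2) l.2 -> hlim u l.
Proof.
move=> h1 h2; apply: (hlim_le (b := fun i => hnorm ((u i).1 - l.1) + hnorm ((u i).2 - l.2))).
  by move=> i; exact: prod_hnorm_le.
by rewrite -[X in _ --> X]addr0; exact: cvgD.
Qed.

Lemma prod_hilbert : hilbert P.
Proof.
split.
- move=> c x y z; rewrite /= !ip_lin//; ring.
- by move=> x y; rewrite /= sconjD -!ipC.
- move=> x x0; apply/scal_gt0P; split; last first.
    by rewrite /= sImD (ipxx hV) (ipxx hW) !sIm_ofR addr0.
  rewrite -/(rip x x) prod_rip lt0r addr_ge0 ?rip_ge0// andbT.
  apply/eqP => h; apply: x0; case: x h => x1 x2 /= h.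
  have := rip_ge0 hV x1; have := rip_ge0 hW x2 => r2 r1.
  have /(rip_eq0 hV)-> : rip x1 x1 = 0 by lra.
  by have /(rip_eq0 hW)-> : rip x2 x2 = 0 by lra.
- move=> u cu.
  have [l1 hl1] : exists l, hlim (fun i => (u i).1) l.
    apply: (hilbert_complete hV) => e /cu[N hN]; exists N => i j Ni Nj.
    exact: le_lt_trans (prod_hnorm_fst (u i - u j)) (hN i j Ni Nj).
  have [l2 hl2] : exists l, hlim (fun i => (u i).2) l.
    apply: (hilbert_complete hW) => e /cu[N hN]; exists N => i j Ni Nj.
    exact: le_lt_trans (prod_hnorm_snd (u i - u j)) (hN i j Ni Nj).
  by exists (l1, l2); exact: prod_hlim.
Qed.

(** The two orthonormal sequences are interleaved, the first factor at odd and the second at even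
    indices. *)
Lemma prod_separable : hseparable V -> hseparable W -> hseparable P.
Proof.
move=> sV sW; have [e [_ _ etot]] := onb_seq_exists hV sV.
have [f [_ _ ftot]] := onb_seq_exists hW sW.
apply: (separable_of_total prod_hilbert
  (x := fun i => if odd i then ((e i./2, 0) : P) else ((0, f i./2) : P))) => -[y1 y2] hy.
congr pair.
  apply: etot => i; have := hy i.*2.+1.
  by rewrite /= odd_double/= uphalf_double ip0r// addr0.
apply: ftot => i; have := hy i.*2.
by rewrite /= odd_double/= half_double ip0r// add0r.
Qed.

End Product.
End ConcreteSpaces.

Section ScalarIntegral.
Context {R : realType} {k : scalar_kind}.
Local Notation K := (scal R k).
Context d (T : measurableType d) (mu : {measure set T -> \bar R}).
Context (D : set T) (mD : measurable D).
Implicit Types f g : T -> K.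

Definition smeas f : Prop :=
  measurable_fun D (fun x => sRe (f x)) /\ measurable_fun D (fun x => sIm (f x)).

Lemma smeas_cst (c : K) : smeas (fun=> c).
Proof. by split; exact: measurable_cst. Qed.

Lemma smeasD f g : smeas f -> smeas g -> smeas (fun x => f x + g x).
Proof.
move=> [f1 f2] [g1 g2]; split.
  by under eq_fun do rewrite sReD; exact: measurable_funD.
by under eq_fun do rewrite sImD; exact: measurable_funD.
Qed.

Lemma smeasM f g : smeas f -> smeas g -> smeas (fun x => f x * g x).
Proof.
move=> [f1 f2] [g1 g2]; split.
  by under eq_fun do rewrite sReM; apply: measurable_funB; exact: measurable_funM.
by under eq_fun do rewrite sImM; apply: measurable_funD; exact: measurable_funM.
Qed.

Lemma smeas_conj f : smeas f -> smeas (fun x => sconj (f x)).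
Proof.
move=> [f1 f2]; split; first by under eq_fun do rewrite sRe_conj.
by under eq_fun do rewrite sIm_conj; exact: measurableT_comp.
Qed.

Lemma smeas_sum (I : Type) (r : seq I) (F : I -> T -> K) :
  (forall i, smeas (F i)) -> smeas (fun x => \sum_(i <- r) F i x).
Proof.
move=> mF; elim: r => [|i r ih].
  by under eq_fun do rewrite big_nil; exact: smeas_cst.
by under eq_fun do rewrite big_cons; exact: smeasD.
Qed.

Definition sintegrable f : Prop :=
  mu.-integrable D (EFin \o (fun x => sRe (f x))) /\
  mu.-integrable D (EFin \o (fun x => sIm (f x))).

Lemma sintegrable_meas f : sintegrable f -> smeas f.
Proof.
by move=> [/integrableP[/measurable_EFinP f1 _] /integrableP[/measurable_EFinP f2 _]].
Qed.

Lemma integrable_ae_le (f g : T -> R) : measurable_fun D f ->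
  mu.-integrable D (EFin \o g) -> {ae mu, forall x, D x -> `|f x| <= g x} ->
  mu.-integrable D (EFin \o f).
Proof.
move=> mf gi fg; apply/integrableP; split; first exact/measurable_EFinP.
have [_] := integrableP _ _ _ gi; apply: le_lt_trans.
apply: nonneg_ae_le_integral => //; apply: aeS fg => x h /h {}h.
by rewrite /= lee_fin (le_trans h)// ler_norm.
Qed.

Lemma sintegrable_le f (g : T -> R) : smeas f -> mu.-integrable D (EFin \o g) ->
  {ae mu, forall x, D x -> `|sRe (f x)| <= g x /\ `|sIm (f x)| <= g x} ->
  sintegrable f.
Proof.
move=> [f1 f2] gi fg; split; apply: (integrable_ae_le _ gi) => //.
  by apply: aeS fg => x h /h[].
by apply: aeS fg => x h /h[].
Qed.

Lemma sRe_sintegral f : sRe (Defs.sintegral mu D f) = \int[mu]_(x in D) sRe (f x).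
Proof. by rewrite /Defs.sintegral sRe_mkscal. Qed.

Lemma sIm_sintegral f : sIm (Defs.sintegral mu D f) = \int[mu]_(x in D) sIm (f x).
Proof.
rewrite /Defs.sintegral; case: k f => f //=.
by rewrite /Rintegral integral0_eq.
Qed.

Lemma integrable_Zl (r : R) (f : T -> R) : mu.-integrable D (EFin \o f) ->
  mu.-integrable D (EFin \o (fun x => r * f x)).
Proof. by move=> fi; have := integrableZl mD r fi. Qed.

Lemma sintegral_lin (c : K) f g : sintegrable f -> sintegrable g ->
  Defs.sintegral mu D (fun x => c * f x + g x) = c * Defs.sintegral mu D f + Defs.sintegral mu D g.
Proof.
move=> [f1 f2] [g1 g2]; apply: scal_ext.
  rewrite sReD sReM !sRe_sintegral sIm_sintegral.
  rewrite -!RintegralZl// -RintegralB//; try exact: integrable_Zl.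
  rewrite -RintegralD//; first by apply: eq_Rintegral => x _; rewrite sReD sReM.
  have := integrableB mD (integrableZl mD (sRe c) f1) (integrableZl mD (sIm c) f2).
  by apply: eq_integrable.
rewrite sImD sImM !sIm_sintegral sRe_sintegral.
rewrite -!RintegralZl// -RintegralD//; try exact: integrable_Zl.
rewrite -RintegralD//; first by apply: eq_Rintegral => x _; rewrite sImD sImM.
have := integrableD mD (integrableZl mD (sRe c) f2) (integrableZl mD (sIm c) f1).
by apply: eq_integrable.
Qed.

Lemma sintegral_conj f : sintegrable f ->
  Defs.sintegral mu D (fun x => sconj (f x)) = sconj (Defs.sintegral mu D f).
Proof.
move=> [f1 f2]; apply: scal_ext.
  by rewrite sRe_conj !sRe_sintegral; apply: eq_Rintegral => x _; rewrite sRe_conj.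
rewrite sIm_conj !sIm_sintegral -mulN1r -RintegralZl//.
by apply: eq_Rintegral => x _; rewrite sIm_conj mulN1r.
Qed.

Lemma eq_sintegral_ae f g : smeas f -> smeas g ->
  {ae mu, forall x, D x -> f x = g x} -> Defs.sintegral mu D f = Defs.sintegral mu D g.
Proof.
move=> [f1 f2] [g1 g2] fg; apply: scal_ext.
  rewrite !sRe_sintegral; congr fine; apply: ae_eq_integral => //.
  - exact/measurable_EFinP.
  - exact/measurable_EFinP.
  - by apply: aeS fg => x h Dx; rewrite h.
rewrite !sIm_sintegral; congr fine; apply: ae_eq_integral => //.
- exact/measurable_EFinP.
- exact/measurable_EFinP.
- by apply: aeS fg => x h Dx; rewrite h.
Qed.

End ScalarIntegral.

(** * The weighted space of square integrable functions *)

(** The primitive is continuous and vanishes at rational points, hence on the open interval;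
    Lebesgue differentiation returns h as its derivative a.e. *)
Lemma integral_itv_ae0 {R : realType} (a b : R) (h : R -> R) : a < b ->
  (@lebesgue_measure R).-integrable `[a, b] (EFin \o h) ->
  (forall q : rat, a < ratr q < b ->
     \int[@lebesgue_measure R]_(x in `[a, ratr q]) h x = 0) ->
  {ae (@lebesgue_measure R), forall x, `[a, b]%classic x -> h x = 0}.
Proof.
move=> ab hi h0; set mu := @lebesgue_measure R.
pose G x := \int[mu]_(t in `[a, x]) h t.
have cG : {within `[a, b], continuous G} by exact: parameterized_integral_continuous (ltW ab) hi.
have [cGo _ _] := (continuous_within_itvP G ab).1 cG.
have G0 x : a < x < b -> G x = 0.
  move=> /andP[ax xb]; apply: contrapT => /eqP Gx.
  have xab : x \in `]a, b[ by rewrite in_itv/= ax.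
  have nG : 0 < `|G x| by rewrite normr_gt0.
  have /cvgrPdist_lt/(_ _ nG)[/= e e0 he] := cGo x xab.
  (* A rational just below x where G differs from G x by less than |G x|, although G vanishes
     there. *)
  have [q] : exists q : rat, ratr q \in `]Num.max a (x - e), x[.
    by apply: rat_in_itvoo; rewrite gt_max ax ltrBlDr ltrDl e0.
  rewrite in_itv/= gt_max => /andP[/andP[aq xeq] qx].
  have := he (ratr q); rewrite /= /ball_/= gtr0_norm ?subr_gt0//.
  rewrite ltrBlDr -ltrBlDl => /(_ xeq).
  have -> : G (ratr q) = 0 by apply: h0; rewrite aq (lt_trans qx).
  by rewrite subr0 ltxx.
pose f := h \_ `[a, b].
have fi : mu.-integrable setT (EFin \o f).
  by rewrite -restrict_EFin; apply/integrable_restrict => //; rewrite setTI.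
have lf : locally_integrable setT f by exact: open_integrable_locally openT fi.
have fiy y : mu.-integrable `]-oo, y] (EFin \o f) by exact: integrableS fi.
have FE x : a < x < b -> \int[mu]_(t in `]-oo, x]) f t = 0.
  move=> axb; rewrite -(G0 x axb) /G -Rintegral_mkcondr; congr (Rintegral _ _ _).
  apply/seteqP; split => t /=; rewrite !in_itv/=; first by move=> [-> /andP[-> _]].
  move=> /andP[-> tx]; split => //; rewrite (le_trans tx)// ltW//.
  by case/andP: axb.
have aeN (c : R) : {ae mu, forall x, x <> c}.
  exists [set c]; split; [exact: measurable_set1|exact: lebesgue_measure_set1|].
  by move=> x /= /contrapT.
apply: aeS3 (FTC1Ny fiy lf) (aeN a) (aeN b) => x [dF F'] xa xb /=.
rewrite in_itv/= => /andP[ax xbl].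
have {}ax : a < x by rewrite lt_neqAle ax eq_sym andbT; apply/eqP.
have {}xbl : x < b by rewrite lt_neqAle xbl andbT; apply/eqP.
have -> : h x = f x by rewrite /f patchE mem_set//= in_itv/= !ltW.
rewrite -F' derive1E; rewrite (near_eq_derive (g := cst 0)) ?derive_cst//.
have := @near_in_itvoo R a b x; rewrite in_itv/= ax xbl => /(_ isT).
by apply: filterS => y; rewrite in_itv/=; exact: FE.
Qed.

Section WeightedL2.
Context {R : realType} {k : scalar_kind} (a b : R) (ab : a < b) (n : nat).
Local Notation K := (scal R k).
Context (Hm : R -> 'M[K]_n) (hHm : energy_density a b Hm).
Local Notation D := (`[a, b]%classic : set R).
Local Notation mu := (@lebesgue_measure R).
Local Notation X := (L2weighted a b Hm).
Local Notation L2f := (L2fun k a b n).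

Let mD : measurable (D : set (measurableTypeR R)). Proof. exact: measurable_itv. Qed.

Let q z (u v : 'cV[K]_n) : K := ((map_mx sconj v)^T *m Hm z *m u) 0 0.

Let qE z u v : q z u v = \sum_i (\sum_j sconj (v j 0) * Hm z j i) * u i 0.
Proof.
rewrite /q mxE; apply: eq_bigr => i _; rewrite mxE; congr (_ * _).
by apply: eq_bigr => j _; rewrite !mxE.
Qed.

Let q_lin c z u u' v : q z (c *: u + u') v = c * q z u v + q z u' v.
Proof. by rewrite /q mulmxDr -scalemxAr !mxE. Qed.

Let q_smeas (f g : R -> 'cV[K]_n) : mx_measurable D f -> mx_measurable D g ->
  smeas D (fun z => q z (f z) (g z)).
Proof.
move=> mf mg; rewrite (_ : (fun _ => _) =
  (fun z => \sum_i (\sum_j sconj (g z j 0) * Hm z j i) * f z i 0)); last first.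
  by apply/funext => z; rewrite qE.
have [mH _ _ _] := hHm.
apply: smeas_sum => i; apply: smeasM; last exact: mf.
by apply: smeas_sum => j; apply: smeasM; [apply: smeas_conj; exact: mg|exact: mH].
Qed.

Let ReIm_le (x y : K) : `|sRe (x * y)| <= sabs2 x + sabs2 y /\
  `|sIm (x * y)| <= sabs2 x + sabs2 y.
Proof.
rewrite /sabs2 sReM sImM; set p := sRe x; set r := sIm x; set s := sRe y; set t := sIm y.
have h1 := sqr_ge0 (p - s); have h2 := sqr_ge0 (p + s); have h3 := sqr_ge0 (r - t).
have h4 := sqr_ge0 (r + t); have h5 := sqr_ge0 (p - t); have h6 := sqr_ge0 (p + t).
have h7 := sqr_ge0 (r - s); have h8 := sqr_ge0 (r + s).
by rewrite !ler_norml; split; apply/andP; split; nra.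
Qed.

(** A crude bound over the n^2 entries; its purpose is an integrable majorant of the quadratic form
    for two square integrable functions. *)
Let q_bound c z u v : (forall i j, sabs2 (Hm z i j) <= c) ->
  `|sRe (q z u v)| <= (n * n)%:R * ((1 + c) * (cvabs2 u + cvabs2 v)) /\
  `|sIm (q z u v)| <= (n * n)%:R * ((1 + c) * (cvabs2 u + cvabs2 v)).
Proof.
move=> hc; have term i j : `|sRe (sconj (v j 0) * Hm z j i * u i 0)| <=
    (1 + c) * (cvabs2 u + cvabs2 v) /\ `|sIm (sconj (v j 0) * Hm z j i * u i 0)| <=
    (1 + c) * (cvabs2 u + cvabs2 v).
  have c0 : 0 <= c by rewrite (le_trans _ (hc i i))// sabs2_ge0.
  have ui : sabs2 (u i 0) <= cvabs2 u.
    by rewrite /cvabs2 (bigD1 i)//= lerDl; apply: sumr_ge0 => *; exact: sabs2_ge0.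
  have vj : sabs2 (v j 0) <= cvabs2 v.
    by rewrite /cvabs2 (bigD1 j)//= lerDl; apply: sumr_ge0 => *; exact: sabs2_ge0.
  have := ReIm_le (sconj (v j 0)) (Hm z j i * u i 0).
  rewrite mulrA sabs2_conj sabs2M => -[r1 r2].
  have hb : sabs2 (v j 0) + sabs2 (Hm z j i) * sabs2 (u i 0) <=
      (1 + c) * (cvabs2 u + cvabs2 v).
    have := sabs2_ge0 (u i 0); have := sabs2_ge0 (v j 0); have := hc j i.
    have := sabs2_ge0 (Hm z j i).
    set A := sabs2 (Hm z j i); set B := sabs2 (u i 0) in ui *.
    set C := sabs2 (v j 0) in vj *.
    move=> A0 Ac C0 B0; have : A * B <= c * cvabs2 u by rewrite ler_pM.
    nra.
  by split; apply: le_trans hb.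
rewrite qE; split; [rewrite sRe_sum|rewrite sIm_sum];
  rewrite (le_trans (ler_norm_sum _ _ _))//;
  (apply: (@le_trans _ _ (\sum_(i < n) (n%:R * ((1 + c) * (cvabs2 u + cvabs2 v)))));
    [apply: ler_sum => i _; rewrite mulr_suml|
     by rewrite sumr_const card_ord -(mulr_natl (n%:R * _) n) mulrA -natrM]).
  rewrite sRe_sum (le_trans (ler_norm_sum _ _ _))//.
  rewrite (le_trans (ler_sum _ (fun j _ => (term i j).1)))//.
  by rewrite sumr_const card_ord mulr_natl.
rewrite sIm_sum (le_trans (ler_norm_sum _ _ _))//.
rewrite (le_trans (ler_sum _ (fun j _ => (term i j).2)))//.
by rewrite sumr_const card_ord mulr_natl.
Qed.

Let f_meas (f : L2f) : mx_measurable D f.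
Proof. by have := L2fun_prop f; rewrite inE => -[]. Qed.

Let f_int (f : L2f) : mu.-integrable D (EFin \o (fun z => cvabs2 (f z))).
Proof.
have := L2fun_prop f; rewrite inE => -[mf fi].
apply/integrableP; split; first by apply/measurable_EFinP; exact: (measurable_cvabs2 (f_meas _)).
by under eq_integral do rewrite /= ger0_norm ?cvabs2_ge0//.
Qed.

Let q_sint (f g : L2f) : sintegrable mu D (fun z => q z (f z) (g z)).
Proof.
have [_ [c hc] _ _] := hHm.
apply: (@sintegrable_le _ _ _ _ mu D _ (fun z => (n * n)%:R * ((1 + c) *
  (cvabs2 (f z) + cvabs2 (g z))))).
- exact: q_smeas.
- do 2 apply: integrable_Zl => //.
  by apply: eq_integrable (integrableD mD (f_int f) (f_int g)).
- by apply: aeS hc => z h /h h'; exact: q_bound.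
Qed.

Let ipE (f g : L2f) : ip (L2cls f : X) (L2cls g : X) =
  ofR 2^-1 * Defs.sintegral mu D (fun z => q z (f z) (g z)).
Proof.
rewrite /=; congr (_ * _); apply: eq_sintegral_ae => //.
- by apply: (q_smeas (f_meas _) (f_meas _)).
- by apply: (q_smeas (f_meas _) (f_meas _)).
by apply: aeS2 (L2repr_ae f) (L2repr_ae g) => z h h' Dz; rewrite /q h// h'.
Qed.

Let qform_le : exists m0 M0 : R, [/\ 0 < m0, 0 < M0 & {ae mu, forall z, D z ->
  (forall u v, q z u v = sconj (q z v u)) /\
  forall v, m0 * cvabs2 v <= sRe (q z v v) <= M0 * cvabs2 v}].
Proof.
have [_ _ hs [m0 [M0 [m00 M00 hm]]]] := hHm; exists m0, M0; split => //.
apply: aeS2 hs hm => z h1 h2 Dz; split; last exact: h2.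
move=> u v; rewrite !qE sconj_sum.
have hz i j : Hm z i j = sconj (Hm z j i).
  by have /matrixP/(_ i j) := h1 Dz; rewrite !mxE => <-.
under eq_bigr do rewrite mulr_suml.
rewrite exchange_big/=; apply: eq_bigr => j _; rewrite sconjM mulrC sconj_sum.
rewrite mulr_sumr; apply: eq_bigr => i _.
by rewrite sconjM sconjK -hz mulrCA mulrA mulrC mulrA.
Qed.

Let nrm2 (f : L2f) : rip (L2cls f : X) (L2cls f : X) =
  2^-1 * \int[mu]_(z in D) sRe (q z (f z) (f z)).
Proof.
by rewrite /rip ipE sReM !sE mul0r subr0 sRe_sintegral.
Qed.

(** The bounds on the energy density make the weighted norm equivalent to the plain one; the halves
    come from the factor 1/2 in the inner product. *)
Let equiv_norm : exists m0 M0 : R, [/\ 0 < m0, 0 < M0 & forall f : L2f,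
  m0 * \int[mu]_(z in D) cvabs2 (f z) <= rip (L2cls f : X) (L2cls f : X) /\
  rip (L2cls f : X) (L2cls f : X) <= M0 * \int[mu]_(z in D) cvabs2 (f z)].
Proof.
have [m0 [M0 [m00 M00 hq]]] := qform_le.
exists (2^-1 * m0), (2^-1 * M0); split; [by rewrite mulr_gt0|by rewrite mulr_gt0|].
have le_ae (g h : R -> R) : mu.-integrable D (EFin \o g) ->
    mu.-integrable D (EFin \o h) -> {ae mu, forall z, D z -> g z <= h z} ->
    \int[mu]_(z in D) g z <= \int[mu]_(z in D) h z.
  move=> gi hi gh; rewrite -subr_ge0 -RintegralB//.
  have mgh : measurable_fun D (fun z => h z - g z).
    apply: measurable_funB.
      by have /integrableP[/measurable_EFinP] := hi.
    by have /integrableP[/measurable_EFinP] := gi.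
  (* The difference is nonnegative only a.e.; its positive part has the same integral and is
     nonnegative everywhere. *)
  rewrite /Rintegral (_ : (\int[mu]_(x in D) (h x - g x)%:E =
    \int[mu]_(x in D) (Num.max (h x - g x) 0)%:E)%E).
    by apply: fine_ge0; apply: integral_ge0 => x _; rewrite lee_fin le_max lexx orbT.
  apply: ae_eq_integral => //.
  - exact/measurable_EFinP.
  - by apply/measurable_EFinP; apply: measurable_maxr => //; exact: measurable_cst.
  apply: aeS gh => z hz /hz {}hz; congr EFin; apply/esym/max_idPl.
  by rewrite subr_ge0.
move=> f; rewrite nrm2 -!mulrA !ler_pM2l ?invr_gt0//.
rewrite -!RintegralZl//; split; apply: le_ae; try exact: integrable_Zl.
- by have [] := q_sint f f.
- by apply: aeS hq => z h /h[_ /(_ (f z))/andP[]].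
- by have [] := q_sint f f.
- by apply: aeS hq => z h /h[_ /(_ (f z))/andP[]].
Qed.

Let cvabs2_euclid (v : 'cV[K]_n) : cvabs2 v = hnorm (v : euclid k n) ^+ 2.
Proof. by rewrite (hnorm2 (euclid_hilbert n)) euclid_rip. Qed.

Lemma mx_measurable_wmeas (f : R -> 'cV[K]_n) : mx_measurable D f <->
  wmeas (D : set (measurableTypeR R)) (f : R -> euclid k n).
Proof.
split=> [mf v|mf].
  rewrite (_ : (fun _ => _) = (fun x => sRe (\sum_i f x i 0 * sconj (v i 0))))//.
  have [] : smeas D (fun x => \sum_i f x i 0 * sconj (v i 0)); last by [].
  by apply: smeas_sum => i; apply: smeasM; [exact: mf|exact: smeas_cst].
move=> i j; rewrite ord1.
have coord x : f x i 0 = ip (f x : euclid k n) (delta_mx i 0 : euclid k n).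
  rewrite /= (bigD1 i)//= big1 ?addr0.
    by rewrite mxE !eqxx/= -ofR1 sconj_ofR ofR1 mulr1.
  by move=> l li; rewrite mxE (negbTE li)/= sconj0 mulr0.
split.
  rewrite (_ : (fun _ => _) = (fun x => rip (f x : euclid k n) (delta_mx i 0 : euclid k n))).
    exact: mf.
  by apply/funext => x; rewrite coord.
rewrite (_ : (fun _ => _) = (fun x => sIm (ip (f x : euclid k n) (delta_mx i 0 : euclid k n)))).
  exact: (wmeas_Im (euclid_hilbert n) _ mf).
by apply/funext => x; rewrite coord.
Qed.

(** Completeness is transferred to the unweighted norm, where the Riesz-Fischer argument applies to
    representatives with values in K^n. *)
Lemma L2weighted_hilbert : hilbert X.
Proof.
have [m0 [M0 [m00 M00 hN]]] := equiv_norm.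
have [? [? [_ _ hq]]] := qform_le.
have lin (c : K) (x y z : X) : ip (c *: x + y) z = c * ip x z + ip y z.
  suff h (f g l : L2f) : ip (c *: (L2cls f : X) + (L2cls g : X)) (L2cls l : X) =
      c * ip (L2cls f : X) (L2cls l : X) + ip (L2cls g : X) (L2cls l : X).
    by rewrite -(L2reprK x) -(L2reprK y) -(L2reprK z).
  have -> : c *: (L2cls f : X) + (L2cls g : X) = (L2cls (c *: f + g) : X).
    by rewrite -[c *: L2cls f]/(L2scale _ _) L2scaleE -[_ + _]/(L2add _ _) L2addE.
  rewrite !ipE mulrCA -mulrDr; congr (_ * _).
  rewrite -sintegral_lin//; congr Defs.sintegral; apply/funext => t.
  by rewrite -q_lin.
have conj (x y : X) : ip y x = sconj (ip x y).
  rewrite -(L2reprK x) -(L2reprK y) !ipE sconjM sconj_ofR; congr (_ * _).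
  rewrite -sintegral_conj//; apply: eq_sintegral_ae => //.
  - by have /sintegrable_meas := q_sint (L2repr y) (L2repr x).
  - by apply: smeas_conj; have /sintegrable_meas := q_sint (L2repr x) (L2repr y).
  by apply: aeS hq => z h /h[h' _].
have int0 (f : L2f) : 0 <= \int[mu]_(z in D) cvabs2 (f z).
  by apply: Rintegral_ge0 => z _; exact: cvabs2_ge0.
split => //.
  move=> x x0; apply/scal_gt0P; split; last first.
    by have := congr1 sIm (conj x x); rewrite sIm_conj => h; lra.
  rewrite -/(rip x x) lt_neqAle; apply/andP; split; last first.
    rewrite -(L2reprK x) (le_trans _ (hN _).1)// mulr_ge0// ltW//.
  apply/negP => /eqP/esym h; apply: x0; rewrite -(L2reprK x); apply/L2clsP.
  have : \int[mu]_(z in D) cvabs2 (L2repr x z) = 0.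
    apply/eqP; rewrite eq_le int0 andbT -(pmulr_rle0 _ m00).
    by rewrite (le_trans (hN _).1)// L2reprK h.
  move=> h0; have : (\int[mu]_(z in D) `|(cvabs2 (L2repr x z))%:E| = 0)%E.
    rewrite (_ : (\int[mu]_(z in D) _)%E = (\int[mu]_(z in D) (cvabs2 (L2repr x z))%:E)%E).
      move: h0; rewrite /Rintegral => /eqP; rewrite fine_eq0//; last first.
        by apply: integrable_fin_num => //; exact: f_int.
      by move=> /eqP.
    by apply: eq_integral => z _; rewrite gee0_abs// lee_fin cvabs2_ge0.
  move=> /(ae_eq_integral_abs _ mD _).1 => /(_ _)h1.
  have {}h1 := h1 (measurable_int _ (f_int (L2repr x))).
  apply: aeS h1 => z h1 Dz; have := h1 Dz => -[] /eqP; rewrite cvabs2_euclid.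
  by rewrite sqrf_eq0 => /eqP/(hnorm_eq0 (euclid_hilbert n)).
move=> u cu.
pose f i : R -> euclid k n := L2repr (u i).
have L2clsB (g h : L2f) : (L2cls g : X) - (L2cls h : X) = (L2cls (g - h) : X).
  by rewrite -[- L2cls h]/(L2opp _) L2oppE -[_ + _]/(L2add _ _) L2addE.
have EFin_int (g : L2f) : (\int[mu]_(z in D) (hnorm (g z : euclid k n) ^+ 2)%:E =
    (\int[mu]_(z in D) cvabs2 (g z))%:E)%E.
  rewrite fineK; first by apply: eq_integral => z _; rewrite cvabs2_euclid.
  by apply: integrable_fin_num => //; exact: f_int.
have mE (g : L2f) : wmeas (D : set (measurableTypeR R)) (g : R -> euclid k n).
  by apply/mx_measurable_wmeas.
have hE := @euclid_hilbert R k n; have sE := @euclid_separable R k n.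
have mf i j : measurable_fun (D : set (measurableTypeR R)) (fun z => hnorm (f i z - f j z)).
  by apply: wmeas_norm => //; apply: wmeasB => //; exact: mE.
have cau (e : R) : 0 < e -> exists N, forall i j, (N <= i)%N -> (N <= j)%N ->
    (\int[mu]_(z in D) (hnorm (f i z - f j z) ^+ 2)%:E <= e%:E)%E.
  (* Weighted distance below sqrt(m0 e) forces the unweighted squared distance below e. *)
  move=> e0; have [|N cuN] := cu (Num.sqrt (m0 * e)); first by rewrite sqrtr_gt0 mulr_gt0.
  exists N => i j Ni Nj; rewrite (EFin_int (L2repr (u i) - L2repr (u j))) lee_fin.
  rewrite -(ler_pM2l m00) (le_trans (hN _).1)// -L2clsB !L2reprK.
  have := cuN i j Ni Nj; rewrite hnormE ltr_sqrt ?mulr_gt0// => /ltW.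
  by [].
have [phi [hphi hae]] := L2_cauchy_ae_subseq mD hE mf cau.
pose g z : euclid k n := hlim_or0 (fun i => f (phi i) z).
have mg : wmeas (D : set (measurableTypeR R)) g.
  by apply: wmeas_hlim_or0 => // i; exact: mE.
have gcv : {ae mu, forall z, D z -> hlim (fun i => f (phi i) z) (g z)}.
  by apply: aeS hae => z h /h[l hl]; rewrite /g (hlim_or0_lim hE hl).
have := L2_cauchy_cvg mD hE mf cau hphi gcv.
set J := fun i => _ => J0.
have J00 i : (0 <= J i)%E by apply: integral_ge0 => z _; rewrite lee_fin sqr_ge0.
have gin : (g : R -> 'cV_n) \in @sq_integrable R k a b n.
  rewrite inE; split; first exact/mx_measurable_wmeas.
  have [N JN] := (ecvg0_nat J00).1 J0 1 ltr01.
  have mfg : measurable_fun (D : set (measurableTypeR R)) (fun z => hnorm (f N z - g z)).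
    by apply: wmeas_norm => //; apply: wmeasB => //; exact: mE.
  apply: (@le_lt_trans _ _ (\int[mu]_(z in D) ((2%:E * (cvabs2 (f N z))%:E) +
      2%:E * (hnorm (f N z - g z) ^+ 2)%:E))%E).
    apply: nonneg_le_integral => z _; first by rewrite lee_fin cvabs2_ge0.
    rewrite -!EFinM -EFinD lee_fin !cvabs2_euclid.
    have := hnormD2_le hE (f N z) (- (f N z - g z)).
    by rewrite hnormN// opprB addrC subrK.
  rewrite ge0_integralD//; last 4 first.
  - by move=> z _; rewrite -EFinM lee_fin mulr_ge0// cvabs2_ge0.
  - apply: measurable_funeM; apply/measurable_EFinP; exact: (measurable_cvabs2 (f_meas _)).
  - by move=> z _; rewrite -EFinM lee_fin mulr_ge0// sqr_ge0.
  - by apply: measurable_funeM; apply/measurable_EFinP; exact: measurable_funX.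
  rewrite !ge0_integralZl_EFin//; last 4 first.
  - by move=> z _; rewrite lee_fin sqr_ge0.
  - by apply/measurable_EFinP; exact: measurable_funX.
  - by move=> z _; rewrite lee_fin cvabs2_ge0.
  - by apply/measurable_EFinP; exact: (measurable_cvabs2 (f_meas _)).
  apply: lte_add_pinfty; apply: lte_mul_pinfty => //.
    by have := L2fun_prop (L2repr (u N)); rewrite inE => -[].
  by rewrite (le_lt_trans (JN N (leqnn N)))// ltry.
pose G := MkL2fun gin; exists (L2cls G).
apply: (cvg0_squeeze (b := fun i => Num.sqrt (M0 * fine (J i)))).
  move=> i; rewrite hnorm_ge0 /= hnormE ler_wsqrtr//.
  rewrite -(L2reprK (u i)) L2clsB (le_trans (hN _).2)// ler_pM2l//.
  by have := EFin_int (L2repr (u i) - G); rewrite -[X in X = _]/(J i) => ->.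
apply: cvg0_sqrt; rewrite [X in _ --> X](_ : _ = M0 * 0); last by rewrite mulr0.
by apply: cvgM; [exact: cvg_cst|exact: (fine_cvg J0)].
Qed.

(** The functions 1_[a, r] e_j with r rational are total: if f is orthogonal to all of them, the
    integrals of (H f)_j over [a, r] vanish, so H f = 0 a.e., and coercivity of H gives f = 0. *)
Lemma L2weighted_separable : hseparable X.
Proof.
have [_ _ hsym [m0 [? [m00 _ hm]]]] := hHm.
pose ind (q' : R) (j : 'I_n) : R -> 'cV[K]_n :=
  fun z => (ofR (\1_(`[a, q']%classic : set R) z) : K) *: delta_mx j 0.
have indP q' j : ind q' j \in @sq_integrable R k a b n.
  rewrite inE; split.
    move=> i l; split.
      rewrite (_ : (fun _ => _) = (fun z => \1_(`[a, q']%classic : set R) z * sRe (delta_mx j 0 i l : K))).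
        by apply: measurable_funM.
      by apply/funext => z; rewrite !mxE sReM sRe_ofR sIm_ofR mul0r subr0.
    rewrite (_ : (fun _ => _) = (fun z => \1_(`[a, q']%classic : set R) z * sIm (delta_mx j 0 i l : K))).
      by apply: measurable_funM.
    by apply/funext => z; rewrite !mxE sImM sRe_ofR sIm_ofR mul0r addr0.
  apply: (@le_lt_trans _ _ (\int[mu]_(z in D) (cst 1%:E z))%E).
    apply: nonneg_le_integral => z _; rewrite lee_fin ?cvabs2_ge0//.
    rewrite /cvabs2 (bigD1 j)//= big1 ?addr0; last first.
      by move=> l lj; rewrite !mxE (negbTE lj)/= mulr0 sabs2_0.
    rewrite !mxE !eqxx/= mulr1 sabs2_ofR indicE.
    by case: (_ \in _); rewrite ?expr1n ?expr0n.
  rewrite integral_cst//= mul1e lebesgue_measure_itv/= lte_fin ab.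
  by rewrite -EFinB ltry.
pose Ind q' j := MkL2fun (indP q' j).
apply: (separable_of_total L2weighted_hilbert (x := fun i =>
  if unpickle i is Some (r, j) then L2cls (Ind (ratr (r : rat)) j) : X else 0)) => y hy.
pose f := L2repr y.
have q_ind q' j z : q z (f z) (Ind q' j z) =
    ofR (\1_(`[a, q']%classic : set R) z) * (Hm z *m f z) j 0.
  rewrite /q -mulmxA mxE (bigD1 j)//= big1 ?addr0.
    by rewrite !mxE !eqxx /= mulr1 sconj_ofR.
  by move=> l lj; rewrite !mxE (negbTE lj) /= mulr0 sconj0 mul0r.
have Hf_int j : sintegrable mu D (fun z => (Hm z *m f z) j 0).
  have [h1 h2] := q_sint f (Ind b j); split.
    apply: eq_integrable h1 => // z; rewrite inE => Dz /=; rewrite q_ind indicE mem_set//.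
    by rewrite ofR1 mul1r.
  apply: eq_integrable h2 => // z; rewrite inE => Dz /=; rewrite q_ind indicE mem_set//.
  by rewrite ofR1 mul1r.
have Hf0 j : {ae mu, forall z, D z -> (Hm z *m f z) j 0 = 0}.
  have hint (r : rat) : a < ratr r < b ->
      Defs.sintegral mu D (fun z => q z (f z) (Ind (ratr r) j z)) = 0.
    move=> _; have := hy (pickle (r, j)); rewrite pickleK -{1}(L2reprK y) ipE => /eqP.
    by rewrite mulf_eq0 (negbTE (ofR_neq0 _)) ?invr_eq0//= => /eqP.
  have restr (r : rat) (h : R -> R) : a < ratr r < b ->
      \int[mu]_(z in D) (\1_(`[a, ratr r]%classic : set R) z * h z) =
      \int[mu]_(z in `[a, ratr r]) h z.
    move=> /andP[ar rb]; rewrite (_ : `[a, ratr r]%classic = D `&` `[a, ratr r]%classic).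
      rewrite Rintegral_mkcondr; apply: eq_Rintegral => z Dz.
      rewrite patchE indicE in_setI Dz/=.
      by case: ifPn => _; rewrite ?mul1r ?mul0r.
    apply/seteqP; split => z /=; rewrite !in_itv/=; last by move=> [].
    by move=> /andP[-> zr]; split => //; rewrite (le_trans zr)// ltW.
  have [i1 i2] := Hf_int j.
  have e1 : {ae mu, forall z, D z -> sRe ((Hm z *m f z) j 0) = 0}.
    apply: integral_itv_ae0 => // r hr; rewrite -restr//.
    have := congr1 sRe (hint r hr); rewrite sRe_sintegral sRe0 => {1}<-.
    by apply: eq_Rintegral => z _; rewrite q_ind sReM !sE mul0r subr0.
  have e2 : {ae mu, forall z, D z -> sIm ((Hm z *m f z) j 0) = 0}.
    apply: integral_itv_ae0 => // r hr; rewrite -restr//.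
    have := congr1 sIm (hint r hr); rewrite sIm_sintegral sIm0 => {1}<-.
    by apply: eq_Rintegral => z _; rewrite q_ind sImM !sE mul0r addr0.
  by apply: aeS2 e1 e2 => z h1 h2 Dz; apply: scal_ext; rewrite ?sRe0 ?sIm0; [exact: h1|exact: h2].
have Hf0' : {ae mu, forall z, D z -> forall j, (Hm z *m f z) j 0 = 0}.
  have : {ae mu, forall z, forall i, D z -> if insub i is Some j then (Hm z *m f z) (j : 'I_n) 0 = 0 else True}.
    apply: ae_foralln => i; case: insubP => [j _ _|_]; first exact: Hf0.
    exact: aeW.
  by apply: aeS => z h Dz j; have := h j Dz; rewrite valK.
rewrite -(L2reprK y) -/f; apply/L2clsP; apply: aeS2 Hf0' hm => z h1 h2 Dz.
have := h2 Dz (f z); rewrite -mulmxA (_ : Hm z *m f z = 0); last first.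
  by apply/matrixP => i l; rewrite ord1 (h1 Dz) mxE.
rewrite mulmx0 mxE sRe0 => /andP[h _].
have /eqP : cvabs2 (f z) = 0.
  by apply/eqP; rewrite eq_le cvabs2_ge0 andbT -(pmulr_rle0 _ m00).
by rewrite cvabs2_euclid sqrf_eq0 => /eqP/(hnorm_eq0 (euclid_hilbert n)).
Qed.

End WeightedL2.

(** * Integration over time intervals *)

Section TimeIntegrals.
Context {R : realType}.
Local Notation mu := (@lebesgue_measure R).

Lemma lebesgue_measure_refl (c : R) (A : set R) : measurable A ->
  pushforward mu ((fun s => c - s) : _ -> measurableTypeR R) A = mu A.
Proof.
have mphi : measurable_fun setT ((fun s => c - s) : measurableTypeR R -> measurableTypeR R).
  by apply: measurable_funB => //; exact: measurable_id.
move=> mA; apply/esym/(@lebesgue_measure_unique R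
   (measure_function.pushforward mu _)) => //= _ [[u v]] _ <-.
rewrite /pushforward (_ : _ @^-1` _ = `[c - v, c - u[%classic); last first.
  by apply/seteqP; split => x /=; rewrite !in_itv/= => /andP[? ?]; apply/andP; split; lra.
rewrite !lebesgue_measure_itv/= !lte_fin.
have -> : (c - v < c - u) = (u < v) by rewrite ltrD2l ltrN2.
by case: ifP => // _; congr EFin; ring.
Qed.

Lemma integral_refl (a b c : R) (f : R -> \bar R) :
  measurable_fun `[c - b, c - a] f ->
  (\int[mu]_(s in `[a, b]) f (c - s)%R = \int[mu]_(s in `[(c - b)%R, (c - a)%R]) f s)%E.
Proof.
have mphi : measurable_fun setT ((fun s => c - s) : measurableTypeR R -> measurableTypeR R).
  by apply: measurable_funB => //; exact: measurable_id.
have pre : ((fun s => c - s) : measurableTypeR R -> measurableTypeR R) @^-1` `[c - b, c - a]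
    = `[a, b]%classic.
  by apply/seteqP; split => x /=; rewrite !in_itv/= => /andP[? ?]; apply/andP; split; lra.
have key (g : R -> \bar R) : measurable_fun `[c - b, c - a] g -> (forall x, 0 <= g x)%E ->
    (\int[mu]_(s in `[a, b]) g (c - s)%R = \int[mu]_(s in `[(c - b)%R, (c - a)%R]) g s)%E.
  move=> mg g0; have := @ge0_integral_pushforward _ _ _ _ R _ mphi mu `[c - b, c - a] g
    (measurable_itv _) mg (fun y _ => g0 y).
  rewrite pre => <-; apply: eq_measure_integral => //= A mA _.
  exact: lebesgue_measure_refl.
move=> mf; rewrite integralE [RHS]integralE; congr (_ - _)%E.
  rewrite -[RHS](key _ (measurable_funepos mf)); last exact: funepos_ge0.
  by apply: eq_integral => x _; rewrite !funeposE.
rewrite -[RHS](key _ (measurable_funeneg mf)); last exact: funeneg_ge0.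
by apply: eq_integral => x _; rewrite !funenegE.
Qed.

Lemma Rintegral_refl (a b c : R) (f : R -> R) : measurable_fun `[c - b, c - a] f ->
  \int[mu]_(s in `[a, b]) f (c - s) = \int[mu]_(s in `[c - b, c - a]) f s.
Proof.
move=> mf; rewrite /Rintegral; congr fine.
by rewrite (@integral_refl _ _ _ (EFin \o f)) //; exact/measurable_EFinP.
Qed.

(** A translation is the composite of two reflections. *)
Lemma Rintegral_shift (a b c : R) (f : R -> R) : measurable_fun `[a + c, b + c] f ->
  \int[mu]_(s in `[a, b]) f (s + c) = \int[mu]_(s in `[a + c, b + c]) f s.
Proof.
move=> mf; have e1 : - (- a - c) = a + c by ring.
have e2 : - (- b - c) = b + c by ring.
have -> : \int[mu]_(s in `[a + c, b + c]) f s = \int[mu]_(s in `[- b - c, - a - c]) f (0 - s).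
  by rewrite Rintegral_refl !sub0r ?e1 ?e2.
have -> : \int[mu]_(s in `[- b - c, - a - c]) f (0 - s) =
    \int[mu]_(s in `[a, b]) (fun s' => f (0 - s')) (- c - s).
  rewrite [- b - c]addrC [- a - c]addrC.
  rewrite [RHS](@Rintegral_refl _ _ _ (fun s => f (0 - s))) //.
  apply: (@measurable_comp _ _ _ _ _ _ `[a + c, b + c] f) => //.
    move=> _ [s hs <-]; move: (s : R) hs => {}s /=; rewrite !in_itv/= => /andP[h1 h2].
    by apply/andP; split; lra.
  by apply: measurable_funB => //; exact: measurable_id.
by apply: eq_Rintegral => s _; congr f; ring.
Qed.

Lemma lebesgue_itv_fin (a b : R) : (mu `[a, b] < +oo)%E.
Proof. by rewrite lebesgue_measure_itv/=; case: ifP => _; rewrite ?ltry// -EFinB ltry. Qed.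

Lemma lebesgue_itv_len (a b : R) : a <= b -> mu `[a, b] = (b - a)%:E.
Proof.
rewrite le_eqVlt => /predU1P[->|ab]; rewrite lebesgue_measure_itv/= lte_fin.
  by rewrite ltxx subrr.
by rewrite ab.
Qed.

Lemma Rintegral_itv_split (a b c : R) (f : R -> R) : a <= b -> b <= c ->
  mu.-integrable `[a, c] (EFin \o f) ->
  \int[mu]_(s in `[a, c]) f s = \int[mu]_(s in `[a, b]) f s + \int[mu]_(s in `[b, c]) f s.
Proof.
move=> ab bc fi; have := @Rintegral_itvB R f (BLeft a) (BRight c) b fi.
rewrite !bnd_simp => /(_ ab bc) h.
have fi' : mu.-integrable `]b, c] (EFin \o f).
  apply: integrableS fi => // x /=; rewrite !in_itv/= => /andP[bx ->].
  by rewrite (le_trans ab)// ltW.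
by rewrite -(Rintegral_itv_obnd_cbnd fi') -h addrC subrK.
Qed.

(** The left end of the cell containing t, for the mesh of width T/(n+1) started at 0. *)
Definition grid (T : R) (n : nat) (t : R) : R :=
  T / n.+1%:R * (Num.truncn (t / (T / n.+1%:R)))%:R.

Section Grid.
Context (T : R) (T0 : 0 < T).

Let h n : R := T / n.+1%:R.
Let h0 n : 0 < h n. Proof. by rewrite divr_gt0. Qed.

Lemma grid_itv n t : 0 <= t -> grid T n t <= t < grid T n t + T / n.+1%:R.
Proof.
move=> t0; have := truncn_itv (divr_ge0 t0 (ltW (h0 n))).
rewrite -/(h n) /grid -/(h n) => /andP[h1 h2]; apply/andP; split.
  by rewrite mulrC -ler_pdivlMr.
by rewrite -[X in _ < _ + X]mulr1 -mulrDr natr1 mulrC -ltr_pdivrMr.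
Qed.

Lemma grid_ge0 n t : 0 <= grid T n t.
Proof. by rewrite /grid mulr_ge0// ltW// h0. Qed.

Lemma grid_dist n t : 0 <= t -> `|t - grid T n t| <= T / n.+1%:R.
Proof.
by move=> /(grid_itv n)/andP[h1 h2]; rewrite ger0_norm ?subr_ge0// lerBlDl ltW.
Qed.

Lemma grid_mem n t : 0 <= t <= T -> 0 <= grid T n t <= T.
Proof.
by move=> /andP[t0 tT]; rewrite grid_ge0 (le_trans _ tT)//; case/andP: (grid_itv n t0).
Qed.

Lemma grid_mesh_cvg : T / n.+1%:R @[n --> \oo] --> (0 : R).
Proof.
by rewrite -[X in _ --> X](mulr0 T); apply: cvgM; [exact: cvg_cst|exact: cvg_harmonic].
Qed.

(** The cells are half-open, so t = T lies in the cell that starts at T; hence n.+2 cells. *)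
Lemma grid_sum n t (F : R -> R) : 0 <= t <= T ->
  F (grid T n t) = \sum_(i < n.+2)
    \1_(`[h n * i%:R, h n * i.+1%:R[%classic : set R) t * F (h n * i%:R).
Proof.
move=> /andP[t0 tT]; have := truncn_itv (divr_ge0 t0 (ltW (h0 n))).
set k := Num.truncn _ => /andP[h1 h2].
have kn : (k < n.+2)%N.
  rewrite ltnS -(ler_nat R) (le_trans h1)// /h ler_pdivrMr ?divr_gt0//.
  by rewrite mulrCA divff ?mulr1// pnatr_eq0.
rewrite (bigD1 (Ordinal kn))//= indicE mem_set; last first.
  by rewrite /= in_itv/= mulrC -ler_pdivlMr// h1/= mulrC -ltr_pdivrMr.
rewrite mul1r big1 ?addr0// => i ik; rewrite indicE memNset ?mul0r//= in_itv/=.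
move=> /andP[]; rewrite [h n * i%:R]mulrC -ler_pdivlMr// [h n * _]mulrC -ltr_pdivrMr// => i1 i2.
have ik1 : (i < k.+1)%N by rewrite -(ltr_nat R) (le_lt_trans i1).
have ik2 : (k < i.+1)%N by rewrite -(ltr_nat R) (le_lt_trans h1).
have ki : nat_of_ord i = k by apply/eqP; rewrite eqn_leq -ltnS ik1 -ltnS ik2.
by case/eqP: ik; apply/val_inj.
Qed.

Context {k : scalar_kind} (V : ipSpace R k) (hV : hilbert V).
Context d (Om : measurableType d).
Local Notation TO := (measurableTypeR R * Om)%type.
Local Notation cyl := ([set p : TO | 0 <= p.1 <= T]).

Lemma measurable_cylinder : measurable cyl.
Proof.
rewrite (_ : cyl = `[0, T]%classic `*` setT); first exact: measurableX.
by apply/seteqP; split => p /=; rewrite in_itv/=; [move=> -> | case].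
Qed.

Lemma wmeas_grid n (X : R -> Om -> V) : (forall t, 0 <= t <= T -> wmeas setT (X t)) ->
  wmeas cyl (fun p : TO => X (grid T n p.1) p.2).
Proof.
move=> mX v; apply: (eq_measurable_fun (fun p : TO => \sum_(i < n.+2)
    \1_(`[h n * i%:R, h n * i.+1%:R[%classic : set R) p.1 *
      (if (h n * i%:R <= T) then rip (X (h n * i%:R) p.2) v else 0))).
  move=> p /set_mem hp; rewrite (grid_sum n (fun t => rip (X t p.2) v) hp).
  apply: eq_bigr => i _; case: ifPn => // hi; rewrite indicE memNset ?mul0r//= in_itv/=.
  move=> /andP[hi' _]; move/negP: hi; apply; rewrite (le_trans hi')//.
  by case/andP: hp.
apply: measurable_sum => i; apply: measurable_funM.
  have m1 : measurable_fun setT (\1_(`[h n * i%:R, h n * i.+1%:R[%classic) : measurableTypeR R -> R).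
    exact: measurable_indic.
  apply: (measurableT_comp m1); apply: measurable_funTS; exact: measurable_fst.
case: (leP (h n * i%:R) T) => hi; last exact: measurable_cst.
have hhi : 0 <= h n * i%:R <= T by rewrite hi mulr_ge0// ltW.
apply: (measurableT_comp (f := fun om => rip (X (h n * i%:R) om) v)); first exact: mX.
by apply: measurable_funTS; exact: measurable_snd.
Qed.

(** A process whose paths are limits of their grid samples is a pointwise limit of step processes,
    which are jointly measurable. *)
Lemma wmeas_caratheodory (X : R -> Om -> V) :
  (forall t, 0 <= t <= T -> wmeas setT (X t)) ->
  (forall om t, 0 <= t <= T -> hlim (fun n => X (grid T n t) om) (X t om)) ->
  wmeas cyl (fun p : TO => X p.1 p.2).
Proof.
move=> mX cX; apply: (wmeas_lim hV (F := fun n (p : TO) => X (grid T n p.1) p.2)).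
  by move=> n; exact: wmeas_grid.
by move=> p hp; exact: cX.
Qed.

Lemma wmeas_section (X : R -> Om -> V) om : wmeas cyl (fun p : TO => X p.1 p.2) ->
  wmeas (`[0, T]%classic : set (measurableTypeR R)) (fun t => X t om).
Proof.
move=> mX; apply: (wmeas_comp (phi := (fun t : measurableTypeR R => (t, om) : TO)) _ _ _ mX).
- exact: measurable_cylinder.
- by move=> _ [t /= ht <-] /=; move: ht; rewrite in_itv.
- by apply: measurable_funTS; exact: measurable_pair2.
Qed.

End Grid.
End TimeIntegrals.

Section RightLimits.
Context {R : realType}.

Lemma rcvg0P (g : R -> R) : (forall t, 0 <= g t) ->
  (g t @[t --> 0^'+] --> (0 : R)) <->
  (forall e, 0 < e -> exists2 dl, 0 < dl & forall t, 0 < t -> t < dl -> g t < e).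
Proof.
move=> g0; split=> [h e e0|h].
  move/cvgrPdist_lt: h => /(_ e e0) [dl /= dl0 hd]; exists dl => // t t0 tdl.
  have := hd t; rewrite /ball_/= sub0r normrN ger0_norm ?(ltW t0)// => /(_ tdl t0).
  by rewrite sub0r normrN ger0_norm.
apply/cvgrPdist_lt => e e0; have [dl dl0 hd] := h e e0.
exists dl => //= t; rewrite /ball_/= sub0r normrN => tdl t0.
rewrite sub0r normrN ger0_norm//; apply: hd => //.
by rewrite (le_lt_trans _ tdl)// ler_norm.
Qed.

End RightLimits.

(** * The uniform boundedness principle *)

Section UniformBoundedness.
Context {R : realType} {k : scalar_kind} (V W : ipSpace R k).
Context (hV : hilbert V) (hW : hilbert W).

(** Nested balls are built such that on the j-th one some [G n] has norm above j; their common point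
    contradicts pointwise boundedness. Given a centre p and a short y with ||G_n y|| large, one of p
    + y, p - y has a large image, since G_n y is half the difference of the two images. *)
Lemma uniform_boundedness (G : nat -> V -> W) : (forall n, bounded_op (G n)) ->
  (forall x, exists C : R, forall n, hnorm (G n x) <= C) ->
  exists2 C : R, 0 < C & forall n x, hnorm (G n x) <= C * hnorm x.
Proof.
move=> bG pG; apply: contrapT => nC.
have unb (C : R) : 0 < C -> exists n x, C * hnorm x < hnorm (G n x).
  move=> C0; apply: contrapT => h; apply: nC; exists C => // n x.
  by rewrite leNgt; apply/negP => h'; apply: h; exists n, x.
have step (j : nat) (p : V * R) : exists q : V * R, 0 < p.2 ->
    [/\ 0 < q.2, q.2 <= p.2 / 4, hnorm (q.1 - p.1) <= p.2 / 2 &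
      exists n, forall z, hnorm (z - q.1) <= q.2 -> j%:R < hnorm (G n z)].
  case: (ltP 0 p.2) => p0; last by exists p.
  have C0 : 0 < (j.+1%:R : R) / (p.2 / 2) by rewrite !divr_gt0.
  have [n [x hx]] := unb _ C0.
  have x0 : 0 < hnorm x.
    rewrite lt_neqAle hnorm_ge0 andbT eq_sym; apply/eqP => h; move: hx.
    by rewrite h mulr0 (hnorm_eq0 hV h) (bop0 (bG n)) hnorm0 ?ltxx.
  pose y := ofR (p.2 / 2 / hnorm x) *: x.
  have ny : hnorm y = p.2 / 2.
    rewrite hnormZR// ger0_norm ?divr_ge0 ?hnorm_ge0 ?(ltW p0)//.
    by rewrite divfK// gt_eqF.
  have Gy : j.+1%:R < hnorm (G n y).
    rewrite /y (bopZ (bG n)) hnormZR// ger0_norm ?divr_ge0 ?hnorm_ge0 ?(ltW p0)//.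
    have c0 : 0 < p.2 / 2 / hnorm x by rewrite !divr_gt0.
    rewrite -(ltr_pM2l c0) in hx; apply: le_lt_trans hx.
    by rewrite le_eqVlt; apply/orP; left; apply/eqP; field; rewrite !gt_eqF.
  have [q1 hq1 Gq1] : exists2 q1, hnorm (q1 - p.1) <= p.2 / 2 & j.+1%:R < hnorm (G n q1).
    case: (ltP j.+1%:R (hnorm (G n (p.1 + y)))) => h1.
      by exists (p.1 + y) => //; rewrite addrC addKr ny.
    exists (p.1 - y); first by rewrite addrC addKr hnormN// ny.
    rewrite ltNge; apply/negP => h2; move: Gy; apply/negP; rewrite -leNgt.
    have -> : G n y = ofR 2^-1 *: (G n (p.1 + y) - G n (p.1 - y)).
      rewrite -(bopB (bG n)) (_ : p.1 + y - (p.1 - y) = ofR 2 *: y); last first.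
        by rewrite opprB addrC addrA subrK -[X in _ = _ X]mulr1n (ofRD 1 1) scalerDl ofR1 !scale1r.
      rewrite (bopZ (bG n)) scalerA -ofRM mulVf// ofR1 scale1r//.
    rewrite hnormZR// ger0_norm ?invr_ge0// mulrC ler_pdivrMr//.
    by apply: le_trans (hnormB hW _ _) _; rewrite mulr_natr mulr2n lerD.
  have [C C1 hC] := bop_bound (bG n).
  (* The bound 1 / C lets [G n] vary by at most 1 on the new ball, so its norm stays above j; p.2 /
     4 keeps the balls nested, the centre having moved by at most p.2 / 2. *)
  exists (q1, Num.min (p.2 / 4) (1 / C)) => _ /=; split.
  - by rewrite lt_min !divr_gt0.
  - by rewrite ge_min lexx.
  - by [].
  - exists n => z hz; rewrite ltNge; apply/negP => h; move: Gq1; apply/negP; rewrite -leNgt.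
    rewrite -(subrK (G n z) (G n q1)) -(bopB (bG n)).
    apply: le_trans (hnormD hW _ _) _; rewrite -natr1 addrC lerD//.
    apply: le_trans (hC _) _; rewrite mulrC -ler_pdivlMr// hnormBC//.
    by apply: le_trans hz _; rewrite ge_min lexx orbT.
have [F hF] := choice (fun jp : nat * (V * R) => step jp.1 jp.2).
pose fix q (j : nat) : V * R := if j is i.+1 then F (i, q i) else (0, 1).
have q0 j : 0 < (q j).2 by elim: j => //= j IH; have [] := hF (j, q j) IH.
have qs j := hF (j, q j) (q0 j).
have r4 j : (q j.+1).2 <= (q j).2 / 4 by have [] := qs j.
have d2 j : hnorm ((q j.+1).1 - (q j).1) <= (q j).2 / 2 by have [] := qs j.
have rj j : (q j).2 <= 2^-1 ^+ j.
  elim: j => [|j IH]; first by rewrite expr0.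
  rewrite (le_trans (r4 j))// exprS mulrC.
  have := q0 j; move: IH; set a := _ ^+ _; set b := (q j).2; lra.
have [l hl] : exists l, hlim (fun i => (q i).1) l.
  apply: (geometric_cauchy hV (C := 1)) => i; rewrite mul1r (le_trans (d2 i))//.
  by have := q0 i; have := rj i; lra.
(* Distances of centres are bounded by differences of radii, so the limit of the centres lies in
   every ball. *)
have tail j m : hnorm ((q (m + j)%N).1 - (q j).1) <= (q j).2 - (q (m + j)%N).2.
  elim: m => [|m IH]; first by rewrite add0n !subrr hnorm0.
  rewrite addSn; apply: le_trans (hnormDB hV _ (q (m + j)%N).1 _) _.
  have := r4 (m + j)%N; have := d2 (m + j)%N; have := q0 (m + j)%N; move: IH; lra.
have lj j : hnorm (l - (q j).1) <= (q j).2.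
  apply/ler_addgt0Pr => e e0; have /hlimP/(_ e e0)[N hN] := hl.
  apply: le_trans (hnormDB hV _ (q (N + j)%N).1 _) _.
  rewrite addrC lerD//; first by apply: le_trans (tail j N) _; rewrite lerBlDr lerDl ltW.
  by rewrite hnormBC// ltW// hN// leq_addr.
have [C hC] := pG l.
have [n _ Cn] : exists2 n : nat, True & C < n%:R.
  by exists (Num.truncn C).+1 => //; apply: truncnS_gt.
have [_ _ _ [n' /(_ l (lj n.+1)) h]] := qs n.
by move: (lt_trans Cn h); apply/negP; rewrite -leNgt.
Qed.

End UniformBoundedness.

Section StrongIntegral.
Context {R : realType} {k : scalar_kind}.
Implicit Types V W : ipSpace R k.

(* Bochner integrability with integral [v], in Pettis form ([bochnerP]). *)
Definition bint V d (T : measurableType d) (mu : {measure set T -> \bar R})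
    (D : set T) (f : T -> V) (v : V) : Prop :=
  [/\ wmeas D f, (\int[mu]_(x in D) (hnorm (f x))%:E < +oo)%E &
      weak_integral mu D f v].

Section Fixed.
Context V (hV : hilbert V) (sV : hseparable V).
Context d (T : measurableType d) (mu : {measure set T -> \bar R}).
Context (D : set T) (mD : measurable D).
Implicit Types (f g : T -> V) (v w : V).
Local Notation nrm f := (\int[mu]_(x in D) (hnorm (f x))%:E)%E.

Lemma bint_bochner f v : (mu D < +oo)%E -> wmeas D f ->
  bint mu D f v <-> is_bochner mu D f v.
Proof. by move=> fD mf; rewrite bochnerP//; split=> [[]|[]]. Qed.

Lemma bint_uniq f v v' : bint mu D f v -> bint mu D f v' -> v = v'.
Proof. by move=> [_ _ h] [_ _ h']; exact: weak_integral_uniq h h'. Qed.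

Lemma bint_bochnerE f v : (mu D < +oo)%E -> bint mu D f v -> bochner mu D f = v.
Proof. by move=> fD h; have [mf _ _] := h; apply: bochnerE => //; apply/bint_bochner. Qed.

Lemma bint_exists f : (mu D < +oo)%E -> wmeas D f -> (nrm f < +oo)%E ->
  exists v, bint mu D f v.
Proof.
move=> fD mf nf; have [v hv] := bochner_exists hV sV mD fD mf nf.
by exists v; apply/bint_bochner.
Qed.

Lemma bint_le f v : bint mu D f v -> ((hnorm v)%:E <= nrm f)%E.
Proof. by move=> [mf nf wf]; exact: weak_integral_le wf. Qed.

Lemma bint_norm_le f v (C : R) : 0 <= C -> bint mu D f v ->
  (forall x, D x -> hnorm (f x) <= C) -> (mu D < +oo)%E -> hnorm v <= C * fine (mu D).
Proof.
move=> C0 hv hC fD; rewrite -lee_fin (le_trans (bint_le hv))//.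
apply: (@le_trans _ _ (\int[mu]_(x in D) (cst C%:E) x)%E).
  apply: nonneg_le_integral => x Dx; first by rewrite lee_fin hnorm_ge0.
  by rewrite lee_fin hC.
rewrite integral_cst// EFinM fineK// ge0_fin_numE//.
Qed.

Lemma bounded_nrm f (C : R) : (forall x, D x -> hnorm (f x) <= C) ->
  (mu D < +oo)%E -> (nrm f < +oo)%E.
Proof.
move=> hC fD; apply: (@le_lt_trans _ _ (\int[mu]_(x in D) (cst C%:E) x)%E).
  apply: nonneg_le_integral => x Dx; first by rewrite lee_fin hnorm_ge0.
  by rewrite lee_fin hC.
rewrite integral_cst// -(@fineK _ (mu D)) ?ge0_fin_numE// -EFinM ltry//.
Qed.

Lemma eq_bint f g v : (forall x, D x -> f x = g x) -> bint mu D f v -> bint mu D g v.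
Proof.
move=> fg [mf nf wf]; split; first exact: eq_wmeas mf.
- rewrite (_ : nrm g = nrm f) //; apply: eq_integral => x /set_mem Dx.
  by rewrite fg.
- by move=> w; rewrite wf; apply: eq_Rintegral => x /set_mem Dx; rewrite fg.
Qed.

Lemma bintD f g v w : bint mu D f v -> bint mu D g w ->
  bint mu D (fun x => f x + g x) (v + w).
Proof.
move=> [mf nf wf] [mg ng wg]; split; first exact: wmeasD.
  by apply: le_lt_trans (le_nrmD hV sV _ _ _ _) _ => //; exact: lte_add_pinfty.
move=> z; rewrite ripDl// wf wg -RintegralD//; try exact: integrable_rip.
by apply: eq_Rintegral => x _; rewrite ripDl.
Qed.

Lemma bint_bop W (G : V -> W) f v : hilbert W -> bounded_op G ->
  bint mu D f v -> bint mu D (fun x => G (f x)) (G v).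
Proof.
move=> hW bG [mf nf wf]; split; first exact: wmeas_bop.
  have [C C0 hC] := bop_bound bG.
  apply: (@le_lt_trans _ _ (\int[mu]_(x in D) (C%:E * (hnorm (f x))%:E))%E).
    by apply: nonneg_le_integral => x Dx; rewrite -?EFinM lee_fin ?hnorm_ge0.
  rewrite ge0_integralZl_EFin ?(ltW C0)//.
  - by apply: lte_mul_pinfty => //; rewrite lee_fin ltW.
  - by move=> x _; rewrite lee_fin hnorm_ge0.
  - by apply/measurable_EFinP; exact: wmeas_norm.
have [e he] := onb_seq_exists hV sV; have [Gs hGs] := adjoint_exists hV he hW bG.
move=> w; rewrite /rip hGs -/(rip v (Gs w)) wf; apply: eq_Rintegral => x _.
by rewrite /rip hGs.
Qed.

Lemma bintZ (c : scal R k) f v : bint mu D f v -> bint mu D (fun x => c *: f x) (c *: v).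
Proof.
by apply: (@bint_bop V (fun x => c *: x)) => //; apply: bounded_opZ => //; exact: bounded_op_id.
Qed.

Lemma bintN f v : bint mu D f v -> bint mu D (fun x => - f x) (- v).
Proof.
by move=> /(bintZ (-1)); rewrite scaleN1r; apply: eq_bint => x _; rewrite scaleN1r.
Qed.

Lemma bintB f g v w : bint mu D f v -> bint mu D g w ->
  bint mu D (fun x => f x - g x) (v - w).
Proof. by move=> hf /bintN hg; exact: bintD. Qed.

End Fixed.

Section Time.
Context V (hV : hilbert V) (sV : hseparable V).
Local Notation mu := (@lebesgue_measure R).
Local Notation tint a b f v := (bint mu `[a, b]%classic (f : R -> V) v).
Implicit Types (f g : R -> V) (v w : V) (a b c : R).

Lemma tint_norm_le a b f v C : a <= b -> 0 <= C -> tint a b f v ->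
  (forall s, a <= s <= b -> hnorm (f s) <= C) -> hnorm v <= C * (b - a).
Proof.
move=> ab C0 hv hC.
have := @bint_norm_le _ hV sV _ _ mu `[a, b]%classic (measurable_itv _) f v C C0 hv.
rewrite (_ : fine _ = b - a); last exact: (congr1 fine (lebesgue_itv_len ab)).
by apply; [move=> x; rewrite /= in_itv/=; exact: hC | exact: lebesgue_itv_fin].
Qed.

Lemma tint_nil a b f : b <= a -> wmeas (`[a, b]%classic : set (measurableTypeR R)) f ->
  tint a b f 0.
Proof.
move=> ba mf.
have m0 : mu `[a, b] = 0%E by rewrite lebesgue_measure_itv/= lte_fin ltNge ba.
split => //.
  rewrite (_ : (\int[mu]_(x in _) _)%E = 0%E) ?ltry//.
  apply: null_set_integral => //; apply/measurable_EFinP; exact: wmeas_norm.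
move=> w; rewrite rip0l// /Rintegral null_set_integral//.
by apply/measurable_EFinP; exact: mf.
Qed.

Lemma tint_split a b c f v w : a <= b -> b <= c ->
  wmeas (`[a, c]%classic : set (measurableTypeR R)) f ->
  tint a b f v -> tint b c f w -> tint a c f (v + w).
Proof.
move=> ab bc mf [_ n1 w1] [_ n2 w2].
have nf : (\int[mu]_(s in `[a, c]) (hnorm (f s))%:E < +oo)%E.
  have e : `[a, c]%classic = `[a, b]%classic `|` `]b, c]%classic :> set R.
    by rewrite -itv_bndbnd_setU// bnd_simp.
  rewrite e ge0_integral_setU//=; last 3 first.
  - by rewrite -e; apply/measurable_EFinP; exact: wmeas_norm.
  - by move=> x _; rewrite lee_fin hnorm_ge0.
  - rewrite disj_set2E; apply/eqP/seteqP; split => // x [/=]; rewrite !in_itv/=.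
    by move=> /andP[_ xb] /andP[bx _]; move: (lt_le_trans bx xb); rewrite ltxx.
  apply: lte_add_pinfty => //; apply: le_lt_trans n2.
  apply: ge0_subset_integral => //; last 2 first.
  - by move=> x _; rewrite lee_fin hnorm_ge0.
  - by move=> x /=; rewrite !in_itv/= => /andP[/ltW -> ->].
  apply/measurable_EFinP; apply: wmeas_norm => //.
  apply: wmeasS mf => // x /=; rewrite !in_itv/= => /andP[h ->].
  by rewrite (le_trans ab h).
split => // z; rewrite ripDl// w1 w2 -Rintegral_itv_split//.
exact: integrable_rip.
Qed.

(** Again a composite of two reflections, here for extended real integrands. *)
Lemma integral_shift (a b c : R) (f : R -> \bar R) :
  measurable_fun `[a + c, b + c] f ->
  (\int[mu]_(s in `[a, b]) f (s + c)%R = \int[mu]_(s in `[(a + c)%R, (b + c)%R]) f s)%E.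
Proof.
move=> mf.
have -> : (\int[mu]_(s in `[(a + c)%R, (b + c)%R]) f s =
    \int[mu]_(s in `[(- b - c)%R, (- a - c)%R]) f (0 - s)%R)%E.
  by rewrite integral_refl !sub0r !opprD !opprK.
have -> : (\int[mu]_(s in `[(- b - c)%R, (- a - c)%R]) f (0 - s)%R =
    \int[mu]_(s in `[a, b]) (fun s' => f (0 - s')%R) (- c - s)%R)%E.
  rewrite [(- b - c)%R]addrC [(- a - c)%R]addrC.
  rewrite [RHS](@integral_refl _ _ _ _ (fun s => f (0 - s)%R)) //.
  apply: (@measurable_comp _ _ _ _ _ _ `[a + c, b + c] f) => //.
    move=> _ [s hs <-]; move: (s : R) hs => {}s /=; rewrite !in_itv/= => /andP[h1 h2].
    by apply/andP; split; lra.
  by apply: measurable_funB => //; exact: measurable_id.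
by apply: eq_integral => s _; congr f; ring.
Qed.

Lemma tint_shift a b c f v : tint (a + c) (b + c) f v -> tint a b (fun s => f (s + c)) v.
Proof.
move=> [mf nf wf].
have sh : (fun s : R => s + c) @` `[a, b] `<=` `[a + c, b + c].
  by move=> _ [s /= + <-]; rewrite !in_itv/= !lerD2r.
have ms : measurable_fun `[a, b] (fun s : measurableTypeR R => s + c : measurableTypeR R).
  by apply: measurable_funD => //; exact: measurable_id.
have mn : measurable_fun `[a + c, b + c] (fun s : measurableTypeR R => (hnorm (f s))%:E).
  by apply/measurable_EFinP; exact: wmeas_norm.
split; first exact: (wmeas_comp _ sh ms mf).
  by rewrite (integral_shift (f := fun s => (hnorm (f s))%:E)).
by move=> z; rewrite wf -(Rintegral_shift (f := fun s => rip (f s) z))//; exact: mf.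
Qed.

Lemma tint_refl a b c f v : tint (c - b) (c - a) f v -> tint a b (fun s => f (c - s)) v.
Proof.
move=> [mf nf wf].
have sh : (fun s : R => c - s) @` `[a, b] `<=` `[c - b, c - a].
  by move=> _ [s /= + <-]; rewrite !in_itv/= => /andP[? ?]; rewrite !lerD2l !lerN2; apply/andP.
have ms : measurable_fun `[a, b] (fun s : measurableTypeR R => c - s : measurableTypeR R).
  by apply: measurable_funB => //; exact: measurable_id.
have mn : measurable_fun `[c - b, c - a] (fun s : measurableTypeR R => (hnorm (f s))%:E).
  by apply/measurable_EFinP; exact: wmeas_norm.
split; first exact: (wmeas_comp _ sh ms mf).
  by rewrite (integral_refl (f := fun s => (hnorm (f s))%:E)).
by move=> z; rewrite wf -(Rintegral_refl (f := fun s => rip (f s) z))//; exact: mf.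
Qed.

End Time.
End StrongIntegral.

Section StrongTimeIntegral.
Context {R : realType} {k : scalar_kind}.
Implicit Types V W : ipSpace R k.
Context V (hV : hilbert V) (sV : hseparable V).
Local Notation mu := (@lebesgue_measure R).
Local Notation tint a b f v := (bint mu `[a, b]%classic (f : R -> V) v).
Implicit Types (f g : R -> V) (v w : V) (a b c : R).

Lemma measurable_cc a b : measurable (`[a, b]%classic : set (measurableTypeR R)).
Proof. exact: measurable_itv. Qed.

Lemma tintD a b f g v w : tint a b f v -> tint a b g w ->
  tint a b (fun s => f s + g s) (v + w).
Proof. by apply: bintD => //; exact: measurable_cc. Qed.

Lemma tintB a b f g v w : tint a b f v -> tint a b g w ->
  tint a b (fun s => f s - g s) (v - w).
Proof. by apply: bintB => //; exact: measurable_cc. Qed.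

Lemma tintZ a b (c : scal R k) f v : tint a b f v -> tint a b (fun s => c *: f s) (c *: v).
Proof. by apply: bintZ => //; exact: measurable_cc. Qed.

Lemma tint_bop W (G : V -> W) a b f v : hilbert W -> bounded_op G ->
  tint a b f v -> bint mu `[a, b]%classic ((fun s => G (f s)) : R -> W) (G v).
Proof. by apply: bint_bop => //; exact: measurable_cc. Qed.

Lemma tint_uniq a b f v v' : tint a b f v -> tint a b f v' -> v = v'.
Proof. exact: bint_uniq. Qed.

Lemma eq_tint a b f g v : (forall s, a <= s <= b -> f s = g s) ->
  tint a b f v -> tint a b g v.
Proof. by move=> fg; apply: eq_bint => s /=; rewrite in_itv; exact: fg. Qed.

Lemma tint_bochner a b f v : wmeas (`[a, b]%classic : set (measurableTypeR R)) f ->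
  tint a b f v <-> is_bochner mu `[a, b]%classic f v.
Proof.
by move=> mf; apply: bint_bochner => //; exact: lebesgue_itv_fin.
Qed.

End StrongTimeIntegral.

(** * Semigroups and generators *)

Section RightHilbertLimit.
Context {R : realType} {k : scalar_kind}.
Implicit Types V W : ipSpace R k.

Definition rlim V (f : R -> V) (l : V) : Prop :=
  hnorm (f t - l) @[t --> 0^'+] --> (0 : R).

Lemma rlimP V (f : R -> V) (l : V) : rlim f l <-> forall e, 0 < e ->
  exists2 dl, 0 < dl & forall t, 0 < t -> t < dl -> hnorm (f t - l) < e.
Proof. by apply: rcvg0P => t; exact: hnorm_ge0. Qed.

Lemma rlim_hlim V (f : R -> V) (l : V) (h : nat -> R) : (forall n, 0 < h n) ->
  h n @[n --> \oo] --> (0 : R) -> rlim f l -> hlim (fun n => f (h n)) l.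
Proof.
move=> h0 hc /rlimP fl; apply/hlimP => e e0; have [dl dl0 hdl] := fl e e0.
have [N hN] := (cvg0_nat (fun n => ltW (h0 n))).1 hc dl dl0.
by exists N => i Ni; apply: hdl => //; exact: hN.
Qed.

Lemma eq_rlim V (f g : R -> V) (l : V) : (forall t, 0 < t -> f t = g t) ->
  rlim f l -> rlim g l.
Proof.
move=> fg /rlimP fl; apply/rlimP => e e0; have [dl dl0 hdl] := fl e e0.
by exists dl => // t t0 td; rewrite -fg//; exact: hdl.
Qed.

Section Fixed.
Context V (hV : hilbert V).
Implicit Types (f g : R -> V) (l : V).

Lemma harmonic_gt0 n : 0 < n.+1%:R^-1 :> R. Proof. by rewrite invr_gt0. Qed.

Lemma rlim_uniq f l l' : rlim f l -> rlim f l' -> l = l'.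
Proof.
move=> hl hl'; have hc : (fun n => n.+1%:R^-1) @ \oo --> (0 : R) by exact: cvg_harmonic.
exact: (hlim_uniq hV (rlim_hlim harmonic_gt0 hc hl) (rlim_hlim harmonic_gt0 hc hl')).
Qed.

Lemma rlimD f g l l' : rlim f l -> rlim g l' -> rlim (fun t => f t + g t) (l + l').
Proof.
move=> /rlimP hf /rlimP hg; apply/rlimP => e e0.
have e20 : 0 < e / 2 by rewrite divr_gt0.
have [d1 d10 h1] := hf _ e20; have [d2 d20 h2] := hg _ e20.
exists (Num.min d1 d2); first by rewrite lt_min d10.
move=> t t0; rewrite lt_min => /andP[t1 t2].
rewrite opprD addrACA; apply: le_lt_trans (hnormD hV _ _) _.
by rewrite [ltRHS]splitr ltrD// ?h1 ?h2.
Qed.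

Lemma rlim_bop W (G : V -> W) f l : hilbert W -> bounded_op G -> rlim f l ->
  rlim (fun t => G (f t)) (G l).
Proof.
move=> hW bG /rlimP hf; apply/rlimP => e e0; have [C C0 hC] := bop_bound bG.
have eC0 : 0 < e / C by rewrite divr_gt0.
have [d1 d10 h1] := hf _ eC0.
exists d1 => // t t0 td; rewrite -(bopB bG); apply: le_lt_trans (hC _) _.
by rewrite mulrC -ltr_pdivlMr// h1.
Qed.

Lemma rlimZ (c : scal R k) f l : rlim f l -> rlim (fun t => c *: f t) (c *: l).
Proof.
by apply: (@rlim_bop V (fun x => c *: x)) => //; apply: bounded_opZ => //; exact: bounded_op_id.
Qed.

Lemma rlim_cst l : rlim (fun=> l) l.
Proof. by apply/rlimP => e e0; exists 1 => // t _ _; rewrite subrr hnorm0. Qed.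

End Fixed.
End RightHilbertLimit.

Section ContinuousPaths.
Context {R : realType} {k : scalar_kind} (V : ipSpace R k) (hV : hilbert V).

Lemma wmeas_path (T : R) (f : R -> V) : 0 < T ->
  (forall t, 0 <= t <= T -> hlim (fun n => f (grid T n t)) (f t)) ->
  wmeas (`[0, T]%classic : set (measurableTypeR R)) f.
Proof.
move=> T0 hf; apply: (@wmeas_section _ T _ _ _ (measurableTypeR R) (fun t _ => f t) 0).
apply: (@wmeas_caratheodory _ T T0 _ V hV _ (measurableTypeR R) (fun t _ => f t)) => [t _|_ t tT].
  exact: wmeas_cst.
exact: hf.
Qed.

End ContinuousPaths.

Section Semigroup.
Context {R : realType} {k : scalar_kind} (V : ipSpace R k).
Context (hV : hilbert V) (sV : hseparable V).
Context (S : R -> V -> V) (hS : C0_semigroup S).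
Local Notation mu := (@lebesgue_measure R).
Local Notation tint a b f v := (bint mu `[a, b]%classic (f : R -> V) v).
Implicit Types (s t h : R) (x y : V).

Lemma sg_bop t : 0 <= t -> bounded_op (S t). Proof. by case: hS => h _ _ _; exact: h. Qed.
Lemma sg0 x : S 0 x = x. Proof. by case: hS. Qed.
Lemma sgD s t x : 0 <= s -> 0 <= t -> S (s + t) x = S s (S t x).
Proof. by case: hS => _ _ h _; exact: h. Qed.
Lemma sgC s t x : 0 <= s -> 0 <= t -> S s (S t x) = S t (S s x).
Proof. by move=> s0 t0; rewrite -!sgD// addrC. Qed.

Lemma sg_rlim x : rlim (S^~ x) x. Proof. by case: hS => _ _ _; exact. Qed.

Lemma sg_cont0 x e : 0 < e ->
  exists2 dl, 0 < dl & forall t, 0 <= t -> t < dl -> hnorm (S t x - x) < e.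
Proof.
move=> e0; have /rlimP/(_ e e0)[dl dl0 h] := sg_rlim x; exists dl => // t.
rewrite le_eqVlt => /predU1P[<-|t0] td; last exact: h.
by rewrite sg0 subrr hnorm0.
Qed.

(** Otherwise some times t_n <= 1/(n+1) have ||S(t_n)|| > n+1, whereas S(t_n) x -> x is bounded for
    each x: a contradiction with uniform boundedness. *)
Lemma sg_local_bound : exists2 dl, 0 < dl & exists M : R,
  forall t x, 0 <= t <= dl -> hnorm (S t x) <= M * hnorm x.
Proof.
apply: contrapT => nB.
have bad (n : nat) : exists p : R * V, 0 <= p.1 <= n.+1%:R^-1 /\
    n.+1%:R * hnorm p.2 < hnorm (S p.1 p.2).
  apply: contrapT => h; apply: nB; exists n.+1%:R^-1; first exact: harmonic_gt0.
  exists n.+1%:R => t x tn; rewrite leNgt; apply/negP => h'; apply: h.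
  by exists (t, x).
have [p hp] := choice bad.
have t0 n : 0 <= (p n).1 by case: (hp n) => /andP[].
have [||C C0 hC] := @uniform_boundedness _ _ _ _ hV hV (fun n => S (p n).1).
- by move=> n; exact: sg_bop.
- move=> x; have [dl dl0 hdl] := sg_cont0 x ltr01.
  have [N _ hN] : exists2 N : nat, True & dl^-1 < N%:R.
    by exists (Num.truncn dl^-1).+1 => //; exact: truncnS_gt.
  exists (\sum_(i < N) hnorm (S (p i).1 x) + (hnorm x + 1)) => n.
  have s0 : 0 <= \sum_(i < N) hnorm (S (p i).1 x) by apply: sumr_ge0 => i _; exact: hnorm_ge0.
  have n0 := hnorm_ge0 x.
  case: (ltnP n N) => nN.
    rewrite (bigD1 (Ordinal nN))//= -addrA lerDl addr_ge0// ?addr_ge0//.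
    by apply: sumr_ge0 => i _; exact: hnorm_ge0.
  rewrite -[S _ _](subrK x); apply: le_trans (hnormD hV _ _) _.
  rewrite -[leLHS]add0r lerD// addrC lerD// ltW// hdl//.
  have [/andP[_ h1] _] := hp n; apply: le_lt_trans h1 _.
  rewrite invf_plt ?posrE// (lt_le_trans hN)// ler_nat ltnW//.
have [_ h1] := hp (Num.truncn C); move: (lt_le_trans h1 (hC _ _)).
apply/negP; rewrite -leNgt ler_wpM2r ?hnorm_ge0// ltW//; exact: truncnS_gt.
Qed.

(** The local bound is iterated over steps of length dl; taking M >= 1 makes its powers increase, so
    one power serves for all t <= T. *)
Lemma sg_bound (T : R) : exists2 M : R, 1 <= M &
  forall t x, 0 <= t <= T -> hnorm (S t x) <= M * hnorm x.
Proof.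
have [dl dl0 [M0 hM0]] := sg_local_bound; pose M := Num.max 1 M0.
have M1 : 1 <= M by rewrite le_max lexx.
have hM t x : 0 <= t <= dl -> hnorm (S t x) <= M * hnorm x.
  move=> td; apply: le_trans (hM0 t x td) _; rewrite ler_wpM2r ?hnorm_ge0//.
  by rewrite le_max lexx orbT.
have iterM (m : nat) : forall t x, 0 <= t <= m.+1%:R * dl -> hnorm (S t x) <= M ^+ m.+1 * hnorm x.
  elim: m => [|m IH] t x /andP[t0 td].
    by rewrite expr1 hM// t0; move: td; rewrite mul1r.
  case: (leP t dl) => tdl.
    apply: le_trans (hM t x _) _; rewrite ?t0// ler_wpM2r ?hnorm_ge0//.
    by rewrite exprS ler_peMr ?(le_trans ler01 M1)// exprn_ege1.
  have tt : 0 <= t - dl by rewrite subr_ge0 ltW.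
  rewrite -(subrK dl t) addrC sgD ?(ltW dl0)//.
  apply: (le_trans (hM _ _ _)); first by rewrite lexx ltW.
  rewrite exprS -mulrA ler_wpM2l ?(le_trans ler01 M1)// IH// tt/=.
  by rewrite lerBlDr -[X in _ + X]mul1r -mulrDl natr1.
exists (M ^+ (Num.truncn (T / dl)).+1); first by rewrite exprn_ege1.
move=> t x /andP[t0 tT]; apply: iterM; rewrite t0/= -ler_pdivrMr//.
apply: ltW; apply: le_lt_trans (truncnS_gt _); by rewrite ler_pM2r ?invr_gt0.
Qed.

(** For s <= t the difference is S(s) applied to S(t-s) x - x, which turns right continuity at 0
    into two-sided continuity. *)
Lemma sg_dist (T M : R) t s x : (forall t x, 0 <= t <= T -> hnorm (S t x) <= M * hnorm x) ->
  0 <= t <= T -> 0 <= s <= T -> hnorm (S t x - S s x) <= M * hnorm (S `|t - s| x - x).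
Proof.
move=> hM; wlog st : t s / s <= t.
  move=> hw ht hs; case: (leP s t) => [|/ltW] st; first exact: hw.
  by rewrite hnormBC// distrC; exact: hw.
move=> /andP[t0 tT] hs; have /andP[s0 sT] := hs.
have ts : 0 <= t - s by rewrite subr_ge0.
have e : S t x = S s (S (t - s) x) by rewrite -sgD// addrC subrK.
rewrite e ger0_norm// -(bopB (sg_bop s0)); exact: hM.
Qed.

Lemma sg_cont t x e : 0 <= t -> 0 < e ->
  exists2 dl, 0 < dl & forall s, 0 <= s -> `|s - t| < dl -> hnorm (S s x - S t x) < e.
Proof.
move=> t0 e0; have [M M1 hM] := sg_bound (t + 1).
have M0 := lt_le_trans ltr01 M1.
have [dl dl0 hdl] := sg_cont0 x (divr_gt0 e0 M0).
exists (Num.min dl 1); first by rewrite lt_min dl0 ltr01.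
move=> s s0; rewrite lt_min => /andP[h1 h2].
have st : s <= t + 1 by rewrite -lerBlDl (le_trans (ler_norm _))// ltW.
apply: le_lt_trans (sg_dist x hM _ _) _; rewrite ?s0 ?st ?t0 ?lerDl ?ler01//.
by rewrite mulrC -ltr_pdivlMr// hdl.
Qed.

Lemma sg_hlim t x (r : nat -> R) : 0 <= t -> (forall n, 0 <= r n) ->
  r n @[n --> \oo] --> t -> hlim (fun n => S (r n) x) (S t x).
Proof.
move=> t0 r0 rt; apply/hlimP => e e0; have [dl dl0 hdl] := sg_cont x t0 e0.
have [N _ hN] : \forall n \near \oo, `|t - r n| < dl by move/cvgrPdist_lt: rt => /(_ _ dl0).
by exists N => i Ni; apply: hdl => //; rewrite distrC; exact: hN.
Qed.

Lemma grid_cvg T t : 0 < T -> 0 <= t -> grid T n t @[n --> \oo] --> t.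
Proof.
move=> T0 t0; apply/cvgrPdist_lt => e e0.
have /cvgrPdist_lt/(_ e e0) [N _ hN] := @grid_mesh_cvg _ T.
exists N => // n /= Nn; apply: le_lt_trans (grid_dist T0 n t0) _.
by have := hN n Nn; rewrite /= sub0r normrN ger0_norm// divr_ge0// ltW.
Qed.

Lemma sg_wmeas a b x : 0 <= a -> wmeas (`[a, b]%classic : set (measurableTypeR R)) (S^~ x).
Proof.
move=> a0; pose T := `|b| + 1; have T0 : 0 < T by rewrite ltr_wpDl.
apply: (@wmeasS _ _ _ _ _ _ (`[0, T]%classic : set (measurableTypeR R))) => //.
  move=> t /=; rewrite !in_itv/= => /andP[h1 h2]; rewrite (le_trans a0 h1)/=.
  by rewrite (le_trans h2)// (le_trans (ler_norm b))// lerDl.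
apply: wmeas_path => // t /andP[t0 tT]; apply: sg_hlim => // [n|].
  exact: grid_ge0.
exact: grid_cvg.
Qed.

(** The integrated semigroup, written Phi below. It is bounded, commutes with the semigroup and maps
    into the domain of the generator, so identities for A are tested through it. *)
Definition sg_int h x : V := bochner mu `[0, h]%classic (S^~ x).

Lemma sg_int_ex a b x : 0 <= a -> exists v, tint a b (S^~ x) v.
Proof.
move=> a0; apply: bint_exists => //; first exact: lebesgue_itv_fin.
  exact: sg_wmeas.
have [M M1 hM] := sg_bound b.
apply: (@bounded_nrm _ _ _ _ _ mu _ _ _ (M * hnorm x)) => //; last exact: lebesgue_itv_fin.
by move=> s /=; rewrite in_itv/= => /andP[s0 sb]; apply: hM; rewrite sb (le_trans a0).
Qed.

Lemma sg_intP h x : tint 0 h (S^~ x) (sg_int h x).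
Proof.
have [v hv] := sg_int_ex h x (lexx 0); rewrite /sg_int (bint_bochnerE hV sV _ _ hv)//.
exact: lebesgue_itv_fin.
Qed.

Lemma sg_int_norm T M h x : (forall t x, 0 <= t <= T -> hnorm (S t x) <= M * hnorm x) ->
  0 <= M -> 0 <= h <= T -> hnorm (sg_int h x) <= M * h * hnorm x.
Proof.
move=> hM M0 /andP[h0 hT].
have := @tint_norm_le _ _ _ hV sV 0 h _ _ (M * hnorm x) h0 _ (sg_intP h x).
rewrite subr0 mulrAC; apply; first by rewrite mulr_ge0// hnorm_ge0.
by move=> s /andP[s0 sh]; rewrite hM// s0 (le_trans sh).
Qed.

Lemma sg_int_bop h : 0 <= h -> bounded_op (sg_int h).
Proof.
move=> h0; have [M M1 hM] := sg_bound h.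
apply: (bounded_opP (C := M * h)) => // [c x y|x]; last first.
  by apply: sg_int_norm hM _ _; rewrite ?h0 ?lexx// (le_trans ler01).
apply: (tint_uniq hV (sg_intP h _)).
apply: eq_tint (tintD hV sV (tintZ hV sV c (sg_intP h x)) (sg_intP h y)) => s /andP[s0 _].
by rewrite (bopP (sg_bop s0)).
Qed.

Lemma sg_int_shift h t x : 0 <= h -> 0 <= t -> sg_int h (S t x) = sg_int (t + h) x - sg_int t x.
Proof.
move=> h0 t0; have [v hv] := sg_int_ex (h + t) x t0.
have e1 : sg_int h (S t x) = v.
  apply: (tint_uniq hV (sg_intP h _)).
  have := @tint_shift _ _ _ hV sV 0 h t (S^~ x) v; rewrite add0r => /(_ hv).
  by apply: eq_tint => s /andP[s0 _]; rewrite sgD.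
rewrite e1 [t + h]addrC; apply/eqP; rewrite eq_sym subr_eq addrC; apply/eqP.
rewrite [h + t]addrC in hv; rewrite [v + _]addrC.
apply: (tint_uniq hV (sg_intP _ _)); apply: (tint_split hV sV t0 _ _ (sg_intP t x) hv).
  by rewrite lerDl.
exact: sg_wmeas.
Qed.

Lemma sg_intC h t x : 0 <= h -> 0 <= t -> S t (sg_int h x) = sg_int h (S t x).
Proof.
move=> h0 t0; apply: (tint_uniq hV _ (sg_intP h _)).
have := tint_bop hV sV hV (sg_bop t0) (sg_intP h x).
by apply: eq_tint => s /andP[s0 _]; rewrite sgC.
Qed.

Lemma tint_cst a b x : a <= b -> tint a b (fun=> x) (ofR (b - a) *: x).
Proof.
move=> ab; split; first exact: wmeas_cst.
  apply: (@bounded_nrm _ _ _ _ _ mu _ _ _ (hnorm x)) => //.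
  exact: lebesgue_itv_fin.
move=> w; rewrite ripZl// Rintegral_cst// mulrC; congr (_ * _).
exact/esym/(congr1 fine (lebesgue_itv_len ab)).
Qed.

Lemma sg_int_near h x e : 0 <= h -> 0 <= e ->
  (forall s, 0 <= s <= h -> hnorm (S s x - x) <= e) ->
  hnorm (sg_int h x - ofR h *: x) <= e * h.
Proof.
move=> h0 e0 he; have := tint_cst x h0; rewrite subr0 => hc.
have := tintB hV sV (sg_intP h x) hc.
by move=> /(tint_norm_le hV sV h0 e0); rewrite subr0; apply.
Qed.

Lemma sg_int_rlim x : rlim (fun t => ofR t^-1 *: sg_int t x) x.
Proof.
apply/rlimP => e e0; have [dl dl0 hdl] := sg_cont0 x (divr_gt0 e0 (ltr0n R 2)).
exists dl => // t t0 td.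
have -> : ofR t^-1 *: sg_int t x - x = ofR t^-1 *: (sg_int t x - ofR t *: x).
  by rewrite scalerBr scalerA -ofRM mulVf ?gt_eqF// ofR1 scale1r.
rewrite hnormZR// ger0_norm ?invr_ge0 ?(ltW t0)// mulrC.
have := @sg_int_near t x (e / 2) (ltW t0) (ltW (divr_gt0 e0 (ltr0n R 2))).
move=> /(_ _) h; rewrite ltr_pdivrMr//; apply: le_lt_trans (h _) _.
  by move=> s /andP[s0 st]; apply: ltW; apply: hdl => //; rewrite (le_lt_trans st).
by rewrite ltr_pM2r// ltr_pdivrMr// ltr_pMr// ltr1n.
Qed.

End Semigroup.

Opaque sg_int.

Section Generator.
Context {R : realType} {k : scalar_kind} (V : ipSpace R k).
Context (hV : hilbert V) (sV : hseparable V).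
Context (A : unbounded V V) (S : R -> V -> V) (gAS : generates A S).
Local Notation mu := (@lebesgue_measure R).
Local Notation tint a b f v := (bint mu `[a, b]%classic (f : R -> V) v).
Implicit Types (s t h : R) (x y : V).

Let hS : C0_semigroup S := proj1 gAS.
Local Notation Phi := (sg_int S).

Definition sg_diff (S : R -> V -> V) t x : V := ofR t^-1 *: (S t x - x).
Local Notation dq := (sg_diff S).

Lemma genP x y : (udom A x /\ A x = y) <-> rlim (dq^~ x) y.
Proof. exact: (proj2 gAS). Qed.

Lemma gen_rlim x : udom A x -> rlim (dq^~ x) (A x).
Proof. by move=> Dx; apply/genP. Qed.

Let rlimB (f g : R -> V) l l' : rlim f l -> rlim g l' -> rlim (fun t => f t - g t) (l - l').
Proof.
move=> hf hg; apply: rlimD => //; move: hg => /rlimP hg; apply/rlimP => e e0.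
have [dl dl0 h] := hg e e0; exists dl => // t t0 td.
by rewrite -opprD hnormN// h.
Qed.

(** (S(h) - I) Phi(t) x = Phi(t+h) x - Phi(h) x - Phi(t) x is symmetric in h and t. The quotient of
    Phi(h) x at t is therefore S(h) - I applied to Phi(t) x / t, and the latter tends to x. *)
Lemma gen_int h x : 0 <= h -> udom A (Phi h x) /\ A (Phi h x) = S h x - x.
Proof.
move=> h0; apply/genP.
have h1 := sg_int_rlim hV sV hS x.
apply: eq_rlim (rlimB (rlim_bop hV (sg_bop hS h0) h1) h1) => t t0.
have key : S h (Phi t x) - Phi t x = S t (Phi h x) - Phi h x.
  have t0' := ltW t0.
  rewrite (sg_intC hV sV hS x t0' h0) (sg_intC hV sV hS x h0 t0').
  rewrite (sg_int_shift hV sV hS x t0' h0) (sg_int_shift hV sV hS x h0 t0').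
  by rewrite [h + t]addrC; move: (Phi (t + h) x) (Phi t x) (Phi h x) => a b c; rewrite addrAC.
rewrite (bopZ (sg_bop hS h0) (ofR t^-1) (Phi t x)) /sg_diff -key.
by rewrite scalerBr.
Qed.

Lemma sg_int_diff h t x : 0 <= h -> 0 < t -> Phi h (dq t x) = dq t (Phi h x).
Proof.
move=> h0 t0; rewrite /sg_diff (bopZ (sg_int_bop hV sV hS h0)) (bopB (sg_int_bop hV sV hS h0)).
by rewrite (sg_intC hV sV hS) ?(ltW t0).
Qed.

(** Both sides are the limit of Phi(h) applied to the quotients of x: boundedness of Phi(h) gives
    one limit, commutation followed by [gen_int] the other. *)
Lemma sg_int_gen h x : 0 <= h -> udom A x -> Phi h (A x) = S h x - x.
Proof.
move=> h0 Dx; apply: (rlim_uniq hV (f := fun t => Phi h (dq t x))).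
  exact: (rlim_bop hV (sg_int_bop hV sV hS h0) (gen_rlim Dx)).
have [D1 <-] := gen_int x h0; apply: eq_rlim (gen_rlim D1) => t t0.
by rewrite sg_int_diff.
Qed.

(** The converse of [sg_int_gen]. It expresses A x = y by bounded operators only, so linearity,
    closedness and commutation with integrals follow by passing to the limit or applying linearity
    on both sides. *)
Lemma gen_crit x y (dl : R) : 0 < dl ->
  (forall h, 0 < h -> h < dl -> S h x - x = Phi h y) -> udom A x /\ A x = y.
Proof.
move=> dl0 hd; apply/genP/rlimP => e e0.
have /rlimP/(_ e e0) [d1 d10 h1] := sg_int_rlim hV sV hS y.
exists (Num.min dl d1); first by rewrite lt_min dl0.
move=> t t0; rewrite lt_min => /andP[t1 t2].
by rewrite /sg_diff hd//; exact: h1.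
Qed.

Lemma gen_S t x : 0 <= t -> udom A x -> udom A (S t x) /\ A (S t x) = S t (A x).
Proof.
move=> t0 Dx; apply: (gen_crit ltr01) => h h0 _.
by rewrite -(sg_intC hV sV hS) ?(ltW h0)// sg_int_gen ?(ltW h0)// (bopB (sg_bop hS t0)) (sgC hS) ?(ltW h0).
Qed.

Lemma gen_closed (u : nat -> V) x y : (forall i, udom A (u i)) -> hlim u x ->
  hlim (fun i => A (u i)) y -> udom A x /\ A x = y.
Proof.
move=> Du ux uy; apply: (gen_crit ltr01) => h /ltW h0 _.
apply: (hlim_uniq hV (u := fun i => S h (u i) - u i)).
  exact: hlimB (hlim_bounded hV hV (sg_bop hS h0) ux) ux.
have := hlim_bounded hV hV (sg_int_bop hV sV hS h0) uy.
by rewrite (_ : _ \o _ = fun i => S h (u i) - u i)//; apply/funext => i /=; rewrite sg_int_gen.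
Qed.

Lemma gen_lin (c : scal R k) x y : udom A x -> udom A y ->
  udom A (c *: x + y) /\ A (c *: x + y) = c *: A x + A y.
Proof.
move=> Dx Dy; apply: (gen_crit ltr01) => h /ltW h0 _.
rewrite (bopP (sg_int_bop hV sV hS h0)) !sg_int_gen// (bopP (sg_bop hS h0)).
by rewrite scalerBr opprD addrACA.
Qed.

Lemma gen0 : udom A 0 /\ A 0 = 0.
Proof.
apply: (gen_crit ltr01) => h /ltW h0 _.
by rewrite (bop0 (sg_bop hS h0)) (bop0 (sg_int_bop hV sV hS h0)) subrr.
Qed.

Lemma genZ (c : scal R k) x : udom A x -> udom A (c *: x) /\ A (c *: x) = c *: A x.
Proof.
move=> Dx; have [D0 A0] := gen0; have := gen_lin c Dx D0.
by rewrite addr0 A0 addr0.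
Qed.

Lemma genD x y : udom A x -> udom A y -> udom A (x + y) /\ A (x + y) = A x + A y.
Proof. by move=> Dx Dy; have := gen_lin 1 Dx Dy; rewrite !scale1r. Qed.

Lemma genB x y : udom A x -> udom A y -> udom A (x - y) /\ A (x - y) = A x - A y.
Proof.
move=> Dx Dy; have := gen_lin (-1) Dy Dx; rewrite !scaleN1r ![- _ + _]addrC.
by [].
Qed.

Lemma sg_diffE h x : 0 < h -> udom A x -> dq h x = ofR h^-1 *: Phi h (A x).
Proof. by move=> h0 Dx; rewrite sg_int_gen// ltW. Qed.

(** Convergence of the quotients along one null sequence suffices: Phi(t) applied to them tends to
    Phi(t) y, and, as quotients of Phi(t) x in the domain, to S(t) x - x. *)
Lemma gen_seq (h : nat -> R) x y : (forall n, 0 < h n) -> h n @[n --> \oo] --> (0 : R) ->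
  hlim (fun n => dq (h n) x) y -> udom A x /\ A x = y.
Proof.
move=> h0 hc hx; apply: (gen_crit ltr01) => t /ltW t0 _.
apply: (hlim_uniq hV (u := fun n => Phi t (dq (h n) x))); last first.
  exact: hlim_bounded hV hV (sg_int_bop hV sV hS t0) hx.
have [D1 e1] := gen_int x t0; rewrite -e1.
have := rlim_hlim h0 hc (gen_rlim D1).
by rewrite (_ : (fun n => _) = (fun n => Phi t (dq (h n) x)))//; apply/funext => n; rewrite sg_int_diff.
Qed.

Lemma gen_tint a b x : 0 <= a -> a <= b -> udom A x ->
  tint a b (fun s => S s (A x)) (S b x - S a x).
Proof.
move=> a0 ab Dx; have [v hv] := sg_int_ex hV sV hS b (A x) a0.
rewrite (_ : S b x - S a x = v)//.
have b0 := le_trans a0 ab.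
have e : sg_int S b (A x) = sg_int S a (A x) + v.
  apply: (tint_uniq hV (sg_intP hV sV hS _ _)).
  apply: (tint_split hV sV a0 ab _ (sg_intP hV sV hS a (A x)) hv).
  exact: (sg_wmeas hV hS).
apply: (addrI (sg_int S a (A x))); rewrite -e !sg_int_gen//.
by rewrite addrC addrA subrK.
Qed.

Lemma gen_dense x e : 0 < e -> exists2 x', udom A x' & hnorm (x' - x) < e.
Proof.
move=> e0; have /rlimP/(_ e e0) [dl dl0 h] := sg_int_rlim hV sV hS x.
have d20 : 0 < dl / 2 by rewrite divr_gt0.
exists (ofR (dl / 2)^-1 *: Phi (dl / 2) x).
  by case: (genZ (ofR (dl / 2)^-1) (proj1 (gen_int x (ltW d20)))).
by apply: h => //; rewrite ltr_pdivrMr// ltr_pMr// ltr1n.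
Qed.

Lemma resolventP l : resolvent_set A l -> is_resolvent A l (resolvent A l).
Proof. by move=> [Rl hRl]; rewrite /resolvent; case: xgetP => [? -> //|/(_ Rl)]. Qed.

Lemma resolvent_uniq l R1 R2 x : is_resolvent A l R1 -> is_resolvent A l R2 -> R1 x = R2 x.
Proof.
by move=> [_ h1 _] [_ _ h2]; have [D1 e1] := h1 x; rewrite -[in RHS]e1 h2.
Qed.

End Generator.

(** * Rescaled semigroups, resolvents and Yosida approximation *)

Section Rescaling.
Context {R : realType} {k : scalar_kind} (V : ipSpace R k) (hV : hilbert V).
Implicit Types (s t h l : R) (x y : V).

(** The upper bound inverts exp(-z) >= 1 - z and expands 1/(1-z) for |z| <= 1/2. *)
Lemma expR_quad (z : R) : `|z| <= 2^-1 -> 0 <= expR z - 1 - z <= 2 * z ^+ 2.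
Proof.
rewrite ler_norml => /andP[z1 z2]; apply/andP; split.
  by have := expR_ge1Dx z; lra.
have h1 : expR z <= (1 - z)^-1.
  rewrite -[z in expR z]opprK expRN lef_pV2 ?posrE ?expR_gt0//; last by lra.
  exact: expR_ge1Dx.
have h2 : (1 - z)^-1 <= 1 + z + 2 * z ^+ 2.
  rewrite -[leLHS]mul1r ler_pdivrMr; last by lra.
  have : 0 <= z ^+ 2 * (1 - 2 * z) by rewrite mulr_ge0 ?sqr_ge0//; lra.
  by rewrite !expr2; nra.
lra.
Qed.

Lemma rlim_scale (c : R -> R) (c0 : R) (f : R -> V) (v : V) :
  (forall e, 0 < e -> exists2 dl, 0 < dl & forall t, 0 < t -> t < dl -> `|c t - c0| < e) ->
  rlim f v -> rlim (fun t => ofR (c t) *: f t) (ofR c0 *: v).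
Proof.
move=> hc /rlimP hf; apply/rlimP => e e0.
have v1 : 0 < 2 * (hnorm v + 1) by rewrite mulr_gt0// ltr_wpDl ?hnorm_ge0.
have c1 : 0 < 2 * (`|c0| + 1) by rewrite mulr_gt0// ltr_wpDl.
have [d1 d10 h1] := hc 1 ltr01; have [d2 d20 h2] := hc _ (divr_gt0 e0 v1).
have [d3 d30 h3] := hf _ (divr_gt0 e0 c1).
exists (Num.min d1 (Num.min d2 d3)); first by rewrite !lt_min d10 d20.
move=> t t0; rewrite !lt_min => /and3P[t1 t2 t3].
have -> : ofR (c t) *: f t - ofR c0 *: v = ofR (c t) *: (f t - v) + ofR (c t - c0) *: v.
  by rewrite scalerBr ofRB scalerBl addrA subrK.
apply: le_lt_trans (hnormD hV _ _) _; rewrite !hnormZR//.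
have ct : `|c t| <= `|c0| + 1.
  rewrite -[c t](subrK c0); apply: le_trans (ler_normD _ _) _.
  by rewrite addrC lerD// ltW// h1.
have e2 : `|c t - c0| * hnorm v <= e / 2.
  apply: le_trans (_ : e / (2 * (hnorm v + 1)) * (hnorm v + 1) <= _).
    by apply: ler_pM => //; rewrite ?hnorm_ge0 ?ltW ?h2// ltrDl.
  by rewrite invfM mulrA -mulrA mulVf ?mulr1// gt_eqF// ltr_wpDl ?hnorm_ge0.
have e3 : `|c t| * hnorm (f t - v) < e / 2.
  apply: le_lt_trans (_ : (`|c0| + 1) * hnorm (f t - v) < _).
    by rewrite ler_wpM2r ?hnorm_ge0.
  rewrite mulrC -ltr_pdivlMr ?ltr_wpDl//; apply: lt_le_trans (h3 t t0 t3) _.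
  by rewrite invfM mulrA.
by rewrite [ltRHS]splitr ltr_leD.
Qed.

Variables (S : R -> V -> V).

Definition rescaled l t x : V := ofR (expR (- l * t)) *: S t x.

Let exp_near l e : 0 < e -> exists2 dl, 0 < dl & forall t, 0 < t -> t < dl ->
  `|(expR (- l * t) - 1) / t - - l| < e.
Proof.
move=> e0; have l1 : 0 < 2 * (`|l| + 1) by rewrite mulr_gt0// ltr_wpDl.
have l2 : 0 < 2 * (l ^+ 2 + 1) by rewrite mulr_gt0// ltr_wpDl ?sqr_ge0.
exists (Num.min (1 / (2 * (`|l| + 1))) (e / (2 * (l ^+ 2 + 1)))).
  by rewrite lt_min !divr_gt0.
move=> t t0; rewrite lt_min => /andP[]; rewrite !ltr_pdivlMr// => t1 t2.
have /expR_quad/andP[h1 h2] : `|- l * t| <= 2^-1.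
  rewrite normrM normrN [`|t|]gtr0_norm//.
  have := normr_ge0 l; set q := `|l| in t1 *; nra.
have -> : (expR (- l * t) - 1) / t - - l = (expR (- l * t) - 1 - - l * t) / t.
  by field; rewrite gt_eqF.
rewrite ger0_norm ?divr_ge0 ?(ltW t0)// ltr_pdivrMr//; apply: le_lt_trans h2 _.
have -> : 2 * (- l * t) ^+ 2 = t * (2 * l ^+ 2) * t by ring.
rewrite ltr_pM2r//; apply: le_lt_trans t2; rewrite ler_wpM2l ?(ltW t0)//.
by rewrite ler_pM2l// lerDl.
Qed.

Let exp_near1 l e : 0 < e -> exists2 dl, 0 < dl & forall t, 0 < t -> t < dl ->
  `|expR (- l * t) - 1| < e.
Proof.
move=> e0; have [dl dl0 h] := exp_near l ltr01.
have l1 : 0 < `|l| + 1 by rewrite ltr_wpDl.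
exists (Num.min dl (e / (`|l| + 1))); first by rewrite lt_min dl0 divr_gt0.
move=> t t0; rewrite lt_min ltr_pdivlMr// => /andP[t1 t2].
apply: le_lt_trans t2; rewrite -[X in `|X|](divfK (lt0r_neq0 t0)) normrM (gtr0_norm t0) mulrC.
rewrite ler_wpM2l ?(ltW t0)//; have {}h := ltW (h t t0 t1).
rewrite -[X in `|X|](subrK (- l)); apply: le_trans (ler_normD _ _) _.
by rewrite normrN addrC lerD2l.
Qed.

Lemma rescaled_rlim l x y : C0_semigroup S -> rlim ((sg_diff S)^~ x) y ->
  rlim ((sg_diff (rescaled l))^~ x) (y - ofR l *: x).
Proof.
move=> hS hy.
have h1 := rlim_scale (exp_near1 l) hy.
have h2 := rlim_scale (exp_near l) (rlim_cst hV x).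
rewrite ofR1 scale1r in h1; have := rlimD hV h1 h2.
rewrite ofRN scaleNr; apply: eq_rlim => t t0; rewrite /sg_diff /rescaled.
have -> : ofR (expR (- l * t)) *: S t x - x =
    ofR (expR (- l * t)) *: (S t x - x) + ofR (expR (- l * t) - 1) *: x.
  by rewrite scalerBr ofRB ofR1 scalerBl scale1r addrA subrK.
rewrite [in RHS]scalerDr; congr (_ + _).
  by rewrite !scalerA -!ofRM mulrC.
by rewrite scalerA -ofRM mulrC.
Qed.

Lemma rescaled_C0 l : C0_semigroup S -> C0_semigroup (rescaled l).
Proof.
move=> hS; split => [t t0|x|s t x s0 t0|x].
- exact: (bounded_opZ _ hV hV (sg_bop hS t0)).
- by rewrite /rescaled mulr0 expR0 ofR1 scale1r (sg0 hS).
- rewrite /rescaled (bopZ (sg_bop hS s0)) scalerA -ofRM -expRD -mulrDr.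
  by rewrite (sgD hS).
- have := rlim_scale (exp_near1 l) (sg_rlim hS x).
  by rewrite ofR1 scale1r.
Qed.

End Rescaling.

Section RescaledGenerator.
Context {R : realType} {k : scalar_kind} (V : ipSpace R k) (hV : hilbert V) (sV : hseparable V).

Lemma rescaledK (S : R -> V -> V) (l t : R) x : rescaled (rescaled S l) (- l) t x = S t x.
Proof. by rewrite /rescaled scalerA -ofRM -expRD opprK mulNr addrN expR0 ofR1 scale1r. Qed.

Context (A : unbounded V V) (S : R -> V -> V) (gAS : generates A S).
Let hS : C0_semigroup S := proj1 gAS.

Lemma rescaled_generates (l : R) :
  generates (Unbounded (udom A) (fun x => A x - ofR l *: x)) (rescaled S l).
Proof.
split; first exact: rescaled_C0.
move=> x y; split=> [[/= Dx <-]|hy].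
  exact: (rescaled_rlim hV l hS (gen_rlim gAS Dx)).
(* Rescaling back by -l recovers the original semigroup, which gives the converse implication. *)
have /= := rescaled_rlim hV (- l) (rescaled_C0 hV l hS) hy.
move=> /(@eq_rlim _ _ _ _ ((sg_diff S)^~ x)) h.
have /(genP gAS) [Dx ex] : rlim ((sg_diff S)^~ x) (y - ofR (- l) *: x).
  by apply: h => t t0; rewrite /sg_diff rescaledK.
by split => //; rewrite ex ofRN scaleNr opprK addrK.
Qed.

(* A fixed-point solution of (lambda - A) Phi(h) x = x - K x, with K the rescaled
   semigroup at time h = 2M/lambda, which is a contraction. *)
Lemma resolvent_large : exists l0 C : R, [/\ 0 < l0, 0 < C & forall l, l0 <= l ->
  exists Rl, is_resolvent A (ofR l) Rl /\ forall x, l * hnorm (Rl x) <= C * hnorm x].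
Proof.
have [M M1 hM] := sg_bound hV hS 1; have M0 := lt_le_trans ltr01 M1.
exists (2 * M), (4 * M ^+ 2); split; rewrite ?mulr_gt0 ?exprn_gt0// => l lM.
have l0 : 0 < l by rewrite (lt_le_trans _ lM)// mulr_gt0.
pose h := 2 * M / l; have h0 : 0 < h by rewrite divr_gt0// mulr_gt0.
have h1 : h <= 1 by rewrite ler_pdivrMr// mul1r.
have gl := rescaled_generates l; have hl := proj1 gl.
set Al := Unbounded _ _ in gl; set Sl := rescaled S l in gl hl.
have hMl t x : 0 <= t <= 1 -> hnorm (Sl t x) <= M * hnorm x.
  move=> t01; rewrite /Sl /rescaled hnormZR// ger0_norm ?expR_ge0//.
  rewrite -[leRHS]mul1r ler_pM ?expR_ge0 ?hnorm_ge0 ?hM//.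
  by rewrite -expR0 ler_expR mulNr oppr_le0 mulr_ge0 ?(ltW l0)//; case/andP: t01.
pose K := Sl h; have bK : bounded_op K := sg_bop hl (ltW h0).
have K2 x : hnorm (K x) <= 2^-1 * hnorm x.
  rewrite /K /Sl /rescaled hnormZR// ger0_norm ?expR_ge0//.
  have -> : - l * h = - (2 * M) by rewrite /h; field; rewrite gt_eqF.
  have h2 : expR (- (2 * M)) * M <= 2^-1.
    rewrite expRN mulrC ler_pdivrMr ?expR_gt0//.
    by have := expR_ge1Dx (2 * M); lra.
  apply: le_trans (_ : expR (- (2 * M)) * (M * hnorm x) <= _).
    by rewrite ler_wpM2l ?expR_ge0// hM// (ltW h0).
  by rewrite mulrA ler_wpM2r ?hnorm_ge0.
have K1 x : x - K x = 0 -> x = 0.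
  move=> /eqP; rewrite subr_eq0 => /eqP ex; apply: (hnorm_eq0 hV).
  by have := K2 x; rewrite -ex; have := hnorm_ge0 x; lra.
(* The Neumann iteration u -> y + K u. As K halves norms, the increments are geometric and ||x|| <=
   ||y|| + ||x|| / 2. *)
have solve y : exists x, x - K x = y /\ hnorm x <= 2 * hnorm y.
  pose fix u (i : nat) : V := if i is j.+1 then y + K (u j) else y.
  have us i : hnorm (u i.+1 - u i) <= hnorm (K y) * 2^-1 ^+ i.
    elim: i => [|i IH]; first by rewrite /= addrC addKr expr0 mulr1.
    rewrite /= opprD addrACA subrr add0r -(bopB bK); apply: le_trans (K2 _) _.
    by rewrite exprS mulrCA ler_pM2l.
  have [x ux] := geometric_cauchy hV us; exists x.
  have ex : x - K x = y.
    have uS : hlim (u \o succn) x by apply: hlim_sub ux => i /=.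
    have uS' : hlim (fun i => y + K (u i)) (y + K x).
      exact: (hlimD hV (hlim_cst hV y) (hlim_bounded hV hV bK ux)).
    by rewrite {1}(hlim_uniq hV uS uS') addrK.
  split => //; have := K2 x; have := hnormD hV (x - K x) (K x); rewrite subrK ex; lra.
have /choice[N hN] := solve; have NP y : N y - K (N y) = y by case: (hN y).
have gi x := gen_int hV sV gl x (ltW h0).
pose Rl x := sg_int Sl h (N x).
have Rl1 x : udom A (Rl x) /\ ofR l *: Rl x - A (Rl x) = x.
  have [/= D1 e1] := gi (N x); split => //.
  by rewrite -opprB e1 opprB NP.
(* Injectivity of l - A, because Phi(h) of the rescaled semigroup sends (A - l) x to K x - x. It
   upgrades the right inverse to a two-sided one. *)
have Rinj x : udom A x -> ofR l *: x - A x = 0 -> x = 0.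
  move=> Dx ex; apply: K1; have /= e1 := sg_int_gen hV sV gl (ltW h0) (Dx : udom Al x).
  rewrite -opprB /K -e1 -opprB ex oppr0 (bop0 (sg_int_bop hV sV hl (ltW h0))) oppr0//.
have sub4 (a1 a2 a3 a4 : V) : a1 - a2 - (a3 - a4) = a1 - a3 - (a2 - a4).
  by rewrite !opprB addrACA [- a2 - a3]addrC -addrACA.
have Nlin (c : scal R k) x y : N (c *: x + y) = c *: N x + N y.
  apply/eqP; rewrite -subr_eq0; apply/eqP/K1; rewrite (bopB bK) (bopP bK).
  have e1 := NP (c *: x + y).
  have e2 : c *: N x + N y - (c *: K (N x) + K (N y)) = c *: x + y.
    by rewrite opprD addrACA -scalerBr !NP.
  by rewrite sub4 e1 e2 subrr.
have Rbd x : l * hnorm (Rl x) <= 4 * M ^+ 2 * hnorm x.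
  have := sg_int_norm hV sV hl (N x) hMl (ltW M0) (_ : 0 <= h <= 1); rewrite (ltW h0) h1.
  move=> /(_ isT) b1; have [_ b2] := hN x.
  apply: le_trans (_ : l * (M * h * (2 * hnorm x)) <= _).
    rewrite ler_pM2l//; apply: le_trans b1 _; rewrite ler_wpM2l// mulr_ge0// ltW//.
  by rewrite le_eqVlt; apply/orP; left; apply/eqP; rewrite /h; field; rewrite gt_eqF.
have bR : bounded_op Rl.
  apply: (bounded_opP (C := 4 * M ^+ 2 / l)) => // [c x y|x].
    by rewrite /Rl Nlin (bopP (sg_int_bop hV sV hl (ltW h0))).
  by rewrite mulrAC ler_pdivlMr// mulrC.
exists Rl; split => //; split => // x Dx.
apply/eqP; rewrite -subr_eq0; apply/eqP.
have [D1 e1] := Rl1 (ofR l *: x - A x).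
have [D2 e2] := genB hV sV gAS D1 Dx; apply: Rinj => //.
by rewrite e2 scalerBr sub4 e1 subrr.
Qed.

(** For x' in the domain, l R(l) x' - x' = R(l) A x' is O(1/l); density and the uniform bound C on l
    R(l) extend the convergence to every x. *)
Lemma yosida_cvg x (e : R) : 0 < e -> exists l1, forall l, l1 <= l ->
  resolvent_set A (ofR l) /\ hnorm (ofR l *: resolvent A (ofR l) x - x) < e.
Proof.
move=> e0; have [l0 [C [l00 C0 hR]]] := resolvent_large.
have C1 : 0 < C + 1 by rewrite addr_gt0.
have e3 : 0 < e / 2 / (C + 1) by rewrite !divr_gt0.
have [x' Dx' hx'] := gen_dense hV sV gAS x e3.
(* The second summand makes C ||A x'|| / l smaller than e / 2; the approximation error (C + 1) ||x'
   - x|| takes the other half. *)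
exists (l0 + 2 * (C * hnorm (A x') + 1) / e) => l hl.
have q0 : 0 < C * hnorm (A x') + 1 by rewrite ltr_wpDl// mulr_ge0 ?hnorm_ge0// ltW.
have l0l : l0 <= l by rewrite (le_trans _ hl)// lerDl divr_ge0 ?mulr_ge0 ?(ltW e0) ?(ltW q0).
have lp : 0 < l := lt_le_trans l00 l0l.
have [Rl [hRl bRl]] := hR l l0l.
have rs : resolvent_set A (ofR l) by exists Rl.
split => //; have hr := resolventP rs.
have rE y : resolvent A (ofR l) y = Rl y := resolvent_uniq y hr hRl.
rewrite rE; have [bop _ R3] := hRl.
have e1 : ofR l *: Rl x' - x' = Rl (A x').
  have := R3 x' Dx'; rewrite (bopB bop) (bopZ bop) => {2}<-.
  by rewrite opprB addrC subrK.
have -> : ofR l *: Rl x - x = ofR l *: Rl (x - x') + (Rl (A x') + (x' - x)).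
  rewrite (bopB bop) scalerBr -e1; move: (ofR l *: Rl x) (ofR l *: Rl x') => p q.
  by rewrite [q - x' + _]addrA subrK addrA subrK.
apply: le_lt_trans (hnormD hV _ _) _.
have b1 : hnorm (ofR l *: Rl (x - x')) <= C * hnorm (x' - x).
  by rewrite hnormZR// gtr0_norm// hnormBC// bRl.
have b2 : hnorm (Rl (A x')) < e / 2.
  have := bRl (A x'); rewrite mulrC -ler_pdivlMr// => h; apply: le_lt_trans h _.
  rewrite ltr_pdivrMr// mulrAC ltr_pdivlMr//; apply: lt_le_trans (_ : 2 * (C * hnorm (A x') + 1) <= _).
    by rewrite mulrC ltr_pM2l// ltrDl.
  by rewrite [e * l]mulrC -ler_pdivrMr//; apply: le_trans hl; rewrite lerDr ltW.
have b3 : (C + 1) * hnorm (x' - x) < e / 2 by rewrite mulrC -ltr_pdivlMr.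
have := hnormD hV (Rl (A x')) (x' - x); lra.
Qed.

End RescaledGenerator.

(** * The extended semigroup and its generator *)

Section ExtendedSemigroup.
Context {R : realType} {k : scalar_kind} (X : ipSpace R k) (m : nat).
Context (hX : hilbert X) (sX : hseparable X).
Local Notation U := (euclid k m : ipSpace R k).
Local Notation Xe := (prod_ip U X).
Context (cA : unbounded X X) (cB : unbounded X U) (B : U -> X) (S : R -> X -> X).
Local Notation A := (restricted_operator cA cB).
Context (gAS : generates A S) (bAB : bounded_op (fun u : U => cA (B u))).
Local Notation Te := (ext_semigroup cA B S).
Local Notation Ae := (ext_operator cA cB B).
Let hS : C0_semigroup S := proj1 gAS.
Let hU : hilbert U := euclid_hilbert m.
Let hXe : hilbert Xe := prod_hilbert hU hX.
Local Notation Phi := (sg_int S).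

(** The substitution s -> t - s identifies the off-diagonal block with Phi(t) applied to cA B. *)
Lemma ext_semigroupE t (x : Xe) : 0 <= t -> Te t x = (x.1, Phi t (cA (B x.1)) + S t x.2).
Proof.
move=> t0; have h : bint (@lebesgue_measure R) `[0, t]%classic
    ((fun s => S (t - s) (cA (B x.1))) : R -> X) (Phi t (cA (B x.1))).
  apply: (tint_refl hX sX (f := S^~ (cA (B x.1)))).
  by rewrite subrr subr0; exact: sg_intP.
rewrite /ext_semigroup (bint_bochnerE hX sX (measurable_cc _ _) _ h)//.
exact: lebesgue_itv_fin.
Qed.

Lemma ext_bop t : 0 <= t -> bounded_op (Te t).
Proof.
move=> t0; have bP := sg_int_bop hX sX hS t0; have bS := sg_bop hS t0.
have [C1 C10 h1] := bop_bound bP; have [C2 C20 h2] := bop_bound bAB.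
have [C3 C30 h3] := bop_bound bS.
apply: (bounded_opP (C := 1 + C1 * C2 + C3)) => // [c x y|x].
  rewrite !ext_semigroupE//=; apply/pair_equal_spec; split => //=.
  rewrite (bopP bS) (bopP bAB) (bopP bP).
  move: (Phi t _) (Phi t _) (S t _) (S t _) => p1 p2 p3 p4.
  by rewrite scalerDr addrACA.
rewrite ext_semigroupE//; apply: le_trans (prod_hnorm_le hU hX _) _ => /=.
have n1 := prod_hnorm_fst hU hX x; have n2 := prod_hnorm_snd hU hX x.
rewrite mulrDl mulrDl mul1r -addrA lerD//; apply: le_trans (hnormD hX _ _) _.
rewrite lerD//.
  apply: le_trans (h1 _) _; rewrite -mulrA ler_pM2l//; apply: le_trans (h2 _) _.
  by rewrite ler_pM2l.
by apply: le_trans (h3 _) _; rewrite ler_pM2l.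
Qed.

Lemma prod_rlim (f : R -> Xe) (l : Xe) :
  rlim f l <-> rlim (fun t => (f t).1) l.1 /\ rlim (fun t => (f t).2) l.2.
Proof.
split=> [/rlimP h|[/rlimP h1 /rlimP h2]].
  split; apply/rlimP => e e0; have [dl dl0 hd] := h e e0; exists dl => // t t0 td.
    apply: le_lt_trans (hd t t0 td); exact: (prod_hnorm_fst hU hX (f t - l)).
  apply: le_lt_trans (hd t t0 td); exact: (prod_hnorm_snd hU hX (f t - l)).
apply/rlimP => e e0; have e20 : 0 < e / 2 by rewrite divr_gt0.
have [d1 d10 k1] := h1 _ e20; have [d2 d20 k2] := h2 _ e20.
exists (Num.min d1 d2); first by rewrite lt_min d10.
move=> t t0; rewrite lt_min => /andP[t1 t2].
apply: le_lt_trans (prod_hnorm_le hU hX _) _.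
by rewrite [ltRHS]splitr ltrD// ?k1 ?k2.
Qed.

Lemma ext_C0 : C0_semigroup Te.
Proof.
split => [|x|s t x s0 t0|x]; first exact: ext_bop.
- rewrite ext_semigroupE// (sg0 hS).
  have h := sg_intP hX sX hS 0 (cA (B x.1)).
  rewrite (tint_uniq hX h (tint_nil hX sX (lexx 0) _)) ?add0r; first by case: x {h}.
  exact: (sg_wmeas hX hS).
- rewrite !ext_semigroupE ?addr_ge0//=; congr (_, _).
  rewrite (sgD hS x.2 s0 t0) (bopD (sg_bop hS s0)).
  rewrite (sg_intC hX sX hS _ t0 s0) (sg_int_shift hX sX hS _ t0 s0).
  move: (Phi (s + t) _) (Phi s _) (S s _) => p1 p2 p3.
  by rewrite addrA [p2 + _]addrC subrK.
- apply/prod_rlim; split.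
    exact: (rlim_cst hU).
  apply: (eq_rlim (f := fun t => ofR t *: (ofR t^-1 *: Phi t (cA (B x.1))) + S t x.2)) => [t t0|].
    by rewrite ext_semigroupE ?(ltW t0)//= scalerA -ofRM divff ?gt_eqF// ofR1 scale1r.
  have h0 : rlim (fun t => ofR t *: (ofR t^-1 *: Phi t (cA (B x.1)))) (ofR 0 *: cA (B x.1)).
    apply: (rlim_scale hX (c := fun t => t)); last exact: sg_int_rlim.
    by move=> e e0; exists e => // t t0 te; rewrite subr0 gtr0_norm.
  by have := rlimD hX h0 (sg_rlim hS x.2); rewrite ofR0 scale0r add0r.
Qed.

(** The first component of a difference quotient is 0. The second is the mean of the semigroup at cA
    B x.1, which always converges, plus the quotient of x.2; hence it converges exactly when x.2
    lies in D(A). *)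
Lemma ext_generates : generates Ae Te.
Proof.
split; first exact: ext_C0.
move=> x y; have h2 := sg_int_rlim hX sX hS (cA (B x.1)).
have eq1 t : 0 < t -> (ofR t^-1 *: (Te t x - x) : Xe).1 = 0.
  by move=> t0; rewrite ext_semigroupE ?(ltW t0)//= subrr scaler0.
have eq2 t : 0 < t -> (ofR t^-1 *: (Te t x - x) : Xe).2 =
    ofR t^-1 *: Phi t (cA (B x.1)) + sg_diff S t x.2.
  move=> t0; rewrite ext_semigroupE ?(ltW t0)//= /sg_diff.
  by rewrite -addrA scalerDr.
split=> [[/= Dx <-]|].
  apply/prod_rlim; split.
    by apply: (eq_rlim (f := fun=> 0)) (rlim_cst hU 0) => t t0; rewrite -(eq1 t t0).
  apply: (eq_rlim (f := fun t => ofR t^-1 *: Phi t (cA (B x.1)) + sg_diff S t x.2)) => [t t0|].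
    by rewrite -eq2.
  apply: (rlimD hX) h2 _.
  exact: (gen_rlim gAS Dx).
move/prod_rlim => [h1 h3].
have y1 : y.1 = 0.
  apply: (rlim_uniq hU h1).
  by apply: (eq_rlim (f := fun=> 0)) (rlim_cst hU 0) => t t0; rewrite -(eq1 t t0).
have h4 : rlim ((sg_diff S)^~ x.2) (y.2 - cA (B x.1)).
  apply: (eq_rlim (f := fun t => (ofR t^-1 *: (Te t x - x) : Xe).2 +
     (-1) *: (ofR t^-1 *: Phi t (cA (B x.1))))) => [t t0|].
    by rewrite eq2// scaleN1r addrAC subrr add0r.
  rewrite -(scaleN1r (cA (B x.1))); exact: (rlimD hX h3 (rlimZ hX (-1) h2)).
have [/= Dx e2] := (genP gAS _ _).2 h4; split => //.
by rewrite /= e2 addrC subrK -y1; case: (y).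
Qed.

End ExtendedSemigroup.

(** * Moments and independence *)

Section Density.
Context {R : realType} d (T : measurableType d).
Context (mu nu : {measure set T -> \bar R}) (p : T -> R).
Hypothesis mp : measurable_fun setT p.
Hypothesis p0 : forall x, 0 <= p x.
Hypothesis nuE : forall A, measurable A -> nu A = (\int[mu]_(x in A) (p x)%:E)%E.

(** Each simple function below f is split into its level sets, on which the density formula holds by
    assumption. The inequality serves to bound Gaussian second moments. *)
Lemma integral_density_le (f : T -> R) : measurable_fun setT f -> (forall x, 0 <= f x) ->
  (\int[nu]_x (f x)%:E <= \int[mu]_x (f x * p x)%:E)%E.
Proof.
move=> mf f0; rewrite ge0_integralTE; last by move=> x; rewrite lee_fin.
apply: ge_ereal_sup => _ [h hf <-].
have -> : sintegral nu h = (\int[nu]_x (h x)%:E)%E.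
  by rewrite integral_nnsfun// patch_setT.
apply: (@le_trans _ _ (\int[mu]_x (h x * p x)%:E)%E); last first.
  apply: nonneg_le_integral => x _; rewrite lee_fin; first by rewrite mulr_ge0// fun_ge0.
  by rewrite ler_wpM2r// -lee_fin.
have mh k : measurable (h @^-1` [set k]) by exact: measurable_funPTI.
rewrite le_eqVlt; apply/orP; left; apply/eqP.
transitivity (\sum_(k \in range h) k%:E * nu (h @^-1` [set k]))%E.
  by rewrite integral_nnsfun// patch_setT sintegralE.
have piece k : (k%:E * nu (h @^-1` [set k]) =
    \int[mu]_x ((k * \1_(h @^-1` [set k]) x)%:E * (p x)%:E))%E.
  (* The level sets of a nonnegative function at negative values are empty. *)
  case: (ltP k 0) => k0.
    rewrite preimage_nnfun0// measure0 mule0 integral0_eq// => x _.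
    by rewrite indicE in_set0 mulr0 mul0e.
  rewrite nuE// integral_mkcond -ge0_integralZl_EFin//; last 2 first.
  - by move=> x _; rewrite patchE; case: ifPn => // _; rewrite lee_fin.
  - apply/(measurable_restrictT _ _).1 => //.
    by apply: measurable_funTS; exact/measurable_EFinP.
  apply: eq_integral => x _; rewrite patchE indicE; case: ifPn => _.
    by rewrite mulr1.
  by rewrite mule0 mulr0 mul0e.
transitivity (\int[mu]_x \sum_(k \in range h) ((k * \1_(h @^-1` [set k]) x)%:E * (p x)%:E))%E.
  rewrite ge0_integral_fsum//.
  - by apply: eq_fsbigr => k _; exact: piece.
  - move=> k; apply: emeasurable_funM; apply/measurable_EFinP => //.
    by apply: measurable_funM.
  - move=> k x _; rewrite mule_ge0 ?lee_fin// -lee_fin EFinM; exact: nnfun_muleindic_ge0.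
apply: eq_integral => x _; rewrite EFinM fimfunE -fsumEFin// ge0_mule_fsuml//.
by move=> k; rewrite EFinM; exact: nnfun_muleindic_ge0.
Qed.

End Density.

Section GaussianMoments.
Context {R : realType} d (Om : measurableType d) (P : probability Om R).
Local Notation mu := (@lebesgue_measure R).

(** With z = x^2 / (4 s^2), the bound z exp(-z) <= 1 absorbs the factor x^2 at the price of doubling
    the variance, so the second moment is dominated by a multiple of a probability density. *)
Lemma normal_pdf_sqr_le (s x : R) : s != 0 ->
  x ^+ 2 * normal_pdf 0 s x <= 4 * s ^+ 2 * normal_peak s / normal_peak (Num.sqrt 2 * s) *
     normal_pdf 0 (Num.sqrt 2 * s) x.
Proof.
move=> s0; have s20 : Num.sqrt 2 * s != 0 :> R by rewrite mulf_neq0// gt_eqF// sqrtr_gt0.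
have pE (t y : R) : t != 0 -> normal_pdf 0 t y = normal_peak t * normal_fun 0 t y.
  by move=> t0; rewrite normal_pdfE.
have p0 := normal_peak_gt0 s0; have p20 := normal_peak_gt0 s20.
rewrite (pE s)// (pE (Num.sqrt 2 * s))//; set f1 := normal_fun _ _ _; set f2 := normal_fun _ _ _.
have -> : x ^+ 2 * (normal_peak s * f1) = normal_peak s * (x ^+ 2 * f1) by ring.
have -> : 4 * s ^+ 2 * normal_peak s / normal_peak (Num.sqrt 2 * s) *
    (normal_peak (Num.sqrt 2 * s) * f2) = normal_peak s * (4 * s ^+ 2 * f2).
  by field; rewrite gt_eqF.
rewrite ler_wpM2l ?normal_peak_ge0// {}/f1 {}/f2.
rewrite /normal_fun subr0 exprMn sqr_sqrtr//.
have s2 : 0 < s ^+ 2 by rewrite exprn_even_gt0.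
pose z := x ^+ 2 / (4 * s ^+ 2).
have -> : - x ^+ 2 / (s ^+ 2 *+ 2) = - z - z.
  by rewrite /z -mulr_natr; field.
have -> : - x ^+ 2 / (2 * s ^+ 2 *+ 2) = - z by rewrite /z -mulr_natr; field.
have -> : x ^+ 2 = 4 * s ^+ 2 * z by rewrite /z; field.
have z1 : z * expR (- z) <= 1.
  by rewrite expRN ler_pdivrMr ?expR_gt0// mul1r; have := expR_ge1Dx z; lra.
rewrite expRD -(mulrA (4 * s ^+ 2)) ler_pM2l; last by rewrite mulr_gt0.
by rewrite mulrA ler_piMl ?expR_ge0.
Qed.

Lemma gaussian_moment2 (Y : Om -> R) (s : R) : has_gaussian_law P Y 0 s ->
  (\int[P]_om (Y om ^+ 2)%:E < +oo)%E.
Proof.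
move=> [mY lY].
have -> : (\int[P]_om (Y om ^+ 2)%:E = \int[pushforward P (Y : Om -> measurableTypeR R)]_y (y ^+ 2)%:E)%E.
  by rewrite ge0_integral_pushforward// => [|y _]; [exact/measurable_EFinP|rewrite lee_fin sqr_ge0].
case: (eqVneq s 0) => [s0|s0].
  rewrite (eq_measure_integral (\d_(0 : measurableTypeR R))) => [|A mA _]; last first.
    by rewrite [LHS](lY A mA) /gaussian_law s0 eqxx.
  by rewrite integral_dirac// ?expr0n ?mule0 ?ltry//; exact/measurable_EFinP.
apply: le_lt_trans; first apply: (@integral_density_le _ _ (measurableTypeR R) mu _ (normal_pdf 0 s) _ _ _ (fun y => y ^+ 2)) => //.
- exact: measurable_normal_pdf.
- by move=> x; exact: normal_pdf_ge0.
- by move=> A mA; rewrite [LHS](lY A mA) /gaussian_law (negbTE s0).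
- by move=> x; rewrite sqr_ge0.
set C := 4 * s ^+ 2 * normal_peak s / normal_peak (Num.sqrt 2 * s).
apply: (@le_lt_trans _ _ (\int[mu]_x (C%:E * (normal_pdf 0 (Num.sqrt 2 * s) x)%:E))%E).
  apply: nonneg_le_integral => x _; first by rewrite lee_fin mulr_ge0 ?sqr_ge0 ?normal_pdf_ge0.
  by rewrite -EFinM lee_fin normal_pdf_sqr_le.
rewrite ge0_integralZl_EFin//; last 3 first.
- by move=> x _; rewrite lee_fin normal_pdf_ge0.
- by apply/measurable_EFinP; exact: measurable_normal_pdf.
- by rewrite /C divr_ge0 ?normal_peak_ge0// mulr_ge0 ?normal_peak_ge0// mulr_ge0 ?sqr_ge0.
by rewrite integral_normal_pdf mule1 ltry.
Qed.

Lemma gaussian_law_sym (s : R) (U : set R) : measurable U ->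
  gaussian_law 0 s (-%R @^-1` U) = gaussian_law 0 s U.
Proof.
move=> mU; rewrite /gaussian_law; case: ifP => s0.
  by rewrite !diracE; congr (_ %:R%:E); congr nat_of_bool; apply/idP/idP => /set_mem h;
    apply/mem_set; move: h; rewrite /preimage/= oppr0.
rewrite /normal_prob; have mphi : measurable_fun setT ((fun x => 0 - x) : measurableTypeR R -> measurableTypeR R).
  by apply: measurable_funB => //; exact: measurable_id.
have mpdf : measurable_fun setT (fun x => (normal_pdf 0 s x)%:E : \bar R).
  by apply/measurable_EFinP; exact: measurable_normal_pdf.
have pdf0 x : U x -> (0 <= (normal_pdf 0 s x)%:E :> \bar R)%E by rewrite lee_fin normal_pdf_ge0.
have := @ge0_integral_pushforward _ _ _ _ R _ mphi mu U _ mU (measurable_funTS mpdf)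
  (fun x hx => pdf0 x (set_mem hx)).
rewrite (_ : _ @^-1` U = -%R @^-1` U); last by apply/seteqP; split => x; rewrite /preimage/= sub0r.
move=> h; transitivity (\int[mu]_(x in -%R @^-1` U) (normal_pdf 0 s (0 - x))%:E)%E.
  apply: eq_integral => x _; congr EFin.
  by rewrite !normal_pdfE ?s0// /normal_fun !subr0 sub0r sqrrN.
rewrite -[LHS]h; apply: eq_measure_integral => A mA _; exact: lebesgue_measure_refl.
Qed.

End GaussianMoments.

Section Moments.
Context {R : realType} d (Om : measurableType d) (P : probability Om R).
Implicit Types X Y : Om -> R.
Local Open Scope ereal_scope.

Definition square_integrable X : Prop :=
  measurable_fun setT X /\ \int[P]_om (X om ^+ 2)%:E < +oo.

Lemma sqi_integrable2 X : square_integrable X ->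
  P.-integrable setT (EFin \o (fun om => (X om ^+ 2)%R)).
Proof.
move=> [mX hX]; apply/integrableP; split.
  by apply/measurable_EFinP; exact: measurable_funX.
by under eq_integral do rewrite /= ger0_norm ?sqr_ge0//.
Qed.

Lemma sqiM X Y : square_integrable X -> square_integrable Y ->
  P.-integrable setT (EFin \o (fun om => (X om * Y om)%R)).
Proof.
move=> hX hY; have h := integrableD measurableT (sqi_integrable2 hX) (sqi_integrable2 hY).
apply: (le_integrable measurableT _ _ h).
  apply/measurable_EFinP; exact: measurable_funM hX.1 hY.1.
move=> om _; rewrite lee_fin normrM [leRHS]ger0_norm ?addr_ge0 ?sqr_ge0//.
have := real_normK (num_real (X om)); have := real_normK (num_real (Y om)).
have := sqr_ge0 (`|X om| - `|Y om|)%R.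
have := normr_ge0 (X om); have := normr_ge0 (Y om); nra.
Qed.

Lemma sqi_cst (c : R) : square_integrable (fun=> c).
Proof.
by split; [exact: measurable_cst|rewrite integral_cst//= (@probability_setT _ _ _ P) mule1 ltry].
Qed.

Lemma sqi_integrable X : square_integrable X -> P.-integrable setT (EFin \o X).
Proof.
move=> hX; have := sqiM hX (sqi_cst 1).
by rewrite (_ : _ \o _ = EFin \o X)//; apply/funext => om /=; rewrite mulr1.
Qed.

Lemma sqiZ (c : R) X : square_integrable X -> square_integrable (fun om => c * X om)%R.
Proof.
move=> hX; split; first by apply: measurable_funM => //; exact: hX.1.
under eq_integral do rewrite exprMn EFinM.
rewrite ge0_integralZl_EFin ?sqr_ge0//; last 2 first.
- by move=> om _; rewrite lee_fin sqr_ge0.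
- by apply/measurable_EFinP; exact: measurable_funX hX.1.
by apply: lte_mul_pinfty; rewrite ?lee_fin ?sqr_ge0//; exact: hX.2.
Qed.

End Moments.

Section IndependentProduct.
Context {R : realType} d (Om : measurableType d) (P : probability Om R).
Implicit Types X Y : Om -> R.
Local Open Scope ereal_scope.

Variables (G1 G2 : set (set Om)) (X Y : Om -> R).
Hypothesis ind : independent_classes P G1 G2.
Hypothesis X1 : forall U : set R, measurable U -> G1 (X @^-1` U).
Hypothesis Y2 : forall U : set R, measurable U -> G2 (Y @^-1` U).
Hypothesis hX : square_integrable P X.
Hypothesis hY : square_integrable P Y.

(** Independence says that the joint law agrees with the product of the laws on rectangles, hence
    everywhere; Fubini then factors the integral. *)
Lemma independent_expectationM :
  (\int[P]_om (X om * Y om) = \int[P]_om (X om) * \int[P]_om (Y om))%R.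
Proof.
have mX := hX.1; have mY := hY.1.
pose XY om : R * R := (X om, Y om).
have mXY : measurable_fun setT XY by apply/measurable_fun_pairP; split.
pose X' : {mfun Om >-> R} := mfun_Sub (mem_set mX).
pose Y' : {mfun Om >-> R} := mfun_Sub (mem_set mY).
pose XY' : {mfun Om >-> (R * R)%type} := mfun_Sub (mem_set mXY).
pose m1 : probability R R := distribution P X'.
pose m2 : probability R R := distribution P Y'.
pose m12 : probability (R * R)%type R := distribution P XY'.
have m12E C : measurable C -> (m1 \x m2) C = m12 C.
  apply: product_measure_unique => A B mA mB.
  exact: (ind (X1 mA) (Y2 mB)).
pose f (p : R * R) : \bar R := (p.1 * p.2)%:E.
have mf : measurable_fun setT f.
  by apply/measurable_EFinP; apply: measurable_funM; [exact: measurable_fst|exact: measurable_snd].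
have iXY := sqiM hX hY.
have i12 : m12.-integrable setT f.
  apply/integrableP; split => //.
  rewrite [LHS in LHS < _](ge0_integral_pushforward mXY)//; last exact: measurableT_comp.
  by case/integrableP: iXY.
have i1x2 : (m1 \x m2).-integrable setT f.
  apply/integrableP; split => //; case/integrableP: i12 => _; apply: le_lt_trans.
  by rewrite (eq_measure_integral m12) => // A mA _; exact: m12E.
have e12 : \int[m1 \x m2]_z f z = \int[P]_om (X om * Y om)%:E.
  rewrite (eq_measure_integral m12) => [|A mA _]; last exact: m12E.
  by rewrite [LHS](integral_pushforward mXY).
have iX : m1.-integrable setT EFin.
  have := sqi_integrable hX; move=> /integrableP[_ hi]; apply/integrableP; split => //.
  by rewrite [LHS in LHS < _](ge0_integral_pushforward mX)//; exact: measurableT_comp.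
have iY : m2.-integrable setT EFin.
  have := sqi_integrable hY; move=> /integrableP[_ hi]; apply/integrableP; split => //.
  by rewrite [LHS in LHS < _](ge0_integral_pushforward mY)//; exact: measurableT_comp.
have eX : \int[m1]_x x%:E = \int[P]_om (X om)%:E.
  by rewrite [LHS](integral_pushforward mX)//; exact: sqi_integrable.
have eY : \int[m2]_x x%:E = \int[P]_om (Y om)%:E.
  by rewrite [LHS](integral_pushforward mY)//; exact: sqi_integrable.
have fX := integrable_fin_num measurableT (sqi_integrable hX).
have fY := integrable_fin_num measurableT (sqi_integrable hY).
rewrite /Rintegral -fineM// -e12 -(integral12_prod_meas1 i1x2) /fubini_F /f /=; congr fine.
transitivity (\int[m1]_x (x%:E * \int[m2]_y y%:E)).
  by apply: eq_integral => x _; under eq_integral do rewrite EFinM; rewrite integralZl.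
by rewrite eY -eX -(fineK fY) integralZr.
Qed.

End IndependentProduct.

Section GaussianMean.
Context {R : realType} d (Om : measurableType d) (P : probability Om R).

Lemma gaussian_sqi (Y : Om -> R) (s : R) : has_gaussian_law P Y 0 s -> square_integrable P Y.
Proof. by move=> h; split; [case: h|exact: gaussian_moment2 h]. Qed.

(** The centred law is symmetric, so Y and -Y have the same mean. *)
Lemma gaussian_mean0 (Y : Om -> R) (s : R) : has_gaussian_law P Y 0 s ->
  \int[P]_om Y om = 0.
Proof.
move=> h; have hY := gaussian_sqi h; have [mY lY] := h.
have hN := sqiZ (-1) hY; set N := (fun om => -1 * Y om) in hN.
have mN := hN.1.
have e1 : (\int[pushforward P Y]_y y%:E = \int[P]_om (Y om)%:E)%E.
  by rewrite [LHS](integral_pushforward mY)//; exact: sqi_integrable.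
have e2 : (\int[pushforward P N]_y y%:E = \int[P]_om (N om)%:E)%E.
  by rewrite [LHS](integral_pushforward mN)//; exact: sqi_integrable.
have e3 : (\int[pushforward P N]_y y%:E = \int[pushforward P Y]_y y%:E)%E.
  apply: eq_measure_integral => A mA _.
  rewrite [RHS](lY A mA) -gaussian_law_sym// -lY.
    by congr (P _); apply/seteqP; split => om; rewrite /preimage/= /N mulN1r.
  have mo : measurable_fun setT (-%R : R -> R).
    rewrite (_ : -%R = fun x : R => -1 * x); first exact: measurable_funM.
    by apply/funext => x; rewrite mulN1r.
  by rewrite -[X in measurable X]setTI; exact: mo.
have : \int[P]_om N om = \int[P]_om Y om by rewrite /Rintegral -e2 e3 e1.
by rewrite /N RintegralZl//; [lra|exact: sqi_integrable].
Qed.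

End GaussianMean.

Section FiltrationMeasurability.
Context {R : realType} {k : scalar_kind} (V : ipSpace R k) (hV : hilbert V) (sV : hseparable V).

Lemma rip_hborel (v : V) (U : set R) : measurable U -> hborel [set x | U (rip x v)].
Proof.
move=> mU; have : (RGenOInfty.G (R:=R)).-sigma.-measurable U by rewrite -RGenOInfty.measurableE.
move: U {mU}.
have [h1 h2 h3] := @smallest_sigma_algebra V setT (@hopen R k V).
apply: smallest_sub.
  split => [|A hA|A hA].
  - by rewrite (_ : [set x | _] = set0).
  - rewrite (_ : [set x | _] = setT `\` [set x | A (rip x v)]); first exact: h2.
    by apply/seteqP; split => x [].
  - rewrite (_ : [set x | _] = \bigcup_i [set x | A i (rip x v)]); first exact: h3.
    by apply/seteqP; split => x [i _ hi]; exists i.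
move=> _ [r ->]; apply: sub_sigma_algebra.
have := @open_rip R k V hV v r; congr hopen; apply/seteqP.
by split => x /=; rewrite in_itv/= andbT.
Qed.

Lemma hmeasurable_rip (T : Type) (G : set (set T)) (f : T -> V) v (U : set R) :
  hmeasurable G f -> measurable U -> G ((fun x => rip (f x) v) @^-1` U).
Proof. by move=> mf mU; exact: mf (rip_hborel v mU). Qed.

Lemma sigma_of_rip d (T : measurableType d) (f : T -> V) v (U : set R) :
  measurable U -> sigma_of f ((fun x => rip (f x) v) @^-1` U).
Proof. by move=> mU; exists [set x | U (rip x v)] => //; exact: rip_hborel. Qed.

Lemma hmeasurable_sub (T : Type) (G G' : set (set T)) (f : T -> V) : G `<=` G' ->
  hmeasurable G f -> hmeasurable G' f.
Proof. by move=> GG mf U /mf; exact: GG. Qed.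

Lemma hmeasurableB (T : pointedType) (G : set (set T)) (f g : T -> V) :
  sigma_algebra setT G -> hmeasurable G f -> hmeasurable G g ->
  hmeasurable G (fun x => f x - g x).
Proof.
move=> sG; rewrite !(hmeasurable_subP hV sV _ sG) => mf mg; exact: wmeasB.
Qed.

End FiltrationMeasurability.

(** * Covariance of the Wiener process and the Ito isometry *)

Section WienerCovariance.
Context {R : realType} {k : scalar_kind} (Z : ipSpace R k) (hZ : hilbert Z) (sZ : hseparable Z).
Context d (Om : measurableType d) (P : probability Om R).
Context (F : R -> set (set Om)) (hF : usual_filtration P F).
Context (E : set Z) (Q : Z -> Z) (hQ : covariance_operator E Q).
Context (w : R -> Om -> Z) (hw : wiener P F Q w).
Local Notation leb := (@lebesgue_measure R).
Implicit Types (s t : R) (z : Z).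

(** Only increments of w have a prescribed law and w(0) vanishes merely almost surely; subtracting
    w(0) keeps the identities free of null sets. *)
Definition wiener0 t om : Z := w t om - w 0 om.

Let sF t : 0 <= t -> sigma_algebra setT (F t). Proof. by case: hF => h _ _ _ /h[]. Qed.
Let mF t : 0 <= t -> F t `<=` measurable. Proof. by case: hF => h _ _ _ /h[]. Qed.

Lemma wiener_adapted t : 0 <= t -> hmeasurable (F t) (w t).
Proof. by case: hw => _ _ h _ _ t0; apply: h; rewrite /= in_itv/= t0. Qed.

Lemma wiener0_adapted s t : 0 <= s -> s <= t -> hmeasurable (F t) (wiener0 s).
Proof.
move=> s0 st; have t0 := le_trans s0 st.
have FF : F s `<=` F t by case: hF => _ h _ _; exact: h.
have F0 : F 0 `<=` F t by case: hF => _ h _ _; exact: h.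
apply: (hmeasurableB hZ sZ (sF t0)).
- exact: hmeasurable_sub FF (wiener_adapted s0).
- exact: hmeasurable_sub F0 (wiener_adapted (lexx 0)).
Qed.

Lemma wiener_wmeas t : 0 <= t -> wmeas setT (w t).
Proof.
move=> t0; apply/(hmeasurableP hZ sZ); apply: hmeasurable_sub (wiener_adapted t0); exact: mF.
Qed.

Lemma wiener_incr_gauss s t z : 0 <= s -> s <= t ->
  exists sg, has_gaussian_law P (fun om => rip (w t om - w s om) z) 0 sg.
Proof. by case: hw => _ _ _ _ h s0 st; have [h1 _] := h s t s0 st; exact: h1. Qed.

Lemma wiener_incr_sqi s t z : 0 <= s -> s <= t ->
  square_integrable P (fun om => rip (w t om - w s om) z).
Proof. by move=> s0 st; have [sg h] := wiener_incr_gauss z s0 st; exact: gaussian_sqi h. Qed.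

Lemma wiener0_sqi t z : 0 <= t -> square_integrable P (fun om => rip (wiener0 t om) z).
Proof. exact: wiener_incr_sqi. Qed.

(** The increment is independent of F_s and has mean zero. *)
Lemma wiener_orth s t z z' : 0 <= s -> s <= t ->
  \int[P]_om (rip (wiener0 s om) z * rip (w t om - w s om) z') = 0.
Proof.
move=> s0 st; have [_ _ _ /(_ s t s0 st) ind _] := hw.
rewrite (independent_expectationM ind).
- by have [sg h] := wiener_incr_gauss z' s0 st; rewrite (gaussian_mean0 h) mulr0.
- by move=> U mU; exact: (hmeasurable_rip hZ z (wiener0_adapted s0 (lexx s)) mU).
- by move=> U mU; exact: (sigma_of_rip hZ (fun om => w t om - w s om) z' mU).
- exact: wiener0_sqi.
- exact: wiener_incr_sqi.
Qed.

(** The real part of <a, z> conj(<b, z'>), the Hermitian covariance fixed by [centred_gaussian].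
    [ip_covE] writes it as a sum of two products of real variables, to which the independence lemma
    applies. *)
Definition ip_cov (a b : Z) z z' : R := sRe (ip a z * sconj (ip b z')).

Lemma ip_covE a b z z' : ip_cov a b z z' = rip a z * rip b z' +
  rip a (mkscal 0 1 *: z) * rip b (mkscal 0 1 *: z').
Proof. by rewrite /ip_cov !sE -!(sIm_ip_rip hZ) /rip; ring. Qed.

Lemma ip_covC a b z z' : ip_cov a b z z' = ip_cov b a z' z.
Proof. by rewrite !ip_covE; ring. Qed.

Lemma ip_cov_int (a b : Om -> Z) z z' :
  (forall v, square_integrable P (fun om => rip (a om) v)) ->
  (forall v, square_integrable P (fun om => rip (b om) v)) ->
  P.-integrable setT (EFin \o (fun om => ip_cov (a om) (b om) z z')).
Proof.
move=> ha hb; have := integrableD measurableT (sqiM (ha z) (hb z'))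
  (sqiM (ha (mkscal 0 1 *: z)) (hb (mkscal 0 1 *: z'))).
apply: eq_integrable => // om _; by rewrite /= ip_covE.
Qed.

Lemma ip_cov_int2 (a b : Om -> Z) z z' :
  (forall v, square_integrable P (fun om => rip (a om) v)) ->
  (forall v, square_integrable P (fun om => rip (b om) v)) ->
  \int[P]_om ip_cov (a om) (b om) z z' = \int[P]_om (rip (a om) z * rip (b om) z') +
    \int[P]_om (rip (a om) (mkscal 0 1 *: z) * rip (b om) (mkscal 0 1 *: z')).
Proof.
move=> ha hb; rewrite -RintegralD//; last 2 first.
- exact: sqiM.
- exact: sqiM.
by apply: eq_Rintegral => om _; rewrite ip_covE.
Qed.

Lemma wiener_cov s t z z' : 0 <= s -> 0 <= t ->
  \int[P]_om ip_cov (wiener0 s om) (wiener0 t om) z z' = Num.min s t * sRe (ip (Q z') z).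
Proof.
wlog st : s t z z' / s <= t.
  move=> hwlog s0 t0; case: (leP s t) => st.
    by rewrite hwlog// min_l.
  have [_ Qsym _ _] := hQ.
  have -> : sRe (ip (Q z') z) = sRe (ip (Q z) z').
    by rewrite Qsym (ipC hZ) sRe_conj.
  have := hwlog t s z' z (ltW st) t0 s0; rewrite min_l ?(ltW st)// => <-.
  by apply: eq_Rintegral => om _; rewrite ip_covC.
move=> s0 t0; rewrite min_l//.
have hs v := wiener0_sqi v s0; have hst v := wiener_incr_sqi v s0 st.
(* w(t) is split at s; the increment after s is orthogonal to the past, leaving the variance at
   s. *)
transitivity (\int[P]_om (ip_cov (wiener0 s om) (wiener0 s om) z z' +
    ip_cov (wiener0 s om) (w t om - w s om) z z')).
  apply: eq_Rintegral => om _; rewrite !ip_covE.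
  have -> : wiener0 t om = wiener0 s om + (w t om - w s om).
    by rewrite /wiener0 [RHS]addrC addrA subrK.
  by rewrite !(ripDl hZ); ring.
rewrite RintegralD//; last 2 first.
- exact: ip_cov_int.
- exact: ip_cov_int.
rewrite (ip_cov_int2 _ _ hs hst) !wiener_orth// !addr0.
have [_ _ _ _ /(_ 0 s (lexx 0) s0) [_ /(_ z' z)]] := hw.
rewrite subr0 (ipZl hZ) => /(congr1 sRe); rewrite sRe_sintegral sReM sIm_ofR mul0r subr0 sRe_ofR.
move=> <-; apply: eq_Rintegral => om _; rewrite /ip_cov -/(wiener0 s om).
by rewrite mulrC (ipC hZ (wiener0 s om) z').
Qed.

End WienerCovariance.

Lemma measurable_nneseries {R : realType} d (T : measurableType d) (D : set T)
    (h : nat -> T -> \bar R) : (forall i x, D x -> (0 <= h i x)%E) ->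
  (forall i, measurable_fun D (h i)) ->
  measurable_fun D (fun x => \sum_(0 <= i <oo) h i x)%E.
Proof.
move=> h0 mh; have := @ge0_emeasurable_sum _ _ _ _ h xpredT (fun k x Dx _ => h0 k x Dx) (fun k _ => mh k).
by apply: eq_measurable_fun => x _; apply: eq_eseriesl.
Qed.

Section ElementaryIsometry.
Context {R : realType} {k : scalar_kind} (Z : ipSpace R k) (hZ : hilbert Z) (sZ : hseparable Z).
Context d (Om : measurableType d) (P : probability Om R).
Context (F : R -> set (set Om)) (hF : usual_filtration P F).
Context (E : set Z) (Q : Z -> Z) (hQ : covariance_operator E Q).
Context (w : R -> Om -> Z) (hw : wiener P F Q w).
Local Notation leb := (@lebesgue_measure R).
Local Notation w0 := (wiener0 w).
Implicit Types (s t : R) (z : Z).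

(** The covariance factor min(s, t) as the time integral of a product of indicators: the bridge from
    moments in Om to integrals over time. *)
Lemma integral_indic_min (T s t c : R) : 0 <= s <= T -> 0 <= t <= T ->
  leb.-integrable `[0, T] (EFin \o (fun r => \1_(`[0, s]%classic : set R) r * \1_(`[0, t]%classic : set R) r * c)) /\
  (\int[leb]_(r in `[0%R, T]) (\1_(`[0, s]%classic : set R) r * \1_(`[0, t]%classic : set R) r * c)%:E =
     (Num.min s t * c)%:E)%E.
Proof.
move=> /andP[s0 sT] /andP[t0 tT]; set m := Num.min s t.
have m0 : 0 <= m by rewrite le_min s0.
have mT : m <= T by rewrite ge_min sT.
have e r : \1_(`[0, s]%classic : set R) r * \1_(`[0, t]%classic : set R) r * c =
    c * \1_(`[0, m]%classic : set R) r.
  rewrite !indicE -natrM mulnb mulrC; congr (_ * _%:R); congr nat_of_bool.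
  by rewrite !mem_setE !in_itv/= /m le_min; case: (0 <= r).
have mi : measurable (`[0, m]%classic : set (measurableTypeR R)) by exact: measurable_cc.
have fi : leb.-integrable `[0, T] (EFin \o (\1_(`[0, m]%classic : set R))).
  apply/integrableP; split; first exact/measurable_EFinP/measurable_indic.
  under eq_integral do rewrite /= ger0_norm//.
  rewrite integral_indic//; apply: le_lt_trans (lebesgue_itv_fin 0 T).
  by apply: le_measure; rewrite ?inE; [exact: measurableI|exact: measurable_cc|exact: subIsetr].
split.
  have := integrable_Zl (measurable_cc 0 T) c fi; apply: eq_integrable => // x _ /=.
  by rewrite e.
under eq_integral do rewrite e EFinM.
rewrite integralZl// integral_indic// setIidl; last first.
  by move=> x /=; rewrite !in_itv/= => /andP[-> /le_trans]; apply.
transitivity (c%:E * (m - 0)%:E)%E; last by rewrite subr0 -EFinM mulrC.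
by congr (_ * _)%E; exact: (lebesgue_itv_len m0).
Qed.

(** Expanding the square gives the sum of the min(tau_i, tau_j) <Q z_j, z_i>; with min written as an
    integral of indicators, this is the integral of the quadratic form of Q at the step function
    g. *)
Lemma wiener_iso_scalar (I : finType) (tau : I -> R) (z : I -> Z) T :
  (forall i, 0 <= tau i <= T) ->
  let g r := \sum_i ofR (\1_(`[0, tau i]%classic : set R) r) *: z i in
  (\int[P]_om (sabs2 (\sum_i ip (w0 (tau i) om) (z i)))%:E =
   \int[leb]_(r in `[0%R, T]) (sRe (ip (Q (g r)) (g r)))%:E)%E.
Proof.
move=> htau g; have [bQ Qsym _ _] := hQ.
have tau0 i : 0 <= tau i by case/andP: (htau i).
have sq i v := wiener0_sqi hw v (tau0 i).
transitivity (\sum_(p : I * I) (Num.min (tau p.1) (tau p.2) * sRe (ip (Q (z p.2)) (z p.1)))%:E)%E.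
  transitivity (\sum_(p : I * I) \int[P]_om
      (ip_cov (w0 (tau p.1) om) (w0 (tau p.2) om) (z p.1) (z p.2))%:E)%E.
    rewrite -integral_sum//; last by move=> p; exact: (ip_cov_int hZ).
    apply: eq_integral => om _; rewrite sumEFin; congr EFin.
    have -> (x : scal R k) : sabs2 x = sRe (x * sconj x) by rewrite mul_sconj sRe_ofR.
    rewrite sconj_sum big_distrlr/= sRe_sum -(pair_big xpredT xpredT (fun i j =>
      ip_cov (w0 (tau i) om) (w0 (tau j) om) (z i) (z j)))/=.
    by apply: eq_bigr => i _; rewrite sRe_sum.
  apply: eq_bigr => p _; rewrite -(wiener_cov hZ sZ hF hQ hw)// /Rintegral fineK//.
  by apply: integrable_fin_num => //; exact: (ip_cov_int hZ).
transitivity (\sum_(p : I * I) \int[leb]_(r in `[0%R, T])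
   (\1_(`[0, tau p.1]%classic : set R) r * \1_(`[0, tau p.2]%classic : set R) r *
     sRe (ip (Q (z p.2)) (z p.1)))%:E)%E.
  by apply: eq_bigr => p _; case: (integral_indic_min (sRe (ip (Q (z p.2)) (z p.1))) (htau p.1) (htau p.2)).
rewrite -integral_sum//; last first.
  by move=> p; case: (integral_indic_min (sRe (ip (Q (z p.2)) (z p.1))) (htau p.1) (htau p.2)).
apply: eq_integral => r _; rewrite sumEFin; congr EFin; rewrite /g.
rewrite (bop_sum bQ) (ip_sumr hZ) sRe_sum -(pair_big xpredT xpredT (fun i j =>
  \1_(`[0, tau i]%classic : set R) r * \1_(`[0, tau j]%classic : set R) r * sRe (ip (Q (z j)) (z i))))/=.
apply: eq_bigr => i _; rewrite (ip_suml hZ) sRe_sum; apply: eq_bigr => j _.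
rewrite (bopZ bQ) (ipZl hZ) (ipZr hZ) sconj_ofR !sE; ring.
Qed.

Context (hE : orthonormal_basis E) (Qh : Z -> Z) (hQh : square_root Q Qh).
Context (W : ipSpace R k) (hW : hilbert W) (sW : hseparable W).
Local Notation L20 G := (L20norm2 E Qh G).

Lemma el_fun_bop t (s : elementary Z W t) r : bounded_op (el_fun s r).
Proof.
apply: bounded_op_sum => // i; apply: bounded_opZ => //; exact: el_bounded.
Qed.

Lemma el_wmeas t (s : elementary Z W t) : wmeas setT (el_integral s w).
Proof.
apply: wmeas_sum => // i; have [l0 [lr rt]] := el_bounds i.
apply: wmeas_bop => //; first exact: el_bounded.
apply: wmeasB => //; apply: (wiener_wmeas hZ sZ hF hw) => //; exact: le_trans lr.
Qed.

Lemma indic_diff (l u r : R) : 0 <= l -> l <= u -> 0 <= r ->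
  \1_(`]l, u]%classic : set R) r = \1_(`[0, u]%classic : set R) r - \1_(`[0, l]%classic : set R) r :> R.
Proof.
move=> l0 lu r0; rewrite !indicE !mem_setE !in_itv/= r0/= ltNge.
case: (leP r l) => rl /=; last by rewrite subr0.
by rewrite (le_trans rl lu) subrr.
Qed.

(** Adjoints turn <G_i (w(r_i) - w(l_i)), v> into scalar functionals of w at the two end points,
    hence the index type 'I_N + 'I_N with opposite signs. The step function g(r) is then the adjoint
    of the integrand applied to v, and Parseval expands ||Q^(1/2) g(r)||^2. *)
Lemma el_iso_coord t (s : elementary Z W t) (v : W) (e : nat -> Z) : onb_seq e ->
  (\int[P]_om (sabs2 (ip (el_integral s w om) v))%:E =
   \int[leb]_(r in `[0%R, t]) \sum_(0 <= i <oo) (sabs2 (ip (el_fun s r (Qh (e i))) v))%:E)%E.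
Proof.
move=> he; have [bQ Qsym _ _] := hQ; have [bQh Qhsym _ QhE] := hQh.
have adj i : exists Gs : W -> Z, forall x y, ip (el_op (e := s) i x) y = ip x (Gs y).
  by apply: (adjoint_exists hZ he) => //; exact: el_bounded.
have [Gs hGs] := choice adj; pose N := el_size s.
pose tau (q : 'I_N + 'I_N) := match q with inl i => el_right (e := s) i | inr i => el_left (e := s) i end.
pose zz (q : 'I_N + 'I_N) := match q with inl i => Gs i v | inr i => - Gs i v end.
have htau q : 0 <= tau q <= t.
  by case: q => i /=; have [l0 [lr rt]] := el_bounds i; apply/andP; split => //;
    [exact: le_trans lr|exact: le_trans rt].
have := wiener_iso_scalar zz htau; set g := (fun r => _) => iso.
transitivity (\int[P]_om (sabs2 (\sum_q ip (w0 (tau q) om) (zz q)))%:E)%E.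
  apply: eq_integral => om _; congr (EFin (sabs2 _)).
  rewrite (ip_suml hW) big_sumType/= -big_split/=; apply: eq_bigr => i _.
  rewrite hGs (ipNr hZ) -(ipBl hZ); congr ip; rewrite /wiener0.
  by rewrite opprB addrA subrK.
rewrite iso; apply: eq_integral => r /set_mem; rewrite /= in_itv/= => /andP[r0 rt].
have -> : sRe (ip (Q (g r)) (g r)) = hnorm (Qh (g r)) ^+ 2.
  by rewrite (hnorm2 hZ) /rip -QhE Qhsym.
rewrite -(onb_parseval hZ he); apply: eq_eseriesr => i _; congr EFin.
rewrite Qhsym (ip_suml hZ) -[LHS]sabs2_conj sconj_sum; congr sabs2.
rewrite (ip_suml hW) big_sumType/= -big_split/=; apply: eq_bigr => j _.
have [l0 [lr _]] := el_bounds j.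
rewrite !(ipZl hZ) !(ipZl hW) !sconjM !sconj_ofR (ipNl hZ) (indic_diff l0 lr r0).
have -> : sconj (ip (Gs j v) (Qh (e i))) = ip (el_op (e := s) j (Qh (e i))) v.
  by rewrite hGs -(ipC hZ).
have -> (x : scal R k) : sconj (- x) = - sconj x by apply: scal_ext; rewrite !sE.
by rewrite -(ipC hZ) hGs mulrN ofRB mulrBl.
Qed.

Lemma el_fun_smeas t (s : elementary Z W t) (x : Z) (v : W) :
  smeas (`[0, t]%classic : set (measurableTypeR R)) (fun r => ip (el_fun s r x) v).
Proof.
rewrite (_ : (fun r => _) = fun r => \sum_i ofR (\1_(`](el_left (e := s) i), (el_right (e := s) i)]%classic) r)
   * ip (el_op (e := s) i x) v); last first.
  by apply/funext => r; rewrite (ip_suml hW); apply: eq_bigr => i _; rewrite (ipZl hW).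
apply: smeas_sum => i; apply: smeasM; last exact: smeas_cst.
split.
  rewrite (_ : (fun r => _) = \1_(`](el_left (e := s) i), (el_right (e := s) i)]%classic : set R)).
    exact: measurable_indic.
  by apply/funext => r; rewrite sRe_ofR.
rewrite (_ : (fun r => _) = cst 0); first exact: measurable_cst.
by apply/funext => r; rewrite sIm_ofR.
Qed.

(** The coordinate identity is summed over a basis of W; the two series and the time integral are
    exchanged by nonnegativity. *)
Theorem elementary_isometry t (s : elementary Z W t) :
  (\int[P]_om (hnorm (el_integral s w om) ^+ 2)%:E =
   \int[leb]_(r in `[0%R, t]) L20 (el_fun s r))%E.
Proof.
have [e [he hEe]] := orthonormal_basis_enum hZ sZ hE.
have [f hf] := onb_seq_exists hW sW.
have mo : measurable (`[0, t]%classic : set (measurableTypeR R)) by exact: measurable_cc.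
transitivity (\int[P]_om \sum_(0 <= j <oo) (sabs2 (ip (el_integral s w om) (f j)))%:E)%E.
  by apply: eq_integral => om _; rewrite (onb_parseval hW hf).
rewrite integral_nneseries//; last 2 first.
- move=> j; apply/measurable_EFinP; apply: (wmeas_sabs2 hW); exact: el_wmeas.
- by move=> j om _; rewrite lee_fin sabs2_ge0.
under eq_eseriesr do rewrite (el_iso_coord s _ he).
have m1 i j : measurable_fun `[0, t] (fun r : measurableTypeR R => (sabs2 (ip (el_fun s r (Qh (e i))) (f j)))%:E).
  by apply/measurable_EFinP; have [a b] := el_fun_smeas s (Qh (e i)) (f j); exact: measurable_sabs2.
rewrite -integral_nneseries//; last 2 first.
- move=> j; apply: (@measurable_nneseries _ _ _ _
    (fun i r => (sabs2 (ip (el_fun s r (Qh (e i))) (f j)))%:E)) => [i r _|i]; last exact: m1.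
  by rewrite lee_fin sabs2_ge0.
- by move=> j r _; apply: nneseries_ge0 => i _ _; rewrite lee_fin sabs2_ge0.
apply: eq_integral => r _.
rewrite nneseries_interchange; last by move=> i j; rewrite lee_fin sabs2_ge0.
have [bQh _ _ _] := hQh; have bs := el_fun_bop s r.
rewrite /L20norm2 hEe; last 2 first.
- by move=> x; rewrite lee_fin sqr_ge0.
- by rewrite (bop0 bQh) (bop0 bs) hnorm0// expr0n.
by apply: eq_eseriesr => i _; rewrite (onb_parseval hW hf).
Qed.

End ElementaryIsometry.

(** * Stochastic integration of deterministic integrands *)

Section SquareIntegrals.
Context {R : realType} {k : scalar_kind} (V : ipSpace R k) (hV : hilbert V) (sV : hseparable V).
Context d (T : measurableType d) (mu : {measure set T -> \bar R}) (D : set T) (mD : measurable D).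
Local Open Scope ereal_scope.
Local Notation n2 f := (\int[mu]_(x in D) (hnorm (f x) ^+ 2)%:E).
Implicit Types f g h : T -> V.

Lemma n2_ge0 f : 0 <= n2 f.
Proof. by apply: integral_ge0 => x _; rewrite lee_fin sqr_ge0. Qed.

Lemma wmeas_norm2 f : wmeas D f -> measurable_fun D (fun x => (hnorm (f x) ^+ 2)%:E).
Proof. by move=> mf; apply/measurable_EFinP; apply: measurable_funX; exact: wmeas_norm. Qed.

Lemma n2_D3 f g h : wmeas D f -> wmeas D g -> wmeas D h ->
  n2 (fun x => f x + g x + h x)%R <= 3%:E * (n2 f + n2 g + n2 h).
Proof.
move=> mf mg mh.
apply: (@le_trans _ _ (\int[mu]_(x in D) (3%:E * ((hnorm (f x) ^+ 2)%:E + (hnorm (g x) ^+ 2)%:E +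
   (hnorm (h x) ^+ 2)%:E)))).
  apply: nonneg_le_integral => x _; first by rewrite lee_fin sqr_ge0.
  by rewrite -!EFinD -EFinM lee_fin hnormD3_le.
have pos (q : V) : 0 <= (hnorm q ^+ 2)%:E by rewrite lee_fin sqr_ge0.
have mfg : measurable_fun D (fun x => (hnorm (f x) ^+ 2)%:E + (hnorm (g x) ^+ 2)%:E).
  by apply: emeasurable_funD; exact: wmeas_norm2.
rewrite ge0_integralZl_EFin//; last 2 first.
- by move=> x _; rewrite !adde_ge0.
- by apply: emeasurable_funD => //; exact: wmeas_norm2.
rewrite ge0_integralD//; [|by move=> x _; rewrite adde_ge0|exact: wmeas_norm2].
by rewrite ge0_integralD//; exact: wmeas_norm2.
Qed.

Lemma eq_n2 f g : (forall x, D x -> hnorm (f x) = hnorm (g x)) -> n2 f = n2 g.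
Proof. by move=> fg; apply: eq_integral => x /set_mem Dx; rewrite fg. Qed.

Lemma n2_BC f g : n2 (fun x => f x - g x)%R = n2 (fun x => g x - f x)%R.
Proof. by apply: eq_n2 => x _; exact: hnormBC. Qed.

Lemma n2_eq0 f : wmeas D f -> n2 f = 0 -> {ae mu, forall x, D x -> f x = 0%R}.
Proof.
move=> mf f0; have m2 := wmeas_norm2 mf.
have /(ae_eq_integral_abs mu mD m2) : \int[mu]_(x in D) `|(hnorm (f x) ^+ 2)%:E| = 0.
  by rewrite -f0; apply: eq_integral => x _; rewrite gee0_abs// lee_fin sqr_ge0.
apply: aeS => x h /h /= [] /eqP; rewrite sqrf_eq0 => /eqP; exact: hnorm_eq0.
Qed.

Lemma n2_bop (W : ipSpace R k) (G : V -> W) (C : R) f : hilbert W -> wmeas D f -> (0 <= C)%R ->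
  (forall x, (hnorm (G x) <= C * hnorm x)%R) ->
  \int[mu]_(x in D) (hnorm (G (f x)) ^+ 2)%:E <= (C ^+ 2)%:E * n2 f.
Proof.
move=> hW mf C0 hC.
apply: (@le_trans _ _ (\int[mu]_(x in D) ((C ^+ 2)%:E * (hnorm (f x) ^+ 2)%:E))).
  apply: nonneg_le_integral => x _; first by rewrite lee_fin sqr_ge0.
  by rewrite -EFinM lee_fin -exprMn lerXn2r ?nnegrE ?mulr_ge0 ?hnorm_ge0.
rewrite ge0_integralZl_EFin ?sqr_ge0//; last exact: wmeas_norm2.
by move=> x _; rewrite lee_fin sqr_ge0.
Qed.

End SquareIntegrals.

Section HilbertSchmidt.
Context {R : realType} {k : scalar_kind} (Z W : ipSpace R k) (hZ : hilbert Z) (hW : hilbert W).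
Context (sW : hseparable W) (Qh : Z -> Z) (bQh : bounded_op Qh) (e : nat -> Z).
Local Open Scope ereal_scope.
Implicit Types G : Z -> W.

(** The squared L_2^0 norm along the enumerated basis; [L20E] identifies it with the sum over E. *)
Definition hs G : \bar R := \sum_(0 <= i <oo) (hnorm (G (Qh (e i))) ^+ 2)%:E.

Let t0 (a : R) : 0 <= (a ^+ 2)%:E. Proof. by rewrite lee_fin sqr_ge0. Qed.

Lemma hs_ge0 G : 0 <= hs G.
Proof. by apply: nneseries_ge0. Qed.

Lemma eq_hs G G' : (forall x, hnorm (G (Qh x)) = hnorm (G' (Qh x))) -> hs G = hs G'.
Proof. by move=> h; apply: eq_eseriesr => i _; rewrite h. Qed.

Lemma hs_le G G' (C : R) : (forall x, (hnorm (G (Qh x)) <= C * hnorm (G' (Qh x)))%R) ->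
  hs G <= (C ^+ 2)%:E * hs G'.
Proof.
move=> h; rewrite -nneseriesZl//; apply: lee_nneseries => // i _.
by rewrite -EFinM lee_fin -exprMn lerXn2r ?nnegrE ?hnorm_ge0// (le_trans (hnorm_ge0 _) (h _)).
Qed.

Lemma hs_D3 G G' G'' : hs (fun x => G x + G' x + G'' x)%R <= 3%:E * (hs G + hs G' + hs G'').
Proof.
rewrite /hs -nneseriesD//; try by move=> *; exact: t0.
rewrite -nneseriesD//; try by move=> *; rewrite ?adde_ge0.
rewrite -nneseriesZl; last by move=> *; rewrite !adde_ge0.
apply: lee_nneseries => [*|i _]; first exact: t0.
by rewrite -!EFinD -EFinM lee_fin hnormD3_le.
Qed.

Lemma hs_D2 G G' : hs (fun x => G x + G' x)%R <= 2%:E * (hs G + hs G').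
Proof.
rewrite /hs -nneseriesD//; try by move=> *; exact: t0.
rewrite -nneseriesZl; last by move=> *; rewrite adde_ge0.
apply: lee_nneseries => [*|i _]; first exact: t0.
by rewrite -!EFinD -EFinM lee_fin mulrDr hnormD2_le.
Qed.

(* Tannery's theorem for the series [hs]. *)
Lemma hs_cvg0 (G : nat -> Z -> W) (b : nat -> \bar R) : (forall i, 0 <= b i) ->
  \sum_(0 <= i <oo) b i < +oo -> (forall n i, (hnorm (G n (Qh (e i))) ^+ 2)%:E <= b i) ->
  (forall i, hnorm (G n (Qh (e i))) @[n --> \oo] --> (0%R : R)) ->
  hs (G n) @[n --> \oo] --> 0.
Proof.
move=> b0 bfin hb hc; apply/ecvg0_nat => [n|ep ep0]; first exact: hs_ge0.
have /ecvg0_nat := nneseries_tail_cvg bfin (fun i _ => b0 i).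
have ep2 : (0 < ep / 2)%R by rewrite divr_gt0.
move=> /(_ (fun N => nneseries_ge0 (fun i _ _ => b0 i)) _ ep2)[N hN].
have hfin : (\sum_(0 <= i < N) hnorm (G n (Qh (e i))) ^+ 2)%R @[n --> \oo] --> (0%R : R).
  elim: N {hN} => [|N IH].
    by under eq_fun do rewrite big_nil; exact: cvg_cst.
  apply: (@cvg_nat_eq _ _ (fun n => \sum_(0 <= i < N) hnorm (G n (Qh (e i))) ^+ 2 +
    hnorm (G n (Qh (e N))) ^+ 2)%R _ 0) => [n _|]; first by rewrite big_nat_recr.
  have h2 := @cvg_sqr _ _ _ (hc N); rewrite expr0n/= in h2.
  have h3 := cvgD IH h2; rewrite (addr0 (0%R : R)) in h3; exact: h3.
have [M hM] := (cvg0_nat (fun n => sumr_ge0 _ (fun i _ => sqr_ge0 _))).1 hfin _ ep2.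
exists M => n Mn; rewrite /hs (nneseries_split 0 N)//; rewrite add0n.
rewrite (splitr ep) EFinD leeD//.
  by rewrite sumEFin lee_fin ltW// hM.
apply: le_trans (hN N (leqnn _)); apply: lee_nneseries => // i _; exact: t0.
Qed.

Lemma measurable_hs d (T : measurableType d) (D : set T) (G : T -> Z -> W) :
  (forall x, wmeas D (fun r => G r x)) -> measurable_fun D (fun r => hs (G r)).
Proof.
move=> mG; apply: (@measurable_nneseries _ _ _ _ (fun i r => (hnorm (G r (Qh (e i))) ^+ 2)%:E)).
  by move=> i x _; exact: t0.
by move=> i; apply: wmeas_norm2.
Qed.

Context (E : set Z).
Hypothesis hEe : forall f : Z -> \bar R, (forall x, 0 <= f x) -> f 0%R = 0 ->
  \esum_(x in E) f x = \sum_(0 <= i <oo) f (e i).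

Lemma L20E G : G 0%R = 0%R -> L20norm2 E Qh G = hs G.
Proof.
move=> G0; rewrite /L20norm2 hEe//; last by rewrite (bop0 bQh) G0 hnorm0// expr0n.
Qed.

End HilbertSchmidt.

Lemma subrDD3 (V : zmodType) (a b c x : V) : a - b + (b - c) + (c - x) = a - x.
Proof. by rewrite [X in X + _]addrA subrK addrA subrK. Qed.

Section ElementarySub.
Context {R : realType} {k : scalar_kind} (Z W : ipSpace R k) (hZ : hilbert Z) (hW : hilbert W).
Context (t : R) (s s' : elementary Z W t).

Let I := 'I_(el_size s + el_size s').
Let lft (i : I) := match fintype.split i with inl j => el_left (e := s) j | inr j => el_left (e := s') j end.
Let rgt (i : I) := match fintype.split i with inl j => el_right (e := s) j | inr j => el_right (e := s') j end.
Let opr (i : I) := match fintype.split i with inl j => el_op (e := s) j | inr j => fun x => - el_op (e := s') j x end.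

Let bnds i : 0 <= lft i /\ lft i <= rgt i /\ rgt i <= t.
Proof. by rewrite /lft /rgt; case: fintype.split => j; exact: el_bounds. Qed.

Let bdd i : bounded_op (opr i).
Proof.
rewrite /opr; case: fintype.split => j; first exact: el_bounded.
have := bounded_opZ (-1) hZ hW (el_bounded (e := s') j).
by rewrite (_ : (fun x => _) = (fun x => - el_op (e := s') j x))//; apply/funext => x; rewrite scaleN1r.
Qed.

Definition el_sub : elementary Z W t := Elementary bnds bdd.

Lemma el_sub_fun r x : el_fun el_sub r x = el_fun s r x - el_fun s' r x.
Proof.
rewrite /el_fun big_split_ord/= -sumrN; congr (_ + _); apply: eq_bigr => i _;
  rewrite /lft /rgt /opr.
- by rewrite (unsplitK (inl i)).
- by rewrite (unsplitK (inr i)) scalerN.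
Qed.

Lemma el_sub_integral d (Om : measurableType d) (w : R -> Om -> Z) om :
  el_integral el_sub w om = el_integral s w om - el_integral s' w om.
Proof.
rewrite /el_integral big_split_ord/= -sumrN; congr (_ + _); apply: eq_bigr => i _;
  rewrite /lft /rgt /opr.
- by rewrite (unsplitK (inl i)).
- by rewrite (unsplitK (inr i)).
Qed.

End ElementarySub.

Section StochasticIntegral.
Context {R : realType} {k : scalar_kind} (Z : ipSpace R k) (hZ : hilbert Z) (sZ : hseparable Z).
Context d (Om : measurableType d) (P : probability Om R).
Context (F : R -> set (set Om)) (hF : usual_filtration P F).
Context (E : set Z) (Q : Z -> Z) (hQ : covariance_operator E Q).
Context (w : R -> Om -> Z) (hw : wiener P F Q w).
Context (hE : orthonormal_basis E) (Qh : Z -> Z) (hQh : square_root Q Qh).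
Context (e : nat -> Z) (he : onb_seq e).
Hypothesis hEe : forall f : Z -> \bar R, (forall x, (0 <= f x)%E) -> f 0 = 0%E ->
  (\esum_(x in E) f x = \sum_(0 <= i <oo) f (e i))%E.
Local Notation leb := (@lebesgue_measure R).
Local Notation cc t := (`[0, t]%classic : set (measurableTypeR R)).
Local Notation HS := (hs Qh e).
Let bQh : bounded_op Qh. Proof. by case: hQh. Qed.

Definition integrand (W : ipSpace R k) t (Phi : R -> Z -> W) : Prop :=
  (forall x, wmeas (cc t) (fun r => Phi r x)) /\
  (forall r, 0 <= r <= t -> bounded_op (Phi r)).

Local Notation SI := (is_stochastic_integral P E Qh w).

Section Fixed.
Context (W : ipSpace R k) (hW : hilbert W) (sW : hseparable W).
Implicit Types (Phi Psi : R -> Z -> W) (I J : Om -> W).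

Lemma el_integrand t (s : elementary Z W t) : integrand t (el_fun s).
Proof.
split => [x|r _]; last exact: (el_fun_bop hZ).
move=> v; have [h _] := el_fun_smeas hW s x v; exact: h.
Qed.

Lemma dist_hs t (s : elementary Z W t) Phi r : bounded_op (Phi r) ->
  L20norm2 E Qh (fun x => Phi r x - el_fun s r x) = HS (fun x => Phi r x - el_fun s r x).
Proof.
move=> bP; apply: (L20E hW bQh hEe).
by rewrite (bop0 bP) (bop0 (el_fun_bop hZ hW s r)) subrr.
Qed.

Lemma el_iso_hs t (s : elementary Z W t) :
  (\int[P]_om (hnorm (el_integral s w om) ^+ 2)%:E = \int[leb]_(r in cc t) HS (el_fun s r))%E.
Proof.
rewrite (elementary_isometry hZ sZ hF hQ hw hE hQh hW sW); apply: eq_integral => r _.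
by apply: (L20E hW bQh hEe); rewrite (bop0 (el_fun_bop hZ hW s r)).
Qed.

Lemma SI_wmeas t Phi I : SI t Phi I -> wmeas setT I.
Proof. by move=> [mI _]; apply/(hmeasurableP hW sW). Qed.

Lemma SI_near t Phi I (ep : R) : integrand t Phi -> SI t Phi I -> 0 < ep ->
  exists s : elementary Z W t,
  (\int[leb]_(r in cc t) HS (fun x => Phi r x - el_fun s r x)%R <= ep%:E)%E /\
  (\int[P]_om (hnorm (el_integral s w om - I om) ^+ 2)%:E <= ep%:E)%E.
Proof.
move=> iP [_ [s [_ s2 s3]]] ep0.
have nn i : (0 <= \int[leb]_(r in cc t) L20norm2 E Qh (fun x => (Phi r x - el_fun (s i) r x)%R))%E.
  apply: integral_ge0 => r _; apply: esum_ge0 => x _; by rewrite lee_fin sqr_ge0.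
have [N1 h1] := (ecvg0_nat nn).1 s2 _ ep0.
have [N2 h2] := (ecvg0_nat (fun i => n2_ge0 P setT (fun om => el_integral (s i) w om - I om))).1 s3 _ ep0.
exists (s (maxn N1 N2)); split; last by apply: h2; exact: leq_maxr.
have := h1 (maxn N1 N2) (leq_maxl _ _); congr (_ <= _)%E; apply: eq_integral => r /set_mem.
by rewrite /= in_itv/= => hr; apply: dist_hs; exact: iP.2.
Qed.

Lemma el_sub_dist t (s s' : elementary Z W t) :
  (\int[P]_om (hnorm (el_integral s w om - el_integral s' w om) ^+ 2)%:E =
   \int[leb]_(r in cc t) HS (fun x => (el_fun s r x - el_fun s' r x)%R))%E.
Proof.
have := el_iso_hs (el_sub hZ hW s s').
under eq_integral do rewrite el_sub_integral.
move=> ->; apply: eq_integral => r _; apply: eq_hs => x.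
by rewrite el_sub_fun.
Qed.

Lemma integral_hs_D3 t (G1 G2 G3 : R -> Z -> W) :
  (forall x, wmeas (cc t) (fun r => G1 r x)) -> (forall x, wmeas (cc t) (fun r => G2 r x)) ->
  (forall x, wmeas (cc t) (fun r => G3 r x)) ->
  (\int[leb]_(r in cc t) HS (fun x => G1 r x + G2 r x + G3 r x)%R <=
   3%:E * (\int[leb]_(r in cc t) HS (G1 r) + \int[leb]_(r in cc t) HS (G2 r) +
     \int[leb]_(r in cc t) HS (G3 r)))%E.
Proof.
move=> m1 m2 m3; have mc : measurable (cc t) by exact: measurable_cc.
have h1 := measurable_hs hW sW Qh e m1; have h2 := measurable_hs hW sW Qh e m2.
have h3 := measurable_hs hW sW Qh e m3.
have h12 : measurable_fun (cc t) (fun r => HS (G1 r) + HS (G2 r))%E by exact: emeasurable_funD.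
have p (G : Z -> W) : (0 <= HS G)%E by exact: hs_ge0.
apply: (@le_trans _ _ (\int[leb]_(r in cc t) (3%:E * (HS (G1 r) + HS (G2 r) + HS (G3 r))))%E).
  by apply: nonneg_le_integral => r _; [exact: hs_ge0|exact: hs_D3].
rewrite ge0_integralZl_EFin//; last 2 first.
- by move=> r _; rewrite !adde_ge0.
- exact: emeasurable_funD.
rewrite ge0_integralD//; last by move=> r _; rewrite adde_ge0.
by rewrite ge0_integralD.
Qed.

(** Both integrals are compared with elementary ones, for which the isometry is exact. The
    three-term inequality for squares is used once in Om and once in time, which gives the constant
    9. *)
Theorem SI_dist t Phi Psi I J : integrand t Phi -> integrand t Psi ->
  SI t Phi I -> SI t Psi J ->
  (\int[P]_om (hnorm (I om - J om) ^+ 2)%:E <=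
     9%:E * \int[leb]_(r in cc t) HS (fun x => (Phi r x - Psi r x)%R))%E.
Proof.
move=> iP iQ sI sJ; have mI := SI_wmeas sI; have mJ := SI_wmeas sJ.
set X := (\int[leb]_(r in cc t) _)%E.
(* The four approximation errors add up to 3 (1 + 3 (1 + 1) + 1) ep / 24 = ep. *)
apply/lee_addgt0Pr => ep ep0; have ep24 : 0 < ep / 24 by rewrite divr_gt0.
have [s [s1 s2]] := SI_near iP sI ep24; have [s' [s1' s2']] := SI_near iQ sJ ep24.
have mS (q : elementary Z W t) : wmeas setT (el_integral q w) by exact: (el_wmeas hZ sZ hF hw hW).
have iS := (el_integrand s).1; have iS' := (el_integrand s').1.
have b1 : (\int[P]_om (hnorm (I om - J om) ^+ 2)%:E <=
    3%:E * (\int[P]_om (hnorm (I om - el_integral s w om) ^+ 2)%:E +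
     \int[P]_om (hnorm (el_integral s w om - el_integral s' w om) ^+ 2)%:E +
     \int[P]_om (hnorm (el_integral s' w om - J om) ^+ 2)%:E))%E.
  apply: le_trans (n2_D3 hW sW P measurableT _ _ _); [|exact: wmeasB..].
  by rewrite le_eqVlt; apply/orP; left; apply/eqP; apply: eq_n2 => om _; rewrite subrDD3.
have b2 : (\int[leb]_(r in cc t) HS (fun x => el_fun s r x - el_fun s' r x)%R <=
    3%:E * (\int[leb]_(r in cc t) HS (fun x => el_fun s r x - Phi r x)%R + X +
      \int[leb]_(r in cc t) HS (fun x => Psi r x - el_fun s' r x)%R))%E.
  apply: le_trans (integral_hs_D3 _ _ _); last 3 first.
  - by move=> x; apply: wmeasB => //; exact: iP.1.
  - by move=> x; apply: wmeasB => //; [exact: iP.1|exact: iQ.1].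
  - by move=> x; apply: wmeasB => //; exact: iQ.1.
  rewrite le_eqVlt; apply/orP; left; apply/eqP; apply: eq_integral => r _; apply: eq_hs => x.
  by rewrite subrDD3.
have e1 : (\int[leb]_(r in cc t) HS (fun x => el_fun s r x - Phi r x)%R <= (ep / 24)%:E)%E.
  apply: le_trans s1; rewrite le_eqVlt; apply/orP; left; apply/eqP.
  by apply: eq_integral => r _; apply: eq_hs => x; exact: hnormBC.
apply: le_trans b1 _; rewrite el_sub_dist n2_BC//.
case: (ltP X +oo%E) => [Xfin|]; last first.
  by rewrite leye_eq => /eqP ->; rewrite mulry gtr0_sg// mul1e addye// leey.
have X0 : (0 <= X)%E by apply: integral_ge0 => r _; exact: hs_ge0.
rewrite -(fineK (x := X)) ?ge0_fin_numE// in b2 *; move: (fine X) b2 => {X Xfin X0} X b2.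
have b3 : (\int[leb]_(r in cc t) HS (fun x => el_fun s r x - el_fun s' r x)%R <=
   (3 * (ep / 24 + X + ep / 24))%:E)%E.
  apply: le_trans b2 _; rewrite EFinM lee_pmul2l// !EFinD.
  exact: (leeD (leeD e1 (lexx _)) s1').
apply: (@le_trans _ _ (3%:E * ((ep / 24)%:E + (3 * (ep / 24 + X + ep / 24))%:E + (ep / 24)%:E)))%E.
  by rewrite lee_pmul2l//; exact: (leeD (leeD s2 b3) s2').
rewrite -?EFinD -?EFinM -?EFinD lee_fin; lra.
Qed.

Lemma SI_uniq t Phi I J : integrand t Phi -> SI t Phi I -> SI t Phi J ->
  {ae P, forall om, I om = J om}.
Proof.
move=> iP sI sJ; have h := SI_dist iP iP sI sJ.
have mI := SI_wmeas sI; have mJ := SI_wmeas sJ.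
have /(n2_eq0 hW sW measurableT (wmeasB hW mI mJ)) :
    (\int[P]_om (hnorm (I om - J om) ^+ 2)%:E = 0)%E.
  apply/eqP; rewrite eq_le n2_ge0 andbT; apply: le_trans h _.
  rewrite (_ : (\int[leb]_(r in _) _)%E = 0%E) ?mule0// integral0_eq// => r _.
  by rewrite /hs eseries0// => i _ _; rewrite subrr hnorm0// expr0n.
by apply: aeS => om /(_ Logic.I) /eqP; rewrite subr_eq0 => /eqP.
Qed.

Lemma SI_ae t Phi I J : {ae P, forall om, I om = J om} -> hmeasurable measurable J ->
  SI t Phi I -> SI t Phi J.
Proof.
move=> IJ mJ [mI [s [s1 s2 s3]]]; split => //; exists s; split => //.
apply: cvg_trans s3; rewrite (_ : (fun i => _) = (fun i => (\int[P]_om (hnorm (el_integral (s i) w om - I om) ^+ 2)%:E)%E))//.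
apply/funext => i; apply: nonneg_ae_eq_integral => [om _|om _|].
- by rewrite lee_fin sqr_ge0.
- by rewrite lee_fin sqr_ge0.
- by apply: aeS IJ => om ->.
Qed.

End Fixed.
End StochasticIntegral.

Section SimplePartition.
Context {R : realType} {k : scalar_kind} (Z W : ipSpace R k) (hZ : hilbert Z) (hW : hilbert W).
Context (t : R) (t0 : 0 <= t) (Phi : R -> Z -> W).
Hypothesis bPhi : forall r, 0 <= r <= t -> bounded_op (Phi r).

Let h n : R := t / n.+1%:R.
Let h0 n : 0 <= h n. Proof. by rewrite divr_ge0. Qed.
Let hn n (i : 'I_n.+1) : 0 <= h n * i%:R <= t.
Proof.
rewrite mulr_ge0//= /h mulrAC ler_pdivrMr// ler_wpM2l// ler_nat ltnW//.
Qed.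
Let hnS n (i : 'I_n.+1) : h n * i.+1%:R <= t.
Proof. by rewrite /h mulrAC ler_pdivrMr// ler_wpM2l// ler_nat. Qed.

Let bnds n (i : 'I_n.+1) :
  0 <= h n * i%:R /\ h n * i%:R <= h n * i.+1%:R /\ h n * i.+1%:R <= t.
Proof.
have /andP[h1 _] := hn i; split => //; split; last exact: hnS.
by rewrite ler_wpM2l// ler_nat.
Qed.

Definition el_partition n : elementary Z W t :=
  Elementary (@bnds n) (fun i : 'I_n.+1 => bPhi (hn i)).

(** On each left-open cell the elementary integrand is frozen at the left end, so its sums are
    left-point sums; r = 0 lies in no cell. *)
Lemma el_partition_fun n r : 0 < r <= t ->
  exists tau, [/\ 0 <= tau <= t, `|tau - r| <= h n & forall x, el_fun (el_partition n) r x = Phi tau x].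
Proof.
move=> /andP[r0 rt].
have find m : r <= h n * m%:R -> exists2 i, (i < m)%N & h n * i%:R < r <= h n * i.+1%:R.
  elim: m => [|m IH]; first by rewrite mulr0 leNgt r0.
  case: (leP r (h n * m%:R)) => [/IH [i im hi] _|hr hr']; first by exists i => //; exact: ltnW.
  by exists m => //; rewrite hr.
have [i im /andP[i1 i2]] : exists2 i, (i < n.+1)%N & h n * i%:R < r <= h n * i.+1%:R.
  by apply: find; rewrite /h divfK// pnatr_eq0.
exists (h n * i%:R); split; first exact: (hn (Ordinal im)).
  rewrite distrC ger0_norm; last by rewrite subr_ge0 ltW.
  rewrite lerBlDl (le_trans i2)//.
  by rewrite -natr1 mulrDr mulr1 addrC.
move=> x; rewrite /el_fun/= (bigD1 (Ordinal im))//= indicE mem_set ?i1//; last first.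
  by rewrite /= in_itv/= i1.
rewrite ofR1 scale1r big1 ?addr0// => j ji; rewrite indicE memNset ?ofR0 ?scale0r//= in_itv/=.
move=> /andP[j1 j2]; case: (ltngtP j i) => ij.
- by move: (lt_le_trans i1 j2); rewrite ltNge ler_wpM2l// ler_nat.
- by move: (lt_le_trans j1 i2); rewrite ltNge ler_wpM2l// ler_nat.
- by case/eqP: ji; exact/val_inj.
Qed.

End SimplePartition.

Section StochasticIntegralExistence.
Context {R : realType} {k : scalar_kind} (Z : ipSpace R k) (hZ : hilbert Z) (sZ : hseparable Z).
Context d (Om : measurableType d) (P : probability Om R).
Context (F : R -> set (set Om)) (hF : usual_filtration P F).
Context (E : set Z) (Q : Z -> Z) (hQ : covariance_operator E Q).
Context (w : R -> Om -> Z) (hw : wiener P F Q w).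
Context (hE : orthonormal_basis E) (Qh : Z -> Z) (hQh : square_root Q Qh).
Context (e : nat -> Z) (he : onb_seq e).
Hypothesis hEe : forall f : Z -> \bar R, (forall x, (0 <= f x)%E) -> f 0 = 0%E ->
  (\esum_(x in E) f x = \sum_(0 <= i <oo) f (e i))%E.
Local Notation leb := (@lebesgue_measure R).
Local Notation cc t := (`[0, t]%classic : set (measurableTypeR R)).
Local Notation HS := (hs Qh e).
Local Notation SI := (is_stochastic_integral P E Qh w).
Let bQh : bounded_op Qh. Proof. by case: hQh. Qed.

Section Fixed.
Context (W : ipSpace R k) (hW : hilbert W) (sW : hseparable W).

Lemma el_adapted t (s : elementary Z W t) : 0 <= t -> hmeasurable (F t) (el_integral s w).
Proof.
move=> t0; have sF : sigma_algebra setT (F t) by case: hF => h _ _ _; case: (h t t0).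
apply/(hmeasurable_subP hW sW _ sF); apply: wmeas_sum => // i.
have [l0 [lr rt]] := el_bounds i.
have mw r : 0 <= r -> r <= t -> wmeas (T := g_sigma_algebraType (F t)) setT (w r).
  move=> r0 rt'; apply/(hmeasurable_subP hZ sZ _ sF).
  apply: hmeasurable_sub (wiener_adapted hw r0); case: hF => _ h _ _; exact: h.
apply: (wmeas_bop hZ sZ) => //; first exact: el_bounded.
by apply: wmeasB => //; apply: mw => //; [exact: le_trans lr|exact: le_trans rt].
Qed.

Lemma ae_neq (x : R) : {ae leb, forall r, r <> x}.
Proof.
exists [set x]; split => //; first exact: lebesgue_measure_set1.
by move=> r /= h; apply: contrapT => h'; apply: h.
Qed.

(** Strong continuity together with domination by one Hilbert-Schmidt operator: the setting in which
    left-point step functions converge in L^2([0, t]; L_2^0) by dominated convergence. *)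
Definition dominated_continuous t (Phi : R -> Z -> W) : Prop :=
  (forall r, 0 <= r <= t -> bounded_op (Phi r)) /\
  (exists (G : Z -> W) (M : R), [/\ (HS G < +oo)%E, 0 <= M &
     forall r x, 0 <= r <= t -> hnorm (Phi r x) <= M * hnorm (G x)]) /\
  (forall x r (tau : nat -> R), 0 <= r <= t -> (forall n, 0 <= tau n <= t) ->
     tau n @[n --> \oo] --> r -> hlim (fun n => Phi (tau n) x) (Phi r x)).

Lemma dc_integrand t Phi : 0 <= t -> dominated_continuous t Phi -> integrand t Phi.
Proof.
move=> t0 [bP [_ cP]]; split => // x.
move: t0; rewrite le_eqVlt => /predU1P[t0|t0].
  rewrite -t0 in cP bP *; apply: (eq_wmeas (f := fun=> Phi 0 x)); last exact: wmeas_cst.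
  by move=> r /=; rewrite in_itv/= -eq_le => /eqP <-.
apply: wmeas_path => // r hr; apply: cP => // [n|]; first exact: grid_mem.
by apply: grid_cvg => //; case/andP: hr.
Qed.

(** By the isometry the left-point sums are Cauchy in L^2, and a subsequence converges almost
    surely. That subsequence is part of the conclusion, since the summation by parts for the
    stochastic convolution is done path by path. *)
Theorem SI_exists t Phi : 0 <= t -> dominated_continuous t Phi ->
  exists (I : Om -> W) (phi : nat -> nat), [/\ SI t Phi I, hmeasurable (F t) I,
    forall j, (j <= phi j)%N &
    {ae P, forall om, hlim (fun j => let h := t / (phi j).+1%:R in
      \sum_(i < (phi j).+1) Phi (h * i%:R) (w (h * i.+1%:R) om - w (h * i%:R) om)) (I om)}].
Proof.
move=> t0 dP; have [bP [[G [M [Gfin M0 hG]]] cP]] := dP.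
have iP := dc_integrand t0 dP; pose s n := el_partition t0 bP n.
have mc : measurable (cc t) by exact: measurable_cc.
pose dist n r := HS (fun x => (Phi r x - el_fun (s n) r x)%R).
have mdist n : measurable_fun (cc t) (dist n).
  apply: measurable_hs => // x; apply: wmeasB => //; [exact: iP.1|].
  exact: (el_integrand hZ hW (s n)).1.
have dom n r x : 0 < r <= t -> hnorm (Phi r x - el_fun (s n) r x) <= 2 * M * hnorm (G x).
  move=> hr; have [tau [htau _ ->]] := el_partition_fun t0 bP n hr.
  have hr' : 0 <= r <= t by case/andP: hr => /ltW -> ->.
  apply: le_trans (hnormB hW _ _) _; rewrite -mulrA mulr_natl mulr2n lerD//; exact: hG.
have dcvg r : 0 < r <= t -> dist n r @[n --> \oo] --> 0%E.
  move=> hr; have hr' : 0 <= r <= t by case/andP: hr => /ltW -> ->.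
  have /choice[tau htau] := fun n => el_partition_fun t0 bP n hr.
  have tc : tau n @[n --> \oo] --> r.
    apply/cvgrPdist_lt => ep ep0; have /cvgrPdist_lt/(_ ep ep0)[N _ hN] := @grid_mesh_cvg _ t.
    exists N => // n /= Nn; rewrite distrC; have [_ h1 _] := htau n.
    apply: le_lt_trans h1 _; have := hN n Nn; rewrite /= sub0r normrN ger0_norm//.
    by rewrite divr_ge0.
  apply: (hs_cvg0 (b := fun i => (((2 * M) ^+ 2)%:E * (hnorm (G (Qh (e i))) ^+ 2)%:E)%E)).
  - by move=> i; rewrite mule_ge0// lee_fin sqr_ge0.
  - rewrite nneseriesZl; last by move=> i _; rewrite lee_fin sqr_ge0.
    by apply: lte_mul_pinfty; rewrite ?lee_fin ?sqr_ge0.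
  - move=> n i; rewrite -EFinM lee_fin -exprMn lerXn2r ?nnegrE ?hnorm_ge0 ?mulr_ge0 ?hnorm_ge0//.
    exact: dom.
  - move=> i; have hc : hlim (fun n => Phi (tau n) (Qh (e i))) (Phi r (Qh (e i))).
      by apply: cP => // n; case: (htau n).
    apply: (@cvg_nat_eq _ _ _ _ 0%N _ hc) => n _.
    by have [_ _ ->] := htau n; rewrite hnormBC.
have dbound n r : 0 < r <= t -> (dist n r <= ((2 * M) ^+ 2)%:E * HS G)%E.
  by move=> hr; apply: hs_le => x; exact: dom.
have HG0 := hs_ge0 Qh e G.
pose C := fine (((2 * M) ^+ 2)%:E * HS G)%E.
have CE : (((2 * M) ^+ 2)%:E * HS G)%E = C%:E.
  by rewrite fineK// ge0_fin_numE ?mule_ge0 ?lee_fin ?sqr_ge0//; apply: lte_mul_pinfty; rewrite ?lee_fin ?sqr_ge0.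
have dae : {ae leb, forall r, cc t r -> dist n r @[n --> \oo] --> 0%E}.
  apply: aeS (ae_neq 0) => r r0; rewrite /= in_itv/= => /andP[r1 r2]; apply: dcvg.
  by rewrite r2 andbT lt_neqAle r1 andbT eq_sym; exact/eqP.
have dint : (\int[leb]_(r in cc t) dist n r)%E @[n --> \oo] --> 0%E.
  have := @dominated_convergence _ _ _ leb (cc t) mc (fun n r => dist n r) (cst 0%E) (cst C%:E) mdist
    (measurable_cst _) dae.
  have ic : leb.-integrable (cc t) (cst C%:E : _ -> \bar R).
    apply/integrableP; split => //; rewrite integral_cst//; apply: lte_mul_pinfty => //.
    exact: lebesgue_itv_fin.
  have ad : {ae leb, forall r n, cc t r -> (`|dist n r| <= cst C%:E r)%E}.
    apply: aeS (ae_neq 0) => r r0 n; rewrite /= in_itv/= => /andP[r1 r2].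
    rewrite gee0_abs ?hs_ge0// -CE; apply: dbound.
    by rewrite r2 andbT lt_neqAle r1 andbT eq_sym; exact/eqP.
  by move=> /(_ ic ad) [_ _]; rewrite integral0.
have mS n : wmeas setT (el_integral (s n) w) by exact: (el_wmeas hZ sZ hF hw hW).
have d0 n : (0 <= \int[leb]_(r in cc t) dist n r)%E by apply: integral_ge0 => r _; exact: hs_ge0.
have cau ep : 0 < ep -> exists N, forall i j, (N <= i)%N -> (N <= j)%N ->
    (\int[P]_om (hnorm (el_integral (s i) w om - el_integral (s j) w om) ^+ 2)%:E <= ep%:E)%E.
  (* 3 (ep / 6 + ep / 6) = ep; the third term fed to the three-term inequality is zero. *)
  move=> ep0; have ep6 : 0 < ep / 6 by rewrite divr_gt0.
  have [N hN] := (ecvg0_nat d0).1 dint _ ep6; exists N => i j Ni Nj.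
  rewrite (el_sub_dist hZ sZ hF hQ hw hE hQh hEe hW sW).
  have m1 i' := (el_integrand hZ hW (s i')).1.
  apply: le_trans (_ : (3%:E * (\int[leb]_(r in cc t) HS (fun x => el_fun (s i) r x - Phi r x)%R +
    \int[leb]_(r in cc t) HS (fun x => Phi r x - el_fun (s j) r x)%R +
    \int[leb]_(r in cc t) HS (fun x => el_fun (s j) r x - el_fun (s j) r x)%R) <= _))%E.
    have w1 x : wmeas (cc t) (fun r => el_fun (s i) r x - Phi r x) by apply: wmeasB => //; exact: iP.1.
    have w2 x : wmeas (cc t) (fun r => Phi r x - el_fun (s j) r x) by apply: wmeasB => //; exact: iP.1.
    have w3 x : wmeas (cc t) (fun r => el_fun (s j) r x - el_fun (s j) r x) by exact: wmeasB.
    apply: le_trans (integral_hs_D3 Qh e hW sW w1 w2 w3).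
    rewrite le_eqVlt; apply/orP; left; apply/eqP; apply: eq_integral => r _.
    by apply: eq_hs => x; rewrite subrDD3.
  have -> : (\int[leb]_(r in cc t) HS (fun x => el_fun (s j) r x - el_fun (s j) r x)%R = 0)%E.
    rewrite integral0_eq// => r _.
    by rewrite /hs eseries0// => i' _ _; rewrite subrr hnorm0// expr0n.
  have -> : (\int[leb]_(r in cc t) HS (fun x => el_fun (s i) r x - Phi r x)%R =
      \int[leb]_(r in cc t) dist i r)%E.
    by apply: eq_integral => r _; apply: eq_hs => x; exact: hnormBC.
  rewrite adde0 (_ : ep%:E = 3%:E * ((ep / 6)%:E + (ep / 6)%:E))%E.
    by rewrite lee_pmul2l//; apply: leeD; exact: hN.
  by rewrite -EFinD -EFinM; congr EFin; field.
have mn i j : measurable_fun setT (fun om => hnorm (el_integral (s i) w om - el_integral (s j) w om)).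
  by apply: (wmeas_norm hW sW); exact: wmeasB.
have [phi [phii hphi]] := L2_cauchy_ae_subseq measurableT hW mn cau.
pose I om := hlim_or0 (fun i => el_integral (s (phi i)) w om).
have aeI : {ae P, forall om, setT om -> hlim (fun i => el_integral (s (phi i)) w om) (I om)}.
  by apply: aeS hphi => om h /h [l hl]; rewrite /I (hlim_or0_lim hW hl).
have sF : sigma_algebra setT (F t) by case: hF => h _ _ _; case: (h t t0).
have FI : hmeasurable (F t) I.
  apply/(hmeasurable_subP hW sW _ sF); apply: (wmeas_hlim_or0 hW sW) => // i.
  by apply/(hmeasurable_subP hW sW _ sF); exact: el_adapted.
have aeI' : {ae P, forall om, hlim (fun i => el_integral (s (phi i)) w om) (I om)}.
  by apply: aeS aeI => om; exact.
exists I, phi; split; [|exact: FI|exact: phii|exact: aeI'].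
split; first by apply: hmeasurable_sub FI; case: hF => h _ _ _; case: (h t t0).
have dE n r : cc t r -> L20norm2 E Qh (fun x => Phi r x - el_fun (s n) r x) = dist n r.
  by rewrite /= in_itv/= => hr; apply: (dist_hs hZ hQh hEe hW); exact (bP r hr).
exists s; split.
- apply: aeS dae => r h hr; rewrite (_ : (fun i => _) = (dist^~ r)); first exact: h.
  by apply/funext => n; exact: dE.
- rewrite (_ : (fun i => _) = (fun n => \int[leb]_(r in cc t) dist n r)%E)//.
  by apply/funext => n; apply: eq_integral => r /set_mem hr; exact: dE.
- exact: (L2_cauchy_cvg measurableT hW mn cau phii aeI).
Qed.

End Fixed.
End StochasticIntegralExistence.

Section SummableConvergence.
Context {R : realType} d (T : measurableType d) (mu : {measure set T -> \bar R}).
Context (D : set T) (mD : measurable D).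
Local Open Scope ereal_scope.

(** The sum of the a_n has finite integral, hence is finite a.e., and the terms of a convergent
    series tend to 0. *)
Lemma summable_ae_cvg0 (a : nat -> T -> \bar R) :
  (forall n, measurable_fun D (a n)) -> (forall n x, 0 <= a n x) ->
  (forall n, \int[mu]_(x in D) a n x <= (1 * 2^-1 ^+ n)%:E) ->
  {ae mu, forall x, D x -> a n x @[n --> \oo] --> 0}.
Proof.
move=> ma a0 ha.
have sumfin : \int[mu]_(x in D) \sum_(0 <= n <oo) a n x < +oo.
  rewrite integral_nneseries//; apply: le_lt_trans (nneseries_geo_le (C := 1) _ ha) (ltry _).
  by move=> n; apply: integral_ge0.
have ms : measurable_fun D (fun x => \sum_(0 <= n <oo) a n x).
  by apply: (@measurable_nneseries _ _ _ _ a).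
have := integral_lty_ae mD ms (fun x _ => nneseries_ge0 (fun n _ _ => a0 n x)) sumfin.
apply: aeS => x h hx; have {h}hx := h hx.
have := nneseries_tail_cvg hx (fun n _ => a0 n x).
move=> /ecvg0_nat h; apply/ecvg0_nat => // ep ep0.
have [|N hN] := h _ ep ep0; first by move=> n; apply: nneseries_ge0.
exists N => n Nn; apply: le_trans (hN n Nn).
rewrite (nneseries_split n 1)// addn1 big_nat1 leeDl//.
by apply: nneseries_ge0.
Qed.

Lemma summable_ae_hlim {k : scalar_kind} (V : ipSpace R k) (hV : hilbert V) (sV : hseparable V)
    (f : nat -> T -> V) (g : T -> V) : (forall n, wmeas D (f n)) -> wmeas D g ->
  (forall n, \int[mu]_(x in D) (hnorm (f n x - g x)%R ^+ 2)%:E <= (1 * 2^-1 ^+ n)%:E) ->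
  {ae mu, forall x, D x -> hlim (fun n => f n x) (g x)}.
Proof.
move=> mf mg h; have := summable_ae_cvg0 (a := fun n x => (hnorm (f n x - g x)%R ^+ 2)%:E) _ _ h.
have h1 n : measurable_fun D (fun x => (hnorm (f n x - g x)%R ^+ 2)%:E).
  by apply: wmeas_norm2 => //; exact: wmeasB.
move=> /(_ h1) => /(_ (fun n x => _)) h2.
apply: aeS (h2 _) => [x cv Dx|n x]; last by rewrite lee_fin sqr_ge0.
have /ecvg0_nat c := cv Dx; apply/hlimP => e e0.
have e2 : (0 < (e / 2) ^+ 2)%R by rewrite exprn_gt0// divr_gt0.
have [|N hN] := c _ _ e2; first by move=> n; rewrite lee_fin sqr_ge0.
exists N => n Nn; have := hN n Nn; have e20 : (0 <= e / 2)%R by rewrite divr_ge0// ltW.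
rewrite lee_fin ler_pXn2r ?nnegrE ?hnorm_ge0// => hn.
by apply: le_lt_trans hn _; rewrite ltr_pdivrMr// ltr_pMr// ltr1n.
Qed.

End SummableConvergence.

Section ElementaryMaps.
Context {R : realType} {k : scalar_kind} (Z W W' : ipSpace R k).
Context (hZ : hilbert Z) (hW : hilbert W) (hW' : hilbert W').

Definition el_map (G : W -> W') (bG : bounded_op G) t (s : elementary Z W t) : elementary Z W' t :=
  Elementary (@el_bounds _ _ _ _ _ s)
    (fun i => bounded_op_comp hZ hW hW' bG (el_bounded (e := s) i)).

Lemma el_map_fun G (bG : bounded_op G) t (s : elementary Z W t) r x :
  el_fun (el_map bG s) r x = G (el_fun s r x).
Proof.
by rewrite /el_fun/= (bop_sum bG); apply: eq_bigr => i _; rewrite (bopZ bG).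
Qed.

Lemma el_map_integral G (bG : bounded_op G) t (s : elementary Z W t) d (Om : measurableType d)
    (w : R -> Om -> Z) om : el_integral (el_map bG s) w om = G (el_integral s w om).
Proof. by rewrite /el_integral/= (bop_sum bG). Qed.

Let bnds_ext s t (st : s <= t) (q : elementary Z W s) i :
  0 <= el_left (e := q) i /\ el_left (e := q) i <= el_right (e := q) i /\ el_right (e := q) i <= t.
Proof. by have [h1 [h2 h3]] := el_bounds i; split => //; split => //; exact: le_trans st. Qed.

Definition el_ext s t (st : s <= t) (q : elementary Z W s) : elementary Z W t :=
  Elementary (@bnds_ext s t st q) (@el_bounded _ _ _ _ _ q).

Lemma el_ext_fun s t (st : s <= t) (q : elementary Z W s) r x :
  el_fun (el_ext st q) r x = el_fun q r x.
Proof. by []. Qed.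

Lemma el_fun_out s (q : elementary Z W s) r x : s < r -> el_fun q r x = 0.
Proof.
move=> sr; apply: big1 => i _; have [_ [_ h]] := el_bounds i.
rewrite indicE memNset ?ofR0 ?scale0r//= in_itv/= => /andP[_ h'].
by move: (lt_le_trans sr (le_trans h' h)); rewrite ltxx.
Qed.

End ElementaryMaps.

Lemma hs_le_het {R : realType} {k : scalar_kind} (Z W W' : ipSpace R k) (Qh : Z -> Z) (e : nat -> Z)
    (G : Z -> W) (G' : Z -> W') (C : R) :
  (forall x, hnorm (G (Qh x)) <= C * hnorm (G' (Qh x))) ->
  (hs Qh e G <= (C ^+ 2)%:E * hs Qh e G')%E.
Proof.
move=> h; rewrite -nneseriesZl; last by move=> *; rewrite lee_fin sqr_ge0.
apply: lee_nneseries => [*|i _]; first by rewrite lee_fin sqr_ge0.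
by rewrite -EFinM lee_fin -exprMn lerXn2r ?nnegrE ?hnorm_ge0// (le_trans (hnorm_ge0 _) (h _)).
Qed.

Section StochasticIntegralCalculus.
Context {R : realType} {k : scalar_kind} (Z : ipSpace R k) (hZ : hilbert Z) (sZ : hseparable Z).
Context d (Om : measurableType d) (P : probability Om R).
Context (F : R -> set (set Om)) (hF : usual_filtration P F).
Context (E : set Z) (Q : Z -> Z) (hQ : covariance_operator E Q).
Context (w : R -> Om -> Z) (hw : wiener P F Q w).
Context (hE : orthonormal_basis E) (Qh : Z -> Z) (hQh : square_root Q Qh).
Context (e : nat -> Z) (he : onb_seq e).
Hypothesis hEe : forall f : Z -> \bar R, (forall x, (0 <= f x)%E) -> f 0 = 0%E ->
  (\esum_(x in E) f x = \sum_(0 <= i <oo) f (e i))%E.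
Local Notation leb := (@lebesgue_measure R).
Local Notation cc t := (`[0, t]%classic : set (measurableTypeR R)).
Local Notation HS := (hs Qh e).
Local Notation SI := (is_stochastic_integral P E Qh w).
Let bQh : bounded_op Qh. Proof. by case: hQh. Qed.

(** Approximating with errors 2^-n makes the time integrals summable, so the a.e. convergence
    demanded by [is_stochastic_integral] is automatic. *)
Lemma SI_intro (W : ipSpace R k) (hW : hilbert W) (sW : hseparable W) t (Phi : R -> Z -> W) I :
  integrand t Phi -> wmeas setT I ->
  (forall ep : R, 0 < ep -> exists s : elementary Z W t,
    (\int[leb]_(r in cc t) HS (fun x => Phi r x - el_fun s r x)%R <= ep%:E)%E /\
    (\int[P]_om (hnorm (el_integral s w om - I om) ^+ 2)%:E <= ep%:E)%E) ->
  SI t Phi I.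
Proof.
move=> iP mI near; split; first exact/(hmeasurableP hW sW).
have mc : measurable (cc t) by exact: measurable_cc.
have pos n : 0 < (1 * 2^-1 ^+ n : R) by rewrite mul1r exprn_gt0.
have /choice[s hs] := fun n => near _ (pos n).
pose dist n r := HS (fun x => (Phi r x - el_fun (s n) r x)%R).
have mdist n : measurable_fun (cc t) (dist n).
  apply: measurable_hs => // x; apply: wmeasB => //; [exact: iP.1|].
  exact: (el_integrand hZ hW (s n)).1.
have d0 n r : (0 <= dist n r)%E by exact: hs_ge0.
have geo : (1 * 2^-1 ^+ n : R) @[n --> \oo] --> (0 : R).
  rewrite -[X in _ --> X](mulr0 1); apply: cvgM; first exact: cvg_cst.
  by apply: cvg_expr; rewrite ger0_norm ?invr_ge0// invf_lt1// ltr1n.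
have small (a : nat -> \bar R) : (forall n, 0 <= a n)%E ->
    (forall n, a n <= (1 * 2^-1 ^+ n)%:E)%E -> a n @[n --> \oo] --> 0%E.
  move=> a0 ha; apply/ecvg0_nat => // ep ep0.
  have [N hN] := (cvg0_nat (fun n => ltW (pos n))).1 geo ep ep0.
  by exists N => n Nn; apply: le_trans (ha n) _; rewrite lee_fin ltW// hN.
have dE n r : cc t r -> L20norm2 E Qh (fun x => Phi r x - el_fun (s n) r x) = dist n r.
  by rewrite /= in_itv/= => hr; apply: (dist_hs hZ hQh hEe hW); exact: iP.2.
have dae := summable_ae_cvg0 mc mdist d0 (fun n => proj1 (hs n)).
exists s; split.
- by apply: aeS dae => r h hr; under eq_fun do rewrite dE//; exact: h.
- apply: small => n; first by apply: integral_ge0 => r _; apply: esum_ge0 => x _; rewrite lee_fin sqr_ge0.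
  have [h _] := hs n; apply: le_trans h; rewrite le_eqVlt; apply/orP; left; apply/eqP.
  by apply: eq_integral => r /set_mem hr; rewrite dE.
- by apply: small => n; [exact: n2_ge0|case: (hs n)].
Qed.

Lemma SI_bop (W W' : ipSpace R k) (hW : hilbert W) (sW : hseparable W) (hW' : hilbert W')
    (sW' : hseparable W') (G : W -> W') t (Phi : R -> Z -> W) I :
  bounded_op G -> integrand t Phi -> SI t Phi I -> SI t (fun r x => G (Phi r x)) (fun om => G (I om)).
Proof.
move=> bG iP sI; have mI := SI_wmeas hW sW sI; have [C C0 hC] := bop_bound bG.
have iG : integrand t (fun r x => G (Phi r x)).
  split=> [x|r hr]; first by apply: wmeas_bop => //; exact: iP.1.
  by apply: (bounded_op_comp hZ hW hW') => //; exact: iP.2.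
apply: SI_intro => //; first exact: wmeas_bop.
move=> ep ep0; have C2 : 0 < C ^+ 2 by rewrite exprn_gt0.
have [s [s1 s2]] := SI_near hZ hQh hEe hW iP sI (divr_gt0 ep0 C2).
have CE : (ep%:E = (C ^+ 2)%:E * (ep / C ^+ 2)%:E)%E by rewrite -EFinM mulrC divfK// gt_eqF.
exists (el_map hZ hW hW' bG s); split.
- have m1 : measurable_fun (cc t) (fun r => HS (fun x => Phi r x - el_fun s r x)%R).
    apply: measurable_hs => // x; apply: wmeasB => //; [exact: iP.1|].
    exact: (el_integrand hZ hW s).1.
  apply: (@le_trans _ _ (\int[leb]_(r in cc t) ((C ^+ 2)%:E * HS (fun x => Phi r x - el_fun s r x)%R))%E).
    apply: nonneg_le_integral => r _; first exact: hs_ge0.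
    apply: hs_le_het => x; rewrite el_map_fun -(bopB bG); exact: hC.
  rewrite ge0_integralZl_EFin ?sqr_ge0//; last by move=> r _; exact: hs_ge0.
  by rewrite CE; apply: lee_wpmul2l; [rewrite lee_fin sqr_ge0|exact: s1].
- apply: (@le_trans _ _ ((C ^+ 2)%:E * \int[P]_om (hnorm (el_integral s w om - I om) ^+ 2)%:E)%E).
    have mS := el_wmeas hZ sZ hF hw hW s.
    have b := n2_bop hW sW P measurableT hW' (wmeasB hW mS mI) (ltW C0) hC; apply: le_trans b.
    rewrite le_eqVlt; apply/orP; left; apply/eqP; apply: eq_n2 => om _.
    by rewrite el_map_integral -(bopB bG).
  by rewrite CE; apply: lee_wpmul2l; [rewrite lee_fin sqr_ge0|exact: s2].
Qed.

(** An integral over [0, s] becomes one over [0, t] by cutting the integrand off at s, so that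
    integrals at different times can be compared by [SI_dist]. *)
Lemma SI_ext (W : ipSpace R k) (hW : hilbert W) (sW : hseparable W) s t (Phi : R -> Z -> W) I :
  0 <= s -> s <= t -> integrand s Phi -> SI s Phi I ->
  integrand t (fun r x => if r <= s then Phi r x else 0) /\
  SI t (fun r x => if r <= s then Phi r x else 0) I.
Proof.
move=> s0 st iP sI; set Psi := (fun r x => _).
have iQ : integrand t Psi.
  split => [x|r /andP[r0 rt]]; last first.
    rewrite /Psi; case: (leP r s) => rs; last exact: bounded_op0.
    by apply: iP.2; rewrite r0.
  have mA : measurable (`]-oo, s]%classic : set (measurableTypeR R)) by exact: measurable_itv.
  apply: (eq_wmeas (f := fun r => if pselect ((`]-oo, s]%classic : set R) r) then Phi r x else 0)).
    move=> r _; rewrite /Psi; case: pselect => /=; rewrite in_itv/=; first by move=> ->.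
    by move=> /negP/negbTE ->.
  apply: (wmeas_restrict hW (measurable_cc 0 t) mA).
  apply: (wmeasS _ _ (iP.1 x)); first exact: measurable_cc.
  by move=> r /= []; rewrite !in_itv/= => /andP[-> _].
split => //; apply: SI_intro => //; first exact: (SI_wmeas hW sW sI).
move=> ep ep0; have [q [q1 q2]] := SI_near hZ hQh hEe hW iP sI ep0; exists (el_ext st q); split; last exact: q2.
apply: le_trans q1.
have -> : (\int[leb]_(r in cc s) HS (fun x => Phi r x - el_fun q r x)%R =
    \int[leb]_(r in cc t `&` cc s) HS (fun x => Phi r x - el_fun q r x)%R)%E.
  congr (integral _ _ _); apply/seteqP; split => r /=; last by case.
  by rewrite !in_itv/= => /andP[-> rs]; rewrite rs (le_trans rs st).
rewrite integral_mkcondr le_eqVlt; apply/orP; left; apply/eqP.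
apply: eq_integral => r /set_mem; rewrite /= in_itv/= => /andP[r0 rt].
rewrite patchE mem_setE in_itv/= r0/= /Psi; case: (leP r s) => rs //.
rewrite /hs eseries0// => i _ _; rewrite el_ext_fun el_fun_out// subrr hnorm0// expr0n//.
Qed.

End StochasticIntegralCalculus.

(** * Fubini theorems and convolution with a semigroup *)

Section ProductDomains.
Context {R : realType} d1 d2 (T1 : measurableType d1) (T2 : measurableType d2).
Context (m1 : {sigma_finite_measure set T1 -> \bar R}) (m2 : {sigma_finite_measure set T2 -> \bar R}).
Context (D1 : set T1) (D2 : set T2) (mD1 : measurable D1) (mD2 : measurable D2).
Local Open Scope ereal_scope.

Let patch_fst (f : T1 * T2 -> \bar R) x : D1 x ->
  (fun y => (f \_ (D1 `*` D2)) (x, y)) = (fun y => f (x, y)) \_ D2.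
Proof.
move=> Dx; apply/funext => y; rewrite !patchE; case: ifPn => [/set_mem [_ Dy]|h].
  by rewrite mem_set.
by rewrite ifF//; apply/negbTE; apply: contra h => /set_mem Dy; apply/mem_set; split.
Qed.

Lemma integral_patch_fst (f : T1 * T2 -> \bar R) :
  (fun x => \int[m2]_y (f \_ (D1 `*` D2)) (x, y)) = (fun x => \int[m2]_(y in D2) f (x, y)) \_ D1.
Proof.
apply/funext => x; rewrite patchE; case: ifPn => [/set_mem Dx|/negP h].
  by rewrite [RHS]integral_mkcond -(patch_fst f Dx).
rewrite -[RHS](integral0 m2 setT); apply: eq_integral => y _; rewrite patchE ifF//.
by apply/negP => /set_mem [Dx _]; apply: h; exact/mem_set.
Qed.

Lemma integral_patch_snd (f : T1 * T2 -> \bar R) :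
  (fun y => \int[m1]_x (f \_ (D1 `*` D2)) (x, y)) = (fun y => \int[m1]_(x in D1) f (x, y)) \_ D2.
Proof.
apply/funext => y; rewrite patchE; case: ifPn => [/set_mem Dy|/negP h].
  rewrite [RHS]integral_mkcond; apply: eq_integral => x _; rewrite !patchE.
  case: ifPn => [/set_mem [Dx _]|hn]; first by rewrite mem_set.
  by rewrite ifF//; apply/negbTE; apply: contra hn => /set_mem Dx; apply/mem_set; split.
rewrite -[RHS](integral0 m1 setT); apply: eq_integral => x _; rewrite patchE ifF//.
by apply/negP => /set_mem [_ Dy]; apply: h; exact/mem_set.
Qed.

Lemma tonelli_setX (f : T1 * T2 -> \bar R) : measurable_fun (D1 `*` D2) f ->
  (forall p, (D1 `*` D2) p -> 0 <= f p) ->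
  [/\ measurable_fun D1 (fun x => \int[m2]_(y in D2) f (x, y)),
      measurable_fun D2 (fun y => \int[m1]_(x in D1) f (x, y))
    & \int[m1]_(x in D1) \int[m2]_(y in D2) f (x, y) =
      \int[m2]_(y in D2) \int[m1]_(x in D1) f (x, y)].
Proof.
move=> mf f0; pose g : T1 * T2 -> \bar R := f \_ (D1 `*` D2).
have mDD : measurable (D1 `*` D2) by exact: measurableX.
have mg : measurable_fun setT g by exact: (iffLR (measurable_restrictT _ mDD) mf).
have g0 p : 0 <= g p.
  by rewrite /g patchE; case: ifPn => // /set_mem; exact: f0.
split.
- apply: (iffRL (measurable_restrictT _ mD1)); rewrite -integral_patch_fst.
  have h := measurable_fun_fubini_tonelli_F (m2 := m2) g mg g0; exact h.
- apply: (iffRL (measurable_restrictT _ mD2)); rewrite -integral_patch_snd.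
  have h := measurable_fun_fubini_tonelli_G (m1 := m1) g mg g0; exact h.
- rewrite [LHS]integral_mkcond [RHS]integral_mkcond -integral_patch_fst -integral_patch_snd.
  have h := fubini_tonelli (m1 := m1) (m2 := m2) g mg g0; exact h.
Qed.

Lemma fubini_setX (f : T1 * T2 -> \bar R) : measurable_fun (D1 `*` D2) f ->
  \int[m1]_(x in D1) \int[m2]_(y in D2) `|f (x, y)| < +oo ->
  [/\ measurable_fun D1 (fun x => \int[m2]_(y in D2) f (x, y)),
      measurable_fun D2 (fun y => \int[m1]_(x in D1) f (x, y))
    & \int[m1]_(x in D1) \int[m2]_(y in D2) f (x, y) =
      \int[m2]_(y in D2) \int[m1]_(x in D1) f (x, y)].
Proof.
move=> mf fi; pose g : T1 * T2 -> \bar R := f \_ (D1 `*` D2).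
have mDD : measurable (D1 `*` D2) by exact: measurableX.
have mg : measurable_fun setT g by exact: (iffLR (measurable_restrictT _ mDD) mf).
have ig : (m1 \x m2).-integrable setT g.
  apply/(integrable12ltyP m1 m2 mg); move: fi.
  rewrite [X in X < _ -> _]integral_mkcond -(integral_patch_fst (fun p => `|f p|)) => fi.
  apply: le_lt_trans fi; rewrite le_eqVlt; apply/orP; left; apply/eqP.
  apply: eq_integral => x _; apply: eq_integral => y _.
  by rewrite /g !patchE; case: ifP => //; rewrite abse0.
split.
- apply: (iffRL (measurable_restrictT _ mD1)); rewrite -integral_patch_fst.
  have h := measurable_fubini_F ig; exact h.
- apply: (iffRL (measurable_restrictT _ mD2)); rewrite -integral_patch_snd.
  have h := measurable_fubini_G ig; exact h.
- rewrite [LHS]integral_mkcond [RHS]integral_mkcond -integral_patch_fst -integral_patch_snd.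
  have h := Fubini ig; exact h.
Qed.

End ProductDomains.

Section StrongFubini.
Context {R : realType} {k : scalar_kind} (V : ipSpace R k) (hV : hilbert V) (sV : hseparable V).
Context d1 d2 (T1 : measurableType d1) (T2 : measurableType d2).
Context (m1 : {sigma_finite_measure set T1 -> \bar R}) (m2 : {sigma_finite_measure set T2 -> \bar R}).
Context (D1 : set T1) (D2 : set T2) (mD1 : measurable D1) (mD2 : measurable D2).
Hypothesis fin1 : (m1 D1 < +oo)%E.

(** Scalar Fubini is applied to <K, w> for each test vector w. Weak measurability of the partial
    integrals a and b comes out of the same application, and their integrals agree because their
    scalar tests do. *)
Lemma bint_fubini (K : T1 -> T2 -> V) (a : T1 -> V) (b : T2 -> V) :
  wmeas (D1 `*` D2) (fun p => K p.1 p.2) ->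
  (\int[m1]_(x in D1) \int[m2]_(y in D2) (hnorm (K x y))%:E < +oo)%E ->
  (forall x, D1 x -> bint m2 D2 (K x) (a x)) ->
  (forall y, D2 y -> bint m1 D1 (K^~ y) (b y)) ->
  exists v, bint m1 D1 a v /\ bint m2 D2 b v.
Proof.
move=> mK fK ha hb.
have mDD : measurable (D1 `*` D2) by exact: measurableX.
have mn : measurable_fun (D1 `*` D2) (fun p => (hnorm (K p.1 p.2))%:E).
  by apply/measurable_EFinP; exact: wmeas_norm.
have [n1 n2 n3] := tonelli_setX m1 m2 mD1 mD2 mn (fun p _ => hnorm_ge0 _).
have fK' : (\int[m2]_(y in D2) \int[m1]_(x in D1) (hnorm (K x y))%:E < +oo)%E by rewrite -n3.
have fub w : [/\ measurable_fun D1 (fun x => rip (a x) w), measurable_fun D2 (fun y => rip (b y) w)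
   & \int[m1]_(x in D1) rip (a x) w = \int[m2]_(y in D2) rip (b y) w].
  pose f p := (rip (K p.1 p.2) w)%:E.
  have mf : measurable_fun (D1 `*` D2) f by apply/measurable_EFinP; exact: mK.
  have fi : (\int[m1]_(x in D1) \int[m2]_(y in D2) `|f (x, y)| < +oo)%E.
    apply: (@le_lt_trans _ _ (\int[m1]_(x in D1) ((hnorm w)%:E * \int[m2]_(y in D2) (hnorm (K x y))%:E))%E).
      apply: nonneg_le_integral => x Dx; first by apply: integral_ge0.
      have [mx _ _] := ha x Dx.
      rewrite -ge0_integralZl_EFin ?hnorm_ge0//; last first.
      - by apply/measurable_EFinP; exact: wmeas_norm.
      - by move=> y _; rewrite lee_fin hnorm_ge0.
      apply: nonneg_le_integral => y Dy //.
      by rewrite -EFinM lee_fin mulrC rip_le.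
    rewrite ge0_integralZl_EFin ?hnorm_ge0//; last first.
      by move=> x _; apply: integral_ge0 => y _; rewrite lee_fin hnorm_ge0.
    by apply: lte_mul_pinfty => //; rewrite lee_fin hnorm_ge0.
  have [f1 f2 f3] := fubini_setX mD1 mD2 mf fi.
  have ea x : D1 x -> rip (a x) w = fine (\int[m2]_(y in D2) f (x, y)).
    by move=> /ha [_ _ ->].
  have eb y : D2 y -> rip (b y) w = fine (\int[m1]_(x in D1) f (x, y)).
    by move=> /hb [_ _ ->].
  have fa x : D1 x -> (\int[m2]_(y in D2) f (x, y))%E = (rip (a x) w)%:E.
    move=> Dx; have [mx nx ->] := ha x Dx; rewrite fineK//.
    by apply: integrable_fin_num => //; exact: integrable_rip.
  have fb y : D2 y -> (\int[m1]_(x in D1) f (x, y))%E = (rip (b y) w)%:E.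
    move=> Dy; have [mx nx ->] := hb y Dy; rewrite fineK//.
    by apply: integrable_fin_num => //; exact: integrable_rip.
  split.
  - apply/measurable_EFinP; apply: eq_measurable_fun f1 => x /set_mem Dx; exact: fa.
  - apply/measurable_EFinP; apply: eq_measurable_fun f2 => x /set_mem Dx; exact: fb.
  - rewrite /Rintegral; congr fine.
    rewrite (eq_integral (fun x => \int[m2]_(y in D2) f (x, y))%E); last first.
      by move=> x /set_mem Dx; rewrite fa.
    rewrite f3; apply: eq_integral => y /set_mem Dy; exact: fb.
have wa : wmeas D1 a by move=> w; case: (fub w).
have wb : wmeas D2 b by move=> w; case: (fub w).
have na : (\int[m1]_(x in D1) (hnorm (a x))%:E < +oo)%E.
  apply: le_lt_trans fK; apply: nonneg_le_integral => x Dx; first by rewrite lee_fin hnorm_ge0.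
  exact (bint_le hV sV mD2 (ha x Dx)).
have nb : (\int[m2]_(y in D2) (hnorm (b y))%:E < +oo)%E.
  apply: le_lt_trans fK'; apply: nonneg_le_integral => y Dy; first by rewrite lee_fin hnorm_ge0.
  exact (bint_le hV sV mD1 (hb y Dy)).
have [v hv] := bint_exists hV sV mD1 fin1 wa na.
exists v; split=> //; split => // w; have [_ _ <-] := fub w; by case: hv.
Qed.

End StrongFubini.

Section TimeIntegralTools.
Context {R : realType} {k : scalar_kind} (V : ipSpace R k) (hV : hilbert V) (sV : hseparable V).
Local Notation mu := (@lebesgue_measure R).
Local Notation tint a b f v := (bint mu `[a, b]%classic (f : R -> V) v).
Local Notation dom a b := (`[a, b]%classic : set (measurableTypeR R)).
Implicit Types (f g : R -> V) (v w : V) (a b c t : R).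

Lemma eq_tint_ae a b f g v : {ae mu, forall s, dom a b s -> f s = g s} -> wmeas (dom a b) g ->
  tint a b f v -> tint a b g v.
Proof.
move=> fg mg hf; have [mf _ _] := hf; apply/(tint_bochner hV) => //.
by apply: (is_bochner_eq_ae fg); apply/(tint_bochner hV).
Qed.

Lemma tint_ex a b f : wmeas (dom a b) f -> (\int[mu]_(s in `[a, b]) (hnorm (f s))%:E < +oo)%E ->
  exists v, tint a b f v.
Proof.
move=> mf nf; have := bint_exists hV sV (measurable_cc a b) (lebesgue_itv_fin a b) mf nf.
exact.
Qed.

Lemma tint_sub a b c d f v : a <= c -> d <= b -> tint a b f v -> exists w, tint c d f w.
Proof.
move=> ac db [mf nf _]; have sub : dom c d `<=` dom a b.
  by move=> x /=; rewrite !in_itv/= => /andP[h1 h2]; rewrite (le_trans ac h1) (le_trans h2 db).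
apply: tint_ex; first exact: (wmeasS (measurable_cc a b) sub mf).
apply: le_lt_trans nf; apply: ge0_subset_integral => //; try exact: measurable_cc.
- by apply/measurable_EFinP; apply: wmeas_norm => //; exact: measurable_cc.
- by move=> x _; rewrite lee_fin hnorm_ge0.
Qed.

(** [is_bochner] determines f only up to a null set. The limit of its simple functions, set to 0
    where it fails to exist, is a measurable representative with the same integral. *)
Lemma bochner_rep a b f v : is_bochner mu `[a, b]%classic f v ->
  exists g, tint a b g v /\ {ae mu, forall s, dom a b s -> f s = g s}.
Proof.
move=> hf; have [s [s1 _ _]] := hf.
pose g x := hlim_or0 (fun i => sf_fun (s i) x).
have fg : {ae mu, forall x, dom a b x -> f x = g x}.
  apply: aeS s1 => x h Dx; rewrite /g (@hlim_or0_lim _ _ _ hV _ (f x))//.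
  by rewrite /hlim; under eq_fun do rewrite (hnormBC hV); exact: h.
have mg : wmeas (dom a b) g.
  apply: (wmeas_hlim_or0 hV sV (measurable_cc a b)) => n.
  by apply: sf_fun_wmeas => //; exact: measurable_cc.
exists g; split => //; apply/(tint_bochner hV) => //.
exact: (is_bochner_eq_ae fg hf).
Qed.

(** Cutting off by 0 turns integrals over intervals of varying length into integrals over a fixed
    one, where dominated convergence and Fubini apply. *)
Lemma tint_ext0 a b c d f v : a <= c -> d <= b -> tint c d f v ->
  tint a b (fun s => if c <= s <= d then f s else 0) v.
Proof.
move=> ac db [mf nf wf]; have sub : dom c d `<=` dom a b.
  by move=> x /=; rewrite !in_itv/= => /andP[h1 h2]; rewrite (le_trans ac h1) (le_trans h2 db).
have DI : dom a b `&` dom c d = dom c d by apply/setIidr.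
have mem_cd x : (x \in dom c d) = (c <= x <= d) by rewrite mem_setE in_itv.
split.
- apply: (eq_wmeas (f := fun s => if pselect (dom c d s) then f s else 0)).
    move=> s _; case: pselect => /=; rewrite in_itv/=; first by move=> ->.
    by move=> /negP/negbTE ->.
  apply: wmeas_restrict => //; try exact: measurable_cc.
  by rewrite DI.
- rewrite -DI integral_mkcondr in nf; apply: le_lt_trans nf.
  apply: nonneg_le_integral => x _; first by rewrite lee_fin hnorm_ge0.
  by rewrite patchE mem_cd; case: ifP => _ //; rewrite hnorm0.
- move=> w; rewrite wf /Rintegral -[in LHS]DI integral_mkcondr; congr fine.
  apply: eq_integral => x _; rewrite patchE mem_cd; case: ifP => _ //.
  by rewrite rip0l.
Qed.

Lemma tint_dct a b (fn : nat -> R -> V) f (vn : nat -> V) v (g : R -> \bar R) :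
  (forall n, tint a b (fn n) (vn n)) -> tint a b f v ->
  {ae mu, forall s, dom a b s -> hlim (fun n => fn n s) (f s)} ->
  measurable_fun (dom a b) g -> (\int[mu]_(s in `[a, b]) g s < +oo)%E ->
  (forall n s, dom a b s -> ((hnorm (fn n s))%:E <= g s)%E) ->
  hlim vn v.
Proof.
move=> hn hf cv mg ig le_g; have [mf nf _] := hf.
have mD := measurable_cc a b.
pose phi n s := (hnorm (fn n s - f s))%:E : \bar R.
have md n : tint a b (fun s => fn n s - f s) (vn n - v) by exact: tintB.
have mphi n : measurable_fun (dom a b) (phi n).
  by apply/measurable_EFinP; apply: wmeas_norm => //; case: (md n).
have mnf : measurable_fun (dom a b) (fun s => (hnorm (f s))%:E).
  by apply/measurable_EFinP; exact: wmeas_norm.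
have g0 s : dom a b s -> (0 <= g s)%E.
  by move=> Ds; apply: le_trans (le_g 0%N s Ds); rewrite lee_fin hnorm_ge0.
have ib : mu.-integrable (dom a b) (fun s => g s + (hnorm (f s))%:E)%E.
  apply/integrableP; split; first exact: emeasurable_funD.
  apply: le_lt_trans (lte_add_pinfty ig nf).
  rewrite -ge0_integralD//; last by move=> s _; rewrite lee_fin hnorm_ge0.
  apply: nonneg_le_integral => s Ds; first exact: abse_ge0.
  by rewrite gee0_abs// adde_ge0 ?g0// lee_fin hnorm_ge0.
have dom_phi : {ae mu, forall s, forall n, dom a b s -> (`|phi n s| <= g s + (hnorm (f s))%:E)%E}.
  apply: aeW => s n Ds; rewrite gee0_abs ?lee_fin ?hnorm_ge0// /phi.
  by apply: le_trans (leeD (le_g n s Ds) (lexx _)); rewrite -EFinD lee_fin hnormB.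
have cv0 : {ae mu, forall s, dom a b s -> phi n s @[n --> \oo] --> 0%E}.
  by apply: aeS cv => s h Ds; apply/fine_cvgP; split; [exact: nearW|exact: h].
have [_ _] := dominated_convergence mD mphi (measurable_cst _) cv0 ib dom_phi.
rewrite integral0 => /ecvg0_nat h; apply/hlimP => ep ep0.
have ep2 : 0 < ep / 2 by rewrite divr_gt0.
have [|N hN] := h _ (ep / 2) ep2; first by move=> n; apply: integral_ge0 => s _; rewrite lee_fin hnorm_ge0.
exists N => n Nn; apply: (@le_lt_trans _ _ (ep / 2)); last by rewrite ltr_pdivrMr// ltr_pMr// ltr1n.
rewrite -lee_fin; apply: le_trans (hN n Nn).
exact (bint_le hV sV mD (md n)).
Qed.

End TimeIntegralTools.

Section SemigroupConvolution.
Context {R : realType} {k : scalar_kind} (V : ipSpace R k) (hV : hilbert V) (sV : hseparable V).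
Context (S : R -> V -> V) (hS : C0_semigroup S).
Local Notation mu := (@lebesgue_measure R).
Local Notation tint a b f v := (bint mu `[a, b]%classic (f : R -> V) v).
Local Notation dom a b := (`[a, b]%classic : set (measurableTypeR R)).
Local Notation Phi := (sg_int S).
Implicit Types (g : R -> V) (t : R).

(** Expanding G in an orthonormal sequence gives sums of measurable scalars times S(tau) e_i, and
    each orbit of a fixed vector is measurable in time. *)
Lemma sg_wmeas_comp d (T : measurableType d) (D : set T) (tau : T -> R) (G : T -> V) (b : R) :
  measurable D -> measurable_fun D tau -> (forall x, D x -> 0 <= tau x <= b) ->
  wmeas D G -> wmeas D (fun x => S (tau x) (G x)).
Proof.
move=> mD mtau tauD mG; have [e he] := onb_seq_exists hV sV.
apply: (@wmeas_lim _ _ _ hV _ _ _ (fun n x => \sum_(i < n) ip (G x) (e i) *: S (tau x) (e i))) => //.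
- move=> n; apply: wmeas_sum => // i; apply: wmeasZ => //; [|exact: wmeas_Im|].
    exact: mG.
  have := @wmeas_comp _ _ V _ _ _ _ (dom 0 b) D (S^~ (e i)) tau (measurable_cc 0 b).
  apply => //; last exact: sg_wmeas.
  by move=> _ [x Dx <-]; rewrite /= in_itv/= tauD.
- move=> x Dx; have /andP[t0 _] := tauD x Dx; have bS := sg_bop hS t0.
  have := hlim_bounded hV hV bS (onb_expansion hV he (G x)); congr hlim.
  by apply/funext => n /=; rewrite (bop_sum bS); apply: eq_bigr => i _; rewrite (bopZ bS).
Qed.

Lemma conv_wmeas t g : wmeas (dom 0 t) g -> wmeas (dom 0 t) (fun s => S (t - s) (g s)).
Proof.
move=> mg; have mtau : measurable_fun (dom 0 t) (fun s : measurableTypeR R => t - s).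
  by apply: measurable_funB => //; exact: measurable_id.
have ht s : dom 0 t s -> 0 <= t - s <= t.
  by rewrite /= in_itv/= => /andP[s0 st]; rewrite subr_ge0 st lerBlDr lerDl.
exact: (sg_wmeas_comp (measurable_cc 0 t) mtau ht mg).
Qed.

Lemma conv_ex t g : wmeas (dom 0 t) g -> (\int[mu]_(s in `[0%R, t]) (hnorm (g s))%:E < +oo)%E ->
  exists v, tint 0 t (fun s => S (t - s) (g s)) v.
Proof.
move=> mg ng; apply: tint_ex => //; first exact: conv_wmeas.
have [M M1 hM] := sg_bound hV hS t.
have M0 : 0 <= M by exact: le_trans M1.
apply: (@le_lt_trans _ _ (\int[mu]_(s in `[0%R, t]) (M%:E * (hnorm (g s))%:E))%E).
  apply: nonneg_le_integral => s; first by rewrite lee_fin hnorm_ge0.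
  rewrite /= in_itv/= => /andP[s0 st]; rewrite -EFinM lee_fin hM//.
  by rewrite subr_ge0 st lerBlDr lerDl.
rewrite ge0_integralZl_EFin//; last first.
- by apply/measurable_EFinP; apply: wmeas_norm => //; exact: measurable_cc.
- by move=> s _; rewrite lee_fin hnorm_ge0.
exact: lte_mul_pinfty.
Qed.

(** Fubini on the triangle r <= s, with the kernel extended by 0. The exponent tau is left general
    because both s - r and t - s occur. *)
Lemma triangle_fubini t g (tau : R -> R -> R) (a b : R -> V) :
  0 <= t -> wmeas (dom 0 t) g -> (\int[mu]_(s in `[0%R, t]) (hnorm (g s))%:E < +oo)%E ->
  measurable_fun (dom 0 t `*` dom 0 t) (fun p => tau p.1 p.2) ->
  (forall s r, 0 <= r -> r <= s -> s <= t -> 0 <= tau s r <= t) ->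
  (forall s, 0 <= s <= t -> tint 0 s (fun r => S (tau s r) (g r)) (a s)) ->
  (forall r, 0 <= r <= t -> tint r t (fun s => S (tau s r) (g r)) (b r)) ->
  exists v, tint 0 t a v /\ tint 0 t b v.
Proof.
move=> t0 mg ng mtau htau ha hb.
have mD := measurable_cc 0 t.
have mDD : measurable (dom 0 t `*` dom 0 t) by exact: measurableX.
pose K s r := if 0 <= r <= s then S (tau s r) (g r) else 0.
have [M M1 hM] := sg_bound hV hS t.
have M0 : 0 <= M by exact: le_trans M1.
have inD s : dom 0 t s = (0 <= s <= t) :> Prop by rewrite /= in_itv.
have nK : (\int[mu]_(x in `[0%R, t]) \int[mu]_(y in `[0%R, t]) (hnorm (K x y))%:E < +oo)%E.
  pose c := (M%:E * \int[mu]_(r in `[0%R, t]) (hnorm (g r))%:E)%E.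
  have c0 : (0 <= c)%E.
    by rewrite mule_ge0 ?lee_fin//; apply: integral_ge0 => r _; rewrite lee_fin hnorm_ge0.
  have cfin : (c < +oo)%E by apply: lte_mul_pinfty.
  apply: (@le_lt_trans _ _ (c * mu (dom 0%R t))%E); last first.
    by apply: lte_mul_pinfty; [|rewrite ge0_fin_numE|exact: lebesgue_itv_fin].
  rewrite -integral_cst//; apply: nonneg_le_integral => s; rewrite inD => /andP[s0 st].
    by apply: integral_ge0 => r _; rewrite lee_fin hnorm_ge0.
  rewrite /= /c -ge0_integralZl_EFin//; last first.
  + by apply/measurable_EFinP; apply: wmeas_norm => //; exact: measurable_cc.
  + by move=> r _; rewrite lee_fin hnorm_ge0.
  apply: nonneg_le_integral => r; rewrite inD => /andP[r0 rt]; first by rewrite lee_fin hnorm_ge0.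
  rewrite -EFinM lee_fin /K r0/=; case: ifP => rs; first by apply: hM; exact: htau.
  by rewrite hnorm0// mulr_ge0// hnorm_ge0.
have fub := @bint_fubini R k V hV sV _ _ _ _ (@lebesgue_measure R) (@lebesgue_measure R) (dom 0 t)
  (dom 0 t) mD mD (lebesgue_itv_fin 0 t) K a b; apply: fub.
- pose A : set (measurableTypeR R * measurableTypeR R) := [set p | p.2 <= p.1].
  have mA : measurable A.
    rewrite -[A]setTI; apply: (measurable_fun_le (f := snd) (g := fst)) => //.
  apply: (eq_wmeas (f := fun p => if pselect (A p) then S (tau p.1 p.2) (g p.2) else 0)).
    move=> [s r] [] /=; rewrite !in_itv/= => _ /andP[r0 _]; rewrite /K r0/=.
    rewrite /A /=; case: pselect => /=; first by move=> ->.
    by move=> /negP/negbTE ->.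
  apply: wmeas_restrict => //.
  apply: (sg_wmeas_comp (b := t)) => //; first exact: measurableI.
  + exact: measurable_funS mtau.
  + by move=> [s r] [[/=]]; rewrite !in_itv/= => /andP[_ st] /andP[r0 _] rs; exact: htau.
  + apply: (@wmeasS _ _ _ _ _ _ (dom 0 t `*` dom 0 t)) => //.
    apply: (wmeas_comp mD _ _ mg) => //; first by move=> _ [p [_ hp] <-].
    by apply: measurable_funTS.
- exact: nK.
- by move=> s; rewrite inD => /andP[s0 st]; apply: tint_ext0 => //; apply: ha; rewrite s0.
- move=> r; rewrite inD => /andP[r0 rt].
  have h := tint_ext0 hV r0 (lexx t) (hb r (introT andP (conj r0 rt))).
  apply: eq_tint h => s /andP[s0 st].
  by rewrite /K r0 st andbT.
Qed.

(** For fixed r the integral of S(s-r) g(r) over s in [r, t] is Phi(t-r) g(r): integrating a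
    convolution replaces the semigroup by the integrated one. *)
Lemma conv_integral t g (a : R -> V) :
  0 <= t -> wmeas (dom 0 t) g -> (\int[mu]_(s in `[0%R, t]) (hnorm (g s))%:E < +oo)%E ->
  (forall s, 0 <= s <= t -> tint 0 s (fun r => S (s - r) (g r)) (a s)) ->
  exists v, tint 0 t a v /\ tint 0 t (fun r => Phi (t - r) (g r)) v.
Proof.
move=> t0 mg ng ha.
apply: (triangle_fubini (g := g) (tau := fun s r => s - r)) => //.
- by apply: measurable_funTS; apply: measurable_funB.
- by move=> s r r0 rs st; rewrite subr_ge0 rs lerBlDr (le_trans st)// lerDl.
- move=> r /andP[r0 rt]; apply: (@tint_shift _ _ _ hV sV r t (- r) (S^~ (g r))).
  by rewrite subrr; exact: sg_intP.
Qed.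

(** Convolving S with the primitive of g gives the same Phi-convolution as integrating the
    convolution with g; the inner integral is now that of S(t-s) g(r). *)
Lemma conv_primitive t g (a : R -> V) :
  0 <= t -> wmeas (dom 0 t) g -> (\int[mu]_(s in `[0%R, t]) (hnorm (g s))%:E < +oo)%E ->
  (forall s, 0 <= s <= t -> tint 0 s g (a s)) ->
  exists v, tint 0 t (fun s => S (t - s) (a s)) v /\ tint 0 t (fun r => Phi (t - r) (g r)) v.
Proof.
move=> t0 mg ng ha.
apply: (triangle_fubini (g := g) (tau := fun s r => t - s)) => //.
- by apply: measurable_funTS; apply: measurable_funB.
- by move=> s r r0 rs st; rewrite subr_ge0 st lerBlDr lerDl (le_trans r0 rs).
- move=> s hs; have /andP[s0 st] := hs; apply: tint_bop => //; last exact: ha.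
  by apply: (sg_bop hS); rewrite subr_ge0.
- move=> r /andP[r0 rt]; apply: (@tint_refl _ _ _ hV sV r t t (S^~ (g r))).
  by rewrite subrr; exact: sg_intP.
Qed.

End SemigroupConvolution.

Section GeneratorConvolution.
Context {R : realType} {k : scalar_kind} (V : ipSpace R k) (hV : hilbert V) (sV : hseparable V).
Context (A : unbounded V V) (S : R -> V -> V) (gAS : generates A S).
Local Notation mu := (@lebesgue_measure R).
Local Notation tint a b f v := (bint mu `[a, b]%classic (f : R -> V) v).
Local Notation dom a b := (`[a, b]%classic : set (measurableTypeR R)).
Local Notation Phi := (sg_int S).
Local Notation fin a b g := (\int[mu]_(s in `[a%R, b%R]) (hnorm (g s))%:E < +oo)%E.
Let hS : C0_semigroup S := proj1 gAS.
Implicit Types (f g : R -> V) (t : R).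

(* Hille's theorem. *)
Lemma gen_tint_comm a b f phi v z : tint a b f v -> tint a b phi z ->
  {ae mu, forall s, dom a b s -> udom A (f s) /\ A (f s) = phi s} ->
  udom A v /\ A v = z.
Proof.
move=> hf hphi Af; apply: (gen_crit hV sV gAS ltr01) => h h0 _.
have bS := sg_bop hS (ltW h0); have bP := sg_int_bop hV sV hS (ltW h0).
have i1 := tintB hV sV (tint_bop hV sV hV bS hf) hf.
have i2 := tint_bop hV sV hV bP hphi.
apply: (tint_uniq hV _ i2); apply: (eq_tint_ae hV sV _ _ i1); last by case: i2.
by apply: aeS Af => s h' Ds; have [u1 <-] := h' Ds; rewrite (sg_int_gen hV sV gAS (ltW h0) u1).
Qed.

Lemma sub_dom s t : s <= t -> dom 0 s `<=` dom 0 t.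
Proof. by move=> st x /=; rewrite !in_itv/= => /andP[-> h]; rewrite (le_trans h st). Qed.

Lemma sub_fin s t g : s <= t -> wmeas (dom 0 t) g -> fin 0 t g -> fin 0 s g.
Proof.
move=> st mg; apply: le_lt_trans; apply: ge0_subset_integral => //; try exact: measurable_cc.
- by apply/measurable_EFinP; apply: wmeas_norm => //; exact: measurable_cc.
- by move=> x _; rewrite lee_fin hnorm_ge0.
- exact: sub_dom.
Qed.

Lemma conv_ex_sub s t g : s <= t -> wmeas (dom 0 t) g -> fin 0 t g ->
  exists v, tint 0 s (fun r => S (s - r) (g r)) v.
Proof.
move=> st mg ng; apply: conv_ex => //; last exact: (sub_fin st).
exact: (wmeasS (measurable_cc 0 t) (sub_dom st) mg).
Qed.

(** As g takes values in D(A), Hille's theorem gives A y(s) as the convolution with gam = A g. Its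
    time integral is the integral of Phi(t-r) A g(r) = S(t-r) g(r) - g(r), that is, y(t) minus the
    integral of g. *)
Lemma conv_strong t g gam y : 0 <= t ->
  (forall s, 0 <= s <= t -> udom A (g s) /\ A (g s) = gam s) ->
  wmeas (dom 0 t) g -> fin 0 t g -> wmeas (dom 0 t) gam -> fin 0 t gam ->
  (forall s, 0 <= s <= t -> tint 0 s (fun r => S (s - r) (g r)) (y s)) ->
  (forall s, 0 <= s <= t -> udom A (y s)) /\ tint 0 t (fun s => A (y s) + g s) (y t).
Proof.
move=> t0 Ag mg ng mgam ngam hy.
have zex s : exists z, 0 <= s <= t -> tint 0 s (fun r => S (s - r) (gam r)) z.
  have [/andP[s0 st]|_] := boolP (0 <= s <= t); last by exists 0.
  by have [z hz] := conv_ex_sub st mgam ngam; exists z.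
have [z hz] := choice zex.
have Ay s : 0 <= s <= t -> udom A (y s) /\ A (y s) = z s.
  move=> hs; apply: (gen_tint_comm (hy s hs) (hz s hs)); apply: aeW => r /=.
  move: hs => /andP[s0 st]; rewrite in_itv/= => /andP[r0 rs].
  have [u1 u2] := Ag r (introT andP (conj r0 (le_trans rs st))).
  have sr : 0 <= s - r by rewrite subr_ge0.
  by have [h1 h2] := gen_S hV sV gAS sr u1; rewrite h2 u2.
split; first by move=> s /Ay[].
have [v [v1 v2]] := conv_integral hV sV hS t0 mgam ngam hz.
have [w hw] := tint_ex hV sV mg ng.
have tt : 0 <= t <= t by rewrite t0 lexx.
have e1 : tint 0 t (fun r => Phi (t - r) (gam r)) (y t - w).
  apply: eq_tint (tintB hV sV (hy t tt) hw) => r /andP[r0 rt].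
  have [u1 u2] := Ag r (introT andP (conj r0 rt)).
  have tr : 0 <= t - r by rewrite subr_ge0.
  by rewrite -u2 (sg_int_gen hV sV gAS tr u1).
have ev : v + w = y t by rewrite (tint_uniq hV v2 e1) subrK.
rewrite -ev; apply: eq_tint (tintD hV sV v1 hw) => s hs.
by rewrite (proj2 (Ay s hs)).
Qed.

(** Integration by parts with all derivatives on the semigroup: the convolution with the primitive G
    is the Phi-convolution of gam, and A Phi(h) = S(h) - I. *)
Lemma conv_parts t gam G y q : 0 <= t -> wmeas (dom 0 t) gam -> fin 0 t gam ->
  (forall s, 0 <= s <= t -> tint 0 s gam (G s)) ->
  tint 0 t (fun r => S (t - r) (gam r)) y ->
  tint 0 t (fun r => S (t - r) (G r)) q ->
  udom A q /\ A q = y - G t.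
Proof.
move=> t0 mg ng hG hy hq.
have [v [v1 v2]] := conv_primitive hV sV hS t0 mg ng hG.
rewrite (tint_uniq hV hq v1).
have tt : 0 <= t <= t by rewrite t0 lexx.
apply: (gen_tint_comm v2 (tintB hV sV hy (hG t tt))); apply: aeW => r /=.
rewrite in_itv/= => /andP[r0 rt]; have tr : 0 <= t - r by rewrite subr_ge0.
exact: gen_int.
Qed.

(** Two evaluations of A applied to the integral of Y: by the assumed identity it is the integral of
    X - g, and by [conv_integral] together with A Phi = S - I it is Y(t) minus the integral of g. *)
Lemma conv_of_integrated t g Y X om : 0 <= t -> wmeas (dom 0 t) g -> fin 0 t g ->
  (forall s, 0 <= s <= t -> tint 0 s (fun r => S (s - r) (g r)) (Y s)) ->
  {ae mu, forall s, dom 0 t s -> udom A (Y s) /\ A (Y s) = X s - g s} ->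
  tint 0 t X om -> Y t = om.
Proof.
move=> t0 mg ng hY AY hX.
have [v [v1 v2]] := conv_integral hV sV hS t0 mg ng hY.
have [w hw] := tint_ex hV sV mg ng.
have tt : 0 <= t <= t by rewrite t0 lexx.
have [_ a1] := gen_tint_comm v1 (tintB hV sV hX hw) AY.
have [|_ a2] := gen_tint_comm v2 (tintB hV sV (hY t tt) hw).
  apply: aeW => r /=; rewrite in_itv/= => /andP[r0 rt].
  have tr : 0 <= t - r by rewrite subr_ge0.
  exact: gen_int.
by apply: (addIr (- w)); rewrite -a2 a1.
Qed.

(* Fubini evaluates the convolution of S with D in two ways, which gives
   int_0^s D = 0; Hille's theorem then yields D s = A 0. *)
Lemma gen_ivp_uniq t gam D : 0 <= t -> wmeas (dom 0 t) gam -> fin 0 t gam -> wmeas (dom 0 t) D ->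
  (forall s, 0 <= s <= t -> tint 0 s gam (D s)) ->
  {ae mu, forall s, dom 0 t s -> udom A (D s) /\ A (D s) = gam s} ->
  forall s, 0 <= s <= t -> D s = 0.
Proof.
move=> t0 mg ng mD hD AD s /andP[s0 st].
have sub := sub_dom st.
have mg' := wmeasS (measurable_cc 0 t) sub mg.
have mD' := wmeasS (measurable_cc 0 t) sub mD.
have ng' := sub_fin st mg ng.
have [|v [v1 v2]] := conv_primitive hV sV hS s0 mg' ng' (a := D).
  by move=> r /andP[r0 rs]; apply: hD; rewrite r0 (le_trans rs st).
have AD' : {ae mu, forall r, dom 0 s r -> udom A (D r) /\ A (D r) = gam r}.
  by apply: aeS AD => r h /sub.
have z : tint 0 s D 0.
  rewrite -(subrr v); apply: (eq_tint_ae hV sV _ _ (tintB hV sV v1 v2)) => //.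
  apply: aeS AD' => r h hr; have [u1 <-] := h hr.
  move: hr; rewrite /= in_itv/= => /andP[r0 rs]; have sr : 0 <= s - r by rewrite subr_ge0.
  by rewrite (sg_int_gen hV sV gAS sr u1) opprB addrC subrK.
have ss : 0 <= s <= t by rewrite s0.
have [_ <-] := gen_tint_comm z (hD s ss) AD'.
by have [_] := gen0 hV sV gAS.
Qed.

End GeneratorConvolution.

(** * Continuous paths and Riemann sums of convolutions *)

Section ContinuousPathIntegrals.
Context {R : realType} {k : scalar_kind} (V : ipSpace R k) (hV : hilbert V) (sV : hseparable V).
Local Notation mu := (@lebesgue_measure R).
Local Notation tint a b f v := (bint mu `[a, b]%classic (f : R -> V) v).
Local Notation dom a b := (`[a, b]%classic : set (measurableTypeR R)).
Implicit Types (f g : R -> V) (t T : R).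

Definition cont_path T g : Prop := forall t, 0 <= t <= T -> forall e, 0 < e ->
  exists2 dl, 0 < dl & forall s, 0 <= s <= T -> `|s - t| < dl -> hnorm (g s - g t) < e.

Lemma cont_path_hlim T g t (tn : nat -> R) : cont_path T g -> 0 <= t <= T ->
  (forall n, 0 <= tn n <= T) -> tn n @[n --> \oo] --> t -> hlim (fun n => g (tn n)) (g t).
Proof.
move=> cg ht htn cv; apply/hlimP => e e0; have [dl dl0 hd] := cg t ht e e0.
have /cvgrPdist_lt/(_ dl dl0) [N _ hN] := cv.
by exists N => n Nn; apply: hd => //; rewrite distrC; exact: hN.
Qed.

Lemma seq_cont_path T g : (forall t (tn : nat -> R), 0 <= t <= T -> (forall n, 0 <= tn n <= T) ->
  tn n @[n --> \oo] --> t -> hlim (fun n => g (tn n)) (g t)) -> cont_path T g.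
Proof.
move=> h t ht e e0; apply: contrapT => nex.
have bad n : exists s, [/\ 0 <= s <= T, `|s - t| < n.+1%:R^-1 & e <= hnorm (g s - g t)].
  apply: contrapT => nb; apply: nex; exists (n.+1%:R^-1); first by rewrite invr_gt0.
  move=> s hs st; rewrite ltNge; apply/negP => es; apply: nb; exists s; split => //.
have [s hs] := choice bad.
have cs : s n @[n --> \oo] --> t.
  apply/cvgrPdist_lt => d d0; have /cvgrPdist_lt/(_ d d0) [N _ hN] := @cvg_harmonic R.
  exists N => // n Nn; have [_ h1 _] := hs n; rewrite distrC (lt_trans h1)//.
  by have := hN n Nn; rewrite /= sub0r normrN gtr0_norm// /harmonic /= invr_gt0.
have /hlimP/(_ e e0) [N hN] := h t s ht (fun n => let: And3 x _ _ := hs n in x) cs.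
by have [_ _] := hs N; rewrite leNgt hN.
Qed.

(** Heine-Cantor by a supremum: c is the least upper bound of the lengths on which a uniform modulus
    exists, and continuity at c would push it further unless T has been reached. *)
Lemma cont_path_unif T g : 0 <= T -> cont_path T g -> forall e, 0 < e ->
  exists2 dl, 0 < dl & forall s t, 0 <= s <= T -> 0 <= t <= T -> `|s - t| < dl ->
    hnorm (g s - g t) < e.
Proof.
move=> T0 cg e e0.
pose P c := [/\ 0 <= c <= T & exists2 dl, 0 < dl & forall s t, 0 <= s <= c -> 0 <= t <= c ->
  `|s - t| < dl -> hnorm (g s - g t) < e].
have P0 : P 0.
  split; first by rewrite lexx.
  exists 1 => // s t; rewrite -!eq_le => /eqP <- /eqP <- _.
  by rewrite subrr hnorm0.
have ubP : ubound P T by move=> c [/andP[]].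
have hsP : has_sup P by split; [exists 0|exists T].
set c := sup P.
have c0 : 0 <= c by apply: ub_le_sup => //; exists T.
have cT : c <= T by apply: ge_sup => //; exists 0.
have hc : 0 <= c <= T by rewrite c0.
have e2 : 0 < e / 2 by rewrite divr_gt0.
have [eta eta0 heta] := cg c hc _ e2.
have eta2 : 0 < eta / 2 by rewrite divr_gt0.
have [b [/andP[b0 bT] [dl dl0 hdl]] bc] := sup_adherent eta2 hsP.
have bc' : c - eta / 2 < b by exact: bc.
(* Within eta / 2 of c on either side: two points that are not both below b lie in the neighbourhood
   of c and are compared through g c. *)
pose c' := Num.min T (c + eta / 2).
have near_c s : `|s - c| < eta -> 0 <= s <= T -> hnorm (g s - g c) < e / 2 by move=> *; exact: heta.
have Pc' : P c'.
  split; first by rewrite /c' le_min T0 ge_min lexx !andbT addr_ge0// ltW.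
  exists (Num.min dl (eta / 2)); first by rewrite lt_min dl0.
  move=> s t /andP[s0]; rewrite le_min => /andP[sT sc] /andP[t0]; rewrite le_min => /andP[tT tc].
  rewrite lt_min ltr_norml => /andP[st1 /ltr_normlP[st2 st3]].
  have [sb|sb] := leP s b; last first.
    have hs : `|s - c| < eta by rewrite ltr_norml; apply/andP; split; lra.
    have ht : `|t - c| < eta by rewrite ltr_norml; apply/andP; split; lra.
    apply: le_lt_trans (hnormDB hV _ (g c) _) _; rewrite [hnorm (g c - _)](hnormBC hV).
    by rewrite [ltRHS]splitr ltrD// near_c ?s0 ?t0.
  have [tb|tb] := leP t b; last first.
    have hs : `|s - c| < eta by rewrite ltr_norml; apply/andP; split; lra.
    have ht : `|t - c| < eta by rewrite ltr_norml; apply/andP; split; lra.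
    apply: le_lt_trans (hnormDB hV _ (g c) _) _; rewrite [hnorm (g c - _)](hnormBC hV).
    by rewrite [ltRHS]splitr ltrD// near_c ?s0 ?t0.
  by apply: hdl; rewrite ?s0 ?t0// ltr_norml.
have c'c : c' <= c by apply: ub_le_sup => //; exists T.
have cE : c' = T.
  have [h|h] := leP T (c + eta / 2); first by rewrite /c' min_l.
  by exfalso; move: c'c; rewrite /c' (min_r (ltW h)) gerDl leNgt eta2.
by move: Pc'; rewrite cE => -[_].
Qed.

Lemma cont_path_wmeas T g : 0 < T -> cont_path T g -> wmeas (dom 0 T) g.
Proof.
move=> T0 cg; apply: wmeas_path => // t ht; apply: (cont_path_hlim cg ht).
  by move=> n; exact: grid_mem.
by apply: grid_cvg => //; case/andP: ht.
Qed.

Lemma cont_path_bound T g : 0 <= T -> cont_path T g -> exists C, forall t, 0 <= t <= T -> hnorm (g t) <= C.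
Proof.
move=> T0 cg; have [dl dl0 hdl] := cont_path_unif T0 cg ltr01.
have [N hN] : exists N, T / N.+1%:R < dl.
  have /cvgrPdist_lt/(_ dl dl0) [N _ hN] := grid_mesh_cvg T.
  by exists N; have := hN N (leqnn N); rewrite sub0r normrN ger0_norm// divr_ge0.
exists (\sum_(i < N.+2) (hnorm (g (T / N.+1%:R * i%:R))) + 1) => t ht.
have [T0'|T0'] := ltP 0 T; last first.
  have tE : t = 0 by move: ht => /andP[t0 tT]; apply/eqP; rewrite eq_le t0 (le_trans tT).
  rewrite (bigD1 ord0)//= mulr0 tE -addrA lerDl addr_ge0// sumr_ge0// => i _; exact: hnorm_ge0.
have gE := grid_sum T0' N (fun s => hnorm (g s)) ht.
have /andP[t0 tT] := ht.
have near1 : hnorm (g t - g (grid T N t)) <= 1.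
  apply: ltW; apply: hdl => //; first exact: grid_mem.
  by apply: le_lt_trans hN; exact: grid_dist.
apply: (@le_trans _ _ (hnorm (g (grid T N t)) + 1)).
  have := hnormD hV (g t - g (grid T N t)) (g (grid T N t)); rewrite subrK; lra.
rewrite lerD2r gE; apply: ler_sum => i _; rewrite ler_piMl ?hnorm_ge0//.
Qed.

Lemma tint_partition f v (s : nat -> R) N : (forall i, s i <= s i.+1) ->
  tint (s 0%N) (s N) f v -> exists vi : nat -> V,
    (forall i, (i < N)%N -> tint (s i) (s i.+1) f (vi i)) /\ v = \sum_(i < N) vi i.
Proof.
move=> sS hf.
have smono i j : (i <= j)%N -> s i <= s j.
  move=> /subnK <-; elim: (j - i)%N => [//|m IH]; rewrite addSn; exact: le_trans IH (sS _).
have ex i : exists w, (i < N)%N -> tint (s i) (s i.+1) f w.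
  have [iN|_] := boolP (i < N)%N; last by exists 0.
  by have [w hw] := tint_sub hV sV (smono 0%N i isT) (smono _ _ iN) hf; exists w.
have [vi hvi] := choice ex; exists vi; split => //.
have sum n : (n <= N)%N -> tint (s 0%N) (s n) f (\sum_(i < n) vi i).
  elim: n => [_|n IH nN]; rewrite ?big_ord0 ?big_ord_recr/=.
    apply: tint_nil => //; have [mf _ _] := hf.
    apply: (wmeasS (measurable_cc _ _) _ mf) => x /=; rewrite !in_itv/= => /andP[h1 h2].
    by rewrite h1 (le_trans h2 (smono 0%N N isT)).
  have [mf _ _] := hf.
  apply: (tint_split hV sV (smono 0%N n isT) (sS n) _ (IH (ltnW nN)) (hvi n nN)).
  apply: (wmeasS (measurable_cc _ _) _ mf) => x /=; rewrite !in_itv/= => /andP[h1 h2].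
  by rewrite h1 (le_trans h2 (smono _ _ nN)).
exact: (tint_uniq hV hf (sum N (leqnn N))).
Qed.

End ContinuousPathIntegrals.

Section RiemannConvolution.
Context {R : realType} {k : scalar_kind} (V : ipSpace R k) (hV : hilbert V) (sV : hseparable V).
Context (S : R -> V -> V) (hS : C0_semigroup S).
Local Notation mu := (@lebesgue_measure R).
Local Notation tint a b f v := (bint mu `[a, b]%classic (f : R -> V) v).
Local Notation dom a b := (`[a, b]%classic : set (measurableTypeR R)).
Local Notation Phi := (sg_int S).
Implicit Types (g : R -> V) (t T : R).

Definition node t (n i : nat) : R := t / n.+1%:R * i%:R.

Lemma node0 t n : node t n 0 = 0.
Proof. by rewrite /node mulr0. Qed.

Lemma node_last t n : node t n n.+1 = t.
Proof. by rewrite /node divfK// pnatr_eq0. Qed.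

Lemma nodeS t n i : node t n i.+1 = node t n i + t / n.+1%:R.
Proof. by rewrite /node -[i.+1%:R]natr1 mulrDr mulr1. Qed.

Lemma node_le t n i : 0 <= t -> node t n i <= node t n i.+1.
Proof. by move=> t0; rewrite nodeS lerDl divr_ge0. Qed.

Lemma node_itv t n i : 0 <= t -> (i <= n.+1)%N -> 0 <= node t n i <= t.
Proof.
move=> t0 ni; rewrite /node mulr_ge0 ?divr_ge0//=.
by rewrite -[leRHS](node_last t n) ler_wpM2l ?divr_ge0// ler_nat.
Qed.

Lemma sg_int_piece t a b x : 0 <= a -> a <= b -> b <= t ->
  tint a b (fun r => S (t - r) x) (Phi (t - a) x - Phi (t - b) x).
Proof.
move=> a0 ab bt; have tb : 0 <= t - b by rewrite subr_ge0.
have tab : t - b <= t - a by rewrite lerB.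
have [w hw] := sg_int_ex hV sV hS (t - a) x tb.
have ta : 0 <= t - a by exact: le_trans tb tab.
have h := tint_split hV sV tb tab (sg_wmeas hV hS x (lexx 0)) (sg_intP hV sV hS _ _) hw.
rewrite (tint_uniq hV (sg_intP hV sV hS (t - a) x) h) addrC addKr.
exact: (tint_refl hV sV (f := S^~ x)).
Qed.

(** g is frozen at the right end of each cell while the semigroup is integrated exactly, so every
    summand lies in the domain of the generator. The right end is the choice for which summation by
    parts yields left-point sums against the increments of g. *)
Definition riemann_conv g t n : V :=
  \sum_(i < n.+1) (Phi (t - node t n i) (g (node t n i.+1)) - Phi (t - node t n i.+1) (g (node t n i.+1))).

Lemma riemann_conv_cvg T g t q : 0 <= t <= T -> cont_path T g ->
  tint 0 t (fun r => S (t - r) (g r)) q -> hlim (riemann_conv g t) q.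
Proof.
move=> /andP[t0 tT] cg hq; have T0 := le_trans t0 tT.
have [M M1 hM] := sg_bound hV hS t; have M0 : 0 < M by exact: lt_le_trans ltr01 M1.
have t1 : 0 < t + 1 by rewrite ltr_wpDl.
(* t + 1 instead of t keeps the tolerance defined when t = 0. *)
apply/hlimP => e e0; pose e' := e / (M * (t + 1)).
have e'0 : 0 < e' by rewrite divr_gt0// mulr_gt0.
have [dl dl0 hdl] := cont_path_unif hV T0 cg e'0.
have /cvgrPdist_lt/(_ dl dl0) [N _ hN] := grid_mesh_cvg t.
exists N => n Nn; have mesh : t / n.+1%:R < dl.
  by have := hN n Nn; rewrite sub0r normrN ger0_norm// divr_ge0.
have hq' : tint (node t n 0) (node t n n.+1) (fun r => S (t - r) (g r)) q by rewrite node0 node_last.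
have [vi [hvi qE]] := tint_partition hV sV (node_le n ^~ t0) hq'.
rewrite (hnormBC hV) qE /riemann_conv -sumrB.
apply: le_lt_trans (hnorm_sum hV _ _ _) _.
apply: (@le_lt_trans _ _ (\sum_(i < n.+1) M * e' * (t / n.+1%:R))).
  apply: ler_sum => i _.
  have /andP[s0 st] := node_itv t0 (ltnW (ltn_ord i) : (i <= n.+1)%N).
  have /andP[s0' st'] := node_itv t0 (ltn_ord i : (i.+1 <= n.+1)%N).
  have d := tintB hV sV (hvi i (ltn_ord i)) (sg_int_piece (g (node t n i.+1)) s0 (node_le n i t0) st').
  have C0 : 0 <= M * e' by rewrite mulr_ge0// ltW.
  have := tint_norm_le hV sV (node_le n i t0) C0 d.
  have -> : node t n i.+1 - node t n i = t / n.+1%:R by rewrite nodeS addrC addKr.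
  apply => r /andP[r1 r2].
  have r0 : 0 <= r by exact: le_trans r1.
  have rt : r <= t by exact: le_trans st'.
  have tr : 0 <= t - r by rewrite subr_ge0.
  rewrite -(bopB (sg_bop hS tr)); apply: le_trans (hM _ _ _) _.
    by rewrite tr lerBlDr lerDl.
  rewrite ler_pM2l// ltW//; apply: hdl.
  - by rewrite r0 (le_trans rt tT).
  - by rewrite s0' (le_trans st' tT).
  - rewrite distrC ger0_norm ?subr_ge0//; apply: le_lt_trans mesh.
    by rewrite nodeS lerBlDr addrC lerD2l.
rewrite sumr_const card_ord -[X in X < _]mulr_natr -mulrA divfK ?pnatr_eq0//.
have -> : M * e' * t = e * (t / (t + 1)) by rewrite /e'; field; rewrite !gt_eqF.
by rewrite gtr_pMr// ltr_pdivrMr// mul1r ltrDl.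
Qed.

(** Summation by parts, for F i j the semigroup at the time remaining after node i applied to g at
    node j: differences in the first index are traded for differences in the second. *)
Lemma abel_telescope (F : nat -> nat -> V) m :
  \sum_(i < m) (F i i.+1 - F i i) = F m m - F 0%N 0%N + \sum_(i < m) (F i i.+1 - F i.+1 i.+1).
Proof.
elim: m => [|m IH]; first by rewrite !big_ord0 subrr addr0.
rewrite !big_ord_recr/= IH.
move: (\sum_(i < m) _) (F m m) (F 0%N 0%N) (F m m.+1) (F m.+1 m.+1) => a b c x y.
by rewrite [LHS]addrC -[b - c + a]addrA subrKA [RHS]addrC -[RHS]addrA subrKA addrA addrC.
Qed.

Section Generator.
Context (A : unbounded V V) (gAS : generates A S).

(** A turns each cell integral into a difference of semigroup values, and summation by parts moves
    the differences onto g; g(0) = 0 removes the boundary term at time 0. *)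
Lemma riemann_conv_gen g t n : 0 <= t -> g 0 = 0 ->
  udom A (riemann_conv g t n) /\
  A (riemann_conv g t n) =
    \sum_(i < n.+1) S (t - node t n i) (g (node t n i.+1) - g (node t n i)) - g t.
Proof.
move=> t0 g0.
have sum m : (m <= n.+1)%N -> let q := \sum_(i < m) (Phi (t - node t n i) (g (node t n i.+1)) -
    Phi (t - node t n i.+1) (g (node t n i.+1))) in
  udom A q /\ A q = \sum_(i < m) (S (t - node t n i) (g (node t n i.+1)) -
    S (t - node t n i.+1) (g (node t n i.+1))).
  elim: m => [_|m IH mn]; first by rewrite !big_ord0; have := gen0 hV sV gAS.
  rewrite !big_ord_recr/=; have [u1 <-] := IH (ltnW mn).
  have /andP[_ st] := node_itv t0 (ltnW mn); have /andP[_ st'] := node_itv t0 mn.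
  have d1 : 0 <= t - node t n m by rewrite subr_ge0.
  have d2 : 0 <= t - node t n m.+1 by rewrite subr_ge0.
  have [a1 a2] := gen_int hV sV gAS (g (node t n m.+1)) d1.
  have [b1 b2] := gen_int hV sV gAS (g (node t n m.+1)) d2.
  have [c1 c2] := genB hV sV gAS a1 b1.
  have [x1 x2] := genD hV sV gAS u1 c1; split; first exact: x1.
  have e (p p' z : V) : p - z - (p' - z) = p - p' by rewrite opprB addrA subrK.
  apply: (etrans x2); apply: (f_equal2 +%R erefl); apply: (etrans c2).
  by apply: (etrans (f_equal2 (fun p q => p - q) a2 b2)); exact: e.
have [q1 q2] := sum n.+1 (leqnn _); split; first exact: q1.
rewrite [LHS]q2.
have bS i : (i <= n.+1)%N -> bounded_op (S (t - node t n i)).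
  by move=> ni; apply: (sg_bop hS); rewrite subr_ge0; case/andP: (node_itv t0 ni).
have -> : \sum_(i < n.+1) S (t - node t n i) (g (node t n i.+1) - g (node t n i)) =
    \sum_(i < n.+1) (S (t - node t n i) (g (node t n i.+1)) - S (t - node t n i) (g (node t n i))).
  by apply: eq_bigr => i _; rewrite (bopB (bS i (ltnW (ltn_ord i)))).
rewrite (abel_telescope (fun i j => S (t - node t n i) (g (node t n j)))).
rewrite node_last subrr (sg0 hS) node0 g0 subr0 (bop0 (sg_bop hS t0)) subr0.
by rewrite [g t + _]addrC addrK.
Qed.

End Generator.
End RiemannConvolution.

Section ConvolutionPaths.
Context {R : realType} {k : scalar_kind} (V : ipSpace R k) (hV : hilbert V) (sV : hseparable V).
Context (S : R -> V -> V) (hS : C0_semigroup S).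
Local Notation mu := (@lebesgue_measure R).
Local Notation tint a b f v := (bint mu `[a, b]%classic (f : R -> V) v).
Local Notation dom a b := (`[a, b]%classic : set (measurableTypeR R)).

(** Dominated convergence for integrands cut off at the varying end point; they converge for every r
    except r = t. *)
Lemma conv_cont_path T (g y : R -> V) : wmeas (dom 0 T) g ->
  (\int[mu]_(s in `[0%R, T]) (hnorm (g s))%:E < +oo)%E ->
  (forall t, 0 <= t <= T -> tint 0 t (fun r => S (t - r) (g r)) (y t)) ->
  cont_path T y.
Proof.
move=> mg ng hy; apply: seq_cont_path => t tn ht htn cv.
have [M M1 hM] := sg_bound hV hS T; have M0 : 0 <= M by exact: le_trans M1.
have mD := measurable_cc 0 T.
pose f u r := if 0 <= r <= u then S (u - r) (g r) else 0.
have hf u : 0 <= u <= T -> tint 0 T (f u) (y u).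
  by move=> hu; apply: tint_ext0 => //; [case/andP: hu|exact: hy].
apply: (tint_dct hV sV (fn := fun n => f (tn n)) (f := f t) (g := fun r => (M%:E * (hnorm (g r))%:E)%E)
  (fun n => hf _ (htn n)) (hf t ht)).
- apply: aeS (ae_neq t) => r rt /=; rewrite in_itv/= => /andP[r0 rT].
  have [lt_rt|le_tr] := ltP r t.
    (* Truncated at 0, where the semigroup starts; for large n the truncation is inactive. *)
    pose h n := Num.max (tn n - r) 0.
    have h0 n : 0 <= h n by rewrite /h le_max lexx orbT.
    have tr : 0 <= t - r by rewrite subr_ge0 ltW.
    have ch : h n @[n --> \oo] --> t - r.
      apply/cvgrPdist_lt => e e0; have /cvgrPdist_lt/(_ e e0) [N _ hN] := cv.
      exists N => // n Nn; apply: le_lt_trans (hN n Nn).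
      have -> : t - r - h n = (t - r) - h n by [].
      rewrite /h; case: (leP (tn n - r) 0) => hc.
        rewrite subr0 !ger0_norm//; first by lra.
        by rewrite subr_ge0; lra.
      by rewrite (_ : t - r - (tn n - r) = t - tn n)//; ring.
    have /hlimP h' := sg_hlim hV hS (g r) tr h0 ch.
    apply/hlimP => e e0; have [N1 hN1] := h' e e0.
    have d0 : 0 < t - r by rewrite subr_gt0.
    have /cvgrPdist_lt/(_ _ d0) [N2 _ hN2] := cv.
    exists (maxn N1 N2) => n; rewrite geq_max => /andP[n1 n2].
    have rn : r <= tn n by have := hN2 n n2; rewrite /= ltr_norml => /andP[_]; lra.
    rewrite /f r0 rn (ltW lt_rt)/=.
    have -> : tn n - r = h n by rewrite /h max_l// subr_ge0.
    exact: hN1.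
  have tr : t < r by rewrite lt_neqAle le_tr andbT; apply/eqP => e; apply: rt.
  have d0 : 0 < r - t by rewrite subr_gt0.
  apply/hlimP => e e0; have /cvgrPdist_lt/(_ _ d0) [N2 _ hN2] := cv.
  exists N2 => n n2; have rn : tn n < r.
    by have := hN2 n n2; rewrite /= ltr_norml => /andP[h1 _]; lra.
  by rewrite /f r0/= !leNgt rn tr/= subrr hnorm0.
- by apply: measurable_funeM; apply/measurable_EFinP; exact: wmeas_norm.
- rewrite ge0_integralZl_EFin//; last first.
  + by apply/measurable_EFinP; exact: wmeas_norm.
  + by move=> s _; rewrite lee_fin hnorm_ge0.
  exact: lte_mul_pinfty.
- move=> n r; rewrite /= in_itv/= => /andP[r0 rT]; rewrite -EFinM lee_fin /f r0/=.
  case: ifP => rn; last by rewrite hnorm0// mulr_ge0// hnorm_ge0.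
  apply: hM; rewrite subr_ge0 rn lerBlDr; case/andP: (htn n) => _ h.
  by rewrite (le_trans h)// lerDl.
Qed.

End ConvolutionPaths.

(** * Adapted processes *)

Section CompleteFiltration.
Context {R : realType} {k : scalar_kind} (V : ipSpace R k) (hV : hilbert V) (sV : hseparable V).
Context d (Om : measurableType d) (P : probability Om R).
Context (F : R -> set (set Om)) (hF : usual_filtration P F).
Local Notation leb := (@lebesgue_measure R).
Implicit Types (t : R) (f g : Om -> V).

Lemma filtration_sigma t : 0 <= t -> sigma_algebra setT (F t).
Proof. by case: hF => h _ _ _ /h[]. Qed.

Lemma filtration_measurable t : 0 <= t -> F t `<=` measurable.
Proof. by case: hF => h _ _ _ /h[]. Qed.

Lemma filtration_le s t : 0 <= s -> s <= t -> F s `<=` F t.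
Proof. by case: hF => _ h _ _; exact: h. Qed.

Lemma negligible_filtration t : 0 <= t -> P.-negligible `<=` F t.
Proof.
by case: hF => _ h [_ h0] _ t0 A /h0; exact: h.
Qed.

Lemma hmeasurable_wmeas t f : 0 <= t -> hmeasurable (F t) f -> wmeas setT f.
Proof.
move=> t0 mf; apply/(hmeasurableP hV sV).
by apply: hmeasurable_sub mf; exact: filtration_measurable.
Qed.

(** The two preimages differ by null sets, which belong to F_t because [F 0] contains all of
    them. *)
Lemma hmeasurable_ae t f g : 0 <= t -> {ae P, forall om, f om = g om} ->
  hmeasurable (F t) g -> hmeasurable (F t) f.
Proof.
move=> t0 fg mg U bU; have sF := filtration_sigma t0.
pose A1 := f @^-1` U `\` g @^-1` U; pose A2 := g @^-1` U `\` f @^-1` U.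
have n1 : F t A1.
  apply: negligible_filtration => //; apply: negligibleS fg => om [h1 h2] /= e.
  by apply: h2; rewrite /preimage /= -e.
have n2 : F t A2.
  apply: negligible_filtration => //; apply: negligibleS fg => om [h1 h2] /= e.
  by apply: h2; rewrite /preimage /= e.
have mg' := mg U bU.
rewrite (_ : f @^-1` U = (g @^-1` U `|` A1) `\` A2).
  have m (B : set Om) : F t B -> @measurable _ (g_sigma_algebraType (F t)) B.
    by move=> ?; exact: sub_sigma_algebra.
  have back (B : set Om) : @measurable _ (g_sigma_algebraType (F t)) B -> F t B.
    by rewrite /measurable/= sigma_algebra_id.
  apply: back; apply: (@measurableD _ (g_sigma_algebraType (F t))); last exact: m.
  by apply: (@measurableU _ (g_sigma_algebraType (F t))); exact: m.
apply/seteqP; split => om /=.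
  move=> fU; have [gU|gU] := pselect (U (g om)); first by split; [left|case].
  by split; [right|case].
move=> [[gU|[//]] h]; apply: contrapT => fU; exact: h.
Qed.

Lemma hmeasurable_hlim_ae t (u : nat -> Om -> V) f : 0 <= t ->
  (forall n, hmeasurable (F t) (u n)) -> {ae P, forall om, hlim (fun n => u n om) (f om)} ->
  hmeasurable (F t) f.
Proof.
move=> t0 mu cv; have sF := filtration_sigma t0.
apply: (hmeasurable_ae (g := fun om => hlim_or0 (fun n => u n om))) => //.
  by apply: aeS cv => om h; rewrite (hlim_or0_lim hV h).
apply/(hmeasurable_subP hV sV _ sF); apply: wmeas_hlim_or0 => //.
by move=> n; apply/(hmeasurable_subP hV sV _ sF); exact: mu.
Qed.

Lemma hmeasurable_sum t n (u : 'I_n -> Om -> V) : 0 <= t ->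
  (forall i, hmeasurable (F t) (u i)) -> hmeasurable (F t) (fun om => \sum_i u i om).
Proof.
move=> t0 mu; have sF := filtration_sigma t0.
apply/(hmeasurable_subP hV sV _ sF); apply: wmeas_sum => // i.
by apply/(hmeasurable_subP hV sV _ sF); exact: mu.
Qed.

Lemma hmeasurable_add t f g : 0 <= t ->
  hmeasurable (F t) f -> hmeasurable (F t) g -> hmeasurable (F t) (fun om => f om + g om).
Proof.
move=> t0 mf mg; have sF := filtration_sigma t0.
apply/(hmeasurable_subP hV sV _ sF); apply: wmeasD => //.
  by apply/(hmeasurable_subP hV sV _ sF); exact: mf.
by apply/(hmeasurable_subP hV sV _ sF); exact: mg.
Qed.

Lemma hmeasurable_bop (W : ipSpace R k) (hW : hilbert W) (sW : hseparable W) (G : V -> W) t f :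
  0 <= t -> bounded_op G -> hmeasurable (F t) f -> hmeasurable (F t) (fun om => G (f om)).
Proof.
move=> t0 bG mf; have sF := filtration_sigma t0.
apply/(hmeasurable_subP hW sW _ sF); apply: (wmeas_bop hV sV) => //.
by apply/(hmeasurable_subP hV sV _ sF); exact: mf.
Qed.

Section Processes.
Context (T : R) (T0 : 0 < T).
Local Notation TO := (measurableTypeR R * Om)%type.
Local Notation cyl := ([set p : TO | 0 <= p.1 <= T]).
Local Notation dom := (`[0, T]%classic : set (measurableTypeR R)).
Implicit Types X Y : R -> Om -> V.

Definition jwmeas X : Prop := wmeas cyl (fun p : TO => X p.1 p.2).

Lemma process_jwmeas X : process F T X -> jwmeas X.
Proof.
move=> [_ mX]; apply/(wmeasP hV sV (@measurable_cylinder R T _ Om)) => U bU.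
exact: mX.
Qed.

Lemma jwmeas_process X : jwmeas X -> (forall t, 0 <= t <= T -> hmeasurable (F t) (X t)) ->
  process F T X.
Proof.
move=> jX aX; split; first by move=> t /=; rewrite in_itv/=; exact: aX.
by move=> U bU; exact: ((wmeasP hV sV (@measurable_cylinder R T _ Om) _).1 jX).
Qed.

Lemma process_adapted X t : process F T X -> 0 <= t <= T -> hmeasurable (F t) (X t).
Proof. by move=> [aX _] ht; apply: aX; rewrite /= in_itv. Qed.

Let cylE : cyl = dom `*` setT.
Proof. by apply/seteqP; split => p /=; rewrite in_itv/=; [move=> ->|case]. Qed.

Lemma jwmeas_tonelli (f : R -> Om -> \bar R) :
  measurable_fun cyl (fun p : TO => f p.1 p.2) -> (forall s om, 0 <= f s om)%E ->
  [/\ measurable_fun setT (fun om => \int[leb]_(s in dom) f s om)%E &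
   (\int[leb]_(s in dom) \int[P]_om f s om = \int[P]_om \int[leb]_(s in dom) f s om)%E].
Proof.
rewrite cylE => mf f0.
have [_ h1 h2] := tonelli_setX leb P (measurable_cc 0 T) measurableT mf (fun p _ => f0 p.1 p.2).
by split.
Qed.

(** Tonelli for the indicator of N: if almost every section at fixed time avoids N, then almost
    every path avoids N at almost all times. *)
Lemma null_sections (N : set TO) : measurable (cyl `&` N) ->
  (forall s, 0 <= s <= T -> {ae P, forall om, ~ N (s, om)}) ->
  {ae P, forall om, {ae leb, forall s, dom s -> ~ N (s, om)}}.
Proof.
move=> mN hN; pose f s om := (\1_N (s, om))%:E : \bar R.
have f0 s om : (0 <= f s om)%E by rewrite lee_fin.
have mf : measurable_fun cyl (fun p : TO => f p.1 p.2).
  apply/measurable_EFinP.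
  have mI : measurable_fun cyl (\1_(cyl `&` N) : TO -> R) by exact: measurable_indic.
  apply: eq_measurable_fun mI => p /set_mem hp.
  by rewrite indicI/= [\1_cyl p]indicE mem_set// mul1r; case: p {hp}.
have [m1 e1] := jwmeas_tonelli mf f0.
have z : (\int[leb]_(s in dom) \int[P]_om f s om = 0)%E.
  rewrite integral0_eq// => s; rewrite /= in_itv/= => hs.
  rewrite -(integral0 P setT); apply: nonneg_ae_eq_integral => //.
  by apply: aeS (hN s hs) => om h _; rewrite /f indicE memNset.
have ae1 : {ae P, forall om, setT om -> (\int[leb]_(s in dom) f s om = 0)%E}.
  have := (ae_eq_integral_abs P measurableT m1).1; apply.
  rewrite -[RHS]z e1; apply: eq_integral => om _; rewrite gee0_abs//.
  exact: integral_ge0.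
apply: aeS ae1 => om /(_ I) h.
have ms : measurable_fun dom (fun s => f s om).
  have h2 := measurable_comp (@measurable_cylinder R T _ Om) _ mf (g := fun s : measurableTypeR R => (s, om)).
  apply: (h2 dom) => //.
    by move=> _ [s hs <-]; move: hs; rewrite /= in_itv.
  by apply: measurable_funTS; exact: measurable_pair2.
have := (ae_eq_integral_abs leb (measurable_cc 0 T) ms).1.
rewrite (eq_integral (fun s => f s om)); last by move=> s _; rewrite gee0_abs.
move=> /(_ h); apply: aeS => s h1 ds Ns; have := h1 ds.
by rewrite /f indicE mem_set// => -[] /eqP; rewrite oner_eq0.
Qed.

(** Tonelli makes the time integral of the squared norm finite on almost every path, and ||x|| <= 1
    + ||x||^2 gives integrability of the norm. *)
Lemma jwmeas_l2_paths X (C : \bar R) : jwmeas X -> (C < +oo)%E ->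
  (forall s, 0 <= s <= T -> (\int[P]_om (hnorm (X s om) ^+ 2)%:E <= C)%E) ->
  {ae P, forall om, (\int[leb]_(s in dom) (hnorm (X s om))%:E < +oo)%E}.
Proof.
move=> jX Cfin hC; have mC := @measurable_cylinder R T _ Om.
have mf : measurable_fun cyl (fun p : TO => (hnorm (X p.1 p.2) ^+ 2)%:E).
  exact: wmeas_norm2.
have [m1 e1] := jwmeas_tonelli (f := fun s om => (hnorm (X s om) ^+ 2)%:E) mf (fun s om => sqr_ge0 _).
have fin1 : (\int[P]_om \int[leb]_(s in dom) (hnorm (X s om) ^+ 2)%:E < +oo)%E.
  rewrite -e1; apply: (@le_lt_trans _ _ (\int[leb]_(s in dom) cst C s)%E).
    apply: nonneg_le_integral => s; rewrite /= in_itv/= => hs; last exact: hC.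
    by apply: integral_ge0 => om _; rewrite lee_fin sqr_ge0.
  have C0 : (0 <= C)%E.
    have h0 : 0 <= (0 : R) <= T by rewrite lexx ltW.
    by apply: le_trans (hC 0 h0); apply: integral_ge0 => om _; rewrite lee_fin sqr_ge0.
  rewrite integral_cst; last exact: measurable_cc.
  by apply: lte_mul_pinfty => //; [rewrite ge0_fin_numE|exact: lebesgue_itv_fin].
have i0 om : setT om -> (0 <= \int[leb]_(s in dom) (hnorm (X s om) ^+ 2)%:E)%E.
  by move=> _; apply: integral_ge0 => s _; rewrite lee_fin sqr_ge0.
apply: aeS (integral_lty_ae measurableT m1 i0 fin1) => om /(_ I) hf.
have mX : wmeas dom (X^~ om) by exact: wmeas_section.
apply: (@le_lt_trans _ _ (\int[leb]_(s in dom) (1 + (hnorm (X s om) ^+ 2)%:E))%E).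
  apply: nonneg_le_integral => s _; first by rewrite lee_fin hnorm_ge0.
  rewrite -EFinD lee_fin; have := sqr_ge0 (hnorm (X s om) - 1); nra.
rewrite (ge0_integralD _ (measurable_cc 0 T))//; last first.
- by apply: wmeas_norm2 => //; exact: measurable_cc.
- by move=> s _; rewrite lee_fin sqr_ge0.
rewrite integral_cst ?mul1e; last exact: measurable_cc.
by apply: lte_add_pinfty => //; exact: lebesgue_itv_fin.
Qed.

Lemma adapted_wmeas X t : 0 <= t <= T -> hmeasurable (F t) (X t) -> wmeas setT (X t).
Proof. by move=> /andP[t0 _]; exact: hmeasurable_wmeas. Qed.

(** X is sampled on meshes so fine that the i-th mean square error is at most 2^-i, uniformly in
    time. Summability gives almost sure convergence at each t, and the limit of the step processes
    is jointly measurable. *)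
Lemma mean_square_modification X : (forall t, 0 <= t <= T -> hmeasurable (F t) (X t)) ->
  (forall e, 0 < e -> exists2 dl, 0 < dl & forall s t, 0 <= s -> s <= t -> t <= T -> t - s < dl ->
    (\int[P]_om (hnorm (X t om - X s om) ^+ 2)%:E <= e%:E)%E) ->
  exists Y, process F T Y /\ forall t, 0 <= t <= T -> {ae P, forall om, Y t om = X t om}.
Proof.
move=> aX ms.
have mX t : 0 <= t <= T -> wmeas setT (X t) by move=> ht; exact: (adapted_wmeas ht (aX t ht)).
have mesh i : exists n, forall s t, 0 <= s -> s <= t -> t <= T -> t - s <= T / n.+1%:R ->
    (\int[P]_om (hnorm (X t om - X s om) ^+ 2)%:E <= (1 * 2^-1 ^+ i)%:E)%E.
  have pos : 0 < (1 * 2^-1 ^+ i : R) by rewrite mul1r exprn_gt0.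
  have [dl dl0 hd] := ms _ pos.
  have /cvgrPdist_lt/(_ dl dl0) [N _ hN] := grid_mesh_cvg T.
  exists N => s t s0 st tT tsN; apply: hd => //; apply: le_lt_trans tsN _.
  by have := hN N (leqnn N); rewrite sub0r normrN ger0_norm// divr_ge0// ltW.
have [phi hphi] := choice mesh.
pose Y t om := hlim_or0 (fun i => X (grid T (phi i) t) om).
have YX t : 0 <= t <= T -> {ae P, forall om, Y t om = X t om}.
  move=> ht; have /andP[t0 tT] := ht.
  have gm i := grid_mem T0 (phi i) ht.
  have cv : {ae P, forall om, setT om -> hlim (fun i => X (grid T (phi i) t) om) (X t om)}.
    apply: summable_ae_hlim => //; [by move=> i; exact: mX|exact: mX|].
    move=> i; rewrite n2_BC//; have /andP[g1 g2] := grid_itv T0 (phi i) t0.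
    apply: hphi => //; first by case/andP: (gm i).
    by rewrite lerBlDl ltW.
  by apply: aeS cv => om /(_ I) h; rewrite /Y (hlim_or0_lim hV h).
exists Y; split => //; apply: jwmeas_process.
  apply: wmeas_hlim_or0 => //; first exact: measurable_cylinder.
  by move=> i; apply: wmeas_grid.
by move=> t ht; have /andP[t0 _] := ht; apply: (hmeasurable_ae t0 (YX t ht)); exact: aX.
Qed.

(** Discontinuous paths are replaced by 0. They fill a null set, so adaptedness survives, and
    continuity everywhere gives joint measurability. *)
Lemma path_modification X : (forall t, 0 <= t <= T -> hmeasurable (F t) (X t)) ->
  {ae P, forall om, cont_path T (X^~ om)} ->
  exists Y, [/\ process F T Y, forall om, cont_path T (Y^~ om) &
    {ae P, forall om, forall t, Y t om = X t om}].
Proof.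
move=> aX cX; pose Y t om := if pselect (cont_path T (X^~ om)) then X t om else 0.
have YX : {ae P, forall om, forall t, Y t om = X t om}.
  by apply: aeS cX => om h t; rewrite /Y; case: pselect.
have cY om : cont_path T (Y^~ om).
  rewrite /Y; case: pselect => //= _ t _ e e0; exists 1 => // s _ _.
  by rewrite subrr hnorm0.
have aY t : 0 <= t <= T -> hmeasurable (F t) (Y t).
  move=> ht; have /andP[t0 _] := ht; apply: (hmeasurable_ae t0 (g := X t)); last exact: aX.
  by apply: aeS YX => om h; exact: h.
exists Y; split => //; apply: jwmeas_process => //.
apply: wmeas_caratheodory => //; first by move=> t ht; exact: (adapted_wmeas ht (aY t ht)).
move=> om t ht; apply: (cont_path_hlim (cY om) ht).
  by move=> n; exact: grid_mem.
by apply: grid_cvg => //; case/andP: ht.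
Qed.

End Processes.
End CompleteFiltration.

(** * Stochastic convolution *)

Section StochasticConvolution.
Context {R : realType} {k : scalar_kind} (Z : ipSpace R k) (hZ : hilbert Z) (sZ : hseparable Z).
Context d (Om : measurableType d) (P : probability Om R).
Context (F : R -> set (set Om)) (hF : usual_filtration P F).
Context (E : set Z) (Q : Z -> Z) (hQ : covariance_operator E Q).
Context (w : R -> Om -> Z) (hw : wiener P F Q w).
Context (hE : orthonormal_basis E) (Qh : Z -> Z) (hQh : square_root Q Qh).
Context (e : nat -> Z) (he : onb_seq e).
Hypothesis hEe : forall f : Z -> \bar R, (forall x, (0 <= f x)%E) -> f 0 = 0%E ->
  (\esum_(x in E) f x = \sum_(0 <= i <oo) f (e i))%E.
Context (W : ipSpace R k) (hW : hilbert W) (sW : hseparable W).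
Context (S : R -> W -> W) (hS : C0_semigroup S) (G : Z -> W) (bG : bounded_op G).
Local Notation leb := (@lebesgue_measure R).
Local Notation cc t := (`[0, t]%classic : set (measurableTypeR R)).
Local Notation HS := (hs Qh e).
Local Notation SI := (is_stochastic_integral P E Qh w).
Hypothesis GHS : (HS G < +oo)%E.

(** Comparison with the zero integral turns the distance estimate [SI_dist] into a bound on second
    moments. *)
Lemma SI_zero t : SI t (fun _ _ => (0 : W)) (fun=> 0).
Proof.
have nil (i : 'I_0) (A : Prop) : A by case: i.
pose s0 := @Elementary R k Z W t 0 (fun=> 0) (fun=> 0) (fun _ _ => 0) (fun i => nil i _) (fun i => nil i _).
have i0 : integrand t (fun (_ : R) (_ : Z) => (0 : W)).
  by split => [x|r _]; [exact: wmeas_cst|exact: bounded_op0].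
have s0f r x : el_fun s0 r x = 0 by rewrite /el_fun big_ord0.
apply: (SI_intro hZ hQh hEe hW sW i0); first exact: wmeas_cst.
move=> ep ep0; exists s0; split.
- rewrite integral0_eq ?lee_fin ?ltW// => r _; rewrite /hs eseries0// => i _ _.
  by rewrite s0f subrr hnorm0// expr0n.
- rewrite integral0_eq ?lee_fin ?ltW// => om _.
  by rewrite /el_integral big_ord0 subrr hnorm0// expr0n.
Qed.

Lemma conv_dominated t : 0 <= t -> dominated_continuous Qh e t (fun r x => S (t - r) (G x)).
Proof.
move=> t0; have sub r : 0 <= r <= t -> 0 <= t - r <= t.
  by move=> /andP[r0 rt]; rewrite subr_ge0 rt lerBlDr lerDl.
split; last split.
- move=> r /sub/andP[tr _]; apply: (bounded_op_comp hZ hW hW) => //; exact: sg_bop.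
- have [M M1 hM] := sg_bound hW hS t; exists G, M; split => //; first exact: le_trans M1.
  by move=> r x /sub; exact: hM.
- move=> x r tau hr htau cv; apply: sg_hlim => //; first by case/andP: (sub r hr).
    by move=> n; case/andP: (sub _ (htau n)).
  by apply: cvgB => //; exact: cvg_cst.
Qed.

(** Strong continuity at 0 becomes continuity in the Hilbert-Schmidt norm on the range of G: along a
    violating null sequence, the series is dominated by a multiple of that of G and tends to 0 term
    by term. *)
Lemma hs_sg_small e0 : 0 < e0 -> exists2 dl, 0 < dl & forall h, 0 <= h -> h < dl ->
  (HS (fun x => S h (G x) - G x)%R <= e0%:E)%E.
Proof.
move=> e00; apply: contrapT => nex.
have bad n : exists h, [/\ 0 <= h, h < n.+1%:R^-1 & (e0%:E < HS (fun x => S h (G x) - G x)%R)%E].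
  apply: contrapT => nb; apply: nex; exists (n.+1%:R^-1); first by rewrite invr_gt0.
  move=> h h0 hn; rewrite leNgt; apply/negP => lt; apply: nb; exists h; split => //.
have [h hh] := choice bad.
have h0 n : 0 <= h n by case: (hh n).
have ch : h n @[n --> \oo] --> (0 : R).
  apply: (@cvg0_squeeze _ _ (fun n => n.+1%:R^-1)); last exact: cvg_harmonic.
  by move=> n; have [-> /ltW-> _] := hh n.
have h1 n : h n <= 1.
  by have [_ /ltW h1 _] := hh n; rewrite (le_trans h1)// invf_le1// ler1n.
have [M M1 hM] := sg_bound hW hS 1; have M0 : 0 <= M by exact: le_trans M1.
have : HS (fun x => S (h n) (G x) - G x)%R @[n --> \oo] --> 0%E.
  apply: (hs_cvg0 (b := fun i => (((M + 1) ^+ 2)%:E * (hnorm (G (Qh (e i))) ^+ 2)%:E)%E)).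
  - by move=> i; rewrite mule_ge0// lee_fin sqr_ge0.
  - rewrite nneseriesZl; last by move=> i _; rewrite lee_fin sqr_ge0.
    by apply: lte_mul_pinfty; rewrite ?lee_fin ?sqr_ge0.
  - move=> n i; have M10 : 0 <= M + 1 by rewrite addr_ge0.
    rewrite -EFinM lee_fin -exprMn lerXn2r ?nnegrE ?hnorm_ge0 ?mulr_ge0 ?hnorm_ge0//.
    apply: le_trans (hnormB hW _ _) _; rewrite mulrDl mul1r lerD2r; apply: hM.
    by rewrite h0 h1.
  - move=> i; have := sg_hlim hW hS (G (Qh (e i))) (lexx 0) h0 ch.
    by rewrite (sg0 hS).
move=> /ecvg0_nat c; have [|N hN] := c _ e0 e00; first by move=> n; exact: hs_ge0.
by have [_ _] := hh N; rewrite ltNge (hN N (leqnn N)).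
Qed.

Let Psi t r (x : Z) := S (t - r) (G x).

Lemma conv_integrand t : 0 <= t -> integrand t (Psi t).
Proof.
move=> t0; exact: (dc_integrand hW t0 (conv_dominated t0)).
Qed.

(** Up to time s the two integrands differ by S(s-r) (S(t-s) - I) G; on the remaining interval of
    length t - s there is only S(t-r) G. *)
Lemma conv_increment_le T M s t I J : (forall t x, 0 <= t <= T -> hnorm (S t x) <= M * hnorm x) ->
  0 <= s -> s <= t -> t <= T -> SI s (Psi s) I -> SI t (Psi t) J ->
  (\int[P]_om (hnorm (J om - I om) ^+ 2)%:E <=
   9%:E * ((M ^+ 2)%:E * HS (fun x => S (t - s) (G x) - G x)%R * T%:E + (M ^+ 2)%:E * HS G * (t - s)%:E))%E.
Proof.
move=> hM s0 st tT sI sJ; have t0 := le_trans s0 st.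
have T0 : 0 <= T by exact: le_trans tT.
have [iX sX] := SI_ext hZ hQh hEe hW sW s0 st (conv_integrand s0) sI.
have b := SI_dist hZ sZ hF hQ hw hE hQh hEe hW sW (conv_integrand t0) iX sJ sX.
apply: le_trans b _; apply: lee_wpmul2l => //.
set a := HS (fun x => S (t - s) (G x) - G x)%R.
have a0 : (0 <= a)%E by exact: hs_ge0.
have g0 : (0 <= HS G)%E by exact: hs_ge0.
have M20 : (0 <= (M ^+ 2)%:E)%E by rewrite lee_fin sqr_ge0.
have mI : measurable (`[s, t]%classic : set (measurableTypeR R)) by exact: measurable_cc.
apply: (@le_trans _ _ (\int[leb]_(r in cc t) (cst ((M ^+ 2)%:E * a) r + (M ^+ 2)%:E * HS G * (\1_(`[s, t]%classic : set R) r)%:E))%E).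
  apply: nonneg_le_integral => r; rewrite /= in_itv/= => /andP[r0 rt]; first exact: hs_ge0.
  have [rs|sr] := leP r s.
    apply: (@le_trans _ _ ((M ^+ 2)%:E * a)%E); last by rewrite leeDl// mule_ge0// ?mule_ge0// lee_fin.
    apply: hs_le => x.
    have sr : 0 <= s - r by rewrite subr_ge0.
    have ts : 0 <= t - s by rewrite subr_ge0.
    have -> : Psi t r (Qh x) = S (s - r) (S (t - s) (G (Qh x))).
      by rewrite /Psi -(sgD hS)//; congr (S _ _); ring.
    rewrite /Psi -(bopB (sg_bop hS sr)); apply: hM; rewrite sr.
    by rewrite lerBlDr (le_trans st)// (le_trans tT)// lerDl.
  apply: (@le_trans _ _ ((M ^+ 2)%:E * HS G)%E).
    apply: hs_le => x; rewrite subr0; apply: hM; rewrite subr_ge0 rt lerBlDr.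
    by rewrite (le_trans tT)// lerDl.
  rewrite indicE mem_set ?mule1; last by rewrite /= in_itv/= (ltW sr) rt.
  by rewrite leeDr// mule_ge0.
have p1 r : cc t r -> (0 <= cst ((M ^+ 2)%:E * a) r)%E by move=> _; rewrite /= mule_ge0.
have p2 r : cc t r -> (0 <= (M ^+ 2)%:E * HS G * (\1_(`[s, t]%classic : set R) r)%:E)%E.
  by move=> _; rewrite mule_ge0// ?mule_ge0// lee_fin.
have m2 : measurable_fun (cc t) (fun r => (M ^+ 2)%:E * HS G * (\1_(`[s, t]%classic : set R) r)%:E)%E.
  by apply: measurable_funeM; apply/measurable_EFinP; exact: measurable_indic.
rewrite (ge0_integralD _ (measurable_cc 0 t) p1 (measurable_cst _) p2 m2).
apply: leeD.
  rewrite integral_cst; last exact: measurable_cc.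
  apply: lee_wpmul2l; first by rewrite mule_ge0.
  by rewrite /= lebesgue_itv_len// subr0 lee_fin.
have m1 : measurable_fun (cc t) (fun r => (\1_(`[s, t]%classic : set R) r)%:E : \bar R).
  by apply/measurable_EFinP; exact: measurable_indic.
have q0 r : cc t r -> (0 <= (\1_(`[s, t]%classic : set R) r)%:E :> \bar R)%E by rewrite lee_fin.
rewrite (ge0_integralZl _ (measurable_cc 0 t) m1 q0); last by rewrite mule_ge0.
apply: lee_wpmul2l; first by rewrite mule_ge0.
rewrite (integral_indic _ (measurable_cc 0 t) mI).
apply: (@le_trans _ _ (leb `[s, t])); last by rewrite lebesgue_itv_len.
by apply: le_measure; rewrite ?inE//; apply: measurableI => //; exact: measurable_cc.
Qed.

(** The integrals are chosen separately for each time; mean square continuity then supplies a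
    jointly measurable adapted version, which keeps the almost sure limits of left-point sums. *)
Theorem stochastic_convolution_exists T : 0 < T -> exists X : R -> Om -> W,
  [/\ process F T X,
      forall t, 0 <= t <= T -> SI t (Psi t) (X t) &
      forall t, 0 <= t <= T -> exists phi : nat -> nat, (forall j, (j <= phi j)%N) /\
        {ae P, forall om, hlim (fun j => \sum_(i < (phi j).+1) S (t - node t (phi j) i)
          (G (w (node t (phi j) i.+1) om - w (node t (phi j) i) om))) (X t om)}].
Proof.
move=> T0.
have ex t : exists I : Om -> W, 0 <= t <= T -> exists phi : nat -> nat, [/\ SI t (Psi t) I, hmeasurable (F t) I,
    forall j, (j <= phi j)%N &
    {ae P, forall om, hlim (fun j => let h := t / (phi j).+1%:R in
      \sum_(i < (phi j).+1) Psi t (h * i%:R) (w (h * i.+1%:R) om - w (h * i%:R) om)) (I om)}].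
  have [/andP[t0 _]|_] := boolP (0 <= t <= T); last by exists (fun=> 0).
  have [I [phi h]] := SI_exists hZ sZ hF hQ hw hE hQh hEe hW sW t0 (conv_dominated t0).
  by exists I => _; exists phi.
have [X0 hX0] := choice ex.
have [M M1 hM] := sg_bound hW hS T; have M0 : 0 < M by exact: lt_le_trans ltr01 M1.
have [||X [pX XX0]] := mean_square_modification hW sW hF T0 (X := X0).
- by move=> t ht; have [phi []] := hX0 t ht.
- move=> ep ep0; have [g g0 gE] : exists2 g, 0 <= g & HS G = g%:E.
    exists (fine (HS G)); first by rewrite fine_ge0// hs_ge0.
    by rewrite fineK// ge0_fin_numE// hs_ge0.
  have M20 : 0 < M ^+ 2 by rewrite exprn_gt0.
  (* Each of the two terms of the increment estimate is made at most ep / 18, which the factor 9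
     turns into ep / 2; g + 1 guards against g = 0. *)
  pose e1 := ep / (18 * M ^+ 2 * T).
  have e10 : 0 < e1 by rewrite divr_gt0// !mulr_gt0.
  have [dl dl0 hdl] := hs_sg_small e10.
  pose e2 := ep / (18 * M ^+ 2 * (g + 1)).
  have g1 : 0 < g + 1 by rewrite ltr_wpDl.
  have e20 : 0 < e2 by rewrite divr_gt0// !mulr_gt0.
  exists (Num.min dl e2); first by rewrite lt_min dl0.
  move=> s t s0 st tT; rewrite lt_min => /andP[ts1 ts2].
  have sT := le_trans st tT; have t0 := le_trans s0 st.
  have [phi [sI _ _ _]] := hX0 s (introT andP (conj s0 sT)).
  have [phi' [sJ _ _ _]] := hX0 t (introT andP (conj t0 tT)).
  apply: le_trans (conv_increment_le hM s0 st tT sI sJ) _.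
  have ts : 0 <= t - s by rewrite subr_ge0.
  have a1 := hdl _ ts ts1.
  apply: (@le_trans _ _ (9%:E * ((M ^+ 2)%:E * e1%:E * T%:E + (M ^+ 2)%:E * HS G * (t - s)%:E))%E).
    apply: lee_wpmul2l => //; rewrite leeD2r//; apply: lee_wpmul2r; first by rewrite lee_fin ltW.
    by apply: lee_wpmul2l; rewrite ?lee_fin// ltW.
  rewrite gE -!EFinM lee_fin.
  have b1 : M ^+ 2 * e1 * T = ep / 18 by rewrite /e1; field; rewrite !gt_eqF.
  have b2 : M ^+ 2 * g * (t - s) <= ep / 18.
    apply: (@le_trans _ _ (M ^+ 2 * (g + 1) * e2)); last by rewrite /e2 le_eqVlt; apply/orP; left; apply/eqP; field; rewrite !gt_eqF.
    apply: ler_pM => //; [by rewrite mulr_ge0// ltW| |exact: ltW].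
    by rewrite ler_pM2l// lerDl.
  rewrite b1; lra.
exists X; split => //.
- move=> t ht; have [phi [sI _ _ _]] := hX0 t ht; have /andP[t0 _] := ht.
  apply: (SI_ae _ _ sI).
    by apply: aeS (XX0 t ht) => om ->.
  by apply: hmeasurable_sub (process_adapted pX ht); exact: (filtration_measurable hF).
- move=> t ht; have [phi [_ _ pj cv]] := hX0 t ht; exists phi; split => //.
  by apply: aeS2 cv (XX0 t ht) => om h ->.
Qed.

End StochasticConvolution.

Section GeneratorOnProcesses.
Context {R : realType} {k : scalar_kind} (V : ipSpace R k) (hV : hilbert V) (sV : hseparable V).
Context (A : unbounded V V) (S : R -> V -> V) (gAS : generates A S).
Let hS : C0_semigroup S := proj1 gAS.

Lemma sg_diff_bop h : 0 <= h -> bounded_op (sg_diff S h).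
Proof.
move=> h0; apply: bounded_opZ => //; apply: bounded_opB => //; [exact: sg_bop|exact: bounded_op_id].
Qed.

Definition gen_seq_val (n : nat) (x : V) := sg_diff S n.+1%:R^-1 x.

(** An everywhere defined, measurable substitute for A, with which it agrees on the domain; the
    values of A itself outside the domain are arbitrary. *)
Definition gen_val (x : V) : V := hlim_or0 (fun n => gen_seq_val n x).

Lemma gen_seq_val_lim x : udom A x -> hlim (fun n => gen_seq_val n x) (A x).
Proof.
move=> Ax; exact: (rlim_hlim (@harmonic_gt0 R) (@cvg_harmonic R) (gen_rlim gAS Ax)).
Qed.

(** The domain is a set of convergence of bounded operators, so the times at which a jointly
    measurable process leaves it form a measurable set. *)
Lemma gen_domP x : udom A x <-> exists l, hlim (fun n => gen_seq_val n x) l.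
Proof.
split=> [/gen_seq_val_lim h|[l hl]]; first by exists (A x).
by have [] := gen_seq hV sV gAS harmonic_gt0 cvg_harmonic hl.
Qed.

Lemma gen_valE x : udom A x -> gen_val x = A x.
Proof. by move=> /gen_seq_val_lim h; exact: (hlim_or0_lim hV h). Qed.

Context d (Om : measurableType d) (P : probability Om R) (T : R).
Local Notation leb := (@lebesgue_measure R).
Local Notation TO := (measurableTypeR R * Om)%type.
Local Notation cyl := ([set p : TO | 0 <= p.1 <= T]).
Local Notation dom := (`[0, T]%classic : set (measurableTypeR R)).
Implicit Types X Y : R -> Om -> V.

Lemma jwmeas_gen_seq_val X n : jwmeas T X -> wmeas cyl (fun p : TO => gen_seq_val n (X p.1 p.2)).
Proof.
by move=> jX; apply: (wmeas_bop hV sV) => //; apply: sg_diff_bop; rewrite invr_ge0.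
Qed.

Lemma jwmeas_gen_val X : jwmeas T X -> jwmeas T (fun s om => gen_val (X s om)).
Proof.
move=> jX; apply: wmeas_hlim_or0 => //; first exact: measurable_cylinder.
by move=> n; exact: jwmeas_gen_seq_val.
Qed.

Lemma ae_paths_dom X : jwmeas T X ->
  (forall s, 0 <= s <= T -> {ae P, forall om, udom A (X s om)}) ->
  {ae P, forall om, {ae leb, forall s, dom s -> udom A (X s om)}}.
Proof.
move=> jX hX; pose N : set TO := [set p | ~ udom A (X p.1 p.2)].
have mN : measurable (cyl `&` N).
  have mC := @measurable_cylinder R T _ Om.
  have mc := wmeas_cvg_set hV sV mC (fun n => jwmeas_gen_seq_val n jX).
  rewrite (_ : cyl `&` N = cyl `\` (cyl `&` [set p | exists l, hlim (fun n => gen_seq_val n (X p.1 p.2)) l])).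
    exact: measurableD.
  apply/seteqP; split => p /=; first by move=> [cp Np]; split => // -[_ /gen_domP].
  by move=> [cp h]; split => // /gen_domP h'; apply: h.
have := null_sections (P := P) mN.
move=> h; apply: aeS (h _) => [om|s hs].
  by apply: aeS => s h' ds; apply: contrapT => nd; exact: (h' ds nd).
by apply: aeS (hX s hs) => om h' /=; apply.
Qed.

Lemma ae_paths_eq X Y : jwmeas T X -> jwmeas T Y ->
  (forall s, 0 <= s <= T -> {ae P, forall om, X s om = Y s om}) ->
  {ae P, forall om, {ae leb, forall s, dom s -> X s om = Y s om}}.
Proof.
move=> jX jY hX; pose N : set TO := [set p | X p.1 p.2 <> Y p.1 p.2].
have mC := @measurable_cylinder R T _ Om.
have mN : measurable (cyl `&` N).
  have mn : measurable_fun cyl (fun p : TO => hnorm (X p.1 p.2 - Y p.1 p.2)).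
    by apply: wmeas_norm => //; exact: wmeasB.
  have := mn mC (~` [set 0]) (measurableC (measurable_set1 _)).
  congr measurable; apply/seteqP; split => p /= [cp h]; split => //.
    by move=> e; apply: h; rewrite e subrr hnorm0.
  by move=> e; apply: h; move/(hnorm_eq0 hV)/eqP: e; rewrite subr_eq0 => /eqP.
have := null_sections (P := P) mN.
move=> h; apply: aeS (h _) => [om|s hs].
  by apply: aeS => s h' ds; apply: contrapT => nd; exact: (h' ds nd).
by apply: aeS (hX s hs) => om h' /=; apply.
Qed.

End GeneratorOnProcesses.

(** * Pathwise convolutions as adapted processes *)

Section ConvolutionProcesses.
Context {R : realType} {k : scalar_kind} (V : ipSpace R k) (hV : hilbert V) (sV : hseparable V).
Context (A : unbounded V V) (S : R -> V -> V) (gAS : generates A S).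
Let hS : C0_semigroup S := proj1 gAS.
Context d (Om : measurableType d) (P : probability Om R).
Context (F : R -> set (set Om)) (hF : usual_filtration P F) (T : R) (T0 : 0 < T).
Local Notation leb := (@lebesgue_measure R).
Local Notation tint a b f v := (bint leb `[a, b]%classic (f : R -> V) v).
Local Notation dom t := (`[0, t]%classic : set (measurableTypeR R)).
Local Notation fin a b g := (\int[leb]_(s in `[a%R, b%R]) (hnorm (g s))%:E < +oo)%E.

Lemma cont_path_fin (g : R -> V) : cont_path T g -> fin 0 T g.
Proof.
move=> cg; have [C hC] := cont_path_bound hV (ltW T0) cg.
apply: (bounded_nrm (C := C) (measurable_cc 0 T)); last exact: lebesgue_itv_fin.
by move=> s; rewrite /= in_itv/=; exact: hC.
Qed.

(** Adaptedness comes from the Riemann sums, finite sums of bounded operators applied to g at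
    earlier times; continuity of the paths then gives joint measurability. *)
Lemma cont_conv_process (g : R -> Om -> V) : process F T g -> (forall om, cont_path T (g^~ om)) ->
  exists Y, process F T Y /\ {ae P, forall om, forall t, 0 <= t <= T ->
    tint 0 t (fun r => S (t - r) (g r om)) (Y t om)}.
Proof.
move=> pg cg.
have ex p : exists v, 0 <= p.1 <= T -> tint 0 p.1 (fun r => S (p.1 - r) (g r p.2)) v.
  case: p => t om /=; have [/andP[t0 tT]|_] := boolP (0 <= t <= T); last by exists 0.
  have mg := cont_path_wmeas hV T0 (cg om).
  by have [v hv] := conv_ex_sub hV sV gAS tT mg (cont_path_fin (cg om)); exists v.
have [Y0 hY0] := choice ex; pose X t om := Y0 (t, om).
have hX om t : 0 <= t <= T -> tint 0 t (fun r => S (t - r) (g r om)) (X t om).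
  by move=> ht; exact: (hY0 (t, om)).
have aX t : 0 <= t <= T -> hmeasurable (F t) (X t).
  move=> ht; have /andP[t0 tT] := ht.
  apply: (hmeasurable_hlim_ae hV sV hF t0 (u := fun n om => riemann_conv S (g^~ om) t n)); last first.
    by apply: aeW => om; exact: (riemann_conv_cvg hV sV hS ht (cg om) (hX om t ht)).
  move=> n; apply: (hmeasurable_sum hV sV hF t0) => i.
  have /andP[s0 st] := node_itv t0 (ltnW (ltn_ord i) : (i <= n.+1)%N).
  have /andP[s0' st'] := node_itv t0 (ltn_ord i : (i.+1 <= n.+1)%N).
  have mg : hmeasurable (F t) (g (node t n i.+1)).
    apply: hmeasurable_sub (process_adapted pg _); first exact: (filtration_le hF).
    by rewrite s0' (le_trans st').
  apply: (hmeasurableB hV sV (filtration_sigma hF t0)).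
    by apply: (hmeasurable_bop hV sV hF hV sV t0) => //; apply: sg_int_bop => //; rewrite subr_ge0.
  by apply: (hmeasurable_bop hV sV hF hV sV t0) => //; apply: sg_int_bop => //; rewrite subr_ge0.
have cX : {ae P, forall om, cont_path T (X^~ om)}.
  apply: aeW => om; apply: (conv_cont_path hV sV hS (cont_path_wmeas hV T0 (cg om)) (cont_path_fin (cg om))).
  exact: hX.
have [Y [pY _ YX]] := path_modification hV sV hF T0 aX cX.
exists Y; split => //; apply: aeS YX => om YX t ht; rewrite YX; exact: hX.
Qed.

(** With the identity semigroup a convolution is a primitive, so [conv_cont_path] also gives
    continuity of primitives. *)
Lemma id_C0 : C0_semigroup (fun (_ : R) (x : V) => x).
Proof.
split => // [t _|x]; first exact: bounded_op_id.
by under eq_fun do rewrite subrr (hnorm0 hV); exact: cvg_cst.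
Qed.

Context (U : ipSpace R k) (hU : hilbert U) (sU : hseparable U) (B : U -> V) (bB : bounded_op B).
Context (u ut : R -> Om -> U).
Hypothesis u_adapted : adapted F `[0, T]%classic u.
Hypothesis ut_process : process F T ut.
Hypothesis u_deriv : has_derivative P T u ut.

Lemma input_paths : {ae P, forall om, [/\ wmeas (dom T) (ut^~ om),
  fin 0 T (ut^~ om) & forall t, 0 <= t <= T -> tint 0 t (fun r => B (ut r om)) (B (u t om - u 0 om))]}.
Proof.
have mut om : wmeas (dom T) (ut^~ om) by apply: wmeas_section; exact: (process_jwmeas hU sU ut_process).
have sub t : t <= T -> wmeas (dom t) (ut^~ _) by move=> tT om; apply: (wmeasS (measurable_cc 0 T) (sub_dom tT)).
apply: aeS u_deriv => om h.
have h' t : 0 <= t <= T -> bint leb (dom t) (ut^~ om) (u t om - u 0 om).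
  move=> ht; apply/(tint_bochner hU sU); last exact: h.
  by case/andP: ht => _ tT; exact: (wmeasS (measurable_cc 0 T) (sub_dom tT)).
split => //.
  by have [] := h' T (introT andP (conj (ltW T0) (lexx T))).
by move=> t ht; apply: (tint_bop hU sU hV bB); exact: h'.
Qed.

Lemma input_conv_process : exists y, process F T y /\ {ae P, forall om, forall t, 0 <= t <= T ->
    tint 0 t (fun r => S (t - r) (B (ut r om))) (y t om)}.
Proof.
pose g0 t om := B (u t om - u 0 om).
have T00 : 0 <= (0 : R) <= T by rewrite lexx ltW.
have gam om : wmeas (dom T) (ut^~ om) -> fin 0 T (ut^~ om) ->
    wmeas (dom T) (fun r => B (ut r om)) /\ fin 0 T (fun r => B (ut r om)).
  move=> m1 f1; split; first by apply: (wmeas_bop hU sU).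
  have [v hv] := tint_ex hU sU m1 f1.
  by have [] := tint_bop hU sU hV bB hv.
have cg0 : {ae P, forall om, cont_path T (g0^~ om)}.
  apply: aeS input_paths => om [m1 f1 h]; have [m2 f2] := gam om m1 f1.
  exact: (conv_cont_path hV sV id_C0 m2 f2 h).
have ag0 t : 0 <= t <= T -> hmeasurable (F t) (g0 t).
  move=> ht; have /andP[t0 tT] := ht.
  have au s : 0 <= s <= T -> hmeasurable (F s) (u s) by move=> hs; apply: u_adapted; rewrite /= in_itv.
  apply: (hmeasurable_bop hU sU hF hV sV t0 bB).
  apply: (hmeasurableB hU sU (filtration_sigma hF t0)); first exact: au.
  by apply: hmeasurable_sub (au 0 T00); exact: (filtration_le hF).
have [g [pg cg gE]] := path_modification hV sV hF T0 ag0 cg0.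
have [Y [pY hY]] := cont_conv_process pg cg.
have ex p : exists v, 0 <= p.1 <= T -> wmeas (dom T) (ut^~ p.2) -> fin 0 T (ut^~ p.2) ->
    tint 0 p.1 (fun r => S (p.1 - r) (B (ut r p.2))) v.
  case: p => t om /=; have [/andP[t0 tT]|_] := boolP (0 <= t <= T); last by exists 0.
  have [[m1 f1]|h] := pselect (wmeas (dom T) (ut^~ om) /\ fin 0 T (ut^~ om)); last first.
    by exists 0 => _ m1 f1; exfalso; exact: h.
  have [m2 f2] := gam om m1 f1.
  by have [v hv] := conv_ex_sub hV sV gAS tT m2 f2; exists v.
have [y0 hy0] := choice ex; pose X t om := y0 (t, om).
have hX : {ae P, forall om, forall t, 0 <= t <= T -> tint 0 t (fun r => S (t - r) (B (ut r om))) (X t om)}.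
  by apply: aeS input_paths => om [m1 f1 _] t ht; exact: (hy0 (t, om)).
have cX : {ae P, forall om, cont_path T (X^~ om)}.
  apply: aeS2 input_paths hX => om [m1 f1 _] h; have [m2 f2] := gam om m1 f1.
  exact: (conv_cont_path hV sV hS m2 f2 h).
have aX t : 0 <= t <= T -> hmeasurable (F t) (X t).
  move=> ht; have /andP[t0 tT] := ht.
  apply: (hmeasurable_hlim_ae hV sV hF t0 (u := fun n om => gen_seq_val S n (Y t om) + g t om)).
    move=> n; apply: (hmeasurable_add hV sV hF t0); last exact: (process_adapted pg ht).
    apply: (hmeasurable_bop hV sV hF hV sV t0); last exact: (process_adapted pY ht).
    by apply: (sg_diff_bop hV gAS); rewrite invr_ge0.
  have step : {ae P, forall om, udom A (Y t om) /\ A (Y t om) = X t om - g t om}.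
    have both : {ae P, forall om, (forall t, 0 <= t <= T -> tint 0 t (fun r => S (t - r) (g r om)) (Y t om)) /\
        forall t, 0 <= t <= T -> tint 0 t (fun r => S (t - r) (B (ut r om))) (X t om)}.
      by apply: aeS2 hY hX => om.
    apply: aeS3 input_paths both gE => om [m1 f1 h] [h1 h2] e; have [m2 f2] := gam om m1 f1.
    have m3 := wmeasS (measurable_cc 0 T) (sub_dom tT) m2.
    have f3 := sub_fin hV sV tT m2 f2.
    apply: (conv_parts hV sV gAS t0 m3 f3 (G := g^~ om) _ (h2 t ht) (h1 t ht)).
    move=> s /andP[s0 st]; rewrite e; apply: h; by rewrite s0 (le_trans st).
  apply: aeS step => om [d1 d2].
  have := hlimD hV (gen_seq_val_lim gAS d1) (hlim_cst hV (g t om)).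
  by rewrite d2 subrK.
have [y [py _ yX]] := path_modification hV sV hF T0 aX cX.
by exists y; split => //; apply: aeS2 yX hX => om e h t ht; rewrite e; exact: h.
Qed.

End ConvolutionProcesses.

(** * The stochastic convolution in the domain of the generator *)

Section SmoothingMeans.
Context {R : realType} {k : scalar_kind} (Z : ipSpace R k) (e : nat -> Z).
Context (W : ipSpace R k) (hW : hilbert W) (sW : hseparable W).
Context (S : R -> W -> W) (hS : C0_semigroup S) (K : Z -> W).
Local Notation leb := (@lebesgue_measure R).
Local Notation cc t := (`[0, t]%classic : set (measurableTypeR R)).

(** The average of the semigroup over [0, 1/(n+1)]. On D(A) the n-th difference quotient of x is
    this mean of A x, and the means are uniformly bounded and tend strongly to the identity. *)
Definition sg_mean (n : nat) (y : W) : W := ofR (n.+1%:R^-1)^-1 *: sg_int S n.+1%:R^-1 y.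

Lemma harmonic_itv (n : nat) : 0 <= (n.+1%:R^-1 : R) <= 1.
Proof. by rewrite invr_ge0 ler0n invf_le1// ler1n. Qed.

Lemma sg_mean_bop n : bounded_op (sg_mean n).
Proof.
by apply: bounded_opZ => //; apply: sg_int_bop => //; case/andP: (harmonic_itv n).
Qed.

Lemma sg_mean_le M n y : (forall t x, 0 <= t <= 1 -> hnorm (S t x) <= M * hnorm x) -> 0 <= M ->
  hnorm (sg_mean n y) <= M * hnorm y.
Proof.
move=> hM M0; rewrite /sg_mean hnormZR// ger0_norm; last by rewrite invrK.
have := sg_int_norm hW sW hS y hM M0 (harmonic_itv n).
move=> h; apply: le_trans (ler_wpM2l _ h) _; first by rewrite invrK.
by rewrite mulrA [_^-1 * _]mulrCA mulVf ?mulr1// invr_eq0.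
Qed.

Lemma sg_mean_lim y : hlim (fun n => sg_mean n y) y.
Proof. exact: (rlim_hlim (@harmonic_gt0 R) (@cvg_harmonic R) (sg_int_rlim hW sW hS y)). Qed.

(** K will be A G Q^(1/2): the square root already sits inside K, where A can be applied, hence [id]
    in its slot. *)
Definition hs_sg (r : R) : \bar R := hs id e (fun x => S r (K x)).

Definition hs_sg_err (n : nat) (r : R) : \bar R :=
  hs id e (fun x => sg_mean n (S r (K x)) - S r (K x)).

Lemma hs_sg_ge0 r : (0 <= hs_sg r)%E.
Proof. exact: hs_ge0. Qed.

Lemma hs_sg_err_ge0 n r : (0 <= hs_sg_err n r)%E.
Proof. exact: hs_ge0. Qed.

Lemma measurable_hs_sg t : measurable_fun (cc t) hs_sg.
Proof. by apply: (measurable_hs hW sW) => x; exact: sg_wmeas. Qed.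

Lemma conv_cst_wmeas t x : wmeas (cc t) (fun r => S (t - r) (K x)).
Proof.
apply: (@conv_wmeas _ _ _ hW sW S hS t (fun=> K x)); exact: wmeas_cst.
Qed.

Lemma measurable_hs_sg_refl t : measurable_fun (cc t) (fun r => hs_sg (t - r)).
Proof. by apply: (measurable_hs hW sW) => x; exact: conv_cst_wmeas. Qed.

Lemma measurable_hs_sg_err t n : measurable_fun (cc t) (fun r => hs_sg_err n (t - r)).
Proof.
apply: (measurable_hs hW sW) => x; apply: wmeasB => //; last exact: conv_cst_wmeas.
by apply: (wmeas_bop hW sW); [exact: hW|exact: sg_mean_bop|exact: conv_cst_wmeas].
Qed.

Lemma hs_sg_refl_le T t : 0 <= t <= T ->
  (\int[leb]_(r in cc t) hs_sg (t - r) <= \int[leb]_(r in cc T) hs_sg r)%E.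
Proof.
move=> /andP[t0 tT]; rewrite (@integral_refl R 0 t t) subrr subr0; last exact: measurable_hs_sg.
apply: ge0_subset_integral; [exact: measurable_cc|exact: measurable_cc|exact: measurable_hs_sg| |exact: sub_dom].
by move=> r _; exact: hs_sg_ge0.
Qed.

Hypothesis KHS : forall t, 0 <= t -> (\int[leb]_(r in cc t) hs_sg (t - r) < +oo)%E.

(** Dominated convergence twice: in the series, at each time where the norm of S(t-r) K is finite,
    and then in time, with that norm as majorant up to a constant. *)
Lemma hs_sg_err_cvg t : 0 <= t ->
  (\int[leb]_(r in cc t) hs_sg_err n (t - r))%E @[n --> \oo] --> 0%E.
Proof.
move=> t0; have [M M1 hM] := sg_bound hW hS 1; have M0 : 0 <= M by exact: le_trans M1.
have M10 : 0 <= M + 1 by rewrite addr_ge0.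
have mc := measurable_cc 0 t.
have bnd n y : hnorm (sg_mean n y - y) <= (M + 1) * hnorm y.
  by apply: le_trans (hnormB hW _ _) _; rewrite mulrDl mul1r lerD2r; exact: sg_mean_le.
have cv : {ae leb, forall r, cc t r -> hs_sg_err n (t - r) @[n --> \oo] --> 0%E}.
  have := integral_lty_ae mc (measurable_hs_sg_refl (t := t)) (fun r _ => hs_sg_ge0 (t - r)) (KHS t0).
  apply: aeS => r h /h fr.
  apply: (hs_cvg0 (b := fun i => (((M + 1) ^+ 2)%:E * (hnorm (S (t - r) (K (e i))) ^+ 2)%:E)%E)).
  - by move=> i; rewrite mule_ge0// lee_fin sqr_ge0.
  - rewrite nneseriesZl; last by move=> i _; rewrite lee_fin sqr_ge0.
    by apply: lte_mul_pinfty; rewrite ?lee_fin ?sqr_ge0.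
  - by move=> n i; rewrite -EFinM lee_fin -exprMn lerXn2r ?nnegrE ?hnorm_ge0 ?mulr_ge0 ?hnorm_ge0.
  - by move=> i; exact: sg_mean_lim.
have ig : leb.-integrable (cc t) (fun r => ((M + 1) ^+ 2)%:E * hs_sg (t - r))%E.
  apply/integrableP; split; first by apply: measurable_funeM; exact: measurable_hs_sg_refl.
  apply: (@le_lt_trans _ _ (((M + 1) ^+ 2)%:E * \int[leb]_(r in cc t) hs_sg (t - r))%E).
    rewrite -ge0_integralZl_EFin ?sqr_ge0//; [|by move=> r _; exact: hs_sg_ge0|exact: measurable_hs_sg_refl].
    apply: nonneg_le_integral => r _; first exact: abse_ge0.
    by rewrite gee0_abs// mule_ge0 ?hs_sg_ge0// lee_fin sqr_ge0.
  apply: lte_mul_pinfty; rewrite ?lee_fin ?sqr_ge0//; exact: KHS.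
have dm : {ae leb, forall r n, cc t r -> (`|hs_sg_err n (t - r)| <= ((M + 1) ^+ 2)%:E * hs_sg (t - r))%E}.
  apply: aeW => r n _; rewrite gee0_abs ?hs_sg_err_ge0//.
  by apply: hs_le => x; exact: bnd.
have [_ _] := dominated_convergence mc (measurable_hs_sg_err (t := t)) (measurable_cst _) cv ig dm.
by rewrite integral0.
Qed.

End SmoothingMeans.

Section StochasticConvolutionDomain.
Context {R : realType} {k : scalar_kind} (Z : ipSpace R k) (hZ : hilbert Z) (sZ : hseparable Z).
Context d (Om : measurableType d) (P : probability Om R).
Context (F : R -> set (set Om)) (hF : usual_filtration P F).
Context (E : set Z) (Q : Z -> Z) (hQ : covariance_operator E Q).
Context (w : R -> Om -> Z) (hw : wiener P F Q w).
Context (hE : orthonormal_basis E) (Qh : Z -> Z) (hQh : square_root Q Qh).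
Context (e : nat -> Z).
Hypothesis hEe : forall f : Z -> \bar R, (forall x, (0 <= f x)%E) -> f 0 = 0%E ->
  (\esum_(x in E) f x = \sum_(0 <= i <oo) f (e i))%E.
Context (W : ipSpace R k) (hW : hilbert W) (sW : hseparable W).
Context (A : unbounded W W) (S : R -> W -> W) (gAS : generates A S) (G : Z -> W) (bG : bounded_op G).
Local Notation leb := (@lebesgue_measure R).
Local Notation cc t := (`[0, t]%classic : set (measurableTypeR R)).
Local Notation HS := (hs Qh e).
Local Notation SI := (is_stochastic_integral P E Qh w).
Hypothesis GHS : (HS G < +oo)%E.
Hypothesis GQ_dom : forall z, udom A (G (Qh z)).
Hypothesis AGHS : forall t, 0 <= t ->
  (\int[leb]_(s in `[0%R, t]) L20norm2 E Qh (fun z => A (S (t - s)%R (G z))) < +oo)%E.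
Let hS : C0_semigroup S := proj1 gAS.
Let bQh : bounded_op Qh. Proof. by case: hQh. Qed.
Let K (x : Z) : W := A (G (Qh x)).
Local Notation kap := (hs_sg e S K).

(** On the domain A commutes with the semigroup, so A S(t-r) G Q^(1/2) = S(t-r) K and the
    integrability assumption is one on S K. *)
Lemma AG_hs_sg t : 0 <= t -> (\int[leb]_(r in cc t) kap (t - r) < +oo)%E.
Proof.
move=> t0; apply: le_lt_trans (AGHS t0); rewrite le_eqVlt; apply/orP; left; apply/eqP.
apply: eq_integral => r /set_mem; rewrite /= in_itv/= => /andP[r0 rt].
have tr : 0 <= t - r by rewrite subr_ge0.
rewrite (L20E hW bQh hEe); last first.
  rewrite (bop0 bG) (bop0 (sg_bop hS tr)); by have [] := gen0 hW sW gAS.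
apply: eq_eseriesr => i _.
by have [_ e1] := gen_S hW sW gAS tr (GQ_dom (e i)); rewrite e1.
Qed.

Lemma gen_seq_val_conv n r z : 0 <= r -> gen_seq_val S n (S r (G (Qh z))) = sg_mean S n (S r (K z)).
Proof.
move=> r0; have [u1 u2] := gen_S hW sW gAS r0 (GQ_dom z).
apply: (etrans (sg_diffE hW sW gAS (harmonic_gt0 n) u1)).
exact: (congr1 (fun q => ofR (n.+1%:R^-1)^-1 *: sg_int S n.+1%:R^-1 q) u2).
Qed.

(** A difference quotient is bounded, so it passes inside the stochastic integral, where it becomes
    a mean of S(t-r) K. The quotients of I are thus Cauchy in L^2; a subsequence converges almost
    surely and [gen_seq] places I in D(A). Fatou gives the moment bound, with C independent of t so
    that it can be integrated over time. *)
Lemma conv_gen_domain T : 0 <= T -> exists C : \bar R, (C < +oo)%E /\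
  forall t I, 0 <= t <= T -> SI t (fun r x => S (t - r) (G x)) I ->
  {ae P, forall om, udom A (I om)} /\ (\int[P]_om (hnorm (gen_val S (I om)) ^+ 2)%:E <= C)%E.
Proof.
move=> T0; have [M M1 hM] := sg_bound hW hS 1; have M0 : 0 <= M by exact: le_trans M1.
pose KT := (\int[leb]_(r in cc T) kap r)%E.
have KT0 : (0 <= KT)%E by apply: integral_ge0 => r _; exact: hs_sg_ge0.
have KTfin : (KT < +oo)%E.
  have := AG_hs_sg T0; rewrite (@integral_refl R 0 T T) subrr subr0; first by [].
  exact: measurable_hs_sg.
exists (9%:E * ((M ^+ 2)%:E * KT))%E; split.
  by apply: lte_mul_pinfty => //; apply: lte_mul_pinfty; rewrite ?lee_fin ?sqr_ge0.
move=> t I ht sI; have /andP[t0 tT] := ht.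
have mI := SI_wmeas hW sW sI.
have iP := conv_integrand hZ hW hS bG GHS t0.
have bD n : bounded_op (gen_seq_val S n).
  by apply: (sg_diff_bop hW gAS); rewrite invr_ge0.
have sD n := SI_bop hZ sZ hF hw hQh hEe hW sW hW sW (bD n) iP sI.
have iD n : integrand t (fun r x => gen_seq_val S n (S (t - r) (G x))).
  split=> [x|r hr]; first by apply: (wmeas_bop hW sW) => //; exact: iP.1.
  by apply: (bounded_op_comp hZ hW hW) => //; exact: iP.2.
have mD n : wmeas setT (fun om => gen_seq_val S n (I om)) by exact: (SI_wmeas hW sW (sD n)).
pose b n := (\int[leb]_(r in cc t) hs_sg_err e S K n (t - r))%E.
have b0 n : (0 <= b n)%E by apply: integral_ge0 => r _; exact: hs_sg_err_ge0.
have bcv : b n @[n --> \oo] --> 0%E by exact: (hs_sg_err_cvg hW sW hS AG_hs_sg t0).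
have dist n j : (\int[P]_om (hnorm (gen_seq_val S n (I om) - gen_seq_val S j (I om)) ^+ 2)%:E <=
    9%:E * (2%:E * (b n + b j)))%E.
  apply: le_trans (SI_dist hZ sZ hF hQ hw hE hQh hEe hW sW (iD n) (iD j) (sD n) (sD j)) _.
  have p i r : cc t r -> (0 <= hs_sg_err e S K i (t - r))%E by move=> _; exact: hs_sg_err_ge0.
  have m i := @measurable_hs_sg_err _ _ _ e W hW sW S hS K t i.
  apply: lee_wpmul2l => //; rewrite /b -(ge0_integralD _ (measurable_cc 0 t) (p n) (m n) (p j) (m j)).
  have mE : measurable_fun (cc t) (fun r => hs_sg_err e S K n (t - r) + hs_sg_err e S K j (t - r))%E.
    by apply: emeasurable_funD; exact: measurable_hs_sg_err.
  rewrite -(ge0_integralZl_EFin _ (measurable_cc 0 t) _ mE)//; last first.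
    by move=> r _; rewrite adde_ge0// hs_sg_err_ge0.
  apply: nonneg_le_integral => r; rewrite /= in_itv/= => /andP[r0 rt]; first exact: hs_ge0.
  have tr : 0 <= t - r by rewrite subr_ge0.
  have e2 : hs_sg_err e S K j (t - r) = hs id e (fun x => S (t - r) (K x) - sg_mean S j (S (t - r) (K x))).
    by apply: eq_hs => x; exact: hnormBC.
  rewrite e2; apply: le_trans (hs_D2 hW _ _ _ _).
  rewrite le_eqVlt; apply/orP; left; apply/eqP; apply: eq_eseriesr => i _.
  by rewrite !gen_seq_val_conv// addrA subrK.
have cau ep : 0 < ep -> exists N, forall i j, (N <= i)%N -> (N <= j)%N ->
    (\int[P]_om (hnorm (gen_seq_val S i (I om) - gen_seq_val S j (I om)) ^+ 2)%:E <= ep%:E)%E.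
  (* 9 * 2 * (ep / 36 + ep / 36) = ep. *)
  move=> ep0; have ep6 : 0 < ep / 36 by rewrite divr_gt0.
  have [N hN] := (ecvg0_nat b0).1 bcv _ ep6; exists N => i j Ni Nj.
  apply: le_trans (dist i j) _.
  apply: (@le_trans _ _ (9%:E * (2%:E * ((ep / 36)%:E + (ep / 36)%:E)))%E).
    apply: lee_wpmul2l => //; apply: lee_wpmul2l => //; exact: (leeD (hN i Ni) (hN j Nj)).
  by rewrite -EFinD -!EFinM lee_fin; lra.
have mn i j : measurable_fun setT (fun om => hnorm (gen_seq_val S i (I om) - gen_seq_val S j (I om))).
  by apply: (wmeas_norm hW sW); exact: wmeasB.
have [phi [phii hphi]] := L2_cauchy_ae_subseq measurableT hW mn cau.
have hpos i : 0 < ((phi i).+1%:R^-1 : R) by rewrite invr_gt0.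
have hcv : ((phi i).+1%:R^-1 : R) @[i --> \oo] --> (0 : R).
  apply: (@cvg0_sub _ (fun n => n.+1%:R^-1) phi phii); exact: cvg_harmonic.
have domI : {ae P, forall om, udom A (I om)}.
  by apply: aeS hphi => om /(_ Logic.I) [l hl]; have [] := gen_seq hW sW gAS hpos hcv hl.
split; first exact: domI.
apply: (@fatou_le _ _ _ P setT measurableT (fun n om => (hnorm (gen_seq_val S n (I om)) ^+ 2)%:E) _ _ 0%N).
- by move=> n; exact: wmeas_norm2.
- by move=> n om _; rewrite lee_fin sqr_ge0.
(* The second moment of the quotient is its squared distance to the zero integral. *)
- move=> n _; have s0 : SI t (fun _ _ => (0 : W)) (fun=> 0) by apply: (SI_zero hZ _ w hQh hEe hW sW).
  have i0 : integrand t (fun (_ : R) (_ : Z) => (0 : W)).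
    by split => [x|r _]; [exact: wmeas_cst|exact: bounded_op0].
  have := SI_dist hZ sZ hF hQ hw hE hQh hEe hW sW (iD n) i0 (sD n) s0.
  move=> h; apply: le_trans (_ : (_ <= \int[P]_om (hnorm (gen_seq_val S n (I om) - 0)%R ^+ 2)%:E)%E) _.
    by rewrite le_eqVlt; apply/orP; left; apply/eqP; apply: eq_n2 => om _; rewrite subr0.
  apply: le_trans h _; apply: lee_wpmul2l => //.
  apply: le_trans (_ : (((M ^+ 2)%:E * \int[leb]_(r in cc t) kap (t - r)) <= _)%E); last first.
    by apply: lee_wpmul2l; [rewrite lee_fin sqr_ge0|exact: hs_sg_refl_le].
  have p r : cc t r -> (0 <= kap (t - r))%E by move=> _; exact: hs_sg_ge0.
  have mk := @measurable_hs_sg_refl _ _ _ e W hW sW S hS K t.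
  rewrite -(ge0_integralZl_EFin _ (measurable_cc 0 t) p mk (sqr_ge0 M)).
  apply: nonneg_le_integral => r; rewrite /= in_itv/= => /andP[r0 rt]; first exact: hs_ge0.
  have tr : 0 <= t - r by rewrite subr_ge0.
  apply: le_trans (_ : (hs id e (fun x => sg_mean S n (S (t - r) (K x))) <= _)%E); last first.
    by apply: hs_le => x; exact: sg_mean_le.
  rewrite le_eqVlt; apply/orP; left; apply/eqP; apply: eq_eseriesr => i _.
  by rewrite gen_seq_val_conv// subr0.
- by move=> om _; rewrite lee_fin sqr_ge0.
- apply: aeS domI => om dI _; have l := gen_seq_val_lim gAS dI.
  rewrite (gen_valE hW gAS dI).
  apply/fine_cvgP; split; first exact: nearW.
  exact: (cvg_sqr (hlim_norm hW l)).
Qed.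

End StochasticConvolutionDomain.

(** * Strong and mild solutions *)

Section SolutionExistence.
Context {R : realType} {k : scalar_kind} (Z : ipSpace R k) (hZ : hilbert Z) (sZ : hseparable Z).
Context d (Om : measurableType d) (P : probability Om R).
Context (F : R -> set (set Om)) (hF : usual_filtration P F).
Context (E : set Z) (Q : Z -> Z) (hQ : covariance_operator E Q).
Context (w : R -> Om -> Z) (hw : wiener P F Q w).
Context (hE : orthonormal_basis E) (Qh : Z -> Z) (hQh : square_root Q Qh).
Context (e : nat -> Z).
Hypothesis hEe : forall f : Z -> \bar R, (forall x, (0 <= f x)%E) -> f 0 = 0%E ->
  (\esum_(x in E) f x = \sum_(0 <= i <oo) f (e i))%E.
Context (W : ipSpace R k) (hW : hilbert W) (sW : hseparable W).
Context (A : unbounded W W) (S : R -> W -> W) (gAS : generates A S) (G : Z -> W) (bG : bounded_op G).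
Context (T : R) (T0 : 0 < T).
Local Notation leb := (@lebesgue_measure R).
Local Notation tint a b f v := (bint leb `[a, b]%classic (f : R -> W) v).
Local Notation cc t := (`[0, t]%classic : set (measurableTypeR R)).
Local Notation fin a b g := (\int[leb]_(s in `[a%R, b%R]) (hnorm (g s))%:E < +oo)%E.
Local Notation HS := (hs Qh e).
Local Notation SI := (is_stochastic_integral P E Qh w).
Hypothesis GHS : (HS G < +oo)%E.
Let hS : C0_semigroup S := proj1 gAS.
Let T00 : 0 <= (0 : R) <= T. Proof. by rewrite lexx ltW. Qed.
Let TT : 0 <= T <= T. Proof. by rewrite lexx ltW. Qed.

Lemma SI_cst t : 0 <= t -> SI t (fun=> G) (fun om => G (w t om - w 0 om)).
Proof.
move=> t0; have bnd (i : 'I_1) : 0 <= (0 : R) /\ (0 : R) <= t /\ t <= t by [].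
pose s0 := @Elementary R k Z W t 1 (fun=> 0) (fun=> t) (fun=> G) bnd (fun=> bG).
have iG : integrand t (fun _ : R => G) by split => [x|//]; exact: wmeas_cst.
apply: (SI_intro hZ hQh hEe hW sW iG).
  apply: (wmeas_bop hZ sZ) => //; apply: wmeasB => //.
    exact: (wiener_wmeas hZ sZ hF hw t0).
  exact: (wiener_wmeas hZ sZ hF hw (lexx 0)).
move=> ep ep0; exists s0; split; last first.
  rewrite integral0_eq ?lee_fin ?ltW// => om _.
  by rewrite /el_integral big_ord1 subrr hnorm0// expr0n.
(* The single interval ]0, t] misses r = 0, so the elementary integrand equals G only almost
   everywhere. *)
rewrite (nonneg_ae_eq_integral (g := cst 0%E)); first by rewrite integral0 lee_fin ltW.
- by move=> r _; exact: hs_ge0.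
- by [].
apply: aeS (ae_neq 0) => r r0; rewrite /= in_itv/= => /andP[r1 r2].
rewrite /hs eseries0// => i _ _; rewrite /el_fun big_ord1 /= indicE mem_set.
  by rewrite ofR1 scale1r subrr hnorm0// expr0n.
by rewrite /= in_itv/= r2 andbT lt_neqAle r1 andbT eq_sym; exact/eqP.
Qed.

Lemma noise_process : exists g : R -> Om -> W, [/\ process F T g, forall om, cont_path T (g^~ om) &
  {ae P, forall om, forall t, g t om = G (w t om - w 0 om)}].
Proof.
apply: (path_modification hW sW hF T0).
  move=> t /andP[t0 _]; apply: (hmeasurable_bop hZ sZ hF hW sW t0 bG).
  exact: (wiener0_adapted hZ sZ hF hw t0 (lexx t)).
have [_ cw _ _ _] := hw; have [C C0 hC] := bop_bound bG.
apply: aeS cw => om cw t /andP[t0 tT] ep ep0.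
have epC : 0 < ep / C by rewrite divr_gt0.
have /cvgrPdist_lt/(_ _ epC) := cw t t0.
rewrite near_withinE => -[dl /= dl0 hd]; exists dl => // s /andP[s0 sT] st.
have := hd s; rewrite /= distrC => /(_ st); rewrite in_itv/= s0 => /(_ isT).
rewrite sub0r normrN ger0_norm ?hnorm_ge0// => h.
rewrite -(bopB bG); apply: le_lt_trans (hC _) _.
by rewrite opprB addrA subrK mulrC -ltr_pdivlMr.
Qed.

(* Summation by parts turns the Riemann-Stieltjes sums of the stochastic
   convolution into A applied to Riemann sums of a deterministic one. *)
Lemma conv_noise_parts (X g Y : R -> Om -> W) t : 0 <= t <= T ->
  (exists phi : nat -> nat, (forall j, (j <= phi j)%N) /\
    {ae P, forall om, hlim (fun j => \sum_(i < (phi j).+1) S (t - node t (phi j) i)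
      (G (w (node t (phi j) i.+1) om - w (node t (phi j) i) om))) (X t om)}) ->
  (forall om, cont_path T (g^~ om)) ->
  {ae P, forall om, forall t, g t om = G (w t om - w 0 om)} ->
  {ae P, forall om, forall t, 0 <= t <= T -> tint 0 t (fun r => S (t - r) (g r om)) (Y t om)} ->
  {ae P, forall om, udom A (Y t om) /\ A (Y t om) = X t om - g t om}.
Proof.
move=> ht [phi [phii cv]] cg gE hY; have /andP[t0 tT] := ht.
apply: aeS3 cv gE hY => om cv gE hY.
have rc := hlim_sub phii (riemann_conv_cvg hW sW hS ht (cg om) (hY t ht)).
have g0 : g 0 om = 0 by rewrite gE subrr (bop0 bG).
have rg n := riemann_conv_gen hW sW hS gAS n t0 g0 (g := g^~ om).
apply: (gen_closed hW sW gAS _ rc); first by move=> j; case: (rg (phi j)).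
have := hlimB hW cv (hlim_cst hW (g t om)); congr hlim; apply/funext => j.
have [_ e1] := rg (phi j); rewrite /= e1; congr (_ - _); apply: eq_bigr => i _; congr (S _ _).
by rewrite !gE -(bopB bG) opprB addrA subrK.
Qed.

Lemma sg_process (x0 : Om -> W) : hmeasurable (F 0) x0 -> process F T (fun t om => S t (x0 om)).
Proof.
move=> mx; apply: (jwmeas_process hW sW).
  apply: (sg_wmeas_comp hW sW hS (b := T)); first exact: measurable_cylinder.
  - by apply: measurable_funTS.
  - by [].
  - apply: (@wmeas_comp _ _ W _ _ _ _ setT _ x0 snd) => //.
      by apply: measurable_funTS.
    by apply: (hmeasurable_wmeas hW sW hF (lexx 0)).
move=> t /andP[t0 _]; apply: (hmeasurable_bop hW sW hF hW sW t0); first exact: sg_bop.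
by apply: hmeasurable_sub mx; exact: (filtration_le hF).
Qed.

Lemma process_add (X Y : R -> Om -> W) : process F T X -> process F T Y ->
  process F T (fun t om => X t om + Y t om).
Proof.
move=> pX pY; apply: (jwmeas_process hW sW).
  exact: (wmeasD hW (process_jwmeas hW sW pX) (process_jwmeas hW sW pY)).
move=> t ht; have /andP[t0 _] := ht.
by apply: (hmeasurable_add hW sW hF t0); [exact: (process_adapted pX ht)|exact: (process_adapted pY ht)].
Qed.

Context (U : ipSpace R k) (hU : hilbert U) (sU : hseparable U) (B : U -> W) (bB : bounded_op B).
Context (u ut : R -> Om -> U).
Hypothesis u_adapted : adapted F `[0, T]%classic u.
Hypothesis ut_process : process F T ut.
Hypothesis u_deriv : has_derivative P T u ut.
Context (x0 : Om -> W) (mx0 : hmeasurable (F 0) x0).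

Lemma mild_exists : exists X, mild_solution P F E Qh w T S (fun s om => B (ut s om)) G x0 X.
Proof.
have [X [pX sX _]] := stochastic_convolution_exists hZ sZ hF hQ hw hE hQh hEe hW sW hS bG GHS T0.
have [y [py hy]] := input_conv_process hW sW gAS hF T0 hU sU bB u_adapted ut_process u_deriv.
exists (fun t om => S t (x0 om) + y t om + X t om); split.
  by apply: process_add => //; apply: process_add => //; exact: sg_process.
move=> t ht; exists (X t); split; first exact: sX.
apply: aeS hy => om hy; exists (y t om); split => //.
by apply/(tint_bochner hW sW); have := hy t ht => //; case.
Qed.

Hypothesis GQ_dom : forall z, udom A (G (Qh z)).
Hypothesis AGHS : forall t, 0 <= t ->
  (\int[leb]_(s in `[0%R, t]) L20norm2 E Qh (fun z => A (S (t - s)%R (G z))) < +oo)%E.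

Lemma stochastic_convolution_strong : exists X : R -> Om -> W,
  [/\ process F T X,
      forall t, 0 <= t <= T -> SI t (fun r x => S (t - r) (G x)) (X t),
      forall t, 0 <= t <= T -> {ae P, forall om, udom A (X t om)},
      {ae P, forall om, {ae leb, forall s, cc T s -> udom A (X s om)}} &
      forall t, 0 <= t <= T -> {ae P, forall om, exists v,
        tint 0 t (fun s => gen_val S (X s om)) v /\ X t om = v + G (w t om - w 0 om)}].
Proof.
have [X [pX sX cX]] := stochastic_convolution_exists hZ sZ hF hQ hw hE hQh hEe hW sW hS bG GHS T0.
have [C [Cfin hC]] := conv_gen_domain hZ sZ hF hQ hw hE hQh hEe hW sW gAS bG GHS GQ_dom AGHS (ltW T0).
have jX := process_jwmeas hW sW pX.
have domX t ht : {ae P, forall om, udom A (X t om)} := proj1 (hC t (X t) ht (sX t ht)).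
have jAX := jwmeas_gen_val hW sW gAS jX.
have domXs := ae_paths_dom hW sW gAS jX domX.
have finAX := jwmeas_l2_paths hW sW T0 jAX Cfin (fun s hs => proj2 (hC s (X s) hs (sX s hs))).
exists X; split => //.
have [g [pg cg gE]] := noise_process.
have [Y [pY hY]] := cont_conv_process hW sW gAS hF T0 pg cg.
have AY t ht := conv_noise_parts ht (cX t ht) cg gE hY.
have jY := process_jwmeas hW sW pY; have jg := process_jwmeas hW sW pg.
have domYs := ae_paths_dom hW sW gAS jY (fun s hs => aeS (fun om h => proj1 h) (AY s hs)).
have jAY := jwmeas_gen_val hW sW gAS jY.
(* The identity A Y + g = X, known almost surely at each time, is turned into one for almost all
   times on almost every path; integration in time needs the latter. *)
have eqs : {ae P, forall om, {ae leb, forall s, cc T s -> gen_val S (Y s om) + g s om = X s om}}.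
  have jsum : jwmeas T (fun s om => gen_val S (Y s om) + g s om) by exact: wmeasD.
  apply: (ae_paths_eq hW sW jsum jX) => s hs; apply: aeS (AY s hs) => om [h1 h2].
  by rewrite (gen_valE hW gAS h1) h2 subrK.
(* Comparison with the zero integral bounds the second moment of X uniformly in time. *)
have finX : {ae P, forall om, fin 0 T (X^~ om)}.
  have g0 : (0 <= HS G)%E by exact: hs_ge0.
  have [M M1 hM] := sg_bound hW hS T; have M0 : 0 <= M by exact: le_trans M1.
  have C0 : (0 <= (M ^+ 2)%:E * HS G)%E by rewrite mule_ge0// lee_fin sqr_ge0.
  apply: (jwmeas_l2_paths hW sW T0 jX (C := (9%:E * (((M ^+ 2)%:E * HS G) * T%:E))%E)).
    apply: lte_mul_pinfty => //; apply: lte_mul_pinfty; rewrite ?ltry//.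
    by rewrite ge0_fin_numE//; apply: lte_mul_pinfty; rewrite ?lee_fin ?sqr_ge0.
  move=> s hs; have /andP[s0 sT] := hs.
  have z : SI s (fun _ _ => (0 : W)) (fun=> 0) by apply: (SI_zero hZ _ w hQh hEe hW sW).
  have i0 : integrand s (fun (_ : R) (_ : Z) => (0 : W)).
    by split => [x|r _]; [exact: wmeas_cst|exact: bounded_op0].
  have b := SI_dist hZ sZ hF hQ hw hE hQh hEe hW sW (conv_integrand hZ hW hS bG GHS s0) i0 (sX s hs) z.
  apply: le_trans (_ : (_ <= \int[P]_om (hnorm (X s om - 0)%R ^+ 2)%:E)%E) _.
    by rewrite le_eqVlt; apply/orP; left; apply/eqP; apply: eq_n2 => om _; rewrite subr0.
  apply: le_trans b _; apply: lee_wpmul2l => //.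
  apply: (@le_trans _ _ (\int[leb]_(r in cc s) cst ((M ^+ 2)%:E * HS G) r)%E).
    apply: nonneg_le_integral => r; rewrite /= in_itv/= => /andP[r0 rs]; first exact: hs_ge0.
    apply: hs_le => x; rewrite subr0; apply: hM; rewrite subr_ge0 rs lerBlDr (le_trans sT)// lerDl//.
  rewrite integral_cst; last exact: measurable_cc.
  apply: lee_wpmul2l => //.
  by rewrite /= lebesgue_itv_len// subr0 lee_fin.
have all : {ae P, forall om, [/\ {ae leb, forall s, cc T s -> udom A (X s om)},
    fin 0 T (fun s => gen_val S (X s om)), fin 0 T (X^~ om) &
    {ae leb, forall s, cc T s -> udom A (Y s om) /\ A (Y s om) = X s om - g s om}]}.
  have a1 : {ae P, forall om, {ae leb, forall s, cc T s -> udom A (Y s om) /\ A (Y s om) = X s om - g s om}}.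
    apply: aeS2 domYs eqs => om h1 h2; apply: aeS2 h1 h2 => s h1 h2 ds.
    have u1 := h1 ds; split => //; rewrite -(gen_valE hW gAS u1) -(h2 ds) addrK//.
  have a2 : {ae P, forall om, fin 0 T (fun s => gen_val S (X s om)) /\ fin 0 T (X^~ om)}.
    by apply: aeS2 finAX finX.
  by apply: aeS3 domXs a1 a2 => om h1 h2 [h3 h4].
move=> t ht; have /andP[t0 tT] := ht.
have sub := sub_dom tT.
have both : {ae P, forall om, (forall t, g t om = G (w t om - w 0 om)) /\
    forall t, 0 <= t <= T -> tint 0 t (fun r => S (t - r) (g r om)) (Y t om)}.
  by apply: aeS2 gE hY.
apply: aeS3 all (AY t ht) both => om [d1 f1 f2 d2] [y1 y2] [ge hy].
have mAX : wmeas (cc T) (fun s => gen_val S (X s om)) by exact: (wmeas_section (X := fun s om => gen_val S (X s om)) om jAX).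
have mX : wmeas (cc T) (X^~ om) by exact: wmeas_section.
have mg : wmeas (cc T) (g^~ om) by exact: wmeas_section.
have fg : fin 0 T (g^~ om) by exact: (cont_path_fin hW T0 (cg om)).
have [v hv] := tint_ex hW sW (wmeasS (measurable_cc 0 T) sub mAX) (sub_fin hW sW tT mAX f1).
have [om' hom] := tint_ex hW sW (wmeasS (measurable_cc 0 T) sub mX) (sub_fin hW sW tT mX f2).
exists v; split => //.
have hy' s : 0 <= s <= t -> tint 0 s (fun r => S (s - r) (g r om)) (Y s om).
  by move=> /andP[s0 st]; apply: hy; rewrite s0 (le_trans st).
(* om' is the time integral of X along the path; the identity A Y = X - g makes Y its primitive. *)
have e1 : Y t om = om'.
  apply: (conv_of_integrated hW sW gAS t0 (wmeasS (measurable_cc 0 T) sub mg)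
    (sub_fin hW sW tT mg fg) hy' _ hom).
  by apply: aeS d2 => s h /sub.
have [_ e2] : udom A om' /\ A om' = v.
  apply: (gen_tint_comm hW sW gAS hom hv); apply: aeS d1 => s h /sub ds.
  by split; [exact: h|rewrite (gen_valE hW gAS (h ds))].
by rewrite -e2 -e1 y2 ge subrK.
Qed.

Hypothesis B_dom : forall v, udom A (B v).
Hypothesis AB_bounded : bounded_op (fun v => A (B v)).
Hypothesis x0_dom : forall om, udom A (x0 om).

(** The orbit of x0, the convolution with the input and the stochastic convolution each satisfy
    their own integral equation, and the three are added. The mild property of the same process is
    recorded because the convergence estimate compares mild solutions. *)
Lemma strong_exists : exists X, strong_solution P F E Qh w T A (fun s om => B (ut s om)) G x0 X /\
  mild_solution P F E Qh w T S (fun s om => B (ut s om)) G x0 X.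
Proof.
have [X [pX sX domX domXs intX]] := stochastic_convolution_strong.
have [y [py hy]] := input_conv_process hW sW gAS hF T0 hU sU bB u_adapted ut_process u_deriv.
have inp := input_paths hW T0 hU sU bB ut_process u_deriv.
have conv_y : {ae P, forall om, (forall s, 0 <= s <= T -> udom A (y s om)) /\
    forall t, 0 <= t <= T -> tint 0 t (fun s => A (y s om) + B (ut s om)) (y t om)}.
  apply: aeS2 inp hy => om [m1 f1 _] h.
  have [v hv] := tint_ex hU sU m1 f1.
  have [mB fB _] := tint_bop hU sU hW bB hv.
  have [mAB fAB _] := tint_bop hU sU hW AB_bounded hv.
  have st t : 0 <= t <= T -> (forall s, 0 <= s <= t -> udom A (y s om)) /\
      tint 0 t (fun s => A (y s om) + B (ut s om)) (y t om).
    move=> /andP[t0 tT]; have sub := sub_dom tT.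
    apply: (conv_strong hW sW gAS t0 (g := fun s => B (ut s om)) (gam := fun s => A (B (ut s om)))) => //.
    - exact: (wmeasS (measurable_cc 0 T) sub mB).
    - exact: (sub_fin hW sW tT mB fB).
    - exact: (wmeasS (measurable_cc 0 T) sub mAB).
    - exact: (sub_fin hW sW tT mAB fAB).
    - by move=> s /andP[s0 st]; apply: h; rewrite s0 (le_trans st).
  by split; [case: (st T TT)|move=> t /st[]].
pose Xl t om := S t (x0 om) + y t om + X t om.
have genX s om : 0 <= s -> udom A (y s om) -> udom A (X s om) ->
    udom A (Xl s om) /\ A (Xl s om) = S s (A (x0 om)) + A (y s om) + gen_val S (X s om).
  move=> s0 u1 u2; have [a1 a2] := gen_S hW sW gAS s0 (x0_dom om).
  have [b1 b2] := genD hW sW gAS a1 u1; have [c1 c2] := genD hW sW gAS b1 u2.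
  by rewrite /Xl c2 b2 a2 (gen_valE hW gAS u2).
have tintX t : 0 <= t <= T -> {ae P, forall om, exists v,
    [/\ tint 0 t (fun s => S s (A (x0 om)) + A (y s om) + gen_val S (X s om) + B (ut s om)) v,
        Xl t om = x0 om + v + G (w t om - w 0 om) &
     {ae leb, forall s, cc t s -> A (Xl s om) = S s (A (x0 om)) + A (y s om) + gen_val S (X s om)}]}.
  move=> ht; have /andP[t0 tT] := ht; have sub := sub_dom tT.
  apply: aeS3 conv_y (intX t ht) domXs => om [y1 y2] [v [v1 v2]] dX.
  have h1 := gen_tint hW sW gAS (lexx 0) t0 (x0_dom om).
  have h2 := tintD hW sW (tintD hW sW h1 (y2 t ht)) v1.
  exists (S t (x0 om) - S 0 (x0 om) + y t om + v); split.
  - by apply: eq_tint h2 => s _; rewrite -[RHS]addrA [gen_val _ _ + _]addrC !addrA.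
  - rewrite /Xl v2 (sg0 hS); move: (S t (x0 om)) => p; move: (x0 om) (y t om) (G _) => q q' q''.
    by rewrite !addrA [q + p]addrC addrK.
  - apply: aeS dX => s h ds; have := sub _ ds; rewrite /= in_itv/= => /andP[s0 sT].
    apply: (proj2 (genX s om s0 _ _)); last exact: (h (sub _ ds)).
    by apply: y1; rewrite s0.
have pXl : process F T Xl by apply: process_add => //; apply: process_add => //; exact: sg_process.
exists Xl; split; last first.
  split => // t ht; exists (X t); split; first exact: sX.
  apply: aeS hy => om hy'; exists (y t om); split => //.
  by apply/(tint_bochner hW sW); have := hy' t ht => //; case.
split; first exact: pXl.
- move=> t ht; have /andP[t0 _] := ht; apply: aeS2 conv_y (domX t ht) => om [y1 _] dX.
  by have [] := genX t om t0 (y1 t ht) dX.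
(* Integrability of A X is read off from that of A X + B ut by subtracting the integrable input. *)
- apply: aeS2 (tintX T TT) inp => om [v [v1 _ eqA]] [m1 f1 _].
  have [z hz] := tint_ex hU sU m1 f1.
  have [_ fA _] := tintB hW sW v1 (tint_bop hU sU hW bB hz).
  apply: le_lt_trans fA; rewrite le_eqVlt; apply/orP; left; apply/eqP.
  apply: nonneg_ae_eq_integral; [by move=> s _; rewrite lee_fin hnorm_ge0..|].
  by apply: aeS eqA => s h /h ->; rewrite addrK.
- move=> t ht; have /andP[t0 _] := ht; exists (fun om => G (w t om - w 0 om)).
  split; first exact: SI_cst.
  apply: aeS (tintX t ht) => om [v [v1 v2 eqA]]; exists v; split; last exact: v2.
  have ea : {ae leb, forall s, cc t s -> S s (A (x0 om)) + A (y s om) + gen_val S (X s om) + B (ut s om) =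
      A (Xl s om) + B (ut s om)} by apply: aeS eqA => s h /h ->.
  have [mf _ _] := v1.
  exact (is_bochner_eq_ae ea ((tint_bochner hW sW v mf).1 v1)).
Qed.

End SolutionExistence.

(** * Uniqueness of strong solutions *)

Section StrongUniqueness.
Context {R : realType} {k : scalar_kind} (Z : ipSpace R k) (hZ : hilbert Z) (sZ : hseparable Z).
Context d (Om : measurableType d) (P : probability Om R).
Context (F : R -> set (set Om)) (hF : usual_filtration P F).
Context (E : set Z) (Q : Z -> Z) (hQ : covariance_operator E Q).
Context (w : R -> Om -> Z) (hw : wiener P F Q w).
Context (hE : orthonormal_basis E) (Qh : Z -> Z) (hQh : square_root Q Qh).
Context (e : nat -> Z).
Hypothesis hEe : forall f : Z -> \bar R, (forall x, (0 <= f x)%E) -> f 0 = 0%E ->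
  (\esum_(x in E) f x = \sum_(0 <= i <oo) f (e i))%E.
Context (W : ipSpace R k) (hW : hilbert W) (sW : hseparable W).
Context (A : unbounded W W) (S : R -> W -> W) (gAS : generates A S) (G : Z -> W) (bG : bounded_op G).
Context (T : R) (T0 : 0 < T) (f : R -> Om -> W) (x0 : Om -> W).
Local Notation leb := (@lebesgue_measure R).
Local Notation tint a b f v := (bint leb `[a, b]%classic (f : R -> W) v).
Local Notation cc t := (`[0, t]%classic : set (measurableTypeR R)).
Local Notation strong := (strong_solution P F E Qh w T A f G x0).

(** The noise terms agree almost surely and the inputs cancel, leaving a deterministic homogeneous
    problem on each path. The delicate point is to define the difference at all times of one path,
    although the equations hold outside null sets depending on time. *)
Theorem strong_unique (X Y : R -> Om -> W) : strong X -> strong Y ->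
  forall t, 0 <= t <= T -> {ae P, forall om, Y t om = X t om}.
Proof.
move=> [pX dX _ iX] [pY dY _ iY].
have TT : 0 <= T <= T by rewrite lexx ltW.
have iG t : integrand t (fun _ : R => G) by split => [x|//]; exact: wmeas_cst.
have diff t : 0 <= t <= T -> {ae P, forall om, exists vX vY,
    [/\ is_bochner leb (cc t) (fun s => A (X s om) + f s om) vX,
        is_bochner leb (cc t) (fun s => A (Y s om) + f s om) vY &
        Y t om - X t om = vY - vX]}.
  move=> ht; have [IX [sX aX]] := iX t ht; have [IY [sY aY]] := iY t ht.
  have eI := SI_uniq hZ sZ hF hQ hw hE hQh hEe hW sW (iG t) sX sY.
  apply: aeS3 aX aY eI => om [vX [bX eX]] [vY [bY eY]] eI; exists vX, vY; split => //.
  rewrite eX eY eI; move: (x0 om) (IY om) => p q.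
  by rewrite opprD addrACA subrr addr0 opprD addrACA subrr add0r.
(* Measurable representatives of the two drifts, taken once on [0, T] and used for every shorter
   interval; paths without them form a null set. *)
pose rep om (gX gY : R -> W) := (exists vX vY, tint 0 T gX vX /\ tint 0 T gY vY) /\
  {ae leb, forall s, cc T s -> A (X s om) + f s om = gX s} /\
  {ae leb, forall s, cc T s -> A (Y s om) + f s om = gY s}.
have ex om : exists g : (R -> W) * (R -> W), (exists gX gY, rep om gX gY) -> rep om g.1 g.2.
  have [[gX [gY h]]|h] := pselect (exists gX gY, rep om gX gY); first by exists (gX, gY).
  by exists (fun=> 0, fun=> 0) => h'; exfalso; exact: h.
have [g hg] := choice ex.
have reps : {ae P, forall om, rep om (g om).1 (g om).2}.
  apply: aeS (diff T TT) => om [vX [vY [bX bY _]]]; apply: hg.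
  have [gX [tX eX]] := bochner_rep hW sW bX; have [gY [tY eY]] := bochner_rep hW sW bY.
  by exists gX, gY; split; [exists vX, vY|split].
pose gam om s := (g om).2 s - (g om).1 s.
have exD p : exists v, rep p.2 (g p.2).1 (g p.2).2 -> 0 <= p.1 <= T -> tint 0 p.1 (gam p.2) v.
  case: p => t om /=.
  have [[[vX [vY [tX tY]]] _]|h] := pselect (rep om (g om).1 (g om).2); last first.
    by exists 0 => h'; exfalso; exact: h.
  have [/andP[t0 tT]|_] := boolP (0 <= t <= T); last by exists 0.
  by have [v hv] := tint_sub hW sW (lexx 0) tT (tintB hW sW tY tX); exists v.
have [D0 hD0] := choice exD; pose D t om := D0 (t, om).
have hD om t : rep om (g om).1 (g om).2 -> 0 <= t <= T -> tint 0 t (gam om) (D t om).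
  by move=> h ht; exact: (hD0 (t, om)).
have DE t : 0 <= t <= T -> {ae P, forall om, D t om = Y t om - X t om}.
  move=> ht; have /andP[t0 tT] := ht; have sub := sub_dom tT.
  apply: aeS2 reps (diff t ht) => om rp [vX [vY [bX bY ->]]].
  have [[wX [wY [tX tY]]] [eX eY]] := rp.
  have mX : wmeas (cc t) (g om).1 by have [m _ _] := tX; exact: (wmeasS (measurable_cc 0 T) sub m).
  have mY : wmeas (cc t) (g om).2 by have [m _ _] := tY; exact: (wmeasS (measurable_cc 0 T) sub m).
  have eX' : {ae leb, forall s, cc t s -> A (X s om) + f s om = (g om).1 s} by apply: aeS eX => s h /sub.
  have eY' : {ae leb, forall s, cc t s -> A (Y s om) + f s om = (g om).2 s} by apply: aeS eY => s h /sub.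
  have iX' := (tint_bochner hW sW vX mX).2 (is_bochner_eq_ae eX' bX).
  have iY' := (tint_bochner hW sW vY mY).2 (is_bochner_eq_ae eY' bY).
  exact: (tint_uniq hW (hD om t rp ht) (tintB hW sW iY' iX')).
have aD t : 0 <= t <= T -> hmeasurable (F t) (D t).
  move=> ht; have /andP[t0 _] := ht; apply: (hmeasurable_ae hF t0 (DE t ht)).
  apply: (hmeasurableB hW sW (filtration_sigma hF t0)).
    exact: (process_adapted pY ht).
  exact: (process_adapted pX ht).
have gfin om : rep om (g om).1 (g om).2 -> wmeas (cc T) (gam om) /\
    (\int[leb]_(s in `[0%R, T]) (hnorm (gam om s))%:E < +oo)%E.
  by move=> [[wX [wY [tX tY]]] _]; have [] := tintB hW sW tY tX.
have cD : {ae P, forall om, cont_path T (D^~ om)}.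
  apply: aeS reps => om rp; have [m1 f1] := gfin om rp.
  (* A primitive is a convolution with the identity semigroup. *)
  by apply: (conv_cont_path hW sW (id_C0 hW) m1 f1) => t ht; exact: hD.
have [D' [pD' _ D'E]] := path_modification hW sW hF T0 aD cD.
have jX := process_jwmeas hW sW pX; have jY := process_jwmeas hW sW pY.
have jD := process_jwmeas hW sW pD'.
have jYX : jwmeas T (fun s om => Y s om - X s om) by exact: wmeasB.
have eqs : {ae P, forall om, {ae leb, forall s, cc T s -> Y s om - X s om = D' s om}}.
  apply: (ae_paths_eq hW sW jYX jD) => s hs.
  by apply: aeS2 (DE s hs) D'E => om h1 h2; rewrite h2 h1.
have doms : {ae P, forall om, {ae leb, forall s, cc T s -> udom A (X s om) /\ udom A (Y s om)}}.
  apply: aeS2 (ae_paths_dom hW sW gAS jX dX) (ae_paths_dom hW sW gAS jY dY) => om h1 h2.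
  by apply: aeS2 h1 h2 => s h1 h2 ds; split; [exact: h1|exact: h2].
have both : {ae P, forall om, rep om (g om).1 (g om).2 /\ forall t, D' t om = D t om}.
  by apply: aeS2 reps D'E.
have zero : {ae P, forall om, forall t, 0 <= t <= T -> D t om = 0}.
  apply: aeS3 both eqs doms => om [rp D'E'] eqs doms t ht.
  have [m1 f1] := gfin om rp.
  have mD : wmeas (cc T) (D^~ om).
    apply: (eq_wmeas (f := D'^~ om)); first by move=> s _; exact: D'E'.
    by apply: wmeas_section.
  apply: (gen_ivp_uniq hW sW gAS (ltW T0) m1 f1 mD (fun s hs => hD om s rp hs) _ ht).
  have [_ [eX eY]] := rp.
  have exy : {ae leb, forall s, cc T s -> A (Y s om) - A (X s om) = gam om s}.
    apply: aeS2 eX eY => s h1 h2 ds; rewrite /gam -(h1 ds) -(h2 ds) opprD addrACA subrr addr0//.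
  apply: aeS3 exy eqs doms => s h1 h2 h3 ds; have [u1 u2] := h3 ds.
  rewrite -D'E' -(h2 ds) -(h1 ds); exact: (genB hW sW gAS u2 u1).
move=> t ht; apply: aeS2 zero (DE t ht) => om z h.
by apply/eqP; rewrite -subr_eq0 -h z.
Qed.

End StrongUniqueness.

(** * Dependence of mild solutions on the input operator *)

Section MildDistance.
Context {R : realType} {k : scalar_kind} (Z : ipSpace R k) (hZ : hilbert Z) (sZ : hseparable Z).
Context d (Om : measurableType d) (P : probability Om R).
Context (F : R -> set (set Om)) (hF : usual_filtration P F).
Context (E : set Z) (Q : Z -> Z) (hQ : covariance_operator E Q).
Context (w : R -> Om -> Z) (hw : wiener P F Q w).
Context (hE : orthonormal_basis E) (Qh : Z -> Z) (hQh : square_root Q Qh).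
Context (e : nat -> Z).
Hypothesis hEe : forall f : Z -> \bar R, (forall x, (0 <= f x)%E) -> f 0 = 0%E ->
  (\esum_(x in E) f x = \sum_(0 <= i <oo) f (e i))%E.
Context (W : ipSpace R k) (hW : hilbert W) (sW : hseparable W).
Context (S : R -> W -> W) (hS : C0_semigroup S) (G : Z -> W) (bG : bounded_op G).
Context (T : R) (T0 : 0 < T) (x0 : Om -> W).
Context (U : ipSpace R k) (hU : hilbert U) (sU : hseparable U).
Context (ut : R -> Om -> U) (ut_process : process F T ut).
Local Notation leb := (@lebesgue_measure R).
Local Notation tint a b f v := (bint leb `[a, b]%classic (f : R -> W) v).
Local Notation cc t := (`[0, t]%classic : set (measurableTypeR R)).
Local Notation mild B := (mild_solution P F E Qh w T S (fun s om => B (ut s om)) G x0).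
Hypothesis GHS : (hs Qh e G < +oo)%E.

(** Cauchy-Schwarz in time from 2 l a <= l^2 + a^2 integrated over [0, T], with the optimal l =
    ||v|| / T; the case of an infinite right-hand side is separate. *)
Lemma tint_l2_le t (f : R -> W) v (g : R -> R) (C : R) : 0 <= t <= T -> tint 0 t f v ->
  measurable_fun (cc T) (fun s => (g s ^+ 2)%:E) -> 0 < C -> (forall s, 0 <= s <= t -> hnorm (f s) <= C * g s) ->
  (((hnorm v) ^+ 2)%:E <= (C ^+ 2 * T)%:E * \int[leb]_(s in cc T) (g s ^+ 2)%:E)%E.
Proof.
move=> /andP[t0 tT] hv mg C0 hf; set J := (\int[leb]_(s in cc T) (g s ^+ 2)%:E)%E.
have J0 : (0 <= J)%E by apply: integral_ge0 => s _; rewrite lee_fin sqr_ge0.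
have CT : 0 < C ^+ 2 * T by rewrite mulr_gt0// exprn_gt0.
pose l := hnorm v / T; have l0 : 0 <= l by rewrite divr_ge0 ?hnorm_ge0// ltW.
have key : ((2 * l * hnorm v)%:E <= (l ^+ 2 * T)%:E + (C ^+ 2)%:E * J)%E.
  have l20 : 0 <= 2 * l by rewrite mulr_ge0.
  apply: (@le_trans _ _ ((2 * l)%:E * \int[leb]_(s in cc t) (hnorm (f s))%:E)%E).
    rewrite EFinM; apply: lee_wpmul2l; first by rewrite lee_fin.
    exact: (bint_le hW sW (measurable_cc 0 t) hv).
  have mf : measurable_fun (cc t) (fun s => (hnorm (f s))%:E).
    apply/measurable_EFinP; have [mf0 _ _] := hv; apply: wmeas_norm => //; exact: measurable_cc.
  have n0 s : cc t s -> (0 <= (hnorm (f s))%:E)%E by rewrite lee_fin hnorm_ge0.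
  rewrite -(ge0_integralZl_EFin _ (measurable_cc 0 t) n0 mf l20).
  have p2 s : cc T s -> (0 <= (C ^+ 2)%:E * (g s ^+ 2)%:E)%E by rewrite mule_ge0// lee_fin sqr_ge0.
  have m2 : measurable_fun (cc T) (fun s => (C ^+ 2)%:E * (g s ^+ 2)%:E)%E by exact: measurable_funeM.
  have p1 s : cc T s -> (0 <= cst (l ^+ 2)%:E s)%E by rewrite lee_fin sqr_ge0.
  apply: (@le_trans _ _ (\int[leb]_(s in cc T) (cst (l ^+ 2)%:E s + (C ^+ 2)%:E * (g s ^+ 2)%:E))%E).
    apply: (@le_trans _ _ (\int[leb]_(s in cc t) (cst (l ^+ 2)%:E s + (C ^+ 2)%:E * (g s ^+ 2)%:E))%E).
      apply: nonneg_le_integral => s ds; first by rewrite mule_ge0 ?n0// lee_fin.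
      move: ds; rewrite /= in_itv/= => ds; have h := hf s ds; have n := hnorm_ge0 (f s).
      rewrite -!EFinM -EFinD lee_fin.
      have h2 : 2 * l * hnorm (f s) <= 2 * l * (C * g s) by exact: ler_wpM2l.
      apply: le_trans h2 _; have := sqr_ge0 (l - C * g s); nra.
    apply: ge0_subset_integral; [exact: measurable_cc|exact: measurable_cc| | |exact: sub_dom].
      by apply: emeasurable_funD => //; exact: measurable_cst.
    by move=> s ds; rewrite adde_ge0 ?p1 ?p2.
  rewrite (ge0_integralD _ (measurable_cc 0 T) p1 (measurable_cst _) p2 m2) integral_cst; last exact: measurable_cc.
  have q s : cc T s -> (0 <= (g s ^+ 2)%:E :> \bar R)%E by rewrite lee_fin sqr_ge0.
  rewrite (ge0_integralZl_EFin _ (measurable_cc 0 T) q mg (sqr_ge0 C)).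
  apply: leeD => //.
  by rewrite /= lebesgue_itv_len ?subr0 -?EFinM// ltW.
have [J1|J1] := ltP J +oo%E; last first.
  have -> : J = +oo%E by apply/eqP; rewrite -leye_eq.
  by rewrite gt0_muley ?lte_fin// leey.
have [j jE] : exists j, J = j%:E by exists (fine J); rewrite fineK// ge0_fin_numE.
move: key; rewrite jE -!EFinM -EFinD !lee_fin /l.
set q := hnorm v.
have -> : 2 * (q / T) * q = 2 * (q ^+ 2 / T) by ring.
have -> : (q / T) ^+ 2 * T = q ^+ 2 / T by field; rewrite gt_eqF.
move=> h; have h' : q ^+ 2 / T <= C ^+ 2 * j by lra.
by move: h'; rewrite ler_pdivrMr// -mulrA [j * T]mulrC mulrA.
Qed.

(** Initial values and stochastic integrals cancel almost surely, so the difference is a convolution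
    with (B1 - B2) ut. The bound does not depend on t, which is what a supremum over time
    requires. *)
Lemma mild_dist M (hM : forall t x, 0 <= t <= T -> hnorm (S t x) <= M * hnorm x) (M0 : 0 < M)
    (B1 B2 : U -> W) (bB1 : bounded_op B1) (bB2 : bounded_op B2) (C : R) (X1 X2 : R -> Om -> W) :
  (forall x, hnorm (B1 x - B2 x) <= C * hnorm x) -> 0 < C -> mild B1 X1 -> mild B2 X2 ->
  forall t, 0 <= t <= T -> (\int[P]_om (hnorm (X1 t om - X2 t om) ^+ 2)%:E <=
    ((M * C) ^+ 2 * T)%:E * \int[P]_om \int[leb]_(s in cc T) (hnorm (ut s om) ^+ 2)%:E)%E.
Proof.
move=> hC C0 [_ m1] [_ m2] t ht; have /andP[t0 tT] := ht; have sub := sub_dom tT.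
have [I1 [s1 a1]] := m1 t ht; have [I2 [s2 a2]] := m2 t ht.
have iP := conv_integrand hZ hW hS bG GHS t0.
have eI := SI_uniq hZ sZ hF hQ hw hE hQh hEe hW sW iP s1 s2.
have ju := process_jwmeas hU sU ut_process.
have mu2 : measurable_fun [set p : measurableTypeR R * Om | 0 <= p.1 <= T] (fun p => (hnorm (ut p.1 p.2) ^+ 2)%:E).
  by apply: (wmeas_norm2 hU sU) => //; exact: measurable_cylinder.
have [mi _] := jwmeas_tonelli P (f := fun s om => (hnorm (ut s om) ^+ 2)%:E) mu2 (fun s om => sqr_ge0 _).
have MC : 0 < M * C by rewrite mulr_gt0.
have i0 om : setT om -> (0 <= \int[leb]_(s in cc T) (hnorm (ut s om) ^+ 2)%:E)%E.
  by move=> _; apply: integral_ge0 => s _; rewrite lee_fin sqr_ge0.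
have c0 : 0 <= (M * C) ^+ 2 * T by rewrite mulr_ge0 ?sqr_ge0// ltW.
rewrite -(ge0_integralZl_EFin _ measurableT i0 mi c0).
apply: nonneg_ae_le_integral.
- by move=> om _; rewrite lee_fin sqr_ge0.
- by move=> om h; rewrite mule_ge0 ?i0// lee_fin.
apply: aeS3 a1 a2 eI => om [v1 [b1 ->]] [v2 [b2 ->]] eI _.
have mut : wmeas (cc T) (ut^~ om) by exact: wmeas_section.
have mut' := wmeasS (measurable_cc 0 T) sub mut.
have mB (B : U -> W) : bounded_op B -> wmeas (cc t) (fun s => S (t - s) (B (ut s om))).
  by move=> bB; apply: (conv_wmeas hW sW hS (g := fun s => B (ut s om))); apply: (wmeas_bop hU sU).
have i1 := (tint_bochner hW sW v1 (mB B1 bB1)).2 b1.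
have i2 := (tint_bochner hW sW v2 (mB B2 bB2)).2 b2.
have -> : S t (x0 om) + v1 + I1 om - (S t (x0 om) + v2 + I2 om) = v1 - v2.
  rewrite eI; move: (S t (x0 om)) (I2 om) => p q.
  by rewrite opprD addrACA subrr addr0 opprD addrACA subrr add0r.
apply: (tint_l2_le ht (tintB hW sW i1 i2)) => //.
- by apply: wmeas_norm2 => //; exact: measurable_cc.
- move=> s /andP[s0 st]; have ts : 0 <= t - s by rewrite subr_ge0.
  rewrite -(bopB (sg_bop hS ts)) -mulrA.
  apply: le_trans (hM _ _ _) _; last by rewrite ler_pM2l.
  by rewrite ts lerBlDr (le_trans tT)// lerDl.
Qed.

End MildDistance.

Lemma ecvg0_pinfty {R : realType} (a : R -> \bar R) : (forall l, 0 <= a l)%E ->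
  (forall ep, 0 < ep -> exists l1, forall l, l1 <= l -> (a l <= ep%:E)%E) ->
  a l @[l --> +oo%R] --> 0%E.
Proof.
move=> a0 h; apply/fine_cvgP; split.
  have [l1 hl] := h 1 ltr01; near=> l.
  rewrite ge0_fin_numE//; apply: le_lt_trans (hl l _) (ltry _).
  by near: l; apply: nbhs_pinfty_ge; exact: num_real.
apply/cvgrPdist_le => ep ep0; have [l1 hl] := h ep ep0; near=> l.
have hl' : (a l <= ep%:E)%E by apply: hl; near: l; apply: nbhs_pinfty_ge; exact: num_real.
rewrite sub0r normrN ger0_norm ?fine_ge0// -lee_fin fineK// ge0_fin_numE//.
exact: le_lt_trans hl' (ltry _).
Unshelve. all: by end_near. Qed.

(** On K^m an operator is controlled by its values at the unit vectors; this upgrades strong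
    convergence to convergence in operator norm. *)
Lemma euclid_op_le {R : realType} {k : scalar_kind} m (W : ipSpace R k) (hW : hilbert W)
    (f : euclid k m -> W) : bounded_op f ->
  forall v, hnorm (f v) <= (\sum_j hnorm (f (delta_mx j 0))) * hnorm v.
Proof.
move=> bf v; have hU := @euclid_hilbert R k m.
have -> : f v = \sum_j v j 0 *: f (delta_mx j 0).
  rewrite {1}(matrix_sum_delta v) (bop_sum bf); apply: eq_bigr => j _.
  by rewrite big_ord1 (bopZ bf).
apply: le_trans (hnorm_sum hW _ _ _) _; rewrite mulr_suml; apply: ler_sum => j _.
rewrite (hnormZ hW) mulrC ler_wpM2l ?hnorm_ge0// /hnorm -[sRe _]/(rip v v) euclid_rip.
rewrite ler_wsqrtr// (bigD1 j)//= lerDl sumr_ge0// => i _; exact: sabs2_ge0.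
Qed.

Lemma yosida_input_small {R : realType} {k : scalar_kind} m (W : ipSpace R k) (hW : hilbert W)
    (sW : hseparable W) (A : unbounded W W) (S : R -> W -> W) (gAS : generates A S)
    (B : euclid k m -> W) (bB : bounded_op B) (ep : R) : 0 < ep ->
  exists l1, forall l, l1 <= l -> resolvent_set A (ofR l) /\
    forall v, hnorm (ofR l *: resolvent A (ofR l) (B v) - B v) <= ep * hnorm v.
Proof.
(* m.+1 rather than m, so that the quotient makes sense for m = 0. *)
move=> ep0; have em : 0 < ep / m.+1%:R by rewrite divr_gt0.
have /choice[l1 hl1] := fun j : 'I_m => yosida_cvg hW sW gAS (B (delta_mx j 0)) em.
(* Applied to the vector 0 this only yields membership in the resolvent set, and does so even when
   there are no unit vectors. *)
have [l0 hl0] := yosida_cvg hW sW gAS 0 ltr01.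
exists (`|l0| + \sum_j `|l1 j|) => l hl.
have sum0 : 0 <= \sum_j `|l1 j| by apply: sumr_ge0.
have [rl _] := hl0 l (le_trans (ler_norm _) (le_trans (ler_wpDr sum0 (lexx _)) hl)).
split => // v.
have [bR _ _] := resolventP rl.
have bf : bounded_op (fun v => ofR l *: resolvent A (ofR l) (B v) - B v).
  apply: (bounded_opB (euclid_hilbert m) hW) => //.
  apply: (bounded_opZ _ (euclid_hilbert m) hW).
  exact: (bounded_op_comp (euclid_hilbert m) hW hW).
apply: le_trans (euclid_op_le hW bf v) _; rewrite ler_wpM2r ?hnorm_ge0//.
apply: (@le_trans _ _ (\sum_(j < m) ep / m.+1%:R)).
  apply: ler_sum => j _; apply: ltW; apply: (hl1 j l _).2.
  apply: le_trans hl; apply: (@le_trans _ _ `|l1 j|); first exact: ler_norm.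
  rewrite (bigD1 j)//= addrCA lerDl addr_ge0// sumr_ge0//.
rewrite sumr_const card_ord -[X in X <= _]mulr_natr -mulrA ger_pMr//.
by rewrite mulrC ler_pdivrMr// mul1r ler_nat.
Qed.

(** * Yosida approximation of the input *)

Section YosidaApproximation.
Context {R : realType} {k : scalar_kind} (Z : ipSpace R k) (hZ : hilbert Z) (sZ : hseparable Z).
Context d (Om : measurableType d) (P : probability Om R).
Context (F : R -> set (set Om)) (hF : usual_filtration P F).
Context (E : set Z) (Q : Z -> Z) (hQ : covariance_operator E Q).
Context (w : R -> Om -> Z) (hw : wiener P F Q w).
Context (hE : orthonormal_basis E) (Qh : Z -> Z) (hQh : square_root Q Qh).
Context (e : nat -> Z).
Hypothesis hEe : forall f : Z -> \bar R, (forall x, (0 <= f x)%E) -> f 0 = 0%E ->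
  (\esum_(x in E) f x = \sum_(0 <= i <oo) f (e i))%E.
Context (W : ipSpace R k) (hW : hilbert W) (sW : hseparable W).
Context (A : unbounded W W) (S : R -> W -> W) (gAS : generates A S) (G : Z -> W) (bG : bounded_op G).
Context (T : R) (T0 : 0 < T) (m : nat).
Local Notation U := (euclid k m : ipSpace R k).
Local Notation leb := (@lebesgue_measure R).
Hypothesis GHS : (hs Qh e G < +oo)%E.
Hypothesis GQ_dom : forall z, udom A (G (Qh z)).
Hypothesis AGHS : forall t, 0 <= t ->
  (\int[leb]_(s in `[0%R, t]) L20norm2 E Qh (fun z => A (S (t - s)%R (G z))) < +oo)%E.
Context (B : U -> W) (bB : bounded_op B) (u ut : R -> Om -> U).
Hypothesis u_adapted : adapted F `[0, T]%classic u.
Hypothesis ut_L2 : L2_process P F T ut.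
Hypothesis u_deriv : has_derivative P T u ut.
Context (x0 : Om -> W) (mx0 : hmeasurable (F 0) x0).
Hypothesis x0_dom : forall om, udom A (x0 om).
Let Bl (l : scal R k) (v : U) : W := l *: resolvent A l (B v).
Let strong l X := strong_solution P F E Qh w T A (fun s om => Bl l (ut s om)) G x0 X.
Let mild (C : U -> W) X := mild_solution P F E Qh w T S (fun s om => C (ut s om)) G x0 X.
Let hU : hilbert U := @euclid_hilbert R k m.
Let sU : hseparable U := @euclid_separable R k m.

(** The resolvent identity A B_l = l (B_l - B) shows that A B_l is bounded: smoothing the input by l
    R(l) is what allows strong solutions. *)
Lemma yosida_bop l : resolvent_set A l -> [/\ bounded_op (Bl l), forall v, udom A (Bl l v) &
  bounded_op (fun v => A (Bl l v))].
Proof.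
move=> rl; have [bR RA _] := resolventP rl.
have bRB : bounded_op (fun v => resolvent A l (B v)) by exact: (bounded_op_comp hU hW hW).
have bBl : bounded_op (Bl l) by exact: bounded_opZ.
have ARE v : udom A (Bl l v) /\ A (Bl l v) = l *: (Bl l v - B v).
  have [d1 d2] := RA (B v); have [z1 z2] := genZ hW sW gAS l d1.
  split; first exact: z1.
  rewrite /Bl z2; congr (_ *: _); rewrite -[X in _ - X]d2 opprB addrC subrK//.
split => //; first by move=> v; case: (ARE v).
rewrite (_ : (fun v => _) = (fun v => l *: (Bl l v - B v))); last first.
  by apply/funext => v; case: (ARE v).
by apply: bounded_opZ => //; exact: bounded_opB.
Qed.

Lemma yosida_solution l : resolvent_set A l -> exists X, strong l X /\ mild (Bl l) X.
Proof.
move=> rl; have [b1 b2 b3] := yosida_bop rl.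
exact: (strong_exists hZ sZ hF hQ hw hE hQh hEe hW sW gAS bG T0 GHS hU sU b1 u_adapted
  (proj1 ut_L2) u_deriv mx0 GQ_dom AGHS b2 b3 x0_dom).
Qed.

Lemma yosida_approximation :
  [/\ forall l, resolvent_set A l -> exists Xl, strong l Xl /\
        forall Yl, strong l Yl -> forall t, 0 <= t <= T -> {ae P, forall om, Yl t om = Xl t om},
      exists X, mild B X
    & forall Xl X, (forall l, resolvent_set A l -> strong l (Xl l)) -> mild B X ->
        forall t, 0 <= t <= T ->
          ereal_sup [set (\int[P]_om (hnorm (Xl (ofR l) s om - X s om) ^+ 2)%:E)%E
                    | s in `[0, t]%classic] @[l --> +oo%R] --> 0%E].
Proof.
have uniq l X Y := strong_unique hZ sZ hF hQ hw hE hQh hEe hW sW gAS bG T0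
  (f := fun s om => Bl l (ut s om)) (x0 := x0) (X := X) (Y := Y).
split.
- move=> l rl; have [X [sX _]] := yosida_solution rl; exists X; split; first exact: sX.
  move=> Y sY; exact: (uniq l X Y sX sY).
- exact: (mild_exists hZ sZ hF hQ hw hE hQh hEe hW sW gAS bG T0 GHS hU sU bB u_adapted
    (proj1 ut_L2) u_deriv mx0).
move=> Xl X sXl mX t /andP[t0 tT].
have hS := proj1 gAS.
have [M M1 hM] := sg_bound hW hS T; have M0 : 0 < M by exact: lt_le_trans ltr01 M1.
have [pu uL2] := ut_L2.
set J := (\int[P]_om _)%E in uL2.
have J0 : (0 <= J)%E.
  by apply: integral_ge0 => om _; apply: integral_ge0 => s _; rewrite lee_fin sqr_ge0.
have [j j0 jE] : exists2 j, 0 <= j & J = j%:E.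
  by exists (fine J); rewrite ?fine_ge0// fineK// ge0_fin_numE.
apply: ecvg0_pinfty => [l|ep ep0].
  apply: le_trans (ereal_sup_ubound _); last first.
    by exists 0 => //=; rewrite in_itv/= lexx t0.
  by apply: integral_ge0 => om _; rewrite lee_fin sqr_ge0.
(* j + 1 keeps N positive when the input has zero norm. With c <= 1 and c N <= ep below, the
   estimate M^2 c^2 T j is at most ep. *)
pose N := M ^+ 2 * T * (j + 1).
have j1 : 0 < j + 1 by rewrite ltr_wpDl.
have N0 : 0 < N by rewrite !mulr_gt0// exprn_gt0.
pose c := Num.min 1 (ep / N).
have c0 : 0 < c by rewrite lt_min ltr01 divr_gt0.
have c1 : c <= 1 by rewrite ge_min lexx.
have cN : c * N <= ep by rewrite -ler_pdivlMr// ge_min lexx orbT.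
have [l1 hl1] := yosida_input_small hW sW gAS bB c0.
exists l1 => l ll1; have [rl small] := hl1 l ll1.
have [X' [sX' mX']] := yosida_solution rl.
have [bBl _ _] := yosida_bop rl.
have dist := mild_dist hZ sZ hF hQ hw hE hQh hEe hW sW hS bG T0 hU sU pu GHS hM M0 bBl bB small c0 mX' mX.
apply: ge_ereal_sup => _ [s /= hs <-].
have hs' : 0 <= s <= T by move: hs; rewrite in_itv/= => /andP[-> h]; exact: le_trans h tT.
(* The given [Xl] is only known to be a strong solution; by uniqueness it is replaced at each time
   by X', which is also mild. *)
rewrite (nonneg_ae_eq_integral (g := fun om => (hnorm (X' s om - X s om) ^+ 2)%:E)); first last.
- by apply: aeS (uniq _ _ _ sX' (sXl _ rl) s hs') => om ->.
- by move=> om _; rewrite lee_fin sqr_ge0.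
- by move=> om _; rewrite lee_fin sqr_ge0.
apply: le_trans (dist s hs') _; rewrite -/J jE -EFinM lee_fin.
apply: le_trans cN; rewrite /N exprMn.
have cc : c ^+ 2 <= c by rewrite expr2 ger_pMl.
have M20 : 0 <= M ^+ 2 * T by rewrite mulr_ge0 ?sqr_ge0// ltW.
have -> : M ^+ 2 * c ^+ 2 * T * j = (M ^+ 2 * T) * (c ^+ 2 * j) by ring.
have -> : c * (M ^+ 2 * T * (j + 1)) = (M ^+ 2 * T) * (c * (j + 1)) by ring.
rewrite ler_wpM2l//; apply: ler_pM => //; first exact: sqr_ge0.
by rewrite lerDl.
Qed.

End YosidaApproximation.

Section ProductEmbeddings.
Context {R : realType} {k : scalar_kind} (U X Z : ipSpace R k).
Context (hU : hilbert U) (sU : hseparable U) (hX : hilbert X) (sX : hseparable X) (hZ : hilbert Z).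
Let hW := prod_hilbert hU hX.

Lemma hnorm_inr (x : X) : hnorm ((0, x) : prod_ip U X) ^+ 2 = hnorm x ^+ 2.
Proof. by rewrite (prod_hnorm2 hU hX)/= hnorm0// expr0n add0r. Qed.

Lemma inr_bop (H : Z -> X) : bounded_op H -> bounded_op (fun z => (0, H z) : prod_ip U X).
Proof.
move=> bH; have [C C0 hC] := bop_bound bH; apply: (bounded_opP (C := C)) => // [c x y|x].
  rewrite (bopP bH); apply/pair_equal_spec; split => //=.
  by rewrite scaler0 addr0.
apply: le_trans (hC x); rewrite -(@ler_pXn2r _ 2) ?nnegrE ?hnorm_ge0//.
by rewrite hnorm_inr.
Qed.

Lemma graph_bop (B : U -> X) : bounded_op B -> bounded_op (fun v => (v, - B v) : prod_ip U X).
Proof.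
move=> bB; have [C C0 hC] := bop_bound bB; apply: (bounded_opP (C := 1 + C)) => // [c x y|x].
  rewrite (bopP bB); apply/pair_equal_spec; split => //=.
  by rewrite opprD scalerN.
apply: le_trans (prod_hnorm_le hU hX _) _ => /=.
by rewrite (hnormN hX) mulrDl mul1r lerD2l.
Qed.

Lemma hmeasurable_pair (T : pointedType) (Fs : set (set T)) (f : T -> U) (g : T -> X) :
  sigma_algebra setT Fs -> hmeasurable Fs f -> hmeasurable Fs g ->
  hmeasurable Fs (fun om => (f om, g om) : prod_ip U X).
Proof.
move=> sF; rewrite (hmeasurable_subP hU sU _ sF) (hmeasurable_subP hX sX _ sF) => mf mg.
apply/(hmeasurable_subP hW (prod_separable hU hX sU sX) _ sF) => v.
rewrite (_ : (fun x => _) = (fun x => rip (f x) v.1 + rip (g x) v.2)).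
  by apply: measurable_funD; [exact: mf|exact: mg].
by apply/funext => x; rewrite prod_rip.
Qed.

End ProductEmbeddings.

Theorem theorem2p4 (R : realType) (k : scalar_kind)
  (T : R) (T_gt0 : 0 < T)
  (d : measure_display) (Om : measurableType d) (P : probability Om R)
  (F : R -> set (set Om)) (F_usual : usual_filtration P F)
  (a b : R) (a_lt_b : a < b) (n : nat) (Hm : R -> 'M[scal R k]_n)
  (Hm_density : energy_density a b Hm)
  (m p : nat)
  (cA : unbounded (L2weighted a b Hm) (L2weighted a b Hm))
  (cB : unbounded (L2weighted a b Hm) (euclid k m))
  (cC : unbounded (L2weighted a b Hm) (euclid k p))
  (B : euclid k m -> L2weighted a b Hm)
  (S : R -> L2weighted a b Hm -> L2weighted a b Hm)
  (bco : bco_system cA cB cC B S)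
  (Z : ipSpace R k) (Z_hilbert : hilbert Z) (Z_separable : hseparable Z)
  (E : set Z) (E_basis : orthonormal_basis E)
  (Q Qh : Z -> Z) (Q_cov : covariance_operator E Q) (Qh_root : square_root Q Qh)
  (w : R -> Om -> Z) (w_wiener : wiener P F Q w)
  (H : Z -> L2weighted a b Hm) (H_bounded : bounded_op H)
  (H_HS : (L20norm2 E Qh H < +oo)%E)
  (eps0 : Om -> L2weighted a b Hm) (eps0_F0 : hmeasurable (F 0) eps0)
  (eps0_gaussian : gaussian_vector P eps0)
  (eps0_indep : independent_classes P (sigma_of eps0) (sigma_of_process w))
  (u ut : R -> Om -> euclid k m)
  (u_adapted : adapted F `[0, T]%classic u)
  (ut_L2 : L2_process P F T ut) (u_deriv : has_derivative P T u ut)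
  (HQ_dom : forall z, udom (restricted_operator cA cB) (H (Qh z)))
  (X0_dom : forall om, udom (restricted_operator cA cB) (eps0 om - B (u 0 om)))
  (AH_HS : forall t : R, 0 <= t ->
    (\int[@lebesgue_measure R]_(s in `[0%R, t])
       L20norm2 E Qh (fun z => restricted_operator cA cB (S (t - s)%R (H z)))
     < +oo)%E) :
  let Ae := ext_operator cA cB B in
  let Te := ext_semigroup cA B S in
  let Be := ext_input B in
  let He := ext_noise m H in
  let x0 : Om -> prod_ip (euclid k m) (L2weighted a b Hm) :=
    fun om => (u 0 om, eps0 om - B (u 0 om)) in
  let is_strong := fun l => strong_solution P F E Qh w T Ae
    (fun s om => yosida_input Ae Be l (ut s om)) He x0 in
  let is_mild := mild_solution P F E Qh w T Te
    (fun s om => Be (ut s om)) He x0 in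
  [/\ forall l, resolvent_set Ae l ->
        exists Xl, is_strong l Xl /\
          forall Yl, is_strong l Yl ->
            forall t, 0 <= t <= T -> {ae P, forall om, Yl t om = Xl t om},
      exists X, is_mild X
    & forall Xl X, (forall l, resolvent_set Ae l -> is_strong l (Xl l)) ->
        is_mild X ->
        forall t, 0 <= t <= T ->
          ereal_sup [set (\int[P]_om
                            (hnorm (Xl (ofR l) s om - X s om) ^+ 2)%:E)%E
                    | s in `[0, t]%classic] @[l --> +oo%R] --> 0%E].
Proof.
move=> Ae Te Be He x0 is_strong is_mild.
have [_ _ gAS [bB _ bAB] _] := bco.
have hX := L2weighted_hilbert Hm_density; have sX := L2weighted_separable a_lt_b Hm_density.
have hU := @euclid_hilbert R k m; have sU := @euclid_separable R k m.
have hW := prod_hilbert hU hX; have sW := prod_separable hU hX sU sX.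
have gAe : generates Ae Te := ext_generates hX sX gAS bAB.
have [e [he hEe]] := orthonormal_basis_enum Z_hilbert Z_separable E_basis.
have bQh : bounded_op Qh by case: Qh_root.
(* Elements of the form (0, x) do not feel the coupling block, so the Hilbert-Schmidt and domain
   assumptions on H carry over unchanged to the extended noise. *)
have cAB0 : cA (B 0) = 0 by exact: (bop0 bAB).
have HeE z : hnorm (He z) ^+ 2 = hnorm (H z) ^+ 2 by exact: hnorm_inr.
have bHe : bounded_op He by exact: inr_bop.
have HeHS : (hs Qh e He < +oo)%E.
  move: H_HS; rewrite (L20E hX bQh hEe (bop0 H_bounded)); congr (_ < _)%E.
  by apply: eq_eseriesr => i _; rewrite HeE.
have AeTe t z : 0 <= t -> Ae (Te t (He z)) = (0, restricted_operator cA cB (S t (H z))).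
  move=> t0; rewrite /Te (@ext_semigroupE R k _ m hX sX cA cB B S gAS t _ t0) /Ae /ext_operator /=.
  by rewrite cAB0 (bop0 (sg_int_bop hX sX (proj1 gAS) t0)) !add0r.
have AeHS t : 0 <= t -> (\int[@lebesgue_measure R]_(s in `[0%R, t])
    L20norm2 E Qh (fun z => Ae (Te (t - s)%R (He z))) < +oo)%E.
  move=> t0; rewrite (_ : (\int[_]_(s in _) _)%E = (\int[@lebesgue_measure R]_(s in `[0%R, t])
    L20norm2 E Qh (fun z => restricted_operator cA cB (S (t - s)%R (H z))))%E); first exact: AH_HS.
  apply: eq_integral => s /set_mem hs; have /andP[s0 st] : 0 <= s <= t by move: hs; rewrite /= in_itv.
  apply: eq_esum => z _; rewrite AeTe ?subr_ge0//; congr EFin.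
  exact: hnorm_inr.
have bBe : bounded_op Be by exact: graph_bop.
(* The initial state is measurable at time 0 because both u(0) and the initial condition are. *)
have mx0 : hmeasurable (F 0) x0.
  have F0 := filtration_sigma F_usual (lexx 0).
  have mu0 : hmeasurable (F 0) (u 0) by apply: u_adapted; rewrite /= in_itv/= lexx ltW.
  apply: (hmeasurable_pair hU sU hX sX F0) => //.
  apply: (hmeasurableB hX sX F0) => //.
  exact: (hmeasurable_bop hU sU F_usual hX sX (lexx 0) bB).
exact: (yosida_approximation Z_hilbert Z_separable F_usual Q_cov w_wiener E_basis Qh_root hEe hW sW gAe
  bHe T_gt0 HeHS HQ_dom AeHS bBe u_adapted ut_L2 u_deriv mx0 X0_dom).
Qed.
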